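(* Consider the $n\times n$ system $\frac{dY}{dz}=A(z,t)Y$, $A(z,t)=\sum_{j\ge0}A_j(t)z^{-j}$, with $A$ holomorphic for $|z|\ge N_0$, $t\in\mathcal U_{\epsilon_0}(0)\subset\mathbb C^n$, for which there is a holomorphic invertible $G_0(t)$ on $\mathcal U_{\epsilon_0}(0)$, $G_0(0)=I$, with $G_0(t)^{-1}A_0(t)G_0(t)=\Lambda(t)=\mathrm{diag}(u_1(t),\dots,u_n(t))$, $u_a(t)=u_a(0)+t_a$, and let $\epsilon_0=\delta_0$ with $0<\delta_0<\min_{i\ne j}\delta_{ij}$ (see context). Let $\widetilde\tau$ be the direction of an admissible ray for $\Lambda(0)$, $\tau_\nu<\widetilde\tau<\tau_{\nu+1}$. Assume that for any $\widetilde\tau$-cell $c$ of $\mathcal U_{\epsilon_0}(0)$ and any $k\in\mathbb Z$, the fundamental solution $Y_{\nu+k\mu}(z,t;\widetilde\tau,c)$, defined for $t\in c$, has analytic continuation in $t$ on the universal covering of $\mathcal U_{\epsilon_0}(0)\setminus\Delta$ as a meromorphic matrix-valued function. Assume that the entries of the Stokes matrices satisfy the vanishing condition $$(\mathbb S_\nu(t))_{ab}=(\mathbb S_\nu(t))_{ba}=(\mathbb S_{\nu+\mu}(t))_{ab}=(\mathbb S_{\nu+\mu}(t))_{ba}=0\qquad\forall t\in c,$$ for any $1\le a\ne b\le n$ such that $u_a(0)=u_b(0)$. Then: (i) The continuation of $Y_{\nu+k\mu}(z,t;\widetilde\tau,c)$ defines a single-valued holomorphic matrix-valued function on $\mathcal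 U_{\epsilon_0}(0)\setminus\Delta$. (ii) $Y_{\nu+k\mu}(z,t;\widetilde\tau,c)=Y_{\nu+k\mu}(z,t;\widetilde\tau,c')$ for $t\in c$ (for any $\widetilde\tau$-cells $c,c'$, the symbols denoting the continuations). Therefore one may write $Y_{\nu+k\mu}(z,t;\widetilde\tau)$. (iii) The asymptotics $$G_0^{-1}(t)Y_{\nu+k\mu}(z,t;\widetilde\tau)e^{-\Lambda(t)z}z^{-B_1(t)}\sim I+\sum_{j\ge1}F_j(t)z^{-j}$$ holds for $z\to\infty$ in $\widehat{\mathcal S}_{\nu+k\mu}(t)$, $t\in\mathcal U_{\epsilon_0}(0)\setminus\Delta$.
   Context: Notation. $\mathcal R$ is the universal covering of $\mathbb C\setminus\{0\}$; $S(\alpha,\beta)=\{z\in\mathcal R:\alpha<\arg z<\beta\}$. $|t|=\max_i|t_i|$, $\mathcal U_\epsilon(0)=\{t\in\mathbb C^n:|t|\le\epsilon\}$. The $u_a(0)$ take distinct values $\lambda_1,\dots,\lambda_s$, ordered so that $A_0(0)=\Lambda(0)=\lambda_1I_{p_1}\oplus\cdots\oplus\lambda_sI_{p_s}$. $\Delta=\{t\in\mathcal U_{\epsilon_0}(0):u_a(t)=u_b(t)\text{ for some }a\ne b\}$. Formal solution. Set $\widehat A_k(t)=G_0(t)^{-1}A_k(t)G_0(t)$ and $B_1(t)=\mathrm{diag}(\widehat A_1(t))$ (diagonal part). For $t\notin\Delta$ there is a unique formal solution $G_0(t)\big(I+\sum_{k\ge1}F_k(t)z^{-k}\big)z^{B_1(t)}e^{\Lambda(t)z}$;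 the $F_k$ are holomorphic on $\mathcal U_{\epsilon_0}(0)\setminus\Delta$. Stokes rays of $\Lambda(t)$: rays $\{z\in\mathcal R:\Re[(u_a(t)-u_b(t))z]=0\}$, $u_a(t)\ne u_b(t)$. Those of $\Lambda(0)$ have directions labelled increasingly $\cdots<\tau_\sigma<\tau_{\sigma+1}<\cdots$, $\sigma\in\mathbb Z$, with $\tau_{\sigma+\mu}=\tau_\sigma+\pi$. $\widetilde\tau$ is admissible if it is none of the $\tau_\sigma$. (If $s=1$ there are no such rays, $\widetilde\tau$ is arbitrary, and the indices $\nu+k\mu$ are mere labels for $k\in\mathbb Z$.) Radius: $\delta_{ij}=\frac12\min_{\rho\in\mathbb R}|\lambda_i-\lambda_j+\rho e^{i\widetilde\eta}|$, $\widetilde\eta=\frac{3\pi}2-\widetilde\tau$, $1\le i\neq j\le s$. Cells: $X(\widetilde\tau)$ is the set of $t\in\mathcal U_{\epsilon_0}(0)$ such that, for some $a\neq b$ with $u_a(t)\ne u_b(t)$, $\arg(u_a(t)-u_b(t))=\widetilde\eta$ mod $\pi$. A $\widetilde\tau$-cell is a connected component of $\mathcal U_{\epsilon_0}(0)\setminus(\Delta\cup X(\widetilde\tau))$. Sectors: for $t\notin X(\widetilde\tau)$, $\mathcal S_{\nu+k\mu}(t)$ is the open sector containing $S(\widetilde\tau-\pi+k\pi,\widetilde\tau+k\pi)$ and extending up to the nearest Stokes rays of $\Lambda(t)$ outside it. $\mathfrak R(t)$ is the set of Stokes rays $\Re[(u_a(t)-u_b(t))z]=0$ for pairs with $u_a(0)\ne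 u_b(0)$; $\widehat{\mathcal S}_{\nu+k\mu}(t)$ is the open sector containing $S(\widetilde\tau-\pi+k\pi,\widetilde\tau+k\pi)$ and extending up to the nearest rays of $\mathfrak R(t)$ (equal to $\mathcal R$ if $s=1$). Solutions: for a cell $c$, $Y_{\nu+k\mu}(z,t;\widetilde\tau,c)$, $t\in c$, is the unique fundamental solution, holomorphic in $t\in c$, such that $G_0(t)^{-1}Y_{\nu+k\mu}e^{-\Lambda(t)z}z^{-B_1(t)}\sim I+\sum_{j\ge1}F_j(t)z^{-j}$ as $z\to\infty$ in $\mathcal S_{\nu+k\mu}(t)$. Asymptotics in an open sector means in every proper closed subsector. Stokes matrices: $Y_{\nu+(k+1)\mu}(z,t;\widetilde\tau,c)=Y_{\nu+k\mu}(z,t;\widetilde\tau,c)\mathbb S_{\nu+k\mu}(t)$ for $t\in c$. *)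

(* Defs.v *)
(* Mathematical Components / MathComp-Analysis, over C := R[i] with R : realType. *)
From HB Require Import structures.
From mathcomp Require Import all_boot all_order all_algebra.
From mathcomp Require Import complex.
From mathcomp Require Import all_classical all_reals all_analysis.

Set Implicit Arguments.
Unset Strict Implicit.
Unset Printing Implicit Defensive.

Import Order.TTheory GRing.Theory Num.Theory.
Import numFieldNormedType.Exports.

Local Open Scope classical_set_scope.
Local Open Scope ring_scope.
Local Open Scope complex_scope.

Local Notation Re := complex.Re.
Local Notation Im := complex.Im.

(* R[i] with the topology of its modulus, as a normed module over itself. *)
#[warnings="-redundant-canonical-projection"]
HB.instance Definition _ (R : realType) := NormedModule.copy R[i] R[i]^o.

Section Complex.
Variable R : realType.
Local Notation C := R[i].

Definition cis (theta : R) : C := cos theta +i* sin theta.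

Definition cexp (z : C) : C := (expR (Re z))%:C * cis (Im z).

Definition is_arg (z : C) (theta : R) :=
  exists r : R, 0 < r /\ z = r%:C * cis theta.

End Complex.

(* The universal covering of C \ {0} is represented by C itself, through the
   coordinate w = log z: the point w lies over z = cexp w, with |z| = expR (Re w)
   and arg z = Im w. Functions of z on the covering are functions of w. *)

Section Holomorphy.
Variable R : realType.
Local Notation C := R[i].

(* D need not be open (e.g. a closed polydisc): f is holomorphic on D when near
   every point of D it is the restriction of a function that is holomorphic on a
   full neighbourhood. Here [differentiable] is C-linear differentiability. *)
Definition holo_on (V W : normedModType C) (D : set V) (f : V -> W) :=
  forall x, D x -> exists g : V -> W,
    (\forall y \near x, differentiable g y) /\
    (\forall y \near x, D y -> f y = g y).

Variables (E : topologicalType) (V : normedModType C) (p : E -> V).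

(* Meromorphic functions on the covering space E, whose complex structure is the
   one pulled back by the local homeomorphism p: local quotients of holomorphic
   functions whose denominator has a nonzero germ. The value of f at zeros of the
   denominator is unspecified, so equality is only meaningful up to [mero_eq]. *)
Definition meromorphic_along (f : E -> C) :=
  forall e : E, exists g h : V -> C,
    [/\ \forall y \near p e, differentiable g y /\ differentiable h y,
        ~ (\forall y \near p e, h y = 0)
      & \forall x \near e, h (p x) != 0 -> f x = g (p x) / h (p x)].

Definition mero_eq (T : Type) (f g : E -> T) :=
  exists O : set E, [/\ open O, dense O & forall x, O x -> f x = g x].

End Holomorphy.

Section UniversalCovering.
Variable R : realType.

Definition path_connected (E : topologicalType) :=
  forall x y : E, exists gamma : R -> E,
    [/\ {within `[0, 1], continuous gamma}, gamma 0 = x & gamma 1 = y].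

Definition simply_connected (E : topologicalType) :=
  path_connected E /\
  forall gamma : R -> E,
    {within `[0, 1], continuous gamma} -> gamma 0 = gamma 1 ->
    exists H : R * R -> E,
      [/\ {within `[0, 1] `*` `[0, 1], continuous H},
          forall s, s \in `[0, 1] -> H (0, s) = gamma s,
          forall s, s \in `[0, 1] -> H (1, s) = gamma 0
        & forall r, r \in `[0, 1] -> H (r, 0) = gamma 0 /\ H (r, 1) = gamma 0].

(* V is evenly covered by p : E -> D (D with the subspace topology): its preimage
   is a disjoint union of open sheets, each mapped homeomorphically onto V `&` D. *)
Definition evenly_covered (E T : topologicalType) (p : E -> T) (D V : set T) :=
  exists (I : Type) (O : I -> set E) (s : I -> T -> E),
    [/\ p @^-1` V = \bigcup_i O i, trivIset setT O, forall i, open (O i)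
      & forall i,
        [/\ {within V `&` D, continuous (s i)},
            forall t, (V `&` D) t -> O i (s i t) /\ p (s i t) = t
          & forall x, O i x -> s i (p x) = x]].

Definition universal_covering (E T : topologicalType) (p : E -> T) (D : set T) :=
  [/\ continuous p, range p = D,
      forall t, D t -> exists V, [/\ open V, V t & evenly_covered p D V]
    & simply_connected E].

End UniversalCovering.

Section System.
Variables (R : realType) (n : nat).
Local Notation C := R[i].
Implicit Types (t : 'rV[C]_n) (w : C) (u : 'I_n -> C) (eps tau : R) (k : int).

(* The norm of 'rV[C]_n is the maximum of the moduli of the coordinates. *)
Definition polydisc eps : set 'rV[C]_n := [set t | `|t| <= eps%:C].

Definition eigval u0 t (a : 'I_n) : C := u0 a + t 0 a.

Definition Lambda u0 t : 'M[C]_n := diag_mx (\row_a eigval u0 t a).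

Definition coalescence u0 eps : set 'rV[C]_n :=
  [set t | polydisc eps t /\
     exists a b : 'I_n, a != b /\ eigval u0 t a = eigval u0 t b].

Definition eta_tilde (tau : R) : R := 3%:R * pi / 2%:R - tau.

(* Half the distance from 0 to the line d + R e^(i theta); the infimum is attained.
   delta_ij is [half_dist_line (lambda_i - lambda_j) (eta_tilde tau)]. *)
Definition half_dist_line (d : C) (theta : R) : R :=
  2%:R^-1 * inf [set Re `|d + rho%:C * cis theta| | rho in [set: R]].

Definition walls u0 eps tau : set 'rV[C]_n :=
  [set t | polydisc eps t /\
     exists a b : 'I_n, eigval u0 t a != eigval u0 t b /\
       exists m : int, is_arg (eigval u0 t a - eigval u0 t b) (eta_tilde tau + m%:~R * pi)].

Definition cell u0 eps tau (c : set 'rV[C]_n) :=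
  let W := polydisc eps `\` (coalescence u0 eps `|` walls u0 eps tau) in
  exists2 t, W t & c = connected_component W t.

(* Directions, in the universal covering, of the Stokes rays of Lambda(t). *)
Definition stokes_directions u0 t : set R :=
  [set theta | exists a b : 'I_n, eigval u0 t a != eigval u0 t b /\
     Re ((eigval u0 t a - eigval u0 t b) * cis theta) = 0].

(* Those coming only from pairs with u_a(0) <> u_b(0). *)
Definition stokes_directions0 u0 t : set R :=
  [set theta | exists a b : 'I_n, u0 a != u0 b /\
     Re ((eigval u0 t a - eigval u0 t b) * cis theta) = 0].

(* The open sector containing S(tau - pi + k pi, tau + k pi) and extending up to
   the nearest rays with directions in D outside it: w belongs to it when no ray
   of D separates w from S(tau - pi + k pi, tau + k pi), w itself included. It is
   the whole covering when D is empty. *)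
Definition sector (D : set R) tau k : set C :=
  [set w | forall theta, D theta ->
     ~ (Im w <= theta <= tau - pi + k%:~R * pi) /\
     ~ (tau + k%:~R * pi <= theta <= Im w)].

Definition B1 (A_ : nat -> 'rV[C]_n -> 'M[C]_n) (G0 : 'rV[C]_n -> 'M[C]_n) t :
    'M[C]_n :=
  diag_mx (\row_a (invmx (G0 t) *m A_ 1%N t *m G0 t) a a).

(* exp(Diag * s) for a diagonal matrix Diag; with s = log z this is z^Diag. *)
Definition exp_diag (B : 'M[C]_n) (s : C) : 'M[C]_n :=
  diag_mx (\row_a cexp (B a a * s)).

(* G0 (sum_k F_k z^-k) z^B1 e^(Lambda z), with F_0 = I, solves dY/dz = A Y
   formally: comparison of the coefficients of z^-k on the left of
   z^B1 e^(Lambda z), for every k >= 0. *)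
Definition formal_solution (A_ : nat -> 'rV[C]_n -> 'M[C]_n)
    (G0 : 'rV[C]_n -> 'M[C]_n) u0 (F : nat -> 'rV[C]_n -> 'M[C]_n) t :=
  let H (k : nat) := G0 t *m F k t in
  F 0%N t = 1%:M /\
  forall k : nat,
    H k *m Lambda u0 t +
      (if k is k'.+1 then H k' *m B1 A_ G0 t - k'%:R *: H k' else 0) =
    \sum_(j < k.+1) A_ j t *m H (k - j)%N.

(* f(z) ~ sum_j F_j z^-j as z -> oo in the open sector S, i.e. in each of its
   closed subsectors. *)
Definition asymptotic (S : set C) (f : C -> 'M[C]_n) (F : nat -> 'M[C]_n) :=
  forall al be : R, [set w : C | al <= Im w <= be] `<=` S ->
  forall m : nat, exists r K : R, forall w : C,
    al <= Im w <= be -> r <= expR (Re w) ->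
    `|f w - \sum_(j < m.+1) (cexp w) ^- j *: F j| <= (K * expR (Re w) ^- m.+1)%:C.

(* G0(t)^-1 Y e^(-Lambda(t) z) z^(-B1(t)) *)
Definition normalized (A_ : nat -> 'rV[C]_n -> 'M[C]_n)
    (G0 : 'rV[C]_n -> 'M[C]_n) u0 t (Y : C -> 'M[C]_n) w : 'M[C]_n :=
  invmx (G0 t) *m Y w *m exp_diag (Lambda u0 t) (- cexp w)
    *m exp_diag (B1 A_ G0 t) (- w).

(* dY/dz = A(z) Y for |z| >= N0 on the universal covering (in the coordinate
   w = log z, d/dz = e^-w d/dw), with Y invertible. *)
Definition fundamental_solution (A : C -> 'M[C]_n) (N0 : R) (Y : C -> 'M[C]_n) :=
  forall w : C, N0 <= expR (Re w) ->
    is_derive w (1 : C) Y (cexp w *: (A (cexp w) *m Y w)) /\ Y w \in unitmx.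

End System.

(* Main.v *)
(* Let t0 be a point of D, possibly on a wall or on the boundary of U, and let tau'
   be a direction admissible for Lambda(t0) that no ray of R(t0) separates from tau.
   On the half-plane centred at the direction tau' + k pi - pi / 2, integration from
   infinity turns the equation for a column of a solution with the prescribed
   asymptotics into a fixed point problem for a contraction, so that such a
   solution exists and is holomorphic in t in a full neighbourhood of t0.

   The Stokes matrices are 2-periodic in k up to formal monodromy, hence their
   vanishing entries vanish for every k, and on a cell the asymptotics of Y_k
   extends to the sector bounded by the rays of R(t) only, which contains the
   half-plane above. By uniqueness every Y_k is therefore, near t0, the restriction
   of one holomorphic function that does not depend on the cell; this holds for
   large z and propagates to all z by Picard iteration. The cells are dense, so
   these local functions glue to a function on D, which is identified with the
   given continuations by the identity theorem along paths of the covering. *)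
Require Import Defs.
From HB Require Import structures.
From mathcomp Require Import all_boot all_order all_algebra.
From mathcomp Require Import complex.
From mathcomp Require Import all_classical all_reals all_analysis.
From mathcomp Require Import ring lra.

Set Implicit Arguments.
Unset Strict Implicit.
Unset Printing Implicit Defensive.

Import Order.TTheory GRing.Theory Num.Theory.
Import numFieldNormedType.Exports.

Local Open Scope classical_set_scope.
Local Open Scope ring_scope.
Local Open Scope complex_scope.

(** The window is a half-plane because its opening is exactly pi. Admissibility of [tau'] has two
    effects. Every exponential e^((u_a - u_b) z), a <> b, grows along some direction of the window,
    so two solutions with the same asymptotics there have connection matrix 1. And from every point
    of the window a ray to infinity stays inside it while a given exponential decays, which
    integration from infinity requires. The vanishing condition leaves in S_k only entries of pairs
    with u_a(0) <> u_b(0); until a ray of R(t) is crossed these are multiplied by decaying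
    exponentials, so Y_k and Y_(k+1) share their asymptotics. The bound on [eps0] keeps tau itself
    off R(t) for all t in U. As t0 may lie on the boundary of the closed polydisc, G0 and the A_j
    must first be extended to a full neighbourhood, the A_j through integrals over |z| = 2 N0. The
    function theory rests on primitives over convex domains, from which come the maximum principle,
    Schwarz's lemma on complex lines, and uniform limits in any normed space. *)

Section Basics.
Variable R : realType.
Local Notation C := R[i].
Local Notation Re := complex.Re.
Local Notation Im := complex.Im.

(** The norm of a normed module over R[i] has values in R[i]. Its real part carries the same
    information and places all estimates in the ordered field R, where [lra] and [nra] apply. *)
Definition nr (V : normedModType C) (x : V) : R := Re `|x|.

Lemma nrE (V : normedModType C) (x : V) : `|x| = (nr x)%:C.
Proof. by rewrite /nr RRe_real // normr_real. Qed.

Lemma nr_ge0 (V : normedModType C) (x : V) : 0 <= nr x.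
Proof. by have := normr_ge0 x; rewrite nrE lecR. Qed.

Lemma nr_le (V : normedModType C) (x : V) (k : R) : (`|x| <= k%:C) = (nr x <= k).
Proof. by rewrite nrE lecR. Qed.

Lemma nr_lt (V : normedModType C) (x : V) (k : R) : (`|x| < k%:C) = (nr x < k).
Proof. by rewrite nrE ltcR. Qed.

Lemma nrD (V : normedModType C) (x y : V) : nr (x + y) <= nr x + nr y.
Proof. by have := ler_normD x y; rewrite !nrE -rmorphD lecR. Qed.

Lemma nrN (V : normedModType C) (x : V) : nr (- x) = nr x.
Proof. by rewrite /nr normrN. Qed.

Lemma nrB (V : normedModType C) (x y : V) : nr (x - y) <= nr x + nr y.
Proof. by rewrite (le_trans (nrD _ _)) // nrN. Qed.

Lemma nr_dist (V : normedModType C) (x y : V) : nr (x - y) = nr (y - x).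
Proof. by rewrite -nrN opprB. Qed.

Lemma nr_subD (V : normedModType C) (z x y : V) : nr (x - y) <= nr (x - z) + nr (z - y).
Proof. by rewrite -[X in nr X](subrKA z) (le_trans (nrD _ _)). Qed.

Lemma nrBl (V : normedModType C) (x y : V) : nr x - nr y <= nr (x - y).
Proof. by rewrite lerBlDr -[X in nr X <= _](subrK y) nrD. Qed.

Lemma nrZ (V : normedModType C) (a : C) (x : V) : nr (a *: x) = nr a * nr x.
Proof. by apply: complexI; rewrite rmorphM /= -!nrE normrZ. Qed.

Lemma nrM (x y : C) : nr (x * y) = nr x * nr y.
Proof. by rewrite -nrZ. Qed.

Lemma nr0 (V : normedModType C) : nr (0 : V) = 0.
Proof. by rewrite /nr normr0. Qed.

Lemma nr1 : nr (1 : C) = 1.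
Proof. by rewrite /nr normr1. Qed.

Lemma nr_eq0 (V : normedModType C) (x : V) : (nr x == 0) = (x == 0).
Proof. by rewrite -[RHS]normr_eq0 nrE -(inj_eq (@complexI R)). Qed.

Lemma nr_gt0 (V : normedModType C) (x : V) : (0 < nr x) = (x != 0).
Proof. by rewrite lt_neqAle nr_ge0 andbT eq_sym nr_eq0. Qed.

Lemma nrX (x : C) n : nr (x ^+ n) = nr x ^+ n.
Proof. by elim: n => [|n IH]; rewrite ?expr0 ?nr1 // !exprS nrM IH. Qed.

Lemma nrV (x : C) : nr x^-1 = (nr x)^-1.
Proof.
have [->|x0] := eqVneq x 0; first by rewrite invr0 nr0 invr0.
have nx : nr x != 0 by rewrite nr_eq0.
by apply: (mulfI nx); rewrite -nrM !mulfV // nr1.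
Qed.

Lemma nrC (x : R) : nr (x%:C : C) = `|x|.
Proof.
by apply: complexI; rewrite -nrE normc_def /= expr0n addr0 sqrtr_sqr.
Qed.

Lemma nr_real (x : R) : 0 <= x -> nr (x%:C : C) = x.
Proof. by rewrite nrC => /ger0_norm. Qed.

Lemma nr_sum (V : normedModType C) I (s : seq I) (P : pred I) (F : I -> V) :
  nr (\sum_(i <- s | P i) F i) <= \sum_(i <- s | P i) nr (F i).
Proof.
elim/big_ind2: _ => //; first by rewrite nr0.
by move=> x1 x2 y1 y2 h1 h2; rewrite (le_trans (nrD _ _)) // lerD.
Qed.

Lemma nr_Re (x : C) : `|Re x| <= nr x.
Proof. by have := normc_ge_Re x; rewrite nrE lecR. Qed.

Lemma nr_Im (x : C) : `|Im x| <= nr x.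
Proof.
have := nr_Re (x * 'i); rewrite ReiNIm normrN nrM => /le_trans; apply.
by rewrite /nr normc_def /= expr0n expr1n add0r sqrtr1 mulr1.
Qed.

Lemma nr_ReIm (x : C) : nr x <= `|Re x| + `|Im x|.
Proof.
have -> : nr x = Num.sqrt ((Re x) ^+ 2 + (Im x) ^+ 2).
  by apply: complexI; rewrite -nrE normc_def.
rewrite -[leRHS]ger0_norm ?addr_ge0 // -sqrtr_sqr ler_sqrt ?sqr_ge0 //.
rewrite sqrrD !real_normK ?num_real // lerD2r lerDl.
by rewrite mulrn_wge0 // mulr_ge0.
Qed.

Lemma Re_mulC (x : R) (z : C) : Re (x%:C * z) = x * Re z.
Proof. by case: z => a b /=; rewrite mul0r subr0. Qed.

Lemma Im_mulC (x : R) (z : C) : Im (x%:C * z) = x * Im z.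
Proof. by case: z => a b /=; rewrite mul0r addr0. Qed.

Lemma ReD (x y : C) : Re (x + y) = Re x + Re y.
Proof. by case: x y => ? ? []. Qed.
Lemma ImD (x y : C) : Im (x + y) = Im x + Im y.
Proof. by case: x y => ? ? []. Qed.
Lemma ReN (x : C) : Re (- x) = - Re x. Proof. by case: x. Qed.
Lemma ImN (x : C) : Im (- x) = - Im x. Proof. by case: x. Qed.
Lemma ReB (x y : C) : Re (x - y) = Re x - Re y.
Proof. by rewrite ReD ReN. Qed.
Lemma ImB (x y : C) : Im (x - y) = Im x - Im y.
Proof. by rewrite ImD ImN. Qed.
Lemma ReM (x y : C) : Re (x * y) = Re x * Re y - Im x * Im y.
Proof. by case: x y => ? ? []. Qed.
Lemma mulJ (x : C) : x^* * x = (nr x ^+ 2)%:C.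
Proof. by rewrite mulrC -sqr_normc nrE rmorphXn. Qed.

Lemma nrJ (x : C) : nr x^* = nr x.
Proof. by rewrite /nr normcJ. Qed.

Lemma nbhs_nrP (V : normedModType C) (x : V) (P : set V) :
  (\forall y \near x, P y) <-> exists2 e : R, 0 < e & forall y, nr (y - x) < e -> P y.
Proof.
split.
  move=> /nbhs_ballP [e /= e0 H]; have re : e = (Re e)%:C.
    by rewrite RRe_real // gtr0_real.
  rewrite re ltcR in e0; exists (Re e) => // y yx; apply: H.
  by rewrite -ball_normE /= re nr_lt nr_dist.
case=> e e0 H; apply/nbhs_ballP; exists e%:C; first by rewrite /= ltcR.
by move=> y; rewrite -ball_normE /= nr_lt nr_dist; apply: H.
Qed.

Lemma cvg_nrP (V W : normedModType C) (f : V -> W) (x : V) (l : W) :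
  f y @[y --> x] --> l <->
  forall e : R, 0 < e -> exists2 d : R, 0 < d &
     forall y, nr (y - x) < d -> nr (f y - l) < e.
Proof.
split.
  move=> H e e0; have : \forall z \near l, nr (z - l) < e by apply/nbhs_nrP; exists e.
  by move=> /H /nbhs_nrP.
move=> H P /nbhs_nrP [e e0 HP]; apply/nbhs_nrP.
by have [d d0 Hd] := H _ e0; exists d => // y /Hd /HP.
Qed.

Lemma cvgn_nrP (W : normedModType C) (u : nat -> W) (l : W) :
  u n @[n --> \oo] --> l <->
  forall e : R, 0 < e -> exists N, forall n, (N <= n)%N -> nr (u n - l) < e.
Proof.
split.
  move=> H e e0.
  have : \forall y \near l, nr (y - l) < e by apply/nbhs_nrP; exists e.
  move=> /H [N _ HN]; exists N => n Nn; exact: HN.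
move=> H P /nbhs_nrP [e e0 HP].
by have [N HN] := H _ e0; exists N => // n /= Nn; apply/HP/HN.
Qed.

Lemma cvgn_nr_unique (W : normedModType C) (u : nat -> W) (l l' : W) :
  u n @[n --> \oo] --> l -> u n @[n --> \oo] --> l' -> l = l'.
Proof. by move=> h h'; exact: (cvg_unique _ h h'). Qed.

Lemma cvgn_nr_le (W : normedModType C) (u : nat -> W) (l : W) (K : R) :
  u n @[n --> \oo] --> l -> (exists N, forall n, (N <= n)%N -> nr (u n) <= K) -> nr l <= K.
Proof.
move=> /cvgn_nrP H [N HN]; apply/ler_addgt0Pr => e e0.
have [M HM] := H _ e0.
have h1 := HN (maxn N M) (leq_maxl _ _); have h2 := HM (maxn N M) (leq_maxr _ _).
rewrite -[X in nr X](subrK (u (maxn N M))) addrC (le_trans (nrD _ _)) //.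
by rewrite lerD // nr_dist ltW.
Qed.

(** Completeness is inherited from R: [Re] and [Im] are additive and bounded by [nr], and [nr] is at
    most the sum of their absolute values. *)
Lemma ccauchy_cvg (u : nat -> C) :
  (forall e : R, 0 < e -> exists N, forall n m, (N <= n)%N -> (N <= m)%N -> nr (u n - u m) < e) ->
  exists l : C, u n @[n --> \oo] --> l.
Proof.
move=> H.
have aux (f : C -> R) : (forall x y, f (x - y) = f x - f y) -> (forall x, `|f x| <= nr x) ->
    cvgn (f \o u).
  move=> fB fn; apply: cauchy_cvg; apply/cauchy_ballP => e e0.
  have [N HN] := H _ e0.
  near_simpl; exists ([set n | (N <= n)%N], [set n | (N <= n)%N]) => /=.
    by split; exists N.
  case=> n m /= [Nn Nm]; rewrite -ball_normE /= -fB.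
  by rewrite (le_lt_trans (fn _)) // HN.
have /cvg_ex [a Ha] := aux _ ReB nr_Re.
have /cvg_ex [b Hb] := aux _ ImB nr_Im.
exists (a +i* b); apply/cvgn_nrP => e e0.
have e2 : 0 < e / 2 by rewrite divr_gt0.
move/cvgrPdist_lt : Ha => /(_ _ e2) [N1 _ H1].
move/cvgrPdist_lt : Hb => /(_ _ e2) [N2 _ H2].
exists (maxn N1 N2) => n; rewrite geq_max => /andP[n1 n2].
rewrite (le_lt_trans (nr_ReIm _)) // [e]splitr ltrD //.
  by rewrite ReB /= distrC; apply: H1.
by rewrite ImB /= distrC; apply: H2.
Qed.

End Basics.

(** * Derivatives and differentials as inequalities between real moduli *)

Section Derivatives.
Variable R : realType.
Local Notation C := R[i].
Local Notation Re := complex.Re.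
Local Notation Im := complex.Im.

Lemma is_derive_cvg (V W : normedModType C) (f : V -> W) (x v : V) (d : W) :
  is_derive x v f d <->
  (fun h : C => h^-1 *: (f (h *: v + x) - f x)) @ 0^' --> d.
Proof.
split=> [H|H].
  have h1 := @ex_derive _ _ _ _ _ _ _ H.
  by have <- := @derive_val _ _ _ _ _ _ _ H.
by split; [apply/cvg_ex; exists d|apply: cvg_lim].
Qed.

(** Multiplying the difference quotient out admits h = 0, which spares later estimates a case
    distinction. *)
Lemma is_derive_nrP (V W : normedModType C) (f : V -> W) (x v : V) (d : W) :
  is_derive x v f d <->
  forall e : R, 0 < e -> exists2 r : R, 0 < r & forall h : C, nr h < r ->
    nr (f (h *: v + x) - f x - h *: d) <= e * nr h.
Proof.
rewrite is_derive_cvg; split.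
  move=> H e e0.
  have : \forall y \near d, nr (y - d) < e by apply/nbhs_nrP; exists e.
  move=> /H H'; have /nbhs_nrP [r r0 Hr] : \forall h \near (0 : C),
    h != 0 -> nr (h^-1 *: (f (h *: v + x) - f x) - d) < e by exact: H'.
  exists r => // h hr; have [->|h0] := eqVneq h 0.
    by rewrite !scale0r add0r subrr subr0 !nr0 mulr0.
  have := Hr h; rewrite subr0 => /(_ hr h0) /ltW H2.
  rewrite -[X in nr (X - _)](scale1r) -(mulfV h0) -scalerA -scalerBr nrZ mulrC.
  by rewrite ler_wpM2r // nr_ge0.
move=> H P /nbhs_nrP [e e0 HP].
have e2 : 0 < e / 2 by rewrite divr_gt0.
have [r r0 Hr] := H _ e2.
suff : \forall h \near (0 : C), h != 0 -> P (h^-1 *: (f (h *: v + x) - f x)) by [].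
apply/nbhs_nrP; exists r => // h.
rewrite subr0 => hr h0; apply: HP.
rewrite -[X in nr (_ - X)](scale1r) -(mulVf h0) -scalerA -scalerBr nrZ nrV.
rewrite mulrC ltr_pdivrMr ?nr_gt0 // (le_lt_trans (Hr _ hr)) //.
by rewrite ltr_pM2r ?nr_gt0 // ltr_pdivrMr // ltr_pMr // ltr1n.
Qed.

Lemma is_derive1_nrP (W : normedModType C) (f : C -> W) (x : C) (d : W) :
  is_derive x (1 : C) f d <->
  forall e : R, 0 < e -> exists2 r : R, 0 < r & forall y, nr (y - x) < r ->
    nr (f y - f x - (y - x) *: d) <= e * nr (y - x).
Proof.
rewrite is_derive_nrP; split => H e /H [r r0 Hr]; exists r => //.
  by move=> y /Hr; rewrite [_%:A]mulr1 subrK.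
by move=> h hr; have := Hr (h + x); rewrite addrK [_%:A]mulr1; apply.
Qed.

Lemma diff_nrP (V W : normedModType C) (f : V -> W) (x : V) :
  differentiable f x -> forall e : R, 0 < e -> exists2 r : R, 0 < r & forall y,
    nr (y - x) < r -> nr (f y - f x - 'd f x (y - x)) <= e * nr (y - x).
Proof.
move=> /diff_locally /eqaddoP H e e0.
have e0' : 0 < e%:C :> C by rewrite ltcR.
have /nbhs_nrP [r r0 Hr] := H _ e0'; exists r => // y yr.
have := Hr (y - x); rewrite subr0 => /(_ yr).
rewrite [X in _ * X]nrE -rmorphM /= nr_le.
by rewrite -[X in nr X <= _ -> _]/(f (y - x + x) - (f x + 'd f x (y - x))) subrK opprD addrA.
Qed.

Lemma nr_diff (V W : normedModType C) (f : V -> W) (x : V) (L : {linear V -> W}) K :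
  (forall v, nr (L v) <= K * nr v) ->
  (forall e : R, 0 < e -> exists2 r : R, 0 < r & forall y,
    nr (y - x) < r -> nr (f y - f x - L (y - x)) <= e * nr (y - x)) ->
  differentiable f x /\ 'd f x = L :> (V -> W).
Proof.
move=> LK H.
have cL : continuous L.
  move=> v; apply/cvg_nrP => e e0; exists (e / (`|K| + 1)).
    by rewrite divr_gt0 // ltr_wpDl.
  move=> y; rewrite -linearB ltr_pdivlMr ?ltr_wpDl // => h.
  rewrite (le_lt_trans (LK _)) // (le_lt_trans _ h) // mulrC ler_wpM2l ?nr_ge0 //.
  by rewrite (le_trans (ler_norm _)) // lerDl.
have Lf : f \o shift x = cst (f x) + L +o_ (0 : V) id.
  apply/eqaddoP => e e0.
  have re : e = (Re e)%:C by rewrite RRe_real // gtr0_real.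
  have e0' : 0 < Re e by rewrite re ltcR in e0.
  have [r r0 Hr] := H _ e0'; apply/nbhs_nrP; exists r => // y.
  rewrite subr0 => yr; rewrite re [X in _ * X]nrE -rmorphM /= nr_le.
  have := Hr (y + x); rewrite addrK => /(_ yr).
  by rewrite -[X in _ -> nr X <= _]/(f (y + x) - (f x + L y)) opprD addrA.
split; last exact: diff_unique cL Lf.
(* The differential is a chosen value, so one witness of its defining property is enough; the
   expansion is needed a second time, now centred at x. *)
apply/diffP; apply: (@getPex _ (fun df : {linear V -> W} => continuous df /\
  forall y, f y = f (lim (nbhs x)) + df (y - lim (nbhs x))
                  +o_(y \near x) (y - lim (nbhs x)))).
exists L; split=> //; apply: eqaddoEx => z.
have {}Lf : f = cst (f x) + L \o center x +o_x (center x).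
  apply/eqaddoP => e e0.
  have re : e = (Re e)%:C by rewrite RRe_real // gtr0_real.
  have e0' : 0 < Re e by rewrite re ltcR in e0.
  have [r r0 Hr] := H _ e0'; apply/nbhs_nrP; exists r => // y yr.
  rewrite re [X in _ * X]nrE -rmorphM /= nr_le.
  by rewrite -[X in nr X <= _]/(f y - (f x + L (y - x))) opprD addrA; exact: Hr.
have /= -> : lim (nbhs x) = x by exact: lim_id.
exact: (congr1 (@^~ z) Lf).
Qed.

Lemma is_derive1_diffP (W : normedModType C) (f : C -> W) (x : C) :
  differentiable f x <-> exists d, is_derive x (1 : C) f d.
Proof.
split=> [/derivable1_diffP /derivableP h|[d h]]; first by eexists; exact: h.
by apply/derivable1_diffP; exact: ex_derive.
Qed.

Lemma diff_is_derive (V W : normedModType C) (f : V -> W) (x v : V) :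
  differentiable f x -> is_derive x v f ('d f x v).
Proof.
by move=> df; apply: DeriveDef; [exact: diff_derivable|rewrite deriveE].
Qed.

Lemma is_derive_uniq (V W : normedModType C) (f : V -> W) (x v : V) d d' :
  is_derive x v f d -> is_derive x v f d' -> d = d'.
Proof. by move=> h1 h2; rewrite -(@derive_val _ _ _ _ _ _ _ h1) (@derive_val _ _ _ _ _ _ _ h2). Qed.

Lemma is_derive1_comp (W : normedModType C) (f : C -> W) (g : C -> C) (x : C) df dg :
  is_derive (g x) (1 : C) f df -> is_derive x (1 : C) g dg ->
  is_derive x (1 : C) (f \o g) (dg *: df).
Proof.
move=> /is_derive1_nrP hf /is_derive1_nrP hg; apply/is_derive1_nrP => e e0.
(* The summands 1 keep both denominators positive; each of the two error terms of the chain rule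
   then costs at most e / 2. *)
have a0 : 0 < nr dg + 1 by rewrite ltr_wpDl // nr_ge0.
have b0 : 0 < nr df + 1 by rewrite ltr_wpDl // nr_ge0.
have [r r0 Hr] := hf (e / (2 * (nr dg + 1))) (divr_gt0 e0 (mulr_gt0 (ltr0Sn R 1) a0)).
have [s s0 Hs] : exists2 s : R, 0 < s & forall y, nr (y - x) < s ->
    nr (g y - g x - (y - x) *: dg) <= Num.min 1 (e / (2 * (nr df + 1))) * nr (y - x).
  by apply: hg; rewrite lt_min ltr01 divr_gt0 // mulr_gt0.
exists (Num.min s (r / (nr dg + 1))); first by rewrite lt_min s0 divr_gt0.
move=> y; rewrite lt_min ltr_pdivlMr // => /andP[/Hs {}Hs yr].
have h1 : nr (g y - g x) <= (nr dg + 1) * nr (y - x).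
  rewrite -[g y - g x](subrK ((y - x) *: dg)) (le_trans (nrD _ _)) //.
  rewrite nrZ [nr (y - x) * _]mulrC mulrDl mul1r [leRHS]addrC lerD2r (le_trans Hs) //.
  by rewrite ler_piMl ?nr_ge0 // ge_min lexx.
have h2 := Hr _ (le_lt_trans h1 _); rewrite mulrC in h2; have {}h2 := h2 yr.
have -> : (f \o g) y - (f \o g) x - (y - x) *: (dg *: df) =
    (f (g y) - f (g x) - (g y - g x) *: df) + (g y - g x - (y - x) *: dg) *: df.
  by rewrite [X in _ = _ + X]scalerBl scalerA [RHS]addrA subrK.
rewrite (le_trans (nrD _ _)) // nrZ [e]splitr mulrDl lerD //.
  apply: (le_trans h2); apply: (le_trans (ler_wpM2l _ h1)).
    by apply/ltW/divr_gt0 => //; exact: mulr_gt0.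
  by rewrite le_eqVlt; apply/orP; left; apply/eqP; field; rewrite gt_eqF.
have h3 : nr (g y - g x - (y - x) *: dg) <= e / (2 * (nr df + 1)) * nr (y - x).
  by rewrite (le_trans Hs) // ler_wpM2r ?nr_ge0 // ge_min lexx orbT.
apply: (le_trans (ler_wpM2r (nr_ge0 _) h3)); rewrite mulrAC ler_wpM2r ?nr_ge0 //.
rewrite mulrAC ler_pdivrMr ?mulr_gt0 //.
have -> : e / 2 * (2 * (nr df + 1)) = e * (nr df + 1) by field.
by rewrite ler_pM2l // lerDl.
Qed.

Lemma is_derive1_continuous (W : normedModType C) (f : C -> W) (x : C) d :
  is_derive x (1 : C) f d -> {for x, continuous f}.
Proof.
move=> h; apply: differentiable_continuous; apply/is_derive1_diffP; by exists d.
Qed.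

Lemma is_derive_near (W : normedModType C) (f g : C -> W) (x : C) d :
  (\forall y \near x, f y = g y) -> is_derive x (1 : C) f d -> is_derive x (1 : C) g d.
Proof.
move=> /nbhs_nrP [r r0 Hr] /is_derive1_nrP h; apply/is_derive1_nrP => e /h [r' r'0 Hr'].
exists (Num.min r r'); first by rewrite lt_min r0.
move=> y; rewrite lt_min => /andP[y1 y2]; rewrite -!Hr ?subrr ?nr0 //.
exact: Hr'.
Qed.

Lemma diff_near (V W : normedModType C) (f g : V -> W) (x : V) :
  (\forall y \near x, f y = g y) -> differentiable f x -> differentiable g x.
Proof.
move=> fg df.
have := nbhs_singleton fg => fgx.
case/nbhs_nrP: fg => [r r0 Hr].
have [K K0] : exists K : R, forall v, nr ('d f x v) <= K * nr v.
  have [k k0 Hk] := linear_lipschitz (diff_continuous df).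
  have rk : k = (Re k)%:C by rewrite RRe_real // gtr0_real.
  by exists (Re k) => v; have := Hk v; rewrite rk [X in _ * X]nrE -rmorphM /= nr_le.
suff [//] : differentiable g x /\ 'd g x = 'd f x :> (V -> W).
apply: (nr_diff K0) => e e0; have [r' r'0 Hr'] := diff_nrP df e0.
exists (Num.min r r'); first by rewrite lt_min r0.
by move=> y; rewrite lt_min => /andP[y1 y2]; rewrite -Hr // -fgx; exact: Hr'.
Qed.

End Derivatives.

(** * Mean value inequality along segments, and the complex exponential *)

Section Exponential.
Variable R : realType.
Local Notation C := R[i].
Local Notation Re := complex.Re.
Local Notation Im := complex.Im.

Lemma real_is_deriveP (f : R -> R) (x d : R) :
  is_derive x (1 : R) f d <->
  forall e : R, 0 < e -> exists2 r : R, 0 < r & forall y, `|y - x| < r ->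
    `|f y - f x - (y - x) * d| <= e * `|y - x|.
Proof.
have E : is_derive x (1 : R) f d <-> (fun h : R => h^-1 *: (f (h *: (1 : R) + x) - f x)) @ 0^' --> d.
  split=> [H|H].
    have h1 := @ex_derive _ _ _ _ _ _ _ H.
    by have <- := @derive_val _ _ _ _ _ _ _ H.
  by split; [apply/cvg_ex; exists d|apply: cvg_lim].
rewrite E; split.
  move=> /cvgrPdist_le H e e0; have := H _ e0.
  move=> /nbhs_ballP [r /= r0 Hr]; exists r => // y yr.
  have [->|yx] := eqVneq y x; first by rewrite !subrr mul0r subr0 normr0 mulr0.
  have := Hr (y - x); rewrite /ball /= sub0r normrN subr_eq0 => /(_ yr yx).
  rewrite [_ *: 1]mulr1 subrK /= => h.
  have -> : f y - f x - (y - x) * d = - ((y - x) * (d - (y - x)^-1 *: (f y - f x))).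
    by rewrite mulrBr -[_ *: (f y - f x)]/(_ * (f y - f x)) mulrA mulfV ?subr_eq0 // mul1r opprB.
  by rewrite normrN normrM mulrC ler_wpM2r.
move=> H; apply/cvgrPdist_le => e e0; have [r r0 Hr] := H _ e0.
apply/nbhs_ballP; exists r => //= y; rewrite /ball /= sub0r normrN => yr y0.
have := Hr (y + x); rewrite addrK [_ *: 1]mulr1 => /(_ yr) h.
rewrite -(ler_pM2r (x := `|y|)) ?normr_gt0 // -normrM; apply: le_trans h.
rewrite -normrN -[X in X <= _]/(`|- ((d - y^-1 * (f (y + x) - f x)) * y)|).
by rewrite mulrBl opprB mulrAC mulVf // mul1r [d * y]mulrC.
Qed.

Lemma is_derive_Re_line (f : C -> C) (c a v : C) (s : R) d :
  is_derive (a + s%:C * v) (1 : C) f d ->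
  is_derive s (1 : R) (fun s : R => Re (c * f (a + s%:C * v))) (Re (c * (d * v))).
Proof.
move=> /is_derive1_nrP H; apply/real_is_deriveP => e e0.
have k0 : 0 < nr c * nr v + 1 by rewrite ltr_wpDl // mulr_ge0 // nr_ge0.
have [r r0 Hr] := H _ (divr_gt0 e0 k0).
have k1 : 0 < nr v + 1 by rewrite ltr_wpDl // nr_ge0.
exists (r / (nr v + 1)); first by rewrite divr_gt0.
move=> y; rewrite ltr_pdivlMr // => yr.
have E : a + y%:C * v - (a + s%:C * v) = (y - s)%:C * v.
  by rewrite opprD addrACA subrr add0r -mulrBl -rmorphB.
have /Hr : nr (a + y%:C * v - (a + s%:C * v)) < r.
  by rewrite E nrM nrC (le_lt_trans _ yr) // ler_wpM2l // lerDl.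
rewrite E nrM nrC => h.
rewrite -ReB -Re_mulC -ReB (le_trans (nr_Re _)) //.
have -> : c * f (a + y%:C * v) - c * f (a + s%:C * v) - (y - s)%:C * (c * (d * v)) =
  c * (f (a + y%:C * v) - f (a + s%:C * v) - ((y - s)%:C * v) *: d).
  by rewrite -[_ *: d]/(_ * d); ring.
rewrite nrM (le_trans (ler_wpM2l (nr_ge0 _) h)) //.
have -> : nr c * (e / (nr c * nr v + 1) * (`|y - s| * nr v)) =
  (e * `|y - s|) * (nr c * nr v / (nr c * nr v + 1)) by ring.
rewrite ler_piMr ?mulr_ge0 //; first exact: ltW.
by rewrite ler_pdivrMr // mul1r lerDl.
Qed.

(** The real mean value theorem is applied to Re (conj(c) f(a + s v)) - |c| psi(s), where c is the
    increment of f itself: conj(c) c = |c|^2, so nothing is lost in the projection. *)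
Lemma mean_value_le (f df : C -> C) (a v : C) (psi dpsi : R -> R) (T : R) : 0 <= T ->
  (forall s : R, 0 <= s <= T -> is_derive (a + s%:C * v) (1 : C) f (df (a + s%:C * v))) ->
  (forall s : R, 0 <= s <= T -> is_derive s (1 : R) psi (dpsi s)) ->
  (forall s : R, 0 <= s <= T -> nr (df (a + s%:C * v) * v) <= dpsi s) ->
  nr (f (a + T%:C * v) - f a) <= psi T - psi 0.
Proof.
move=> T0 Hf Hpsi Hle; set c := f _ - f a.
pose chi := (fun s : R => Re (c^* * f (a + s%:C * v)) - nr c * psi s).
pose dchi := fun s : R => Re (c^* * (df (a + s%:C * v) * v)) - nr c * dpsi s.
have Hchi s : 0 <= s <= T -> is_derive s (1 : R) chi (dchi s).
  move=> h; apply: is_deriveB.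
    exact: is_derive_Re_line (Hf _ h).
  by apply: is_deriveZ; exact: Hpsi.
have [s /[!in_itv]/= hs Es] : exists2 s, s \in `[0, T] & chi T - chi 0 = dchi s * (T - 0).
  apply: MVT_segment => //.
    by move=> s; rewrite in_itv /= => /andP[s0 sT]; apply: Hchi; rewrite !ltW.
  apply: derivable_within_continuous => s; rewrite in_itv /= => hs.
  exact: @ex_derive _ _ _ _ _ _ _ (Hchi _ hs).
have : chi T - chi 0 <= 0.
  rewrite Es subr0 mulr_le0_ge0 // subr_le0.
  rewrite (le_trans (ler_norm _)) // (le_trans (nr_Re _)) // nrM nrJ.
  by rewrite ler_wpM2l ?nr_ge0 // Hle.
rewrite /chi mul0r addr0 => h.
have E : Re (c^* * f (a + T%:C * v)) - Re (c^* * f a) = nr c ^+ 2.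
  by rewrite -ReB -mulrBr mulJ.
have {}h : nr c ^+ 2 <= nr c * (psi T - psi 0).
  rewrite -E -subr_le0; apply: le_trans h; rewrite le_eqVlt; apply/orP; left; apply/eqP.
  ring.
(* For c = 0 the claim is psi 0 <= psi T, which follows from 0 <= dpsi. *)
have [c0|c0] := eqVneq (nr c) 0.
  rewrite c0 subr_ge0.
  have [s1 /[!in_itv]/= hs1 Es1] : exists2 s, s \in `[0, T] & psi T - psi 0 = dpsi s * (T - 0).
    apply: MVT_segment => //.
      by move=> x; rewrite in_itv /= => /andP[s0 sT]; apply: Hpsi; rewrite !ltW.
    apply: derivable_within_continuous => x; rewrite in_itv /= => hx.
    exact: @ex_derive _ _ _ _ _ _ _ (Hpsi _ hx).
  rewrite -subr_ge0 Es1 subr0 mulr_ge0 // (le_trans _ (Hle _ hs1)) //.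
  exact: nr_ge0.
by rewrite -(ler_pM2l (x := nr c)) -?expr2 // lt_neqAle eq_sym c0 nr_ge0.
Qed.

Lemma mean_value_segment (f df : C -> C) (a b : C) (K : R) :
  (forall s : R, 0 <= s <= 1 -> is_derive (a + s%:C * (b - a)) (1 : C) f (df (a + s%:C * (b - a)))) ->
  (forall s : R, 0 <= s <= 1 -> nr (df (a + s%:C * (b - a))) <= K) ->
  nr (f b - f a) <= K * nr (b - a).
Proof.
move=> Hf HK.
have := @mean_value_le f df a (b - a) (fun s => K * nr (b - a) * s) (fun=> K * nr (b - a)) 1 ler01 Hf.
rewrite rmorph1 mul1r [a + _]addrC subrK mulr1 mulr0 subr0; apply.
  move=> s _; have := @is_deriveZ _ _ _ id (K * nr (b - a)) s (1 : R) (1 : R) (is_derive_id _ _).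
  by rewrite [_ *: 1]mulr1.
by move=> s hs; rewrite nrM ler_wpM2r ?nr_ge0 // HK.
Qed.

Lemma is_derive0_cst (f : C -> C) (a b : C) :
  (forall s : R, 0 <= s <= 1 -> is_derive (a + s%:C * (b - a)) (1 : C) f 0) -> f b = f a.
Proof.
move=> H; apply/eqP; rewrite -subr_eq0 -nr_eq0 eq_le nr_ge0 andbT.
have := @mean_value_segment f (fun=> 0) a b 0 H; rewrite mul0r; apply => s _.
by rewrite nr0.
Qed.

Lemma cisD (x y : R) : cis (x + y) = cis x * cis y.
Proof. by rewrite /cis cosD sinD; congr (_ +i* _); rewrite addrC [X in _ + X]mulrC. Qed.

Lemma nr_cis (x : R) : nr (cis x) = 1.
Proof.
apply/eqP; rewrite -(eqrXn2 (n := 2)) ?nr_ge0 // expr1n; apply/eqP/complexI.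
by rewrite rmorphXn /= -nrE -add_Re2_Im2 /= cos2Dsin2.
Qed.

Lemma cexpD (z w : C) : cexp (z + w) = cexp z * cexp w.
Proof. by rewrite /cexp ReD ImD expRD cisD rmorphM /= mulrACA. Qed.

Lemma cexp0 : cexp (0 : C) = 1.
Proof. by rewrite /cexp /cis /= expR0 cos0 sin0 mul1r. Qed.

Lemma nr_cexp (z : C) : nr (cexp z) = expR (Re z).
Proof. by rewrite /cexp nrM nr_cis mulr1 nrC ger0_norm // expR_ge0. Qed.

Lemma cexp_neq0 (z : C) : cexp z != 0.
Proof. by rewrite -nr_gt0 nr_cexp expR_gt0. Qed.

Lemma cexpN (z : C) : cexp (- z) = (cexp z)^-1.
Proof.
by apply: (mulfI (cexp_neq0 z)); rewrite -cexpD subrr cexp0 mulfV // cexp_neq0.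
Qed.

Lemma cexp2pi : cexp (0 +i* (2 * pi)) = 1 :> C.
Proof. by rewrite /cexp /cis /= expR0 mulr_natl cos2pi sin2pi mul1r. Qed.

Lemma is_derive_cexp (z : C) : is_derive z (1 : C) (@cexp R) (cexp z).
Proof.
(* By the functional equation the origin suffices. There the real derivatives of exp, cos and sin
   leave an error of at most 9 d |h|, so d <= e / 32 is ample. *)
have D0 : forall e : R, 0 < e -> exists2 r : R, 0 < r & forall h : C, nr h < r ->
    nr (cexp h - 1 - h) <= e * nr h.
  move=> e e0.
  have [d d0 [d1 de]] : exists2 d : R, 0 < d & d <= 1 /\ d <= e / 32.
    by exists (Num.min 1 (e / 32)); rewrite ?lt_min ?ltr01 ?divr_gt0 // !ge_min !lexx orbT.
  have [r1 r10 H1] := (real_is_deriveP _ _ _).1 (@is_derive_expR R 0) d d0.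
  have [r2 r20 H2] := (real_is_deriveP _ _ _).1 (is_derive_cos (0 : R)) d d0.
  have [r3 r30 H3] := (real_is_deriveP _ _ _).1 (is_derive_sin (0 : R)) d d0.
  exists (Num.min d (Num.min r1 (Num.min r2 r3))); first by rewrite !lt_min d0 r10 r20.
  move=> h; rewrite !lt_min => /and4P[h0 h1 h2 h3].
  have hR := nr_Re h; have hI := nr_Im h.
  have {H1} := H1 (Re h); rewrite subr0 expR0 mulr1 => /(_ (le_lt_trans hR h1)) H1.
  have {H2} := H2 (Im h); rewrite subr0 cos0 sin0 oppr0 mulr0 subr0 => /(_ (le_lt_trans hI h2)) H2.
  have {H3} := H3 (Im h); rewrite subr0 sin0 cos0 mulr1 subr0 => /(_ (le_lt_trans hI h3)) H3.
  set a := Re h in hR H1 *; set b := Im h in hI H2 H3 *.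
  have N0 := nr_ge0 h.
  have Ea : `|expR a - 1| <= 2 * nr h.
    rewrite -[expR a - 1](subrK a) (le_trans (ler_normD _ _)) //.
    have := ler_wpM2r (normr_ge0 a) d1; lra.
  have Eb : `|expR a| <= 3.
    rewrite -[expR a](subrK 1) (le_trans (ler_normD _ _)) // normr1; lra.
  have P1 : `|expR a * (cos b - 1)| <= 3 * (d * nr h).
    rewrite normrM; apply: ler_pM => //.
    by rewrite (le_trans H2) // ler_wpM2l // ltW.
  have P2 : `|expR a * (sin b - b)| <= 3 * (d * nr h).
    rewrite normrM; apply: ler_pM => //.
    by rewrite (le_trans H3) // ler_wpM2l // ltW.
  have P3 : `|(expR a - 1) * b| <= 2 * (d * nr h).
    rewrite normrM mulrA; apply: ler_pM => //.
    by rewrite (le_trans Ea) // ler_wpM2l // ltW.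
  have P4 : `|expR a - 1 - a| <= d * nr h.
    by rewrite (le_trans H1) // ler_wpM2l // ltW.
  rewrite (le_trans (nr_ReIm _)) //.
  have -> : Re (cexp h - 1 - h) = expR a * (cos b - 1) + (expR a - 1 - a).
    by rewrite !ReB /cexp Re_mulC /=; rewrite -/a -/b; ring.
  have -> : Im (cexp h - 1 - h) = expR a * (sin b - b) + (expR a - 1) * b.
    by rewrite !ImB /cexp Im_mulC /=; rewrite -/a -/b; ring.
  have := ler_normD (expR a * (cos b - 1)) (expR a - 1 - a).
  have := ler_normD (expR a * (sin b - b)) ((expR a - 1) * b).
  have := ler_wpM2r N0 de; have : 0 <= e * nr h by rewrite mulr_ge0 // ltW.
  lra.
apply/is_derive1_nrP => e e0.
have k0 := expR_gt0 (Re z).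
have [r r0 Hr] := D0 _ (divr_gt0 e0 k0).
exists r => // y yr; have := Hr _ yr.
have -> : cexp y = cexp (y - z) * cexp z by rewrite -cexpD subrK.
have -> : cexp (y - z) * cexp z - cexp z - (y - z) *: cexp z = cexp z * (cexp (y - z) - 1 - (y - z)).
  by rewrite -[_ *: _]/(_ * _); ring.
rewrite nrM nr_cexp => h; apply: (le_trans (ler_wpM2l (ltW k0) h)).
by rewrite mulrA mulrCA mulfV ?mulr1 // gt_eqF.
Qed.

End Exponential.

(** * Rules of differentiation for functions of one complex variable *)

Section DerivativeRules.
Variable R : realType.
Local Notation C := R[i].
Implicit Types (f g : C -> C) (z a b c : C).

Lemma der_cst c z : is_derive z (1 : C) (fun=> c) 0.
Proof. exact: is_derive_cst. Qed.

Lemma der_id z : is_derive z (1 : C) (fun x => x) 1.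
Proof. exact: is_derive_id. Qed.

Lemma der_add f g z a b : is_derive z (1 : C) f a -> is_derive z (1 : C) g b ->
  is_derive z (1 : C) (fun x => f x + g x) (a + b).
Proof. by move=> hf hg; exact: (is_deriveD hf hg). Qed.

Lemma der_opp f z a : is_derive z (1 : C) f a -> is_derive z (1 : C) (fun x => - f x) (- a).
Proof. by move=> hf; exact: (is_deriveN hf). Qed.

Lemma der_sub f g z a b : is_derive z (1 : C) f a -> is_derive z (1 : C) g b ->
  is_derive z (1 : C) (fun x => f x - g x) (a - b).
Proof. by move=> hf /der_opp; exact: der_add. Qed.

Lemma der_mul f g z a b : is_derive z (1 : C) f a -> is_derive z (1 : C) g b ->
  is_derive z (1 : C) (fun x => f x * g x) (a * g z + f z * b).
Proof.
move=> hf hg; have := is_deriveM hf hg; rewrite addrC.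
by move=> h; have -> : a * g z + f z * b = g z *: a + f z *: b by rewrite [a * _]mulrC.
Qed.

Lemma der_scale c f z a : is_derive z (1 : C) f a -> is_derive z (1 : C) (fun x => c * f x) (c * a).
Proof. by move=> /(der_mul (der_cst c z)); rewrite mul0r add0r. Qed.

Lemma der_eq f z a b : is_derive z (1 : C) f a -> a = b -> is_derive z (1 : C) f b.
Proof. by move=> h <-. Qed.

Lemma der_expn f z a n : is_derive z (1 : C) f a ->
  is_derive z (1 : C) (fun x => f x ^+ n) (n%:R * f z ^+ n.-1 * a).
Proof.
move=> hf; elim: n => [|n IH].
  by rewrite mulr0n !mul0r; apply: der_eq (der_cst 1 z) _.
apply: (@is_derive_near _ _ (fun x => f x * f x ^+ n)).
  by apply/nbhs_nrP; exists 1 => // y _; rewrite exprS.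
apply: der_eq (der_mul hf IH) _.
case: n {IH} => [|n] /=; first by rewrite expr0 mulr1 mulr0n mul0r mul0r mulr0 addr0 mul1r mul1r.
by rewrite [f z ^+ n.+1]exprS -[in RHS](addn1 n.+1) natrD; ring.
Qed.

Lemma der_inv f z a : is_derive z (1 : C) f a -> f z != 0 ->
  is_derive z (1 : C) (fun x => (f x)^-1) (- a / f z ^+ 2).
Proof.
move=> hf fz0; have df := @ex_derive _ _ _ _ _ _ _ hf.
apply: DeriveDef; first exact: derivableV.
rewrite deriveV // (@derive_val _ _ _ _ _ _ _ hf).
by rewrite -[_ *: a]/(_ * a) mulrC mulrN mulNr.
Qed.

Lemma der_comp f g z a b : is_derive z (1 : C) g b -> is_derive (g z) (1 : C) f a ->
  is_derive z (1 : C) (fun x => f (g x)) (b * a).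
Proof. by move=> hg hf; exact: (is_derive1_comp hf hg). Qed.

Lemma der_cexp f z a : is_derive z (1 : C) f a ->
  is_derive z (1 : C) (fun x => cexp (f x)) (a * cexp (f z)).
Proof. by move=> h; apply: (der_comp h); exact: is_derive_cexp. Qed.

End DerivativeRules.

(** * Continuous induction on a real interval *)

Section IntervalInduction.
Variable R : realType.

(** The supremum of the points reachable from a has a neighbourhood on which Q holds, so it is
    reached and equals b. This takes the place of compactness of [a, b]: Q is either a uniform bound
    on a subinterval or the passage of a property from one end to the other. *)
Lemma itv_ind (Q : R -> R -> Prop) (a b : R) : a <= b ->
  (forall x y z, a <= x -> x <= y -> y <= z -> z <= b -> Q x y -> Q y z -> Q x z) ->
  (forall x, a <= x <= b -> exists2 e : R, 0 < e &
     forall y z, a <= y -> y <= z -> z <= b -> x - e < y -> z < x + e -> Q y z) ->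
  Q a b.
Proof.
move=> ab Qtr Qloc.
pose S := [set x : R | a <= x <= b /\ Q a x].
have Sa : S a.
  have [|e e0 He] := Qloc a; first by rewrite lexx.
  by split; [rewrite lexx|apply: He => //; rewrite ?ltrBlDr ltrDl].
have hS : has_sup S by split; [exists a|exists b => x [/andP[]]].
have sb : sup S <= b by apply: ge_sup => //; [exists a|move=> x [/andP[]]].
have sa : a <= sup S by apply: ub_le_sup; case: hS.
have [|e e0 He] := Qloc (sup S); first by rewrite sa sb.
have [x [/andP[ax xb] Qx] xe] := sup_adherent e0 hS.
pose z := Num.min b (sup S + e / 2).
have xs : x <= sup S by apply: ub_le_sup; [case: hS|split; rewrite ?ax].
have e2 : e / 2 < e by rewrite ltr_pdivrMr // ltr_pMr // ltr1n.
have xz : x <= z by rewrite le_min xb (le_trans xs) // lerDl divr_ge0 // ltW.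
have zb : z <= b by rewrite ge_min lexx.
have Qz : Q a z.
  apply: (Qtr a x z) => //; apply: He => //.
  by rewrite gt_min ltrD2l e2 orbT.
have : z <= sup S.
  by apply: ub_le_sup; [case: hS|split => //; rewrite zb (le_trans ax)].
rewrite ge_min => /orP[h|]; last by lra.
by have <- : z = b by apply/min_idPl; lra.
Qed.

End IntervalInduction.

(** * Riemann sums over dyadic subdivisions *)

Section SegmentIntegral.
Variable R : realType.
Local Notation C := R[i].
Local Notation Re := complex.Re.
Local Notation Im := complex.Im.

(* Left Riemann sum over the dyadic subdivision of [0, 1] into 2^N intervals,
   in a recursive form making its behaviour under bisection definitional. *)
Fixpoint dysum (N : nat) (phi : R -> C) : C :=
  if N is M.+1 then
    (dysum M (fun s => phi (s / 2)) + dysum M (fun s => phi ((1 + s) / 2))) / 2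
  else phi 0.

Definition dyint (phi : R -> C) : C := lim (dysum N phi @[N --> \oo]).

(** A dyadic modulus of continuity tells directly from which level N on the sums are stable. *)
Definition ucont01 (phi : R -> C) := forall e : R, 0 < e -> exists N : nat, 
  forall s s', 0 <= s <= 1 -> 0 <= s' <= 1 -> `|s - s'| <= 2 ^- N -> nr (phi s - phi s') <= e.

Let half0 (s : R) : 0 <= s <= 1 -> 0 <= s / 2 <= 1.
Proof. by lra. Qed.

Let half1 (s : R) : 0 <= s <= 1 -> 0 <= (1 + s) / 2 <= 1.
Proof. by lra. Qed.

Let nr2 : nr (2 : C) = 2.
Proof. by have := @nr_real R 2; rewrite rmorph_nat; apply. Qed.

Let avg_le (x y : C) e : nr x <= e -> nr y <= e -> nr ((x + y) / 2) <= e.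
Proof.
move=> h1 h2; rewrite nrM nrV nr2 ler_pdivrMr // (le_trans (nrD _ _)) //.
by rewrite mulr_natr mulr2n lerD.
Qed.

Lemma dysumB N (phi psi : R -> C) :
  dysum N (fun s => phi s - psi s) = dysum N phi - dysum N psi.
Proof. by elim: N phi psi => //= N IH phi psi; rewrite !IH -mulrBl opprD addrACA. Qed.

Lemma dysum_le N (phi : R -> C) (c : C) e :
  (forall s, 0 <= s <= 1 -> nr (phi s - c) <= e) -> nr (dysum N phi - c) <= e.
Proof.
elim: N phi => [|N IH] phi H /=; first by apply: H; rewrite lexx ler01.
have -> : (dysum N (fun s => phi (s / 2)) + dysum N (fun s => phi ((1 + s) / 2))) / 2 - c =
  ((dysum N (fun s => phi (s / 2)) - c) + (dysum N (fun s => phi ((1 + s) / 2)) - c)) / 2.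
  by field.
apply: avg_le; apply: IH => s hs; apply: H; [exact: half0|exact: half1].
Qed.

Lemma dysum_cauchy N m (phi : R -> C) e :
  (forall s s', 0 <= s <= 1 -> 0 <= s' <= 1 -> `|s - s'| <= 2 ^- N -> nr (phi s - phi s') <= e) ->
  nr (dysum (N + m) phi - dysum N phi) <= e.
Proof.
elim: N phi => [|N IH] phi H /=.
  rewrite add0n; apply: dysum_le => s hs; apply: H => //; first by rewrite lexx ler01.
  by rewrite expr0 invr1 subr0 ger0_norm; case/andP: hs.
rewrite -mulrBl opprD addrACA; apply: avg_le; apply: IH => s s' hs hs' h; apply: H.
- exact: half0.
- exact: half0.
- rewrite -mulrBl normrM [`|2^-1|]ger0_norm // exprSr invfM ler_pM2r //.
- exact: half1.
- exact: half1.
- have -> : (1 + s) / 2 - (1 + s') / 2 = (s - s') / 2 by field.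
  by rewrite normrM [`|2^-1|]ger0_norm // exprSr invfM ler_pM2r.
Qed.

(** Reversing the parameter exchanges left and right endpoints, so the two sums differ by at most
    the oscillation over one interval of the subdivision. *)
Lemma dysum_rev N (phi : R -> C) e :
  (forall s s', 0 <= s <= 1 -> 0 <= s' <= 1 -> `|s - s'| <= 2 ^- N -> nr (phi s - phi s') <= e) ->
  nr (dysum N (fun s => phi (1 - s)) - dysum N phi) <= e.
Proof.
elim: N phi => [|N IH] phi H /=.
  by apply: H; rewrite ?subr0 ?lexx ?ler01 // expr0 invr1 normr1.
rewrite [X in X / 2 - _]addrC -mulrBl opprD addrACA.
have E1 : (fun s => phi (1 - (1 + s) / 2)) = (fun s : R => (fun s => phi (s / 2)) (1 - s)).
  by apply/funext => s /=; congr phi; field.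
have E2 : (fun s => phi (1 - s / 2)) = (fun s : R => (fun s => phi ((1 + s) / 2)) (1 - s)).
  by apply/funext => s /=; congr phi; field.
rewrite E1 E2; apply: avg_le; apply: IH => s s' hs hs' h; apply: H.
- exact: half0.
- exact: half0.
- rewrite -mulrBl normrM [`|2^-1|]ger0_norm // exprSr invfM ler_pM2r //.
- exact: half1.
- exact: half1.
- have -> : (1 + s) / 2 - (1 + s') / 2 = (s - s') / 2 by field.
  by rewrite normrM [`|2^-1|]ger0_norm // exprSr invfM ler_pM2r.
Qed.

(** On each half P is replaced by its double in the rescaled parameter; the two increments average
    back to P 1 - P 0. The error stays e throughout because it is relative to the length. *)
Lemma dysum_ftc N (phi P : R -> C) e :
  (forall s s', 0 <= s <= 1 -> 0 <= s' <= 1 -> `|s' - s| <= 2 ^- N ->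
     nr (P s' - P s - (s' - s)%:C * phi s) <= e * `|s' - s|) ->
  nr (dysum N phi - (P 1 - P 0)) <= e.
Proof.
elim: N phi P => [|N IH] phi P H /=.
  have := H 0 1; rewrite subr0 rmorph1 mul1r lexx ler01 expr0 invr1 normr1 mulr1.
  by rewrite nr_dist; apply; rewrite ?lexx.
have -> : (dysum N (fun s => phi (s / 2)) + dysum N (fun s => phi ((1 + s) / 2))) / 2 - (P 1 - P 0) =
 ((dysum N (fun s => phi (s / 2)) - (2 * P (1 / 2) - 2 * P (0 / 2))) +
  (dysum N (fun s => phi ((1 + s) / 2)) - (2 * P ((1 + 1) / 2) - 2 * P ((1 + 0) / 2)))) / 2.
  have -> : (1 + 1) / 2 = 1 :> R by field.
  by rewrite addr0 mul0r; field.
apply: avg_le.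
  apply: (IH _ (fun s => 2 * P (s / 2))) => s s' hs hs' h.
  have -> : 2 * P (s' / 2) - 2 * P (s / 2) - (s' - s)%:C * phi (s / 2) =
      2 * (P (s' / 2) - P (s / 2) - (s' / 2 - s / 2)%:C * phi (s / 2)).
    by rewrite -mulrBl rmorphM /= fmorphV rmorph_nat; field.
  rewrite nrM nr2.
  have E : s' / 2 - s / 2 = (s' - s) / 2 by field.
  have := H (s / 2) (s' / 2) (half0 hs) (half0 hs').
  rewrite E normrM [`|2^-1|]ger0_norm // exprSr invfM ler_pM2r // => /(_ h).
  lra.
apply: (IH _ (fun s => 2 * P ((1 + s) / 2))) => s s' hs hs' h.
have E : (1 + s') / 2 - (1 + s) / 2 = (s' - s) / 2 by field.
have -> : 2 * P ((1 + s') / 2) - 2 * P ((1 + s) / 2) - (s' - s)%:C * phi ((1 + s) / 2) =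
    2 * (P ((1 + s') / 2) - P ((1 + s) / 2) - ((1 + s') / 2 - (1 + s) / 2)%:C * phi ((1 + s) / 2)).
  by rewrite E rmorphM /= fmorphV rmorph_nat; field.
rewrite nrM nr2.
have := H ((1 + s) / 2) ((1 + s') / 2) (half1 hs) (half1 hs').
rewrite E normrM [`|2^-1|]ger0_norm // exprSr invfM ler_pM2r // => /(_ h).
lra.
Qed.

Lemma dyint_cvg (phi : R -> C) : ucont01 phi -> dysum N phi @[N --> \oo] --> dyint phi.
Proof.
move=> H; have [|l Hl] := @ccauchy_cvg R (fun N => dysum N phi).
  move=> e e0; have e3 : 0 < e / 3 by rewrite divr_gt0.
  have [N HN] := H _ e3; exists N => n m Nn Nm.
  have h1 := dysum_cauchy (n - N) HN; have h2 := dysum_cauchy (m - N) HN.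
  rewrite subnKC // in h1; rewrite subnKC // in h2.
  rewrite (le_lt_trans (nr_subD (dysum N phi) _ _)) // [X in _ + X]nr_dist; lra.
by rewrite /dyint (cvg_lim _ Hl).
Qed.

End SegmentIntegral.

(** * Integrals over segments in the plane *)

Section Goursat.
Variable R : realType.
Local Notation C := R[i].
Local Notation Re := complex.Re.
Local Notation Im := complex.Im.

Definition seg (a b : C) (s : R) : C := a + s%:C * (b - a).

(** Continuity at the points of the segment is that of a function on the plane, which avoids a
    subspace topology on the segment. *)
Definition cont_seg (f : C -> C) (a b : C) :=
  forall s : R, 0 <= s <= 1 -> forall e : R, 0 < e ->
  exists2 d : R, 0 < d & forall y, nr (y - seg a b s) < d -> nr (f y - f (seg a b s)) < e.

Definition segint (f : C -> C) (a b : C) : C := (b - a) * dyint (fun s => f (seg a b s)).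

Lemma nr_segB (a b : C) s s' : nr (seg a b s - seg a b s') = `|s - s'| * nr (b - a).
Proof. by rewrite /seg opprD addrACA subrr add0r -mulrBl -rmorphB nrM nrC. Qed.

Lemma exists_2expn (e : R) : 0 < e -> exists N : nat, 2 ^- N < e.
Proof.
move=> e0; exists (Num.bound e^-1).
rewrite -[ltRHS]invrK ltf_pV2 ?posrE ?invr_gt0 ?exprn_gt0 //.
have e1 : 0 <= e^-1 by rewrite invr_ge0 ltW.
have := archi_boundP e1 => /lt_trans; apply.
by rewrite -natrX ltr_nat ltn_expl.
Qed.

Lemma seg_unif (f : C -> C) (a b : C) : cont_seg f a b ->
  forall e : R, 0 < e -> exists2 d : R, 0 < d & forall s, 0 <= s <= 1 ->
    forall y, nr (y - seg a b s) < d -> nr (f y - f (seg a b s)) < e.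
Proof.
move=> H e e0.
suff [d d0 Hd] : exists2 d : R, 0 < d & forall s, 0 <= s -> s <= 1 ->
    forall y, nr (y - seg a b s) < d -> nr (f y - f (seg a b s)) < e.
  by exists d => // s /andP[]; exact: Hd.
apply: (@itv_ind R (fun x y => exists2 d : R, 0 < d & forall s, x <= s -> s <= y ->
    forall z, nr (z - seg a b s) < d -> nr (f z - f (seg a b s)) < e)) => //.
  move=> x y z _ _ _ _ [d d0 Hd] [d' d'0 Hd'].
  exists (Num.min d d'); first by rewrite lt_min d0.
  move=> s sx sz u; rewrite lt_min => /andP[u1 u2].
  by have [sy|/ltW sy] := leP s y; [exact: Hd|exact: Hd'].
move=> x x01; have e2 : 0 < e / 2 by rewrite divr_gt0.
have [d d0 Hd] := H x x01 _ e2.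
have k0 : 0 < nr (b - a) + 1 by rewrite ltr_wpDl ?nr_ge0.
have d2 : 0 < d / 2 by rewrite divr_gt0.
exists (d / 2 / (nr (b - a) + 1)); first by rewrite divr_gt0.
move=> y z y0 yz z1 xy zx; exists (d / 2) => // s ys sz u us.
have ss : nr (seg a b s - seg a b x) < d / 2.
  rewrite nr_segB; apply: (@le_lt_trans _ _ (`|s - x| * (nr (b - a) + 1))).
    by rewrite ler_wpM2l // lerDl.
  by rewrite -ltr_pdivlMr // ltr_norml; apply/andP; split; lra.
have h1 : nr (f u - f (seg a b x)) < e / 2.
  apply: Hd; rewrite (le_lt_trans (nr_subD (seg a b s) _ _)) //; lra.
have h2 : nr (f (seg a b s) - f (seg a b x)) < e / 2 by apply: Hd; lra.
rewrite (le_lt_trans (nr_subD (f (seg a b x)) _ _)) // [X in _ + X]nr_dist; lra.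
Qed.

Lemma seg_ucont (f : C -> C) (a b : C) : cont_seg f a b -> ucont01 (fun s => f (seg a b s)).
Proof.
move=> /seg_unif H e e0; have [d d0 Hd] := H e e0.
have k0 : 0 < nr (b - a) + 1 by rewrite ltr_wpDl ?nr_ge0.
have [N HN] := exists_2expn (divr_gt0 d0 k0).
exists N => s s' hs hs' h; apply/ltW/Hd => //.
rewrite nr_segB; apply: (@le_lt_trans _ _ (`|s - s'| * (nr (b - a) + 1))).
  by rewrite ler_wpM2l // lerDl.
by rewrite -ltr_pdivlMr // (le_lt_trans h).
Qed.

Lemma segint_cvg (f : C -> C) (a b : C) : cont_seg f a b ->
  dysum N (fun s => f (seg a b s)) @[N --> \oo] --> dyint (fun s => f (seg a b s)).
Proof. by move=> /seg_ucont /dyint_cvg. Qed.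

Lemma dyint_eq (phi : R -> C) l : dysum N phi @[N --> \oo] --> l -> dyint phi = l.
Proof. by move=> H; rewrite /dyint (cvg_lim _ H). Qed.

Lemma cvgn_nrB (u v : nat -> C) (l m : C) : u n @[n --> \oo] --> l -> v n @[n --> \oo] --> m ->
  (u n - v n) @[n --> \oo] --> l - m.
Proof. by move=> h1 h2; exact: (cvgB h1 h2). Qed.

Lemma cvgn_nrZ (c : C) (u : nat -> C) (l : C) : u n @[n --> \oo] --> l ->
  (c * u n) @[n --> \oo] --> c * l.
Proof.
move=> /cvgn_nrP H; apply/cvgn_nrP => e e0.
have k0 : 0 < nr c + 1 by rewrite ltr_wpDl ?nr_ge0.
have [N HN] := H _ (divr_gt0 e0 k0); exists N => n /HN.
rewrite -mulrBr nrM ltr_pdivlMr // mulrC => h; apply: le_lt_trans h.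
by rewrite ler_wpM2r ?nr_ge0 // lerDl.
Qed.

Lemma cvgn_ext (u v : nat -> C) (l : C) : (forall n, u n = v n) ->
  u n @[n --> \oo] --> l -> v n @[n --> \oo] --> l.
Proof. by move/funext ->. Qed.

Lemma segintB (f g : C -> C) (a b : C) : cont_seg f a b -> cont_seg g a b ->
  segint (fun z => f z - g z) a b = segint f a b - segint g a b.
Proof.
move=> /segint_cvg hf /segint_cvg hg; rewrite /segint -mulrBr; congr (_ * _).
by apply: dyint_eq; apply: (cvgn_ext _ (cvgn_nrB hf hg)) => n; rewrite dysumB.
Qed.

Lemma segint_le (f : C -> C) (a b : C) (K : R) : cont_seg f a b ->
  (forall s, 0 <= s <= 1 -> nr (f (seg a b s)) <= K) -> nr (segint f a b) <= K * nr (b - a).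
Proof.
move=> /segint_cvg hf HK; rewrite /segint nrM mulrC ler_wpM2r ?nr_ge0 //.
apply: (cvgn_nr_le hf); exists 0%N => n _.
by rewrite -[dysum _ _]subr0; apply: dysum_le => s /HK; rewrite subr0.
Qed.

Lemma segint_ftc (f P : C -> C) (a b : C) : cont_seg f a b ->
  (forall s, 0 <= s <= 1 -> is_derive (seg a b s) (1 : C) P (f (seg a b s))) ->
  segint f a b = P b - P a.
Proof.
move=> cf HP.
have [ab|ab] := eqVneq (nr (b - a)) 0.
  by move/eqP : ab; rewrite nr_eq0 subr_eq0 => /eqP ->; rewrite /segint !subrr mul0r.
have ba0 : b - a != 0 by rewrite -nr_eq0.
have nba : 0 < nr (b - a) by rewrite nr_gt0.
rewrite /segint; apply: (mulfI (invr_neq0 ba0)); rewrite mulrA mulVf // mul1r.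
apply: dyint_eq; apply/cvgn_nrP => e e0.
have e2 : 0 < e / 2 by rewrite divr_gt0.
have [d d0 Hd] := seg_unif cf e2.
have [N HN] := exists_2expn (divr_gt0 d0 nba).
exists N => n Nn.
have -> : (b - a)^-1 * (P b - P a) = (b - a)^-1 * P (seg a b 1) - (b - a)^-1 * P (seg a b 0).
  by rewrite -mulrBr /seg rmorph1 mul1r rmorph0 mul0r addr0 [a + _]addrC subrK.
apply: (@le_lt_trans _ _ (e / 2)); last by lra.
apply: (@dysum_ftc R n _ (fun s => (b - a)^-1 * P (seg a b s))) => s s' hs hs' ss.
have ssd : `|s' - s| * nr (b - a) < d.
  rewrite -ltr_pdivlMr // (le_lt_trans ss) // (le_lt_trans _ HN) //.
  by rewrite lef_pV2 ?posrE ?exprn_gt0 // ler_eXn2l // ltr1n.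
have -> : (b - a)^-1 * P (seg a b s') - (b - a)^-1 * P (seg a b s) - (s' - s)%:C * f (seg a b s)
  = (b - a)^-1 * ((P (seg a b s') - seg a b s' * f (seg a b s)) -
     (P (seg a b s) - seg a b s * f (seg a b s))).
  have -> : (s' - s)%:C = (b - a)^-1 * (seg a b s' - seg a b s).
    by rewrite /seg opprD addrACA subrr add0r -mulrBl -rmorphB mulrC mulfK.
  ring.
rewrite nrM nrV mulrC ler_pdivrMr // -mulrA -nr_segB.
(* The mean value inequality for P z - z c on the subsegment, with derivative f - c small by uniform
   continuity, yields the error relative to the length that [dysum_ftc] asks for. *)
pose c := f (seg a b s).
pose pt r := seg a b s + r%:C * (seg a b s' - seg a b s).
have ptE r : pt r = seg a b (s + r * (s' - s)).
  by rewrite /pt /seg !rmorphD !rmorphM /= !rmorphB /=; ring.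
have h01 r : 0 <= r <= 1 -> 0 <= s + r * (s' - s) <= 1.
  by move=> hr; have := hs; have := hs'; nra.
apply: (@mean_value_segment R (fun z => P z - z * c) (fun z => f z - c)) => r hr.
  rewrite -/(pt r) ptE; have D := HP _ (h01 _ hr).
  have D2 : is_derive (seg a b (s + r * (s' - s))) (1 : C) (fun z : C => z * c) c.
    apply/is_derive1_nrP => u u0; exists 1 => // y _.
    by rewrite -[_ *: c]/(_ * c) -!mulrBl subrr mul0r nr0 mulr_ge0 ?nr_ge0 // ltW.
  exact: is_deriveB.
rewrite -/(pt r) ptE /c; apply/ltW/Hd => //.
rewrite nr_segB; apply: le_lt_trans ssd; rewrite ler_wpM2r ?nr_ge0 //.
have -> : s + r * (s' - s) - s = r * (s' - s) by ring.
by rewrite normrM ler_piMl // ger0_norm; case/andP: hr.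
Qed.

Lemma cont_seg_cont (f : C -> C) (a b : C) :
  (forall s, 0 <= s <= 1 -> {for seg a b s, continuous f}) -> cont_seg f a b.
Proof. by move=> H s hs; apply/cvg_nrP; exact: H. Qed.

Lemma cont_seg_diff (f : C -> C) (a b : C) (df : C -> C) :
  (forall s, 0 <= s <= 1 -> is_derive (seg a b s) (1 : C) f (df (seg a b s))) -> cont_seg f a b.
Proof. by move=> H; apply: cont_seg_cont => s hs; exact: is_derive1_continuous (H _ hs). Qed.

Lemma seg_rev (a b : C) s : seg b a s = seg a b (1 - s).
Proof. by rewrite /seg rmorphB rmorph1; ring. Qed.

Lemma segint_rev (f : C -> C) (a b : C) : cont_seg f a b -> segint f b a = - segint f a b.
Proof.
move=> cf; rewrite /segint -mulNr opprB; congr (_ * _).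
apply: dyint_eq; have /cvgn_nrP h := segint_cvg cf; apply/cvgn_nrP => e e0.
have e2 : 0 < e / 2 by rewrite divr_gt0.
have [N HN] := h _ e2.
have [M HM] := seg_ucont cf e2.
exists (maxn N M) => n; rewrite geq_max => /andP[Nn Mn].
have E : (fun s => f (seg b a s)) = (fun s : R => (fun s => f (seg a b s)) (1 - s)).
  by apply/funext => s /=; rewrite seg_rev.
rewrite E; rewrite (le_lt_trans (nr_subD (dysum n (fun s => f (seg a b s))) _ _)) //.
have := HN _ Nn.
have : nr (dysum n (fun s => (fun s0 : R => f (seg a b s0)) (1 - s)) - dysum n (fun s => f (seg a b s))) <= e / 2.
  apply: dysum_rev => s s' hs hs' ss; apply: HM => //; apply: (le_trans ss).
  by rewrite lef_pV2 ?posrE ?exprn_gt0 // ler_eXn2l // ltr1n.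
lra.
Qed.

Lemma cont_seg_sub (f : C -> C) (a b : C) r r' : 0 <= r <= 1 -> 0 <= r' <= 1 ->
  cont_seg f a b -> cont_seg f (seg a b r) (seg a b r').
Proof.
move=> hr hr' H s hs e e0.
have -> : seg (seg a b r) (seg a b r') s = seg a b (r + s * (r' - r)).
  by rewrite /seg !rmorphD !rmorphM /= !rmorphB /=; ring.
apply: H => //; nra.
Qed.

(** Bisection is the recursion step of [dysum]: the sum of level N + 1 over [a, b] is the mean of
    the sums of level N over the two halves. *)
Lemma segint_mid (f : C -> C) (a b : C) : cont_seg f a b ->
  segint f a b = segint f a (seg a b 2^-1) + segint f (seg a b 2^-1) b.
Proof.
move=> cf; set m := seg a b 2^-1.
have h1 : 0 <= (2^-1 : R) <= 1 by lra.
have h2 : 0 <= (0 : R) <= 1 by lra.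
have h3 : 0 <= (1 : R) <= 1 by lra.
have E0 : seg a b 0 = a by rewrite /seg rmorph0 mul0r addr0.
have E1 : seg a b 1 = b by rewrite /seg rmorph1 mul1r addrC subrK.
have c1 := cont_seg_sub h2 h1 cf; have c2 := cont_seg_sub h1 h3 cf.
rewrite E0 in c1; rewrite E1 in c2.
have am : m - a = (b - a) / 2.
  by rewrite /m /seg addrAC subrr add0r fmorphV rmorph_nat mulrC.
have mb : b - m = (b - a) / 2.
  by rewrite /m /seg fmorphV rmorph_nat; field.
rewrite /segint am mb -mulrDr.
have -> : (b - a) / 2 * (dyint (fun s => f (seg a m s)) + dyint (fun s => f (seg m b s))) =
  (b - a) * ((dyint (fun s => f (seg a m s)) + dyint (fun s => f (seg m b s))) / 2) by ring.
congr (_ * _); apply: dyint_eq.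
have H : dysum n.+1 (fun s => f (seg a b s)) @[n --> \oo] -->
    (dyint (fun s => f (seg a m s)) + dyint (fun s => f (seg m b s))) / 2.
  have E : (fun n => dysum n.+1 (fun s => f (seg a b s))) =
     (fun n => 2^-1 * (dysum n (fun s => f (seg a m s)) - - dysum n (fun s => f (seg m b s)))).
    apply/funext => n /=; rewrite mulrC opprK; congr (_ * (dysum n _ + dysum n _)).
      apply/funext => s; congr f; rewrite /seg am rmorphM /= fmorphV rmorph_nat; ring.
    apply/funext => s; congr f; rewrite /seg mb /m /seg !rmorphM /= rmorphD rmorph1 fmorphV rmorph_nat; ring.
  rewrite E mulrC; apply: cvgn_nrZ.
  rewrite -[X in _ --> _ + X]opprK; apply: cvgn_nrB; first exact: segint_cvg.
  by apply: cvgN; exact: segint_cvg.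
by rewrite -(cvg_shiftS).
Qed.

End Goursat.

(** * Goursat's theorem on triangles and primitives on convex domains *)

Section Primitive.
Variable R : realType.
Local Notation C := R[i].
Local Notation Re := complex.Re.
Local Notation Im := complex.Im.

Definition cconvex (K : set C) := forall a b s, K a -> K b -> 0 <= s <= 1 -> K (seg a b s).

Definition nr_closed (K : set C) :=
  forall p, (forall e : R, 0 < e -> exists2 x, K x & nr (x - p) < e) -> K p.

(** No continuity of the derivative is asked for; Goursat's subdivision makes up for it. *)
Definition cholo (D : set C) (f : C -> C) := forall z, D z -> exists d, is_derive z (1 : C) f d.

Let T3 := (C * C * C)%type.

Definition tri (f : C -> C) (t : T3) : C :=
  segint f t.1.1 t.1.2 + segint f t.1.2 t.2 + segint f t.2 t.1.1.

Definition perim (t : T3) : R := nr (t.1.2 - t.1.1) + nr (t.2 - t.1.2) + nr (t.1.1 - t.2).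

Definition mid (a b : C) : C := seg a b 2^-1.

(** The middle triangle is oriented so that its sides are the inner sides of the three corner
    triangles, reversed; their integrals cancel. *)
Definition quarter (t : T3) (i : 'I_4) : T3 :=
  let: (a, b, c) := t in
  match val i with
  | 0 => (a, mid a b, mid c a)
  | 1 => (mid a b, b, mid b c)
  | 2 => (mid c a, mid b c, c)
  | _ => (mid a b, mid b c, mid c a)
  end.

Definition intri (K : set C) (t : T3) := [/\ K t.1.1, K t.1.2 & K t.2].

Lemma midE (a b : C) : mid a b = (a + b) / 2.
Proof. by rewrite /mid /seg fmorphV rmorph_nat; field. Qed.

Let nr_half (x : C) : nr (x / 2) = nr x / 2.
Proof. by rewrite nrM nrV; have := @nr_real R 2; rewrite rmorph_nat => ->. Qed.

Lemma perim_quarter t i : perim (quarter t i) = perim t / 2.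
Proof.
case: t => -[a b] c.
have h1 : nr (mid a b - a) = nr (b - a) / 2 by rewrite -nr_half midE; congr nr; field.
have h2 : nr (b - mid a b) = nr (b - a) / 2 by rewrite -nr_half midE; congr nr; field.
have h3 : nr (mid b c - b) = nr (c - b) / 2 by rewrite -nr_half midE; congr nr; field.
have h4 : nr (c - mid b c) = nr (c - b) / 2 by rewrite -nr_half midE; congr nr; field.
have h5 : nr (mid c a - c) = nr (a - c) / 2 by rewrite -nr_half midE; congr nr; field.
have h6 : nr (a - mid c a) = nr (a - c) / 2 by rewrite -nr_half midE; congr nr; field.
have h7 : nr (mid c a - mid a b) = nr (c - b) / 2.
  by rewrite -nr_half !midE; congr nr; field.
have h8 : nr (mid a b - mid b c) = nr (a - c) / 2.
  by rewrite -nr_half !midE; congr nr; field.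
have h9 : nr (mid b c - mid c a) = nr (b - a) / 2.
  by rewrite -nr_half !midE; congr nr; field.
rewrite /perim /quarter; case: i => -[|[|[|i]]] /= _.
- by rewrite h1 h7 h6; ring.
- by rewrite h2 h3 h8; ring.
- by rewrite [nr (mid b c - mid c a)]h9 h4 h5; ring.
- by rewrite -[nr (mid b c - mid a b)]nr_dist h8 -[nr (mid c a - mid b c)]nr_dist h9
    -[nr (mid a b - mid c a)]nr_dist h7; ring.
Qed.

Lemma quarter_in (K : set C) t i : cconvex K -> intri K t -> intri K (quarter t i).
Proof.
case: t => -[a b] c cK [/= Ka Kb Kc].
have h : 0 <= (2^-1 : R) <= 1 by lra.
by case: i => -[|[|[|i]]] /= _; split => //=; apply: cK.
Qed.

Lemma quarter_vertex t i : nr ((quarter t i).1.1 - t.1.1) <= perim t.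
Proof.
case: t => -[a b] c; rewrite /perim /=.
have n1 := nr_ge0 (b - a); have n2 := nr_ge0 (c - b); have n3 := nr_ge0 (a - c).
have h1 : nr (mid a b - a) = nr (b - a) / 2 by rewrite -nr_half midE; congr nr; field.
have h6 : nr (mid c a - a) = nr (a - c) / 2.
  by rewrite nr_dist -nr_half midE; congr nr; field.
case: i => -[|[|[|i]]] /= _; rewrite ?subrr ?nr0 ?h1 ?h6; lra.
Qed.

Lemma tri_quarter (f : C -> C) (K : set C) t : cconvex K -> intri K t -> cholo K f ->
  tri f t = \sum_(i < 4) tri f (quarter t i).
Proof.
case: t => -[a b] c cK [/= Ka Kb Kc] hf.
have cf x y : K x -> K y -> cont_seg f x y.
  move=> Kx Ky; apply: cont_seg_cont => s hs.
  by have [d] := hf _ (cK _ _ _ Kx Ky hs); exact: is_derive1_continuous.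
have h : 0 <= (2^-1 : R) <= 1 by lra.
have Kab : K (mid a b) by exact: cK.
have Kbc : K (mid b c) by exact: cK.
have Kca : K (mid c a) by exact: cK.
rewrite !big_ord_recl big_ord0 addr0 /tri /=.
rewrite (segint_mid (cf _ _ Ka Kb)) (segint_mid (cf _ _ Kb Kc)) (segint_mid (cf _ _ Kc Ka)).
rewrite -!/(mid _ _) (segint_rev (cf _ _ Kca Kab)) (segint_rev (cf _ _ Kab Kbc)).
rewrite (segint_rev (cf _ _ Kbc Kca)).
ring.
Qed.

Lemma exists_quarter (f : C -> C) (K : set C) t : cconvex K -> intri K t -> cholo K f ->
  exists i, nr (tri f t) <= 4 * nr (tri f (quarter t i)).
Proof.
move=> cK Kt hf; apply/existsP; rewrite -[X in is_true X]negbK negb_exists; apply/negP => /forallP H.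
have := tri_quarter cK Kt hf => /(congr1 (@nr R _)) E.
have : nr (tri f t) < nr (tri f t).
  rewrite {1}E (le_lt_trans (nr_sum _ _ _)) //.
  rewrite !big_ord_recl big_ord0 addr0.
  have L (a b c d x : R) : 4 * a < x -> 4 * b < x -> 4 * c < x -> 4 * d < x ->
    a + (b + (c + d)) < x by lra.
  by apply: L; rewrite ltNge; exact: H.
by rewrite ltxx.
Qed.

Lemma goursat (f : C -> C) (K : set C) t : cconvex K -> nr_closed K -> intri K t -> cholo K f ->
  tri f t = 0.
Proof.
move=> cK clK Kt hf.
have /choice [q Hq] : forall t, exists i, intri K t -> nr (tri f t) <= 4 * nr (tri f (quarter t i)).
  move=> t'; have [Kt'|nK] := pselect (intri K t').
    by have [i Hi] := exists_quarter cK Kt' hf; exists i.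
  by exists ord0.
pose u := fix u n := if n is m.+1 then quarter (u m) (q (u m)) else t.
have Ku n : intri K (u n) by elim: n => //= n IH; exact: quarter_in.
have Pu n : perim (u n) = perim t / 2 ^+ n.
  by elim: n => [|n IH] /=; rewrite ?expr0 ?divr1 // perim_quarter IH exprSr invfM mulrA.
have Tu n : nr (tri f t) <= 4 ^+ n * nr (tri f (u n)).
  elim: n => [|n IH] /=; first by rewrite expr0 mul1r.
  by rewrite (le_trans IH) // exprSr -mulrA ler_wpM2l ?exprn_ge0 // Hq.
have p0 n : 0 <= perim (u n) by rewrite /perim !addr_ge0 // nr_ge0.
(* The first vertex moves by at most the perimeter, and the perimeter halves at each step, so the
   displacements telescope. *)
have Vu n m : nr ((u (n + m)%N).1.1 - (u n).1.1) <= 2 * perim (u n) - 2 * perim (u (n + m)%N).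
  elim: m => [|m IH]; first by rewrite addn0 !subrr nr0.
  rewrite addnS (le_trans (nr_subD (u (n + m)%N).1.1 _ _)) //=.
  have := quarter_vertex (u (n + m)%N) (q (u (n + m)%N)).
  have := perim_quarter (u (n + m)%N) (q (u (n + m)%N)).
  move=> -> h; have := p0 (n + m)%N; lra.
have Psmall e : 0 < e -> exists N, forall n, (N <= n)%N -> perim (u n) < e.
  move=> e0; have k0 : 0 < perim t + 1 by rewrite ltr_wpDl // (p0 0%N).
  have [N HN] := exists_2expn (divr_gt0 e0 k0).
  exists N => n Nn; rewrite Pu; apply: (@le_lt_trans _ _ ((perim t + 1) / 2 ^+ N)).
    apply: ler_pM; rewrite ?(p0 0%N) ?invr_ge0 ?exprn_ge0 // ?lerDl //.
    by rewrite lef_pV2 ?posrE ?exprn_gt0 // ler_eXn2l // ltr1n.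
  by rewrite mulrC -ltr_pdivlMr.
have [|p Hp] := @ccauchy_cvg R (fun n => (u n).1.1).
  move=> e e0; have e4 : 0 < e / 4 by rewrite divr_gt0.
  have [N HN] := Psmall _ e4; exists N => n m Nn Nm.
  rewrite (le_lt_trans (nr_subD (u N).1.1 _ _)) // [X in _ + X]nr_dist.
  have := Vu N (n - N)%N; have := Vu N (m - N)%N; rewrite !subnKC //.
  have := HN N (leqnn _); have := p0 n; have := p0 m; lra.
have pV n : nr ((u n).1.1 - p) <= 2 * perim (u n).
  rewrite nr_dist; have H : (fun m => (u m).1.1 - (u n).1.1) m @[m --> \oo] --> p - (u n).1.1.
    by apply: (@cvgn_nrB R _ (fun=> _) _ _ Hp); exact: cvg_cst.
  apply: (cvgn_nr_le H); exists n => m nm.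
  have := Vu n (m - n)%N; rewrite subnKC //; have := p0 m; lra.
have Kp : K p.
  apply: clK => e e0; move/cvgn_nrP: Hp => /(_ _ e0) [N HN].
  by exists (u N).1.1; [case: (Ku N)|exact: HN].
have [d /is_derive1_nrP Hd] := hf _ Kp.
apply/eqP; rewrite -nr_eq0 eq_le nr_ge0 andbT.
have P0 : 0 <= perim t := p0 0%N.
move: (perim t) P0 Pu => P P0 Pu.
apply/ler_addgt0Pr => e e0; rewrite add0r.
(* The final error is 4^N e / (3 P^2 + 1) (3 D) D with D = P / 2^N, hence at most e; the summand 1
   covers P = 0. *)
have k0 : 0 < 3 * P ^+ 2 + 1 by rewrite ltr_wpDl // mulr_ge0 // sqr_ge0.
have [r r0 Hr] := Hd _ (divr_gt0 e0 k0).
have r3 : 0 < r / 4 by rewrite divr_gt0.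
have [N /(_ N (leqnn _)) HN] := Psmall _ r3.
have := Tu N; move: (Ku N) (pV N) (p0 N) HN (Pu N); move: (u N) => -[[a b] c].
rewrite /intri /perim /=; set D := _ + _ + _ => -[Ka Kb Kc] pa D0 Dr DE.
pose g z := f p + (z - p) * d.
have nab := nr_ge0 (b - a); have nbc := nr_ge0 (c - b); have nca := nr_ge0 (a - c).
have pb : nr (b - p) <= 3 * D.
  by rewrite (le_trans (nr_subD a _ _)) //; rewrite /D in pa *; lra.
have pc : nr (c - p) <= 3 * D.
  by rewrite (le_trans (nr_subD a _ _)) // [X in X + _]nr_dist; rewrite /D in pa *; lra.
have {}pa : nr (a - p) <= 3 * D by lra.
have cf x y : K x -> K y -> cont_seg f x y.
  move=> Kx Ky; apply: cont_seg_cont => s hs.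
  by have [d'] := hf _ (cK _ _ _ Kx Ky hs); exact: is_derive1_continuous.
have Dg z : is_derive z (1 : C) g d.
  apply/is_derive1_nrP => e' e'0; exists 1 => // y _.
  rewrite /g -[_ *: d]/(_ * d).
  have -> : f p + (y - p) * d - (f p + (z - p) * d) - (y - z) * d = 0 by ring.
  by rewrite nr0 mulr_ge0 ?nr_ge0 // ltW.
(* A primitive of the affine approximation g of f at p, so that the integral of g over the closed
   triangle vanishes. *)
pose G z := (f p - p * d) * z + d / 2 * z ^+ 2.
have DG z : is_derive z (1 : C) G (g z).
  apply: der_eq (der_add (der_scale _ (der_id z)) (der_scale _ (der_expn 2 (der_id z)))) _.
  by rewrite /g /= expr1; field.
have cg x y : cont_seg g x y by apply: (@cont_seg_diff R g x y (fun=> d)) => s _.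
have cG x y : segint g x y = G y - G x by apply: segint_ftc => // s _.
have bnd x y : K x -> K y -> nr (x - p) <= 3 * D -> nr (y - p) <= 3 * D ->
    nr (segint f x y - segint g x y) <= e / (3 * P ^+ 2 + 1) * (3 * D) * nr (y - x).
  move=> Kx Ky xp yp; rewrite -segintB //; last exact: cf.
  apply: segint_le.
    apply: cont_seg_cont => s hs.
    have [d' h'] := hf _ (cK _ _ _ Kx Ky hs).
    exact: is_derive1_continuous (der_sub h' (Dg (seg x y s))).
  move=> s hs; have sp : nr (seg x y s - p) <= 3 * D.
    have -> : seg x y s - p = (1 - s)%:C * (x - p) + s%:C * (y - p).
      by rewrite /seg rmorphB rmorph1; ring.
    case/andP: hs => s0 s1.
    rewrite (le_trans (nrD _ _)) // !nrM !nr_real ?subr_ge0 //.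
    have := nr_ge0 (x - p); have := nr_ge0 (y - p); nra.
  have -> : f (seg x y s) - g (seg x y s) = f (seg x y s) - f p - (seg x y s - p) *: d.
    by rewrite /g opprD addrA.
  have spr : nr (seg x y s - p) < r by lra.
  rewrite (le_trans (Hr _ spr)) // ler_wpM2l // divr_ge0 // ltW //.
have : tri f (a, b, c) = (segint f a b - segint g a b) + (segint f b c - segint g b c) +
    (segint f c a - segint g c a).
  by rewrite /tri /= !cG; ring.
move=> -> h; apply: (le_trans h).
have {h} : nr (segint f a b - segint g a b + (segint f b c - segint g b c) + (segint f c a - segint g c a))
   <= e / (3 * P ^+ 2 + 1) * (3 * D) * D.
  rewrite (le_trans (nrD _ _)) // (le_trans (lerD (nrD _ _) (lexx _))) //.
  have := bnd _ _ Ka Kb pa pb; have := bnd _ _ Kb Kc pb pc; have := bnd _ _ Kc Ka pc pa.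
  by move=> h1 h2 h3; apply: (le_trans (lerD (lerD h3 h2) h1)); rewrite -!mulrDr.
move=> h; apply: (le_trans (ler_wpM2l _ h)); first exact: exprn_ge0.
have -> : 4 ^+ N * (e / (3 * P ^+ 2 + 1) * (3 * D) * D) =
   e * ((3 * P ^+ 2) / (3 * P ^+ 2 + 1)).
  have -> : 4 ^+ N = 2 ^+ N * 2 ^+ N :> R by rewrite -exprMn -natrM.
  by rewrite DE; field; rewrite gt_eqF //= expf_neq0.
by rewrite ler_piMr // ?ltW // ltr_pdivrMr // mul1r ltrDl.
Qed.

(** Goursat's argument needs a closed convex set that contains the triangle and catches the limit of
    the nested ones. It is demanded for any three points; half-planes and discs supply smaller
    closed sets of their own kind. *)
Definition cvx_domain (D : set C) :=
  (forall z, D z -> exists2 r : R, 0 < r & forall y, nr (y - z) < r -> D y) /\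
  (forall a b c, D a -> D b -> D c -> exists K : set C,
     [/\ cconvex K, nr_closed K, K `<=` D & [/\ K a, K b & K c]]).

Lemma cvx_domain_convex D : cvx_domain D -> cconvex D.
Proof.
by case=> _ H a b s Da Db hs; have [K [cK _ KD [Ka Kb _]]] := H _ _ _ Da Db Da; exact/KD/cK.
Qed.

Lemma cholo_cont_seg D f a b : cconvex D -> cholo D f -> D a -> D b -> cont_seg f a b.
Proof.
move=> cD hf Da Db; apply: cont_seg_cont => s hs.
by have [d] := hf _ (cD _ _ _ Da Db hs); exact: is_derive1_continuous.
Qed.

Lemma cont_seg_cst (c a b : C) : cont_seg (fun=> c) a b.
Proof. by move=> s hs e e0; exists 1 => // u _; rewrite subrr nr0. Qed.

Lemma segint_cst (c a b : C) : segint (fun=> c) a b = (b - a) * c.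
Proof.
have D s : 0 <= s <= 1 -> is_derive (seg a b s) (1 : C) (fun u : C => c * u) c.
  by move=> _; apply: der_eq (der_scale c (der_id _)) _; rewrite mulr1.
by rewrite (segint_ftc (@cont_seg_cst c a b) D) -mulrBr mulrC.
Qed.

Lemma primitive D f z0 : cvx_domain D -> cholo D f -> D z0 ->
  forall z, D z -> is_derive z (1 : C) (segint f z0) (f z).
Proof.
move=> dD hf D0 z Dz; have cD := cvx_domain_convex dD.
have [r0 r00 Hr0] := dD.1 _ Dz.
have [d hd] := hf _ Dz.
have /cvg_nrP Hc := is_derive1_continuous hd.
apply/is_derive1_nrP => e e0; have [r1 r10 Hr1] := Hc _ e0.
exists (Num.min r0 r1); first by rewrite lt_min r00.
move=> y; rewrite lt_min => /andP[y0 y1].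
have Dy : D y by exact: Hr0.
have E : segint f z0 y - segint f z0 z = segint f z y.
  have [K [cK clK KD [K0 Kz Ky]]] := dD.2 _ _ _ D0 Dz Dy.
  have := @goursat f K (z0, z, y) cK clK; rewrite /tri /= => H.
  have {H} : segint f z0 z + segint f z y + segint f y z0 = 0.
    by apply: H => // x /KD /hf.
  rewrite (segint_rev (cholo_cont_seg cD hf D0 Dy)) => /eqP.
  by rewrite subr_eq0 => /eqP <-; ring.
have cz := @cont_seg_cst (f z) z y.
rewrite -[_ *: _]/(_ * _) -segint_cst.
have cf := cholo_cont_seg cD hf Dz Dy.
rewrite E -segintB //; apply: segint_le.
  apply: cont_seg_cont => s hs.
  have [d' h'] := hf _ (cD _ _ _ Dz Dy hs).
  exact: is_derive1_continuous (der_sub h' (der_cst (f z) (seg z y s))).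
move=> s hs; apply/ltW/Hr1.
rewrite /seg addrAC subrr add0r nrM nr_real; last by case/andP: hs.
apply: le_lt_trans y1; rewrite ler_piMl ?nr_ge0 //; by case/andP: hs.
Qed.

Lemma half_plane_domain (k : C) (x : R) : cvx_domain [set z | x < Re (k * z)].
Proof.
split=> [z /= xz|a b c /= ha hb hc].
  have k0 : 0 < nr k + 1 by rewrite ltr_wpDl ?nr_ge0.
  exists ((Re (k * z) - x) / (nr k + 1)); first by rewrite divr_gt0 // subr_gt0.
  move=> y; rewrite ltr_pdivlMr // => h.
  have : `|Re (k * (y - z))| < Re (k * z) - x.
    apply: le_lt_trans h; rewrite (le_trans (nr_Re _)) // nrM mulrC.
    by rewrite ler_wpM2l ?nr_ge0 // lerDl.
  by rewrite mulrBr ReB ltr_norml => /andP[h1 h2]; lra.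
exists [set z | Num.min (Re (k * a)) (Num.min (Re (k * b)) (Re (k * c))) <= Re (k * z)].
split=> /=.
- move=> u v s /= hu hv /andP[s0 s1].
  have -> : Re (k * seg u v s) = Re (k * u) + s * (Re (k * v) - Re (k * u)).
    by rewrite /seg mulrDr ReD mulrCA Re_mulC mulrBr ReB.
  nra.
- move=> p Hp /=; apply/ler_addgt0Pr => e e0.
  have k0 : 0 < nr k + 1 by rewrite ltr_wpDl ?nr_ge0.
  have [u /= hu up] := Hp _ (divr_gt0 e0 k0).
  apply: (le_trans hu); rewrite ltr_pdivlMr // in up.
  have : `|Re (k * (u - p))| < e.
    apply: le_lt_trans up; rewrite (le_trans (nr_Re _)) // nrM mulrC.
    by rewrite ler_wpM2l ?nr_ge0 // lerDl.
  by rewrite mulrBr ReB ltr_norml => /andP[h1 h2]; lra.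
- by move=> z /=; apply: lt_le_trans; rewrite !lt_min ha hb hc.
- by split; rewrite !ge_min lexx ?orbT.
Qed.

Lemma ball_domain (z0 : C) (r : R) : cvx_domain [set z | nr (z - z0) < r].
Proof.
split=> [z /= zr|a b c /= ha hb hc].
  exists (r - nr (z - z0)); first by rewrite subr_gt0.
  by move=> y h; rewrite (le_lt_trans (nr_subD z _ _)) // -ltrBrDr.
exists [set z | nr (z - z0) <= Num.max (nr (a - z0)) (Num.max (nr (b - z0)) (nr (c - z0)))].
split=> /=.
- move=> u v s /=; set M := Num.max _ _ => hu hv /andP[s0 s1].
  have -> : seg u v s - z0 = (1 - s)%:C * (u - z0) + s%:C * (v - z0).
    by rewrite /seg rmorphB rmorph1; ring.
  rewrite (le_trans (nrD _ _)) // !nrM !nr_real ?subr_ge0 //.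
  have := nr_ge0 (u - z0); have := nr_ge0 (v - z0); nra.
- move=> p Hp /=; apply/ler_addgt0Pr => e e0.
  have [u /= hu up] := Hp _ e0.
  rewrite (le_trans (nr_subD u _ _)) // addrC lerD // nr_dist; exact: ltW.
- by move=> z /= /le_lt_trans; apply; rewrite !gt_max ha hb hc.
- by split; rewrite !le_max lexx ?orbT.
Qed.

End Primitive.

(** * Maximum principle, Schwarz's lemma and the identity theorem on the unit disc *)

Section MaximumModulus.
Variable R : realType.
Local Notation C := R[i].
Local Notation Re := complex.Re.
Local Notation Im := complex.Im.

Lemma nr_sqr (x : C) : nr x ^+ 2 = Re x ^+ 2 + Im x ^+ 2.
Proof. by apply: complexI; rewrite rmorphXn /= -nrE -add_Re2_Im2. Qed.

(** Divided by the first square, this is 1 - |phi z|^2 for the disc automorphism phi z = (z + a) /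
    (1 + conj(a) z). It shows that phi preserves the disc and measures how close |phi z| is to 1. *)
Lemma mobius_sub (a z : C) : nr (1 + a^* * z) ^+ 2 - nr (z + a) ^+ 2 = (1 - nr a ^+ 2) * (1 - nr z ^+ 2).
Proof. by rewrite !nr_sqr; case: a z => [a1 a2] [z1 z2] /=; ring. Qed.

Lemma mobius_den (a z : C) : nr a < 1 -> nr z < 1 -> 1 - nr a <= nr (1 + a^* * z).
Proof.
move=> a1 z1; have := @nrD R _ (1 + a^* * z) (- (a^* * z)).
rewrite addrK nr1 nrN nrM nrJ.
have := nr_ge0 a; have := nr_ge0 z; nra.
Qed.

(* The mean value of f over small circles around a is transported, through the
   disc automorphism sending 0 to a and w |-> exp w, to the increment over one
   period of a primitive on the left half plane, which does not depend on the
   point. *)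
Lemma maximum_modulus (f : C -> C) (K : R) (a : C) :
  cholo [set z | nr z < 1] f ->
  (forall e : R, 0 < e -> exists2 r : R, r < 1 & forall z, r <= nr z -> nr z < 1 -> nr (f z) <= K + e) ->
  nr a < 1 -> nr (f a) <= K.
Proof.
move=> hf hK a1.
have a0 := nr_ge0 a.
have sq1 (x : R) : 0 <= x -> x < 1 -> 0 < 1 - x ^+ 2 by nra.
pose phi (z : C) := (z + a) / (1 + a^* * z).
have den z : nr z < 1 -> 1 + a^* * z != 0.
  by move=> z1; rewrite -nr_gt0; have := mobius_den a1 z1; lra.
have phi1 z : nr z < 1 -> nr (phi z) < 1.
  move=> z1; rewrite nrM nrV ltr_pdivrMr ?nr_gt0 ?den // mul1r.
  rewrite -(@ltr_pXn2r _ 2) ?nnegrE ?nr_ge0 // -subr_gt0 mobius_sub.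
  by rewrite mulr_gt0 // sq1 ?nr_ge0.
have phia z : nr z < 1 -> nr (phi z - a) <= 2 * nr z.
  move=> z1; have -> : phi z - a = z * (1 - (nr a ^+ 2)%:C) / (1 + a^* * z).
    rewrite -mulJ /phi; have := den _ z1 => d0.
    by apply: (mulIf d0); rewrite mulfVK // mulrBl mulfVK //; ring.
  rewrite !nrM nrV ler_pdivrMr ?nr_gt0 ?den //.
  have -> : nr (1 - (nr a ^+ 2)%:C : C) = 1 - nr a ^+ 2.
    have -> : 1 - (nr a ^+ 2)%:C = (1 - nr a ^+ 2)%:C :> C by rewrite rmorphB rmorph1.
    by rewrite nr_real // ltW // sq1.
  rewrite [2 * _]mulrC -mulrA ler_wpM2l ?nr_ge0 //.
  have := mobius_den a1 z1; nra.
pose g w := f (phi (cexp w)).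
pose D := [set w : C | 0 < Re (-1 * w)].
have DE w : D w <-> Re w < 0 by rewrite /D /= mulN1r ReN oppr_gt0.
have dD : cvx_domain D := half_plane_domain (-1) 0.
have e1 w : D w -> nr (cexp w) < 1 by move=> /DE w0; rewrite nr_cexp expR_lt1.
have hg : cholo D g.
  move=> w Dw; have [d hd] := hf _ (phi1 _ (e1 _ Dw)).
  have h1 := der_add (der_id (cexp w)) (der_cst a (cexp w)).
  have h2 := der_add (der_cst 1 (cexp w)) (der_scale a^* (der_id (cexp w))).
  have h3 := der_mul h1 (der_inv h2 (den _ (e1 _ Dw))).
  have := der_comp (der_comp (is_derive_cexp w) h3) hd.
  by move=> h; eexists; exact: h.
have D1 : D (-1) by apply/DE; rewrite ReN /= ltrN10.
pose P := segint g (-1).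
have hP : forall w, D w -> is_derive w (1 : C) P (g w) by exact: primitive dD hg D1.
pose T : C := 0 +i* (2 * pi).
have ReT (w : C) : Re (w + T) = Re w by rewrite ReD /= addr0.
have DT w : D w -> D (w + T) by rewrite !DE ReT.
have gT w : g (w + T) = g w by rewrite /g cexpD cexp2pi mulr1.
pose Q w := P (w + T) - P w.
have Qc w : D w -> Q w = Q (-1).
  move=> Dw; apply: is_derive0_cst => s hs.
  have Ds : D (seg (-1) w s) := cvx_domain_convex dD D1 Dw hs.
  have h1 := der_comp (der_add (der_id _) (der_cst T _)) (hP _ (DT _ Ds)).
  have := der_sub h1 (hP _ Ds); rewrite gT addr0 mul1r subrr.
  exact.
have nT : nr T = 2 * pi.
  have p0 : 0 <= 2 * pi :> R by rewrite mulr_ge0 // pi_ge0.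
  have -> : T = 'i * (2 * pi)%:C.
    by apply/eqP; rewrite eq_complex /=; apply/andP; split; apply/eqP; ring.
  by rewrite nrM nr_real // /nr normc_def /= expr0n expr1n add0r sqrtr1 mul1r.
have p0 : 0 < pi :> R := pi_gt0 R.
have main e : 0 < e -> nr (f a) <= K + 2 * e.
  move=> e0.
  have [d hd] := hf _ a1.
  have /cvg_nrP Hc := is_derive1_continuous hd.
  have [r r0 Hr] := Hc _ e0.
  have B1 : nr (Q (-1) - T * f a) <= e * (2 * pi).
    pose x := Num.min (-1) (ln (r / 4)).
    have x0 : x < 0 by rewrite gt_min ltrN10.
    have Dx : D x%:C by apply/DE.
    rewrite -(Qc _ Dx) -nT.
    have E : x%:C + T - x%:C = T by rewrite addrC addKr.
    have E2 : Q x%:C - T * f a = (P (x%:C + T) - (x%:C + T) * f a) - (P x%:C - x%:C * f a).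
      by rewrite /Q; ring.
    rewrite E2 -[X in _ <= _ * nr X]E.
    apply: (@mean_value_segment R (fun w => P w - w * f a) (fun w => g w - f a)) => s hs.
      have Ds := cvx_domain_convex dD Dx (DT _ Dx) hs.
      have := der_sub (hP _ Ds) (der_mul (der_id _) (der_cst (f a) _)).
      by rewrite mulr0 addr0 mul1r; exact.
    have Ds := cvx_domain_convex dD Dx (DT _ Dx) hs.
    apply/ltW/Hr; rewrite (le_lt_trans (phia _ (e1 _ Ds))) // nr_cexp.
    have -> : Re (x%:C + s%:C * (x%:C + T - x%:C)) = x by rewrite E ReD Re_mulC /= mulr0 addr0.
    have : expR x <= r / 4.
      have -> : r / 4 = expR (ln (r / 4)) by rewrite lnK // posrE divr_gt0.
      by rewrite ler_expR ge_min lexx orbT.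
    lra.
  have [r1 r11 Hr1] := hK _ e0.
  pose r2 := Num.max 0 r1.
  have r20 : 0 <= r2 by rewrite le_max lexx.
  have r21 : r2 < 1 by rewrite gt_max ltr01.
  have k1 : 0 < 1 - nr a by lra.
  (* For |z| = 1 - q, [mobius_sub] together with |1 + conj(a) z| >= 1 - |a| gives |phi z| >= r2,
     where the boundary bound is available. *)
  pose q := Num.min (1 / 2) ((1 - r2 ^+ 2) * (1 - nr a) / 4).
  have q0 : 0 < q by rewrite lt_min !divr_gt0 // mulr_gt0 //; nra.
  have q1 : q <= 1 / 2 by rewrite ge_min lexx.
  have q2 : q <= (1 - r2 ^+ 2) * (1 - nr a) / 4 by rewrite ge_min lexx orbT.
  pose x := ln (1 - q).
  have x0 : x < 0 by rewrite ln_lt0 //; lra.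
  have ex : expR x = 1 - q by rewrite lnK // posrE; lra.
  have Dx : D x%:C by apply/DE.
  have B2 : nr (Q (-1)) <= (K + e) * (2 * pi).
    rewrite -(Qc _ Dx) -nT.
    have E : x%:C + T - x%:C = T by rewrite addrC addKr.
    rewrite /Q -[X in _ <= _ * nr X]E.
    apply: (@mean_value_segment R P g) => s hs.
      exact: hP _ (cvx_domain_convex dD Dx (DT _ Dx) hs).
    have Ds := cvx_domain_convex dD Dx (DT _ Dx) hs.
    rewrite -/(seg x%:C (x%:C + T) s); set w := seg _ _ _ in Ds *.
    have nw : nr (cexp w) = 1 - q.
      by rewrite nr_cexp /w /seg E ReD Re_mulC /= mulr0 addr0.
    apply: Hr1; last exact: phi1 (e1 _ Ds).
    apply: (@le_trans _ _ r2); first by rewrite le_max lexx orbT.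
    rewrite nrM nrV ler_pdivlMr ?nr_gt0 ?den //; last exact: e1.
    rewrite -(@ler_pXn2r _ 2) ?nnegrE ?mulr_ge0 ?nr_ge0 //.
    have := mobius_sub a (cexp w); rewrite nw exprMn.
    have := mobius_den a1 (e1 _ Ds).
    move: (nr (1 + a^* * cexp w)) (nr (cexp w + a)) => u v hu huv.
    suff : (1 - nr a ^+ 2) * (1 - (1 - q) ^+ 2) <= (1 - r2 ^+ 2) * u ^+ 2 by lra.
    have h1 : (1 - nr a) ^+ 2 <= u ^+ 2 by nra.
    have h2 : 0 <= 1 - r2 ^+ 2 by nra.
    apply: (@le_trans _ _ ((1 - r2 ^+ 2) * (1 - nr a) ^+ 2)); last by rewrite ler_wpM2l.
    have -> : (1 - nr a ^+ 2) = (1 - nr a) * (1 + nr a) by ring.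
    have -> : (1 - r2 ^+ 2) * (1 - nr a) ^+ 2 = (1 - nr a) * ((1 - r2 ^+ 2) * (1 - nr a)) by ring.
    rewrite -mulrA ler_wpM2l //; first exact: ltW.
    by nra.
  have : nr (T * f a) <= (K + 2 * e) * (2 * pi).
    have -> : T * f a = Q (-1) - (Q (-1) - T * f a) by ring.
    by rewrite (le_trans (nrB _ _)) //; lra.
  by rewrite nrM nT mulrC ler_pM2r // mulr_gt0.
apply/ler_addgt0Pr => e e0; have e2 : 0 < e / 2 by rewrite divr_gt0.
by have := main _ e2; rewrite mulrC divfK.
Qed.

Lemma bernoulli (h : R) n : 0 <= h -> 1 + n%:R * h <= (1 + h) ^+ n.
Proof.
move=> h0; elim: n => [|n IH]; first by rewrite mul0r addr0 expr0.
have n0 : 0 <= n%:R :> R by [].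
rewrite exprS -natr1; nra.
Qed.

(** Otherwise (u / v)^N would be unbounded by Bernoulli's inequality. This replaces passing to N-th
    roots and turns estimates with a constant into sharp ones. *)
Lemma expn_growth (x u v M : R) : 0 < x -> 0 <= u -> 0 <= v ->
  (forall N, x * u ^+ N <= M * v ^+ N) -> u <= v.
Proof.
move=> x0 u0 v0 H; rewrite leNgt; apply/negP => vu.
have [v00|vn0] := eqVneq v 0.
  have := H 1%N; rewrite !expr1 v00 mulr0; have := mulr_gt0 x0 (le_lt_trans v0 vu); lra.
have {}v0 : 0 < v by rewrite lt_neqAle eq_sym vn0.
have H2 N : (u / v) ^+ N <= M / x.
  rewrite expr_div_n ler_pdivrMr ?exprn_gt0 // mulrAC ler_pdivlMr // mulrC; exact: H.
pose h := u / v - 1.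
have h0 : 0 < h by rewrite subr_gt0 ltr_pdivlMr // mul1r.
have M0 : 0 <= M / x by rewrite (le_trans _ (H2 0%N)) // expr0 ler01.
pose N := Num.bound (M / x / h).
have hN : M / x < N%:R * h.
  by rewrite -ltr_pdivrMr //; apply: archi_boundP; rewrite divr_ge0 // ltW.
have := bernoulli N (ltW h0); have := H2 N.
have -> : u / v = 1 + h by rewrite /h; ring.
lra.
Qed.

Lemma cholo_sub (D : set C) (f g : C -> C) : cholo D f -> cholo D g -> cholo D (fun z => f z - g z).
Proof.
by move=> hf hg z Dz; have [a ha] := hf _ Dz; have [b hb] := hg _ Dz; eexists; exact: der_sub ha hb.
Qed.

(** At 0 only continuity of f / z is at hand, but f^(N+1) / z^N = z (f / z)^(N+1) visibly has the
    derivative f'(0)^(N+1) there. For this reason powers of f are used in place of f / z. *)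
Lemma cholo_divX (f : C -> C) N : cholo [set z | nr z < 1] f ->
  f 0 = 0 -> cholo [set z | nr z < 1] (fun z => f z ^+ N.+1 / z ^+ N).
Proof.
move=> hf f0 z z1; have [d hd] := hf _ z1.
have [->|z0] := eqVneq z 0; last first.
  have zN : z ^+ N != 0 by rewrite expf_neq0.
  by eexists; exact: der_mul (der_expn _ hd) (der_inv (der_expn _ (der_id _)) zN).
case: N => [|N].
  have [d' hd'] := hf (0 : C) ltac:(by rewrite /= nr0 ltr01).
  exists d'; apply: is_derive_near hd'; apply/nbhs_nrP; exists 1 => // y _.
  by rewrite expr1 expr0 divr1.
have [d' hd'] := hf (0 : C) ltac:(by rewrite /= nr0 ltr01).
pose g (z : C) := if z == 0 then d' else f z / z.
have cg : forall e : R, 0 < e -> exists2 r : R, 0 < r & forall y, nr y < r -> nr (g y - d') <= e.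
  move=> e e0; move/is_derive1_nrP: hd' => /(_ _ e0) [r r0 Hr]; exists r => // y yr.
  rewrite /g; case: eqVneq => [_|y0]; first by rewrite subrr nr0 ltW.
  have -> : f y / y - d' = (f y - f 0 - (y - 0) *: d') / y.
    by rewrite f0 !subr0 -[_ *: _]/(_ * _) mulrBl [y * _]mulrC mulfK.
  rewrite nrM nrV ler_pdivrMr ?nr_gt0 //.
  by have := Hr y; rewrite subr0; apply.
have cgn n : forall e : R, 0 < e -> exists2 r : R, 0 < r & forall y, nr y < r -> nr (g y ^+ n - d' ^+ n) <= e.
  elim: n => [|n IH] e e0.
    by exists 1 => // y _; rewrite !expr0 subrr nr0 ltW.
  have k0 : 0 < nr d' + 1 by rewrite ltr_wpDl ?nr_ge0.
  have k1 : 0 < nr (d' ^+ n) + 1 by rewrite ltr_wpDl ?nr_ge0.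
  have e1 : 0 < Num.min 1 (e / 2 / (nr (d' ^+ n) + 1)) by rewrite lt_min ltr01 !divr_gt0.
  have e2 : 0 < e / 2 / (nr d' + 1) by rewrite !divr_gt0.
  have [r1 r10 H1] := cg _ e1; have [r2 r20 H2] := IH _ e2.
  exists (Num.min r1 r2); first by rewrite lt_min r10.
  move=> y; rewrite lt_min => /andP[/H1 y1 /H2 y2].
  move: y1; rewrite le_min => /andP[y1 y3].
  have -> : g y ^+ n.+1 - d' ^+ n.+1 = g y * (g y ^+ n - d' ^+ n) + (g y - d') * d' ^+ n.
    by rewrite !exprS; ring.
  have gy : nr (g y) <= nr d' + 1.
    rewrite -[X in nr X <= _](subrK d') (le_trans (nrD _ _)) // addrC lerD2l //.
  rewrite (le_trans (nrD _ _)) // [e]splitr !nrM lerD //.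
    have := ler_pM (nr_ge0 _) (nr_ge0 _) gy y2; rewrite [X in _ <= X -> _]mulrC divfK //.
    by rewrite gt_eqF.
  rewrite (le_trans (ler_wpM2r (nr_ge0 _) y3)) // mulrAC ler_pdivrMr //.
  by rewrite ler_wpM2l ?lerDl // divr_ge0 // ltW.
exists (d' ^+ N.+2); apply/is_derive1_nrP => e e0.
have [r r0 Hr] := cgn N.+2 _ e0; exists r => // y; rewrite subr0 => /Hr yr.
rewrite f0 [0 ^+ N.+2]expr0n mul0r subr0 -[_ *: _]/(_ * _).
have [->|y0] := eqVneq y 0.
  by rewrite f0 expr0n !mul0r subr0 nr0 mulr_ge0 // ltW.
have -> : f y ^+ N.+2 / y ^+ N.+1 - y * d' ^+ N.+2 = (g y ^+ N.+2 - d' ^+ N.+2) * y.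
  rewrite /g (negPf y0) expr_div_n [y ^+ N.+2]exprS invfM mulrBl [_ * y in RHS]mulrC.
  by rewrite [y * d' ^+ _]mulrC; congr (_ - _); rewrite -[RHS]mulrA; congr (_ * _); rewrite mulrAC mulVf // mul1r.
by rewrite nrM ler_wpM2r ?nr_ge0.
Qed.

(** The maximum principle for f^(N+1) / z^N, bounded by M^(N+1) / r^N on r <= |z| < 1, gives |f a|
    (|f a| r)^N <= M (M |a|)^N. Then N tends to infinity by [expn_growth], and r to 1. *)
Lemma schwarz (f : C -> C) (M : R) (a : C) : cholo [set z | nr z < 1] f -> f 0 = 0 ->
  (forall z, nr z < 1 -> nr (f z) <= M) -> nr a < 1 -> nr (f a) <= M * nr a.
Proof.
move=> hf f0 hM a1.
have [->|a0] := eqVneq a 0; first by rewrite f0 nr0 mulr0.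
have na : 0 < nr a by rewrite nr_gt0.
have M0 : 0 <= M by rewrite (le_trans _ (hM _ a1)) // nr_ge0.
have [x0|x0] := eqVneq (nr (f a)) 0; first by rewrite x0 mulr_ge0 // nr_ge0.
have {}x0 : 0 < nr (f a) by rewrite lt_neqAle eq_sym x0 nr_ge0.
have main r : 0 < r -> r < 1 -> nr (f a) * r <= M * nr a.
  move=> r0 r1; apply: (@expn_growth (nr (f a)) _ _ M) => // [||N].
  - by rewrite mulr_ge0 ?nr_ge0 // ltW.
  - by rewrite mulr_ge0 ?nr_ge0.
  have := @maximum_modulus _ (M ^+ N.+1 / r ^+ N) a (cholo_divX N hf f0) _ a1.
  rewrite nrM nrV !nrX ler_pdivrMr ?exprn_gt0 // mulrAC ler_pdivlMr ?exprn_gt0 //.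
  rewrite !exprMn => H; have {}H : nr (f a) ^+ N.+1 * r ^+ N <= M ^+ N.+1 * nr a ^+ N.
    apply: H => e e0; exists r => // z rz z1.
    apply: (@le_trans _ _ (M ^+ N.+1 / r ^+ N)); last by rewrite lerDl ltW.
    have z0 : 0 < nr z by rewrite (lt_le_trans r0).
    rewrite nrM nrV !nrX; apply: ler_pM.
    - by rewrite exprn_ge0 // nr_ge0.
    - by rewrite invr_ge0 exprn_ge0 // nr_ge0.
    - by rewrite lerXn2r ?nnegrE ?nr_ge0 // hM.
    - by rewrite lef_pV2 ?posrE ?exprn_gt0 // lerXn2r ?nnegrE ?(ltW r0) ?nr_ge0.
  by rewrite !mulrA -!exprS.
rewrite leNgt; apply/negP => lt.
pose r := (M * nr a / nr (f a) + 1) / 2.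
have q1 : M * nr a / nr (f a) < 1 by rewrite ltr_pdivrMr // mul1r.
have q0 : 0 <= M * nr a / nr (f a) by rewrite divr_ge0 ?mulr_ge0 ?nr_ge0.
have r0 : 0 < r by rewrite /r; lra.
have r1 : r < 1 by rewrite /r; lra.
have := main _ r0 r1; rewrite mulrC -ler_pdivlMr // /r; lra.
Qed.

(** As f vanishes near 0, every f / z^N is holomorphic, whence |f a| r^N <= M |a|^N. With |a| < r <
    1 this forces f a = 0. *)
Lemma identity_bounded (f : C -> C) (M d : R) (a : C) : cholo [set z | nr z < 1] f -> 0 < d ->
  (forall z, nr z < d -> f z = 0) ->
  (forall z, nr z < 1 -> nr (f z) <= M) -> nr a < 1 -> f a = 0.
Proof.
move=> hf d0 fd hM a1; apply/eqP; rewrite -nr_eq0; apply/negPn/negP => x0.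
have {}x0 : 0 < nr (f a) by rewrite lt_neqAle eq_sym x0 nr_ge0.
pose r := (nr a + 1) / 2.
have r1 : r < 1 by rewrite /r; lra.
have ra : nr a < r by rewrite /r; lra.
have r0 : 0 < r by rewrite (le_lt_trans _ ra) // nr_ge0.
have : r <= nr a.
  apply: (@expn_growth (nr (f a)) _ _ M) => //; [exact: ltW|exact: nr_ge0|move=> N].
  have [->|a0] := eqVneq a 0.
    have := fd 0; rewrite nr0 => -> //; rewrite nr0 mul0r mulr_ge0 ?exprn_ge0 //.
    by rewrite (le_trans _ (hM _ a1)) // nr_ge0.
  have na : 0 < nr a by rewrite nr_gt0.
  have h : cholo [set z | nr z < 1] (fun z => f z / z ^+ N).
    move=> z z1; have [z0|z0] := ltP (nr z) d.
      exists 0; apply: is_derive_near (der_cst 0 z); apply/nbhs_nrP.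
      exists (d - nr z); first by rewrite subr_gt0.
      move=> y yz; rewrite fd ?mul0r // -[y](subrK z).
      by rewrite (le_lt_trans (nrD _ _)) // -ltrBrDr.
    have zN : z ^+ N != 0 by rewrite expf_neq0 // -nr_gt0 (lt_le_trans d0).
    have [d' hd'] := hf _ z1.
    by eexists; exact: der_mul hd' (der_inv (der_expn _ (der_id _)) zN).
  have := @maximum_modulus _ (M / r ^+ N) a h _ a1.
  rewrite nrM nrV !nrX ler_pdivrMr ?exprn_gt0 // mulrAC ler_pdivlMr ?exprn_gt0 //.
  apply => e e0; exists r => // z rz z1.
  apply: (@le_trans _ _ (M / r ^+ N)); last by rewrite lerDl ltW.
  have z0 : 0 < nr z by rewrite (lt_le_trans r0).
  rewrite nrM nrV !nrX; apply: ler_pM => //.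
  - exact: nr_ge0.
  - by rewrite invr_ge0 exprn_ge0 // nr_ge0.
  - exact: hM.
  - by rewrite lef_pV2 ?posrE ?exprn_gt0 // lerXn2r ?nnegrE ?(ltW r0) ?nr_ge0.
by rewrite leNgt ra.
Qed.

End MaximumModulus.

(** * Holomorphic functions on a complex normed space *)

Section SeveralVariables.
Variable R : realType.
Local Notation C := R[i].
Local Notation Re := complex.Re.
Local Notation Im := complex.Im.
Variable V : normedModType C.
Implicit Types (x y u v : V) (f g : V -> C).

Lemma cvgn_cst (c : C) : c @[n --> \oo] --> c.
Proof. exact: cvg_cst. Qed.

Definition nball x (r : R) : set V := [set y | nr (y - x) < r].

Lemma nball_center x r : 0 < r -> nball x r x.
Proof. by move=> r0; rewrite /nball /= subrr nr0. Qed.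

Lemma nball_sub x y r s : nr (y - x) + s <= r -> nball y s `<=` nball x r.
Proof. by move=> h z; rewrite /nball /= => zs; rewrite (le_lt_trans (nr_subD y _ _)) //; lra. Qed.

Definition vholo (D : set V) f := forall x, D x -> differentiable f x.

Lemma vholo_sub (D D' : set V) f : D `<=` D' -> vholo D' f -> vholo D f.
Proof. by move=> h hf x /h /hf. Qed.

Lemma differentiable_slice f x v (z : C) : differentiable f (x + z *: v) ->
  is_derive z (1 : C) (fun s : C => f (x + s *: v)) ('d f (x + z *: v) v).
Proof.
move=> df; have /is_derive_nrP H := diff_is_derive v df.
apply/is_derive1_nrP => e /H [r r0 Hr]; exists r => // y yz.
have := Hr _ yz; rewrite addrCA -scalerDl subrK.
exact.
Qed.

Lemma cholo_slice x v (r : R) f : 0 < r -> vholo (nball x r) f -> nr v <= r ->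
  cholo [set z | nr z < 1] (fun z => f (x + z *: v)).
Proof.
move=> r0 hf vr z /= z1; eexists; apply/differentiable_slice/hf.
rewrite /nball /= addrAC subrr add0r nrZ.
have := nr_ge0 z; have := nr_ge0 v; nra.
Qed.

(** Schwarz's lemma on the complex line through x and y, in the disc of radius r, for f - f x, which
    is bounded by 2 K. The estimate plays the role of Cauchy's inequality. *)
Lemma vholo_lipschitz f x (r K : R) y : vholo (nball x r) f ->
  (forall u, nball x r u -> nr (f u) <= K) -> nball x r y ->
  nr (f y - f x) <= 2 * K / r * nr (y - x).
Proof.
move=> hf hK; rewrite /nball /= => yr.
have r0 : 0 < r by rewrite (le_lt_trans _ yr) // nr_ge0.
have [->|yx] := eqVneq y x; first by rewrite !subrr !nr0 mulr0.
have n0 : 0 < nr (y - x) by rewrite nr_gt0 subr_eq0.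
pose v := (r / nr (y - x))%:C *: (y - x).
have nv : nr v = r by rewrite nrZ nr_real ?divr_ge0 ?ltW // divfK // gt_eqF.
pose a : C := (nr (y - x) / r)%:C.
have na : nr a = nr (y - x) / r by rewrite nr_real // divr_ge0 ?ltW.
have av : a *: v = y - x.
  rewrite /v /a scalerA -rmorphM /= mulrA divfK ?gt_eqF // divff ?gt_eqF //.
  by rewrite rmorph1 scale1r.
have inb (z : C) : nr z < 1 -> nball x r (x + z *: v).
  by move=> z1; rewrite /nball /= addrAC subrr add0r nrZ nv; nra.
have a1 : nr a < 1 by rewrite na ltr_pdivrMr // mul1r.
have h1 : cholo [set z | nr z < 1] (fun z => f (x + z *: v) - f x).
  apply: cholo_sub; first by apply: (@cholo_slice x v r) => //; rewrite nv.
  by move=> z _; exists 0; exact: der_cst.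
have := @schwarz R _ (2 * K) a h1; rewrite scale0r addr0 subrr => /(_ erefl).
have -> : x + a *: v = y by rewrite av addrC subrK.
have -> : 2 * K / r * nr (y - x) = 2 * K * nr a by rewrite na; ring.
apply => // z z1.
rewrite (le_trans (nrB _ _)) // mulrDl mul1r lerD // hK //; first exact: inb.
exact: nball_center.
Qed.

Lemma vholo_identity_ball f x (r K d : R) y : vholo (nball x r) f -> 0 < d ->
  (forall u, nball x r u -> nr (f u) <= K) -> (forall u, nball x d u -> f u = 0) ->
  nball x r y -> f y = 0.
Proof.
move=> hf d0 hK hd; rewrite /nball /= => yr.
have r0 : 0 < r by rewrite (le_lt_trans _ yr) // nr_ge0.
have [->|yx] := eqVneq y x; first by apply: hd; exact: nball_center.
have n0 : 0 < nr (y - x) by rewrite nr_gt0 subr_eq0.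
pose v := (r / nr (y - x))%:C *: (y - x).
have nv : nr v = r by rewrite nrZ nr_real ?divr_ge0 ?ltW // divfK // gt_eqF.
pose a : C := (nr (y - x) / r)%:C.
have na : nr a = nr (y - x) / r by rewrite nr_real // divr_ge0 ?ltW.
have av : a *: v = y - x.
  rewrite /v /a scalerA -rmorphM /= mulrA divfK ?gt_eqF // divff ?gt_eqF //.
  by rewrite rmorph1 scale1r.
have inb (z : C) : nr z < 1 -> nball x r (x + z *: v).
  by move=> z1; rewrite /nball /= addrAC subrr add0r nrZ nv; nra.
have a1 : nr a < 1 by rewrite na ltr_pdivrMr // mul1r.
have h1 : cholo [set z | nr z < 1] (fun z => f (x + z *: v)).
  by apply: (@cholo_slice x v r) => //; rewrite nv.
have <- : x + a *: v = y by rewrite av addrC subrK.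
apply: (@identity_bounded R _ K (d / r) a h1) => //.
- by rewrite divr_gt0.
- by move=> z zd; apply: hd; rewrite /nball /= addrAC subrr add0r nrZ nv -ltr_pdivlMr.
- by move=> z z1; apply: hK; exact: inb.
Qed.

Definition vconvex (D : set V) := forall x y (s : R), D x -> D y -> 0 <= s <= 1 -> D (x + s%:C *: (y - x)).

Lemma nball_convex x r : vconvex (nball x r).
Proof.
move=> y z s; rewrite /nball /= => hy hz /andP[s0 s1].
have -> : y + s%:C *: (z - y) - x = (1 - s)%:C *: (y - x) + s%:C *: (z - x).
  have -> : z - y = (z - x) - (y - x) by rewrite opprB addrA subrK.
  by rewrite rmorphB rmorph1 scalerBl scale1r scalerBr addrAC -[RHS]addrA [X in _ = _ + X]addrC.
rewrite (le_lt_trans (nrD _ _)) // !nrZ !nr_real ?subr_ge0 //.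
move: (nr (y - x)) (nr (z - x)) hy hz => a b ha hb.
have [h|h] := leP a b; [apply: le_lt_trans hb|apply: le_lt_trans ha]; nra.
Qed.

Lemma vholo_identity (D : set V) f x y (d : R) : vconvex D ->
  (forall u, D u -> exists2 r : R, 0 < r & nball u r `<=` D) ->
  vholo D f -> D x -> D y -> 0 < d -> (forall u, nball x d u -> f u = 0) -> f y = 0.
Proof.
move=> cD oD hf Dx Dy d0 hd.
pose p (s : R) := x + s%:C *: (y - x).
pose Z u := exists2 d : R, 0 < d & forall v, nball u d v -> f v = 0.
have nk : 0 < nr (y - x) + 1 by rewrite ltr_wpDl ?nr_ge0.
have pp s s' : nr (p s - p s') = `|s - s'| * nr (y - x).
  by rewrite /p opprD addrACA subrr add0r -scalerBl -rmorphB nrZ nrC.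
suff : Z (p 0) -> Z (p 1).
  rewrite /p rmorph0 scale0r addr0 rmorph1 scale1r [x + _]addrC subrK => H.
  by have [|e e0 He] := H; [exists d|apply: He; exact: nball_center].
apply: (@itv_ind R (fun a b => Z (p a) -> Z (p b))) => //.
  by move=> a b c _ _ _ _ h1 h2 /h1 /h2.
move=> s s01; have Dp := cD _ _ _ Dx Dy s01.
have [r r0 Hr] := oD _ Dp.
have /differentiable_continuous /cvg_nrP Hc := hf _ Dp.
have [r1 r10 Hr1] := Hc 1 ltr01.
(* The ball of radius q / 2 about [p a] lies in the ball of radius q about [p s], where f is bounded
   by continuity, and contains the ball of radius q / 8 about [p b]. A zero germ at [p a] thus
   passes to [p b]. *)
pose q := Num.min r r1; have q0 : 0 < q by rewrite lt_min r0.
exists (q / 8 / (nr (y - x) + 1)); first by rewrite !divr_gt0.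
move=> a b a0 ab b1 sa bs [e e0 He].
have close c : s - q / 8 / (nr (y - x) + 1) < c -> c < s + q / 8 / (nr (y - x) + 1) ->
    nr (p c - p s) < q / 8.
  move=> h1 h2; rewrite pp; apply: (@le_lt_trans _ _ (`|c - s| * (nr (y - x) + 1))).
    by rewrite ler_wpM2l // lerDl.
  by rewrite -ltr_pdivlMr // ltr_norml; apply/andP; split; lra.
have ca : nr (p a - p s) < q / 8 by apply: close; lra.
have cb : nr (p b - p s) < q / 8 by apply: close; lra.
have sub : nball (p a) (q / 2) `<=` nball (p s) q by apply: nball_sub; lra.
have qr : nball (p s) q `<=` nball (p s) r by apply: nball_sub; rewrite subrr nr0 add0r ge_min lexx.
exists (q / 8); first by rewrite divr_gt0.
move=> v; rewrite /nball /= => vb.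
apply: (@vholo_identity_ball f (p a) (q / 2) (nr (f (p s)) + 1) e) => //.
- by move=> u /sub /qr /Hr /hf.
- move=> u /sub; rewrite /nball /= lt_min => /andP[_ /Hr1 /ltW h].
  by rewrite -[X in nr X](subrK (f (p s))) (le_trans (nrD _ _)) // addrC lerD2l.
- rewrite /nball /= (le_lt_trans (nr_subD (p b) _ _)) //.
  have := nr_subD (p s) (p b) (p a); rewrite [nr (p s - p a)]nr_dist.
  lra.
Qed.

Lemma diff_bound f x (k : R) : differentiable f x -> 
  (exists2 r : R, 0 < r & forall y, nr (y - x) < r -> nr (f y - f x) <= k * nr (y - x)) ->
  forall v, nr ('d f x v) <= k * nr v.
Proof.
move=> df [r r0 Hr] v.
have [->|v0] := eqVneq v 0; first by rewrite linear0 !nr0 mulr0.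
have nv : 0 < nr v by rewrite nr_gt0.
apply/ler_addgt0Pr => e e0.
have [r1 r10 Hr1] := diff_nrP df (divr_gt0 e0 nv).
pose q := Num.min r r1 / 2 / nr v.
have m0 : 0 < Num.min r r1 by rewrite lt_min r0.
have q0 : 0 < q by rewrite !divr_gt0.
have E : x + q%:C *: v - x = q%:C *: v by rewrite addrAC subrr add0r.
have nq : nr (x + q%:C *: v - x) = q * nr v by rewrite E nrZ nr_real // ltW.
have qm : q * nr v < Num.min r r1.
  by rewrite /q divfK ?gt_eqF // ltr_pdivrMr // ltr_pMr // ltr1n.
move: (qm); rewrite -nq lt_min => /andP[/Hr h1 /Hr1 h2].
rewrite !nq in h1 h2; rewrite !E linearZ /= in h2 *.
have h3 : nr (q%:C *: 'd f x v) <= k * (q * nr v) + e / nr v * (q * nr v).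
  have -> : q%:C *: 'd f x v = (f (x + q%:C *: v) - f x) - (f (x + q%:C *: v) - f x - q%:C *: 'd f x v).
    by rewrite opprB addrCA subrr addr0.
  by rewrite (le_trans (nrB _ _)) // lerD.
rewrite nrZ nr_real ?(ltW q0) // in h3.
rewrite -(ler_pM2l q0) (le_trans h3) // le_eqVlt; apply/orP; left; apply/eqP.
by field; rewrite gt_eqF.
Qed.

(** [vholo_lipschitz] applied to f_n - f_m bounds its increments from x by e |u - x|. Hence the
    differentials at x form a Cauchy sequence, uniformly on bounded sets of v, and the first-order
    expansions pass to the limit. *)
Lemma weierstrass (f_ : nat -> V -> C) f x (r : R) : 0 < r ->
  (forall n, vholo (nball x r) (f_ n)) ->
  (forall e : R, 0 < e -> exists N, forall n u, (N <= n)%N -> nball x r u -> nr (f_ n u - f u) <= e) ->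
  differentiable f x /\ forall v, 'd (f_ n) x v @[n --> \oo] --> 'd f x v.
Proof.
move=> r0 hf hu.
have xb := nball_center x r0.
have cau e : 0 < e -> exists N, forall n m u, (N <= n)%N -> (N <= m)%N -> nball x r u ->
    nr (f_ n u - f_ m u) <= e.
  move=> e0; have e2 : 0 < e / 2 by rewrite divr_gt0.
  have [N HN] := hu _ e2; exists N => n m u Nn Nm xu.
  rewrite (le_trans (nr_subD (f u) _ _)) // [X in _ + X]nr_dist.
  have := HN _ _ Nn xu; have := HN _ _ Nm xu; lra.
have hsub n m : vholo (nball x r) (fun u => f_ n u - f_ m u).
  by move=> u xu; exact: differentiableB (hf n u xu) (hf m u xu).
have lip e : 0 < e -> exists N, forall n m u, (N <= n)%N -> (N <= m)%N -> nball x r u ->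
    nr ((f_ n u - f_ m u) - (f_ n x - f_ m x)) <= e * nr (u - x).
  move=> e0; have e2 : 0 < e * r / 2 by rewrite divr_gt0 // mulr_gt0.
  have [N HN] := cau _ e2; exists N => n m u Nn Nm xu.
  have := @vholo_lipschitz (fun u => f_ n u - f_ m u) x r (e * r / 2) u (hsub n m).
  have -> : 2 * (e * r / 2) / r = e by field; rewrite gt_eqF.
  by apply => // u' xu'; exact: HN.
have dcau e : 0 < e -> exists N, forall n m v, (N <= n)%N -> (N <= m)%N ->
    nr ('d (f_ n) x v - 'd (f_ m) x v) <= e * nr v.
  move=> e0; have [N HN] := lip _ e0; exists N => n m v Nn Nm.
  have E : 'd (fun u => f_ n u - f_ m u) x v = 'd (f_ n) x v - 'd (f_ m) x v.
    have h1 := diff_is_derive v (hsub n m x xb).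
    have h2 := is_deriveB (diff_is_derive v (hf n x xb)) (diff_is_derive v (hf m x xb)).
    exact: is_derive_uniq h1 h2.
  rewrite -E; apply: diff_bound; first exact: hsub.
  by exists r => // u ur; exact: HN.
have /choice [D HD] : forall v, exists d : C, 'd (f_ n) x v @[n --> \oo] --> d.
  move=> v; apply: ccauchy_cvg => e e0.
  have k0 : 0 < nr v + 1 by rewrite ltr_wpDl ?nr_ge0.
  have [N HN] := dcau _ (divr_gt0 e0 k0); exists N => n m Nn Nm.
  apply: (le_lt_trans (HN _ _ v Nn Nm)).
  by rewrite mulrAC ltr_pdivrMr // ltr_pM2l // ltrDl.
have linD : linear D.
  move=> a u v; apply: (cvgn_nr_unique (HD (a *: u + v))).
  have h1 := cvgn_nrZ (c := a) (HD u).
  have h2 := cvgn_nrB h1 (cvgn_nrZ (c := -1) (HD v)).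
  have -> : a *: D u + D v = a * D u - -1 * D v by rewrite mulN1r opprK.
  by apply: cvgn_ext h2 => n; rewrite mulN1r opprK linearP.
have [L LE] : exists L : {linear V -> C}, forall v, L v = D v.
  pose L : {linear V -> C} := HB.pack D (GRing.isLinear.Build _ _ _ _ _ linD).
  by exists L.
have DL e : 0 < e -> exists N, forall n v, (N <= n)%N -> nr ('d (f_ n) x v - L v) <= e * nr v.
  move=> e0; have [N HN] := dcau _ e0; exists N => n v Nn.
  have H := @cvgn_nrB R (fun m => 'd (f_ m) x v) (fun=> 'd (f_ n) x v) _ _ (HD v) (@cvgn_cst _).
  rewrite -LE in H.
  rewrite nr_dist; apply: (cvgn_nr_le H); exists N => m Nm; exact: HN.
have [N1 HN1] := DL 1 ltr01.
have [K HK] : exists K : R, forall v, nr (L v) <= K * nr v.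
  have [k k0 Hk] := linear_lipschitz (diff_continuous (hf N1 x xb)).
  have rk : k = (Re k)%:C by rewrite RRe_real // gtr0_real.
  exists (1 + Re k) => v.
  have h1 : nr ('d (f_ N1) x v) <= Re k * nr v.
    by have := Hk v; rewrite rk [X in _ * X]nrE -rmorphM /= nr_le.
  rewrite -[L v](subrK ('d (f_ N1) x v)) (le_trans (nrD _ _)) // mulrDl lerD // nr_dist.
  exact: HN1.
have [df dfE] : differentiable f x /\ 'd f x = L :> (V -> C).
  apply: (nr_diff HK) => e e0.
  have e3 : 0 < e / 3 by rewrite divr_gt0.
  have [Na HNa] := lip _ e3; have [Nb HNb] := DL _ e3.
  pose N := maxn Na Nb.
  have [r2 r20 Hr2] := diff_nrP (hf N x xb) e3.
  exists (Num.min r r2); first by rewrite lt_min r0.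
  move=> y; rewrite lt_min => /andP[yr yr2].
  have A : nr ((f y - f_ N y) - (f x - f_ N x)) <= e / 3 * nr (y - x).
    have cv u : nball x r u -> f_ n u @[n --> \oo] --> f u.
      move=> xu; apply/cvgn_nrP => e' e'0.
      have e2 : 0 < e' / 2 by rewrite divr_gt0.
      have [M HM] := hu _ e2; exists M => n Mn.
      by rewrite (le_lt_trans (HM _ _ Mn xu)) // ltr_pdivrMr // ltr_pMr // ltr1n.
    have h u : nball x r u -> (f_ n u - f_ N u) @[n --> \oo] --> f u - f_ N u.
      by move=> xu; exact: (@cvgn_nrB R (fun m => f_ m u) (fun=> f_ N u) _ _ (cv _ xu) (@cvgn_cst _)).
    have H := cvgn_nrB (h _ yr) (h _ xb).
    apply: (cvgn_nr_le H); exists Na => n Nan; apply: HNa => //; exact: leq_maxl.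
  have B := Hr2 _ yr2.
  have D' := HNb N (y - x) (leq_maxr _ _).
  have -> : f y - f x - L (y - x) = ((f y - f_ N y) - (f x - f_ N x)) +
    (f_ N y - f_ N x - 'd (f_ N) x (y - x)) + ('d (f_ N) x (y - x) - L (y - x)) by ring.
  rewrite (le_trans (nrD _ _)) // (le_trans (lerD (nrD _ _) (lexx _))) //; lra.
split; [exact: df|move=> v].
have E : 'd f x v = L v := congr1 (fun h : V -> C => h v) dfE.
by move: (HD v); rewrite -LE -E.
Qed.

End SeveralVariables.

(** * Holomorphic dependence on a parameter *)

Section ParametricHolomorphy.
Variable R : realType.
Local Notation C := R[i].
Local Notation Re := complex.Re.
Local Notation Im := complex.Im.
Variable V : normedModType C.

Lemma diff_cstC (c : C) (x : V) : differentiable (fun _ : V => c) x.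
Proof. exact: differentiable_cst. Qed.

Lemma diff_addC (f g : V -> C) x : differentiable f x -> differentiable g x ->
  differentiable (fun t => f t + g t) x.
Proof. by move=> hf hg; exact: (differentiableD hf hg). Qed.

Lemma diff_oppC (f : V -> C) x : differentiable f x -> differentiable (fun t => - f t) x.
Proof. by move=> hf; exact: (differentiableN hf). Qed.

Lemma diff_subC (f g : V -> C) x : differentiable f x -> differentiable g x ->
  differentiable (fun t => f t - g t) x.
Proof. by move=> hf hg; exact: (differentiableB hf hg). Qed.

Lemma diff_mulC (f g : V -> C) x : differentiable f x -> differentiable g x ->
  differentiable (fun t => f t * g t) x.
Proof. by move=> hf hg; exact: (differentiableM hf hg). Qed.

Lemma diff_invC (f : V -> C) x : differentiable f x -> f x != 0 ->
  differentiable (fun t => (f t)^-1) x.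
Proof. by move=> hf f0; exact: (differentiableV hf f0). Qed.

Lemma diff_sumC (I : Type) (s : seq I) (P : pred I) (f : I -> V -> C) x :
  (forall i, differentiable (f i) x) -> differentiable (fun t => \sum_(i <- s | P i) f i t) x.
Proof.
move=> hf; elim: s => [|i s IH].
  apply: diff_near (diff_cstC 0 x); apply/nbhs_nrP; exists 1 => // y _.
  by rewrite big_nil.
have h : differentiable (fun t => (if P i then f i t else 0) + \sum_(j <- s | P j) f j t) x.
  by apply: diff_addC => //; case: (P i) => //; exact: diff_cstC.
apply: diff_near h; apply/nbhs_nrP; exists 1 => // y _.
by rewrite big_cons; case: (P i); rewrite ?add0r.
Qed.

Lemma diff_prodC (I : Type) (s : seq I) (P : pred I) (f : I -> V -> C) x :
  (forall i, differentiable (f i) x) -> differentiable (fun t => \prod_(i <- s | P i) f i t) x.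
Proof.
move=> hf; elim: s => [|i s IH].
  apply: diff_near (diff_cstC 1 x); apply/nbhs_nrP; exists 1 => // y _.
  by rewrite big_nil.
have h : differentiable (fun t => (if P i then f i t else 1) * \prod_(j <- s | P j) f j t) x.
  by apply: diff_mulC => //; case: (P i) => //; exact: diff_cstC.
apply: diff_near h; apply/nbhs_nrP; exists 1 => // y _.
by rewrite big_cons; case: (P i); rewrite ?mul1r.
Qed.

Lemma diff_compC (f : C -> C) (g : V -> C) x d : differentiable g x -> is_derive (g x) (1 : C) f d ->
  differentiable (fun t => f (g t)) x.
Proof.
move=> hg hf; have df : differentiable f (g x) by apply/is_derive1_diffP; exists d.
exact: (differentiable_comp hg df).
Qed.

Lemma diff_cexpC (g : V -> C) x : differentiable g x -> differentiable (fun t => cexp (g t)) x.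
Proof. by move=> hg; exact: diff_compC hg (is_derive_cexp _). Qed.

Lemma weierstrass1 (f_ df_ : nat -> C -> C) (f : C -> C) (z d : C) (r : R) : 0 < r ->
  (forall n y, nr (y - z) < r -> is_derive y (1 : C) (f_ n) (df_ n y)) ->
  (forall e : R, 0 < e -> exists N, forall n u, (N <= n)%N -> nr (u - z) < r -> nr (f_ n u - f u) <= e) ->
  df_ n z @[n --> \oo] --> d -> is_derive z (1 : C) f d.
Proof.
move=> r0 hf hu hd.
have hv n : vholo (nball z r) (f_ n).
  by move=> y yr; apply/is_derive1_diffP; exists (df_ n y); exact: hf.
have [Df Dl] := weierstrass r0 hv hu.
have E n : 'd (f_ n) z (1 : C) = df_ n z.
  apply: is_derive_uniq (diff_is_derive (1 : C) _) _; first exact/hv/nball_center.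
  by apply: hf; rewrite subrr nr0.
have -> : d = 'd f z (1 : C) := cvgn_nr_unique hd (cvgn_ext E (Dl (1 : C))).
exact: diff_is_derive.
Qed.

Definition vopen (N : set V) := forall u, N u -> exists2 r : R, 0 < r & nball u r `<=` N.

Lemma nball_open x r : vopen (nball x r).
Proof.
move=> u ur; exists (r - nr (u - x)); first by rewrite subr_gt0.
by apply: nball_sub; rewrite addrC subrK.
Qed.

Lemma vholo_lim (f_ : nat -> V -> C) (f : V -> C) (N : set V) : vopen N ->
  (forall n, vholo N (f_ n)) ->
  (forall e : R, 0 < e -> exists N0, forall n u, (N0 <= n)%N -> N u -> nr (f_ n u - f u) <= e) ->
  vholo N f.
Proof.
move=> oN hf hu x Nx; have [r r0 Hr] := oN _ Nx.
suff [//] : differentiable f x /\ forall v, 'd (f_ n) x v @[n --> \oo] --> 'd f x v.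
apply: (weierstrass r0) => [n y /Hr|e e0]; first exact: hf.
by have [N0 HN0] := hu _ e0; exists N0 => n u Nn /Hr; exact: HN0.
Qed.

Lemma uniform_limit (f_ : nat -> V -> C) (N : set V) (b : nat -> R) :
  (forall e : R, 0 < e -> exists N0, b N0 <= e) ->
  (forall n m u, (n <= m)%N -> N u -> nr (f_ m u - f_ n u) <= b n) ->
  exists f : V -> C, forall n u, N u -> nr (f_ n u - f u) <= b n /\ f_ n u @[n --> \oo] --> f u.
Proof.
move=> hb hc.
have /choice [f Hf] : forall u, exists l : C, N u -> f_ n u @[n --> \oo] --> l.
  move=> u; have [Nu|nN] := pselect (N u); last by exists 0.
  have [|l hl] := @ccauchy_cvg R (f_ ^~ u); last by exists l.
  move=> e e0; have e4 : 0 < e / 4 by rewrite divr_gt0.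
  have [N0 h0] := hb _ e4; exists N0 => n m Nn Nm.
  rewrite (le_lt_trans (nr_subD (f_ N0 u) _ _)) // [X in _ + X]nr_dist.
  have := hc _ _ u Nn Nu; have := hc _ _ u Nm Nu; lra.
exists f => n u Nu; split; last exact: Hf.
have H := @cvgn_nrB R (fun m => f_ m u) (fun=> f_ n u) _ _ (Hf _ Nu) (@cvgn_cst _ _).
by rewrite nr_dist; apply: (cvgn_nr_le H); exists n => m nm; exact: hc.
Qed.

Lemma dysum_vholo (N : set V) K (phi : R -> V -> C) :
  (forall s, 0 <= s <= 1 -> vholo N (phi s)) -> vholo N (fun t => dysum K (phi ^~ t)).
Proof.
elim: K phi => [|K IH] phi H /=; first by apply: H; rewrite lexx ler01.
move=> x Nx; apply: diff_mulC; last exact: diff_cstC.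
by apply: diff_addC; apply: (IH (fun s => phi _)) => // s hs; apply: H; lra.
Qed.

(** A bound on a rho-neighbourhood of the segment gives, through the Lipschitz estimate in z, a
    modulus of continuity common to all t. The Riemann sums, holomorphic in t, therefore converge
    uniformly. *)
Lemma segint_vholo (N : set V) (f : C -> V -> C) (a b : C) (rho K : R) : vopen N -> 0 < rho ->
  (forall s, 0 <= s <= 1 -> vholo N (f (seg a b s))) ->
  (forall t s z, N t -> 0 <= s <= 1 -> nr (z - seg a b s) < rho ->
     (exists d, is_derive z (1 : C) (f ^~ t) d) /\ nr (f z t) <= K) ->
  vholo N (fun t => segint (f ^~ t) a b).
Proof.
move=> oN r0 hf hz.
have mod t s s' : N t -> 0 <= s <= 1 -> 0 <= s' <= 1 -> nr (seg a b s - seg a b s') < rho ->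
    nr (f (seg a b s) t - f (seg a b s') t) <= 2 * K / rho * nr (seg a b s - seg a b s').
  move=> Nt hs hs' ss; apply: (@vholo_lipschitz R C (f ^~ t)) => // [z zr|z zr].
    by apply/is_derive1_diffP; have [] := hz t s' z Nt hs' zr.
  by have [] := hz t s' z Nt hs' zr.
have uc e : 0 < e -> exists n, forall t s s', N t -> 0 <= s <= 1 -> 0 <= s' <= 1 -> `|s - s'| <= 2 ^- n ->
    nr (f (seg a b s) t - f (seg a b s') t) <= e.
  move=> e0; pose L := `|2 * K / rho| + 1; have L0 : 0 < L by rewrite ltr_wpDl.
  have k0 : 0 < nr (b - a) + 1 by rewrite ltr_wpDl ?nr_ge0.
  have m0 : 0 < Num.min rho (e / L) / (nr (b - a) + 1) by rewrite divr_gt0 // lt_min r0 divr_gt0.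
  have [n Hn] := exists_2expn m0; exists n => t s s' Nt hs hs' ss.
  have h : nr (seg a b s - seg a b s') < Num.min rho (e / L).
    rewrite nr_segB; apply: (@le_lt_trans _ _ (`|s - s'| * (nr (b - a) + 1))).
      by rewrite ler_wpM2l // lerDl.
    by rewrite -ltr_pdivlMr // (le_lt_trans ss).
  move: h; rewrite lt_min => /andP[h1 h2].
  apply: (le_trans (mod t s s' Nt hs hs' h1)).
  have := nr_ge0 (seg a b s - seg a b s'); move: (nr _) h2 => y h2 y0.
  rewrite ltr_pdivlMr // in h2; apply/ltW/(le_lt_trans _ h2).
  rewrite mulrC ler_wpM2l // (le_trans (ler_norm _)) // lerDl ler01 //.
have hlim t : N t -> dysum n (fun s => f (seg a b s) t) @[n --> \oo] --> dyint (fun s => f (seg a b s) t).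
  move=> Nt; apply: dyint_cvg => e /uc [n Hn]; exists n => s s' hs hs' ss; exact: Hn.
have H : vholo N (fun t => dyint (fun s => f (seg a b s) t)).
  apply: (@vholo_lim (fun n t => dysum n (fun s => f (seg a b s) t))) => // [n|e e0].
    by apply: (@dysum_vholo N n (fun s => f (seg a b s))).
  have [n0 Hn0] := uc _ e0; exists n0 => n t nn Nt.
  have H := @cvgn_nrB R _ (fun=> dysum n (fun s => f (seg a b s) t)) _ _ (hlim _ Nt) (@cvgn_cst _ _).
  rewrite nr_dist; apply: (cvgn_nr_le H); exists n => m nm.
  rewrite -(subnKC nm); apply: dysum_cauchy => s s' hs hs' ss; apply: Hn0 => //.
  by rewrite (le_trans ss) // lef_pV2 ?posrE ?exprn_gt0 // ler_eXn2l // ltr1n.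
move=> x Nx; rewrite /segint; apply: diff_mulC; [exact: diff_cstC|exact: H].
Qed.

(** Separate holomorphy suffices: z is used for differentiation, t for continuation, and the two
    interact only through uniform bounds. *)
Definition hol2 (H : set C) (N : set V) (f : C -> V -> C) :=
  (forall t, N t -> cholo H (f ^~ t)) /\ (forall z, H z -> vholo N (f z)).

Lemma hol2_cst H N c : hol2 H N (fun _ _ => c).
Proof. by split=> [t _ z _|z _ t _]; [exists 0; exact: der_cst|exact: diff_cstC]. Qed.

Lemma hol2_add H N f g : hol2 H N f -> hol2 H N g -> hol2 H N (fun z t => f z t + g z t).
Proof.
move=> [f1 f2] [g1 g2]; split=> [t Nt z Hz|z Hz t Nt].
  have [a ha] := f1 t Nt z Hz; have [b hb] := g1 t Nt z Hz.
  by eexists; exact: der_add ha hb.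
by apply: diff_addC; [exact: f2|exact: g2].
Qed.

Lemma hol2_mul H N f g : hol2 H N f -> hol2 H N g -> hol2 H N (fun z t => f z t * g z t).
Proof.
move=> [f1 f2] [g1 g2]; split=> [t Nt z Hz|z Hz t Nt].
  have [a ha] := f1 t Nt z Hz; have [b hb] := g1 t Nt z Hz.
  by eexists; exact: der_mul ha hb.
by apply: diff_mulC; [exact: f2|exact: g2].
Qed.

Lemma hol2_param H N (q : V -> C) : vholo N q -> hol2 H N (fun _ t => q t).
Proof. by move=> hq; split=> [t _ z _|z _ t]; [exists 0; exact: der_cst|exact: hq]. Qed.

Lemma hol2_var H N (q : C -> C) : cholo H q -> hol2 H N (fun z _ => q z).
Proof. by move=> hq; split=> [t _ z|z _ t _]; [exact: hq|exact: diff_cstC]. Qed.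

Lemma hol2_sum H N (I : Type) (s : seq I) (P : pred I) (f : I -> C -> V -> C) :
  (forall i, hol2 H N (f i)) -> hol2 H N (fun z t => \sum_(i <- s | P i) f i z t).
Proof.
move=> hf; split=> [t Nt|z Hz]; last first.
  by move=> t Nt; apply: diff_sumC => i; exact: (hf i).2.
elim: s => [|i s IH] z Hz.
  exists 0; apply: is_derive_near (der_cst 0 z); apply/nbhs_nrP; exists 1 => // y _.
  by rewrite big_nil.
have [a ha] := IH z Hz.
have [b hb] : exists b, is_derive z (1 : C) (fun z => if P i then f i z t else 0) b.
  by case: (P i); [exact: (hf i).1|exists 0; exact: der_cst].
exists (b + a); apply: is_derive_near (der_add hb ha); apply/nbhs_nrP; exists 1 => // y _.
by rewrite big_cons; case: (P i); rewrite ?add0r.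
Qed.

Lemma hol2_sub H H' N N' f : H' `<=` H -> N' `<=` N -> hol2 H N f -> hol2 H' N' f.
Proof.
move=> hH hN [f1 f2]; split=> [t /hN Nt z /hH|z /hH Hz t /hN]; [exact: f1|exact: f2].
Qed.

Lemma hol2_cexp H N f : hol2 H N f -> hol2 H N (fun z t => cexp (f z t)).
Proof.
move=> [f1 f2]; split=> [t Nt z Hz|z Hz t Nt].
  by have [a ha] := f1 t Nt z Hz; eexists; exact: der_cexp ha.
by apply: diff_cexpC; exact: f2.
Qed.

Lemma hol2_primitive (H : set C) (N : set V) (g : C -> V -> C) (z0 : C) :
  cvx_domain H -> vopen N -> H z0 -> hol2 H N g ->
  (forall M : R, exists K : R, forall z t, H z -> nr z <= M -> N t -> nr (g z t) <= K) ->
  exists G : C -> V -> C, (forall z, H z -> vholo N (G z)) /\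
    (forall z t, H z -> N t -> is_derive z (1 : C) (G ^~ t) (g z t)).
Proof.
move=> dH oN Hz0 [g1 g2] gK; exists (fun z t => segint (g ^~ t) z0 z); split=> [z Hz|z t Hz Nt].
  have cH := cvx_domain_convex dH.
  (* Compactness of the segment in the open set H, again by continuous induction. *)
  have [r r0 Hr] : exists2 r : R, 0 < r & forall s u, 0 <= s <= 1 -> nr (u - seg z0 z s) < r -> H u.
    suff [r r0 Hr] : exists2 r : R, 0 < r & forall s, 0 <= s -> s <= 1 -> forall u, nr (u - seg z0 z s) < r -> H u.
      by exists r => // s u /andP[s0 s1]; exact: (Hr s).
    apply: (@itv_ind R (fun x y => exists2 r : R, 0 < r &
        forall s, x <= s -> s <= y -> forall u, nr (u - seg z0 z s) < r -> H u)) => //.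
      move=> x y w _ _ _ _ [d d0 Hd] [d' d'0 Hd']; exists (Num.min d d'); first by rewrite lt_min d0.
      move=> s sx sz u; rewrite lt_min => /andP[u1 u2].
      by have [sy|/ltW sy] := leP s y; [exact: (Hd s)|exact: (Hd' s)].
    move=> x x01; have [d d0 Hd] := dH.1 _ (cH _ _ _ Hz0 Hz x01).
    have k0 : 0 < nr (z - z0) + 1 by rewrite ltr_wpDl ?nr_ge0.
    have d2 : 0 < d / 2 by rewrite divr_gt0.
    exists (d / 2 / (nr (z - z0) + 1)); first by rewrite divr_gt0.
    move=> y w y0 yz z1 xy zx; exists (d / 2) => // s ys sz u us; apply: Hd.
    have ss : nr (seg z0 z s - seg z0 z x) < d / 2.
      rewrite nr_segB; apply: (@le_lt_trans _ _ (`|s - x| * (nr (z - z0) + 1))).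
        by rewrite ler_wpM2l // lerDl.
      by rewrite -ltr_pdivlMr // ltr_norml; apply/andP; split; lra.
    by rewrite (le_lt_trans (nr_subD (seg z0 z s) _ _)) //; lra.
  have [K HK] := gK (nr z0 + nr (z - z0) + r).
  apply: (@segint_vholo N g z0 z r K) => // [s hs|t s u Nt hs us].
    exact/g2/cH.
  have Hu := Hr _ _ hs us; split; first exact: g1.
  apply: HK => //; rewrite -[u](subrK (seg z0 z s)) (le_trans (nrD _ _)) // addrC lerD //; last exact: ltW.
  rewrite /seg (le_trans (nrD _ _)) // lerD2l nrM nr_real; last by case/andP: hs.
  by rewrite ler_piMl ?nr_ge0 //; case/andP: hs.
by apply: (primitive dH) => //; exact: g1.
Qed.

End ParametricHolomorphy.

(** * A scalar linear equation integrated from infinity *)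

Section HalfPlaneSolver.
Variable R : realType.
Local Notation C := R[i].
Local Notation Re := complex.Re.
Local Notation Im := complex.Im.
Variable V : normedModType C.

Definition half_plane (kappa : C) (x : R) : set C := [set z | x < Re (kappa * z)].

Lemma real_der_inv (f : R -> R) (s d : R) : is_derive s (1 : R) f d -> f s != 0 ->
  is_derive s (1 : R) (fun r => (f r)^-1) (- d / f s ^+ 2).
Proof.
move=> hf f0; have df := @ex_derive _ _ _ _ _ _ _ hf.
apply: DeriveDef; first exact: derivableV.
rewrite deriveV // (@derive_val _ _ _ _ _ _ _ hf).
by rewrite -[_ *: d]/(_ * d) mulrC mulrN mulNr.
Qed.

Lemma real_der_affine (a b s : R) : is_derive s (1 : R) (fun r : R => a + b * r) b.
Proof.
apply/real_is_deriveP => e e0; exists 1 => // y _.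
have -> : a + b * y - (a + b * s) - (y - s) * b = 0 by ring.
by rewrite normr0 mulr_ge0 // ltW.
Qed.

Lemma real_der_scale (c : R) (f : R -> R) (s d : R) : is_derive s (1 : R) f d ->
  is_derive s (1 : R) (fun r => c * f r) (c * d).
Proof. by move=> hf; exact: (is_deriveZ c hf). Qed.

Lemma small_tail (c k : R) : 0 <= c -> 0 < k -> forall e : R, 0 < e ->
  exists n0, forall n, (n0 <= n)%N -> c / (1 + k * n%:R) <= e.
Proof.
move=> c0 k0 e e0; exists (Num.bound (c / e / k)) => n nn.
have n1 : 0 <= n%:R :> R by [].
rewrite ler_pdivrMr; last by rewrite ltr_pwDl // mulr_ge0 // ltW.
have h : c / e / k <= n%:R.
  apply: le_trans (ltW (archi_boundP _)) _; first by rewrite !divr_ge0 // ltW.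
  by rewrite ler_nat.
rewrite ler_pdivrMr // ler_pdivrMr // in h; lra.
Qed.

(** The solution is minus the integral of e^(q (z - zeta)) f(zeta) from z to infinity in the
    direction e, written e^(q z) (G z - G(oo)) with G a primitive of e^(-q z) f. Decay like (1 + k
    s)^-2 has an elementary primitive and covers both exponential and power decay. *)
Lemma solve_half_plane (kappa : C) (x0 : R) (N : set V) (q : V -> C) (e z0 : C)
    (f : C -> V -> C) (Q B : R) (M k : C -> R) :
  vopen N -> vholo N q -> (forall t, N t -> nr (q t) <= Q) ->
  0 <= Re (kappa * e) -> half_plane kappa x0 z0 -> hol2 (half_plane kappa x0) N f ->
  (forall z t, half_plane kappa x0 z -> N t -> nr (f z t) <= B) ->
  (forall z, half_plane kappa x0 z -> 0 <= M z /\ 0 < k z) ->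
  (forall L : R, exists M0 k0 : R, [/\ 0 <= M0, 0 < k0 & forall z, half_plane kappa x0 z -> nr z <= L ->
     M z <= M0 /\ k0 <= k z]) ->
  (forall z t s, half_plane kappa x0 z -> N t -> 0 <= s ->
     nr (cexp (- (q t * (s%:C * e))) * f (z + s%:C * e) t) <= M z / (1 + k z * s) ^+ 2) ->
  exists y : C -> V -> C, [/\ hol2 (half_plane kappa x0) N y,
    forall z t, half_plane kappa x0 z -> N t -> is_derive z (1 : C) (y ^~ t) (q t * y z t + f z t) &
    forall z t, half_plane kappa x0 z -> N t -> nr (y z t) <= nr e * (M z / k z)].
Proof.
set H := half_plane kappa x0.
move=> oN hq hQ ke Hz0 hf hB Mk loc dec.
have dH : cvx_domain H := half_plane_domain kappa x0.
have cH := cvx_domain_convex dH.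
have He z s : H z -> 0 <= s -> H (z + s%:C * e).
  rewrite /H /half_plane /= => hz s0; rewrite mulrDr ReD mulrCA Re_mulC.
  by rewrite ltr_wpDr // mulr_ge0.
pose g z t := cexp (- (q t * z)) * f z t.
have hg : hol2 H N g.
  apply: hol2_mul hf; apply: hol2_cexp.
  have h := hol2_mul (hol2_cst H N (-1)) (hol2_mul (hol2_param H hq) (hol2_var N (fun z _ => ex_intro _ _ (der_id z)))).
  have -> : (fun z t => - (q t * z)) = (fun z t => -1 * (q t * z)) :> (C -> V -> C).
    by apply/funext => z; apply/funext => t; rewrite mulN1r.
  exact: h.
have nexp t z L : N t -> nr z <= L -> nr (cexp (q t * z)) <= expR (Q * L) /\ nr (cexp (- (q t * z))) <= expR (Q * L).
  move=> Nt zL; have h : nr (q t * z) <= Q * L.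
    by rewrite nrM; apply: ler_pM => //; [exact: nr_ge0|exact: nr_ge0|exact: hQ].
  rewrite !nr_cexp !ler_expR; split; first exact: le_trans (ler_norm _) (le_trans (nr_Re _) h).
  by rewrite ReN (le_trans (ler_norm _)) // normrN (le_trans (nr_Re _)).
have gL L : exists K : R, forall z t, H z -> nr z <= L -> N t -> nr (g z t) <= K.
  exists (expR (Q * L) * B) => z t Hz zL Nt; rewrite nrM; apply: ler_pM; rewrite ?nr_ge0 //.
    by have [] := nexp t z L Nt zL.
  exact: hB.
have [G [GN GH]] := hol2_primitive dH oN Hz0 hg gL.
have E1 z t s s' : H z -> N t -> 0 <= s -> s <= s' ->
    nr (cexp (q t * z) * (G (z + s'%:C * e) t - G (z + s%:C * e) t)) <=
    nr e * (M z / k z) * ((1 + k z * s)^-1 - (1 + k z * s')^-1).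
  move=> Hz Nt s0 ss'; have [M0 k0] := Mk z Hz.
  have T0 : 0 <= s' - s by rewrite subr_ge0.
  have D r : 0 <= r <= s' - s -> is_derive (z + s%:C * e + r%:C * e) (1 : C)
      (fun u => cexp (q t * z) * G u t) (cexp (q t * z) * g (z + s%:C * e + r%:C * e) t).
    move=> /andP[r0 _]; apply: der_scale; apply: GH => //; exact/He/r0/He.
  (* The primitive of the bound |e| M / (1 + k (s + r))^2 on the integrand. *)
  pose psi r := - (nr e * (M z / k z)) * (1 + k z * s + k z * r)^-1.
  have pos r : 0 <= r -> 0 < 1 + k z * s + k z * r.
    move=> r0; rewrite ltr_pwDl ?mulr_ge0 ?(ltW k0) //.
    by rewrite ltr_pwDl // mulr_ge0 // ltW.
  have Dpsi r : 0 <= r <= s' - s -> is_derive r (1 : R) psi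
       (- (nr e * (M z / k z)) * (- k z / (1 + k z * s + k z * r) ^+ 2)).
    move=> /andP[r0 _]; apply/real_der_scale/real_der_inv; first exact: real_der_affine.
    by rewrite gt_eqF // pos.
  have := @mean_value_le R _ (fun u => cexp (q t * z) * g u t) _ e psi _ _ T0 D Dpsi.
  have -> : z + s%:C * e + (s' - s)%:C * e = z + s'%:C * e by rewrite rmorphB /=; ring.
  rewrite -mulrBr => h; apply: (le_trans (h _)); last first.
    rewrite /psi mulr0 addr0.
    have -> : 1 + k z * s + k z * (s' - s) = 1 + k z * s' by ring.
    by rewrite mulrBr !mulNr opprK addrC.
  move=> r /andP[r0 _].
  have -> : cexp (q t * z) * g (z + s%:C * e + r%:C * e) t * e =
     e * (cexp (- (q t * ((s + r)%:C * e))) * f (z + (s + r)%:C * e) t).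
    have -> : z + s%:C * e + r%:C * e = z + (s + r)%:C * e by rewrite rmorphD /=; ring.
    have <- : cexp (q t * z) * cexp (- (q t * (z + (s + r)%:C * e))) = cexp (- (q t * ((s + r)%:C * e))).
      by rewrite -cexpD; congr cexp; ring.
    by rewrite /g; ring.
  have sr : 0 <= s + r by rewrite addr_ge0.
  rewrite nrM; apply: (le_trans (ler_wpM2l (nr_ge0 _) (dec _ _ _ Hz Nt sr))).
  rewrite le_eqVlt; apply/orP; left; apply/eqP.
  by rewrite mulrDr addrA; field; rewrite !gt_eqF // pos.
have Qn L : 0 < expR (Q * L) by exact: expR_gt0.
(* The value at infinity is reached along integer steps from one base point; convergence uniform in
   t makes it holomorphic. *)
have [Ginf HG] : exists Ginf : V -> C, vholo N Ginf /\ forall t, N t -> G (z0 + n%:R%:C * e) t @[n --> \oo] --> Ginf t.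
  have [M0 k0] := Mk z0 Hz0.
  pose b n := expR (Q * nr z0) * (nr e * (M z0 / k z0)) / (1 + k z0 * n%:R).
  have b0 : 0 <= expR (Q * nr z0) * (nr e * (M z0 / k z0)).
    by rewrite mulr_ge0 ?(ltW (Qn _)) // mulr_ge0 ?nr_ge0 // divr_ge0 // ltW.
  have hc n m t : (n <= m)%N -> N t -> nr (G (z0 + m%:R%:C * e) t - G (z0 + n%:R%:C * e) t) <= b n.
    move=> nm Nt.
    have h := E1 z0 t n%:R m%:R Hz0 Nt (ler0n _ _) ltac:(by rewrite ler_nat).
    have [_ h2] := nexp t z0 _ Nt (lexx _).
    rewrite -[X in nr X]mul1r -(mulVf (cexp_neq0 (q t * z0))) -mulrA nrM -cexpN.
    rewrite /b -mulrA; apply: ler_pM; rewrite ?nr_ge0 //.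
    apply: (le_trans h); rewrite ler_wpM2l //; first by rewrite mulr_ge0 ?nr_ge0 // divr_ge0 // ltW.
    by rewrite gerBl invr_ge0 addr_ge0 // mulr_ge0 // ltW.
  have tail e' : 0 < e' -> exists n0, b n0 <= e'.
    by move=> e'0; have [n0 h] := small_tail b0 k0 e'0; exists n0; exact: h.
  have [Gi HGi] := uniform_limit tail hc; exists Gi; split; last first.
    by move=> t Nt; have [] := HGi 0%N t Nt.
  apply: (vholo_lim oN (f_ := fun n t => G (z0 + n%:R%:C * e) t)).
    by move=> n; exact/GN/He.
  move=> e' e'0; have [n0 h] := small_tail b0 k0 e'0.
  exists n0 => n t nn Nt; have [h1 _] := HGi n t Nt; apply: (le_trans h1); exact: h.
have {HG}[GiN HG0] := HG.
(* The limit is the same from every z: the segment from z0 + n e to z + n e keeps its length while g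
   tends to 0 on it, uniformly by [loc]. *)
have HG z t : H z -> N t -> G (z + n%:R%:C * e) t @[n --> \oo] --> Ginf t.
  move=> Hz Nt; apply/cvgn_nrP => e' e'0.
  have e2 : 0 < e' / 2 by rewrite divr_gt0.
  have /cvgn_nrP /(_ _ e2) [n1 Hn1] := HG0 t Nt.
  have [M0 [k0 [M00 k00 hM]]] := loc (nr z0 + nr (z - z0)).
  pose c := expR (Q * (nr z0 + nr (z - z0))) * M0 * nr (z - z0).
  have c0 : 0 <= c by rewrite !mulr_ge0 ?nr_ge0 // ltW.
  have [n2 Hn2] := small_tail c0 k00 (divr_gt0 e2 (ltr0Sn R 1)).
  exists (maxn n1 n2) => n; rewrite geq_max => /andP[/Hn1 h1 /Hn2 h2].
  rewrite (le_lt_trans (nr_subD (G (z0 + n%:R%:C * e) t) _ _)) //.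
  suff : nr (G (z + n%:R%:C * e) t - G (z0 + n%:R%:C * e) t) <= c / (1 + k0 * n%:R) by lra.
  rewrite /c mulrAC; set L := nr z0 + _.
  have <- : nr (z + n%:R%:C * e - (z0 + n%:R%:C * e)) = nr (z - z0) by congr nr; ring.
  have n0 : 0 <= n%:R :> R by [].
  apply: (@mean_value_segment R (G ^~ t) (g ^~ t)) => s hs.
    apply: GH => //; apply: cH => //; exact: He.
  have sE : z0 + n%:R%:C * e + s%:C * (z + n%:R%:C * e - (z0 + n%:R%:C * e)) = seg z0 z s + n%:R%:C * e.
    by rewrite /seg; ring.
  have Hs : H (seg z0 z s) by exact: cH.
  have nL : nr (seg z0 z s) <= L.
    rewrite /seg (le_trans (nrD _ _)) // lerD2l nrM nr_real; last by case/andP: hs.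
    by rewrite ler_piMl ?nr_ge0 //; case/andP: hs.
  rewrite sE /g.
  have -> : cexp (- (q t * (seg z0 z s + n%:R%:C * e))) * f (seg z0 z s + n%:R%:C * e) t =
     cexp (- (q t * seg z0 z s)) * (cexp (- (q t * (n%:R%:C * e))) * f (seg z0 z s + n%:R%:C * e) t).
    have -> : cexp (- (q t * (seg z0 z s + n%:R%:C * e))) =
        cexp (- (q t * seg z0 z s)) * cexp (- (q t * (n%:R%:C * e))).
      by rewrite -cexpD; congr cexp; ring.
    by ring.
  have [_ hx] := nexp t (seg z0 z s) _ Nt nL.
  rewrite nrM -[X in _ <= X]mulrA; apply: ler_pM; rewrite ?nr_ge0 //.
  apply: (le_trans (dec _ _ _ Hs Nt n0)).
  have [hM0 hk0] := hM _ Hs nL; have [Ms ks] := Mk _ Hs.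
  have p1 : 1 <= 1 + k0 * n%:R by rewrite lerDl mulr_ge0 // ltW.
  have p2 : 1 + k0 * n%:R <= 1 + k (seg z0 z s) * n%:R by rewrite lerD2l ler_wpM2r.
  have p3 : 1 <= 1 + k (seg z0 z s) * n%:R := le_trans p1 p2.
  apply: ler_pM => //; first by rewrite invr_ge0 sqr_ge0.
  rewrite lef_pV2 ?posrE ?exprn_gt0 ?(lt_le_trans ltr01) //.
  by rewrite expr2; nra.
exists (fun z t => cexp (q t * z) * (G z t - Ginf t)).
have Dy z t : H z -> N t -> is_derive z (1 : C) (fun z => cexp (q t * z) * (G z t - Ginf t))
     (q t * (cexp (q t * z) * (G z t - Ginf t)) + f z t).
  move=> Hz Nt; have h := der_mul (der_cexp (der_scale (q t) (der_id z))) (der_sub (GH z t Hz Nt) (der_cst (Ginf t) z)).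
  apply: der_eq h _; rewrite mulr1 subr0 /g mulrA -cexpD subrr cexp0 mul1r.
  by ring.
split; [|exact: Dy|].
- split=> [t Nt z Hz|z Hz t Nt]; first by eexists; exact: Dy.
  apply: diff_mulC.
    by apply: diff_cexpC; apply: diff_mulC; [exact: hq|exact: diff_cstC].
  by apply: diff_subC; [exact: GN|exact: GiN].
- move=> z t Hz Nt; have [M0 k0] := Mk z Hz.
  have h := cvgn_nrZ (c := cexp (q t * z)) (cvgn_nrB (@cvgn_cst _ (G z t)) (HG z t Hz Nt)).
  apply: (cvgn_nr_le h); exists 0%N => n _.
  have := E1 z t 0 n%:R Hz Nt (lexx _) (ler0n _ _).
  rewrite rmorph0 mul0r addr0 mulr0 addr0 invr1.
  rewrite -[X in nr X <= _ -> _]opprK nrN -mulrN opprB => h'; apply: (le_trans h').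
  rewrite ler_piMr //; first by rewrite mulr_ge0 ?nr_ge0 // divr_ge0 // ltW.
  by rewrite gerBl invr_ge0 addr_ge0 // mulr_ge0 // ltW.
Qed.

End HalfPlaneSolver.

(** * The fixed point problem for one column on a half-plane *)

Section Contraction.
Variable R : realType.
Local Notation C := R[i].
Local Notation Re := complex.Re.
Local Notation Im := complex.Im.
Variable V : normedModType C.

Lemma half_plane_sub (kappa : C) (x y : R) : x <= y -> half_plane kappa y `<=` half_plane kappa x.
Proof. by move=> xy z; rewrite /half_plane /=; exact: le_lt_trans. Qed.

Lemma half_plane_nr (kappa z : C) (x : R) : nr kappa = 1 -> half_plane kappa x z -> x < nr z.
Proof.
move=> k1; rewrite /half_plane /= => h; apply: (lt_le_trans h).
by rewrite (le_trans (ler_norm _)) // (le_trans (nr_Re _)) // nrM k1 mul1r.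
Qed.

(** Projection by kappa gives |z + s e| >= s, and the triangle inequality |z + s e| >= |z| - s |e|.
    Powers of |z + s e| can thus be traded for powers of |z| + s. *)
Lemma ray_lower_bound (kappa z e : C) (s : R) : nr kappa = 1 -> 0 < Re (kappa * z) ->
  Re (kappa * e) = 1 -> 0 <= s -> nr z + s <= (2 + nr e) * nr (z + s%:C * e).
Proof.
move=> k1 kz ke s0.
have h1 : s <= nr (z + s%:C * e).
  rewrite -[leRHS]mul1r -k1 -nrM (le_trans _ (nr_Re _)) // (le_trans _ (ler_norm _)) //.
  by rewrite mulrDr ReD mulrCA Re_mulC ke mulr1 lerDr ltW.
have h2 : nr z <= nr (z + s%:C * e) + s * nr e.
  by have := @nrB R _ (z + s%:C * e) (s%:C * e); rewrite addrK nrM (nr_real s0).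
have := nr_ge0 e; nra.
Qed.

(** The square of 1 + x <= exp x at x = c s / 2: exponential decay in the form required by
    [solve_half_plane]. *)
Lemma exp_decay (c s : R) : 0 < c -> 0 <= s -> expR (- (c * s)) <= ((1 + c / 2 * s) ^+ 2)^-1.
Proof.
move=> c0 s0; have cs : 0 <= c / 2 * s by rewrite mulr_ge0 // divr_ge0 // ltW.
rewrite expRN lef_pV2 ?posrE ?expR_gt0 ?exprn_gt0 ?ltr_pwDl //.
have -> : c * s = c / 2 * s + c / 2 * s by field.
rewrite expRD -expr2 lerXn2r ?nnegrE ?expR_ge0 ?addr_ge0 //.
exact: expR_ge1Dx.
Qed.

Lemma ler_sum_ord n (F : 'I_n -> R) (B : R) : (forall i, F i <= B) -> \sum_i F i <= n%:R * B.
Proof.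
move=> h; apply: (le_trans (ler_sum _ (fun i _ => h i))).
by rewrite sumr_const card_ord mulr_natl.
Qed.

Lemma cvgn_nrD (u v : nat -> C) (l m : C) : u n @[n --> \oo] --> l -> v n @[n --> \oo] --> m ->
  (u n + v n) @[n --> \oo] --> l + m.
Proof. by move=> h1 h2; exact: (cvgD h1 h2). Qed.

Lemma cvgn_sumZ (I : Type) (r : seq I) (c : I -> C) (u : I -> nat -> C) (l : I -> C) :
  (forall i, u i n @[n --> \oo] --> l i) ->
  (\sum_(i <- r) c i * u i n) @[n --> \oo] --> \sum_(i <- r) c i * l i.
Proof.
move=> hu; elim: r => [|i r IH].
  by rewrite big_nil; apply: cvgn_ext (@cvgn_cst _ 0) => n; rewrite big_nil.
rewrite big_cons -[X in _ --> _ + X]opprK.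
have h2 := cvgn_nrZ (c := -1) IH; rewrite mulN1r in h2.
apply: cvgn_ext (cvgn_nrB (cvgn_nrZ (c := c i) (hu i)) h2) => n.
by rewrite big_cons mulN1r opprK.
Qed.

Section Column.
Variables (n : nat) (b : 'I_n) (kappa : C) (x0 : R) (N : set V) (q : 'I_n -> V -> C)
  (e : 'I_n -> C) (Q c K E : R) (m : nat)
  (P : 'I_n -> 'I_n -> C -> V -> C) (h : 'I_n -> C -> V -> C).
Let H := half_plane kappa.

Hypotheses (oN : vopen N) (k1 : nr kappa = 1) (x0_gt0 : 0 < x0) (c0 : 0 < c) (K0 : 0 < K)
  (hq : forall a, vholo N (q a)) (hQ : forall a t, N t -> nr (q a t) <= Q)
  (qb : forall t, N t -> q b t = 0)
  (ke : forall a, Re (kappa * e a) = 1) (eE : forall a, nr (e a) <= E)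
  (qe : forall a t, a != b -> N t -> c <= Re (q a t * e a))
  (hP : forall a d, hol2 (H x0) N (P a d))
  (PK : forall a d z t, H x0 z -> N t -> nr (P a d z t) <= K / nr z)
  (PbK : forall z t, H x0 z -> N t -> nr (P b b z t) <= K / nr z ^+ 2)
  (hh : forall a, hol2 (H x0) N (h a))
  (hK : forall a z t, H x0 z -> N t -> nr (h a z t) <= K / nr z ^+ m.+2).

(** One constant for both regimes: E bounds the line element, 2 / c or 1 comes from the integrated
    decay, and the power of 2 + E from [ray_lower_bound]. *)
Let A : R := E * (2 / c + 1) * (2 + E) ^+ m.+2.

Let E0 : 0 <= E. Proof. exact: le_trans (nr_ge0 (e b)) (eE b). Qed.

Let sig1 : 1 <= 2 + E. Proof. by have := E0; lra. Qed.

Let A0 : 0 <= A.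
Proof. have d0 : 0 <= 2 / c by rewrite divr_ge0 // ltW.
have s0 : 0 <= 2 + E := le_trans ler01 sig1.
rewrite /A; apply: mulr_ge0; last exact: exprn_ge0.
by apply: mulr_ge0; [exact: E0|exact: addr_ge0]. Qed.

(** For a != b the exponential decays and the solution keeps the order of f. For a = b there is
    none, integration costs a power of z, and f has to be one order smaller. *)
Lemma column_solve (x : R) (a : 'I_n) (f : C -> V -> C) (F : R) : x0 <= x -> 0 <= F ->
  hol2 (H x) N f ->
  (forall z t, H x z -> N t -> nr (f z t) <= F / nr z ^+ (if a == b then m.+2 else m.+1)) ->
  exists y : C -> V -> C, [/\ hol2 (H x) N y,
    forall z t, H x z -> N t -> is_derive z (1 : C) (y ^~ t) (q a t * y z t + f z t) &
    forall z t, H x z -> N t -> nr (y z t) <= A * F / nr z ^+ m.+1].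
Proof.
move=> xx F0 hf fF.
have xp : 0 < x by exact: lt_le_trans xx.
have zx z : H x z -> x < nr z by exact: half_plane_nr.
have zp z : H x z -> 0 < nr z by move=> /zx; exact: lt_trans.
have kk0 : kappa != 0 by rewrite -nr_gt0 k1.
have Hz0 : H x (kappa^-1 * (x + 1)%:C).
  by rewrite /H /half_plane /= mulrA mulfV // mul1r /= ltrDl.
have He z s : H x z -> 0 <= s -> H x (z + s%:C * e a).
  rewrite /H /half_plane /= => hz s0; rewrite mulrDr ReD mulrCA Re_mulC ke mulr1.
  by rewrite ltr_wpDr.
have ray z s : H x z -> 0 <= s -> nr z + s <= (2 + E) * nr (z + s%:C * e a).
  move=> hz s0; apply: (le_trans (@ray_lower_bound kappa z (e a) s k1 _ (ke a) s0)).
    by move: hz; rewrite /H /half_plane /=; exact: lt_trans.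
  by rewrite ler_wpM2r ?nr_ge0 // lerD2l.
have inv_le z j : H x z -> (nr z ^+ j)^-1 <= (x ^+ j)^-1.
  move=> Hz; rewrite lef_pV2 ?posrE ?exprn_gt0 ?zp //.
  by rewrite lerXn2r ?nnegrE ?(ltW xp) ?(ltW (zp _ Hz)) // ltW // zx.
have fB z t : H x z -> N t -> nr (f z t) <= F / x ^+ (if a == b then m.+2 else m.+1).
  move=> Hz Nt; apply: (le_trans (fF _ _ Hz Nt)); rewrite ler_wpM2l //; exact: inv_le.
have sp : 0 < 2 + E by rewrite (lt_le_trans ltr01).
have S0 j : 0 <= (2 + E) ^+ j by rewrite exprn_ge0 // ltW.
have pw z s j : H x z -> 0 <= s -> (nr (z + s%:C * e a) ^+ j)^-1 <= (2 + E) ^+ j / (nr z + s) ^+ j.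
  move=> Hz s0; have r := ray _ _ Hz s0.
  have p1 : 0 < nr (z + s%:C * e a) by exact/zp/He.
  have p2 : 0 < nr z + s by rewrite ltr_pwDl // zp.
  rewrite -expr_div_n -exprVn lerXn2r ?nnegrE ?invr_ge0 ?(ltW p1) ?divr_ge0 ?(ltW sp) ?(ltW p2) //.
  by rewrite ler_pdivlMr // mulrC ler_pdivrMr.
have [ab|ab] := eqVneq a b.
- (* q a = 0: there is no exponential factor and the decay of f is integrated. *)
  pose M (z : C) := F * (2 + E) ^+ m.+2 / nr z ^+ m.+2.
  pose k (z : C) := (nr z)^-1.
  have [||L|z t s Hz Nt s0|y [y1 y2 y3]] := @solve_half_plane R V kappa x N (q a) (e a)
      _ f Q _ M k oN (hq a) (hQ a) _ Hz0 hf fB.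
  + by rewrite ke.
  + move=> z Hz; split; last by rewrite invr_gt0 zp.
    by rewrite divr_ge0 ?exprn_ge0 ?nr_ge0 // mulr_ge0 // exprn_ge0 // ltW.
  + exists (F * (2 + E) ^+ m.+2 / x ^+ m.+2), ((`|L| + 1)^-1); split.
    * by rewrite divr_ge0 ?exprn_ge0 ?(ltW xp) // mulr_ge0 // exprn_ge0 // ltW.
    * by rewrite invr_gt0 ltr_wpDl.
    * move=> z Hz zL; split.
        apply: ler_wpM2l; last exact: inv_le.
        by rewrite mulr_ge0 // exprn_ge0 // ltW.
      rewrite /k lef_pV2 ?posrE ?zp ?ltr_wpDl //; apply: (le_trans zL).
      by rewrite (le_trans (ler_norm L)) // lerDl.
  + rewrite ab qb // mul0r oppr0 cexp0 mul1r -ab.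
    apply: (le_trans (fF _ _ (He _ _ Hz s0) Nt)); rewrite ab eqxx -ab.
    apply: (le_trans (ler_wpM2l F0 (pw _ s m.+2 Hz s0))).
    rewrite /M mulrA -[leRHS]mulrA; apply: (ler_wpM2l (mulr_ge0 F0 (S0 _))).
    have p1 := zp _ Hz; rewrite /k.
    have -> : 1 + (nr z)^-1 * s = (nr z + s) / nr z by field; rewrite gt_eqF.
    have p2 : 0 < nr z + s by rewrite ltr_pwDl.
    have -> : nr z ^- m.+2 / ((nr z + s) / nr z) ^+ 2 = (nr z ^+ m * (nr z + s) ^+ 2)^-1.
      rewrite -[m.+2]addn2 exprD; field; rewrite !gt_eqF // exprn_gt0 //.
    have n0 j y : 0 < y -> y ^+ j \is Num.pos by move=> y0; rewrite posrE exprn_gt0.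
    rewrite lef_pV2; [|exact: n0|by rewrite rpredM ?n0].
    rewrite -[m.+2]addn2 exprD; apply: ler_wpM2r; first exact: sqr_ge0.
    by rewrite lerXn2r ?nnegrE ?(ltW p1) ?(ltW p2) // lerDl.
  + exists y; split=> // z t Hz Nt; apply: (le_trans (y3 _ _ Hz Nt)).
    have p1 := zp _ Hz.
    rewrite /M /k invrK [nr z ^+ m.+2]exprS invfM.
    have -> : F * (2 + E) ^+ m.+2 * ((nr z)^-1 / nr z ^+ m.+1) * nr z = (2 + E) ^+ m.+2 * F / nr z ^+ m.+1.
      by field; rewrite !gt_eqF // ?exprn_gt0.
    have -> : nr (e a) * ((2 + E) ^+ m.+2 * F / nr z ^+ m.+1) =
       (nr (e a) * (2 + E) ^+ m.+2) * F / nr z ^+ m.+1 by ring.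
    have Zi : 0 <= (nr z ^+ m.+1)^-1 by rewrite invr_ge0 exprn_ge0 // ltW.
    apply: (ler_wpM2r Zi); apply: (ler_wpM2r F0); apply: (ler_wpM2r (S0 _)).
    apply: (le_trans (eE a)); rewrite ler_peMr ?E0 // lerDr divr_ge0 // ltW //.
- pose M (z : C) := F * (2 + E) ^+ m.+1 / nr z ^+ m.+1.
  pose k := fun _ : C => c / 2.
  have k0 : 0 < c / 2 by rewrite divr_gt0.
  have [||L|z t s Hz Nt s0|y [y1 y2 y3]] := @solve_half_plane R V kappa x N (q a) (e a)
      _ f Q _ M k oN (hq a) (hQ a) _ Hz0 hf fB.
  + by rewrite ke.
  + move=> z Hz; split => //.
    by rewrite divr_ge0 ?exprn_ge0 ?nr_ge0 // mulr_ge0 // exprn_ge0 // ltW.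
  + exists (F * (2 + E) ^+ m.+1 / x ^+ m.+1), (c / 2); split => //.
    * by rewrite divr_ge0 ?exprn_ge0 ?(ltW xp) // mulr_ge0 // exprn_ge0 // ltW.
    * move=> z Hz zL; split => //.
      apply: ler_wpM2l; last exact: inv_le.
      by rewrite mulr_ge0 // exprn_ge0 // ltW.
  + rewrite nrM nr_cexp mulrC.
    apply: ler_pM; rewrite ?nr_ge0 ?expR_ge0 //.
      apply: (le_trans (fF _ _ (He _ _ Hz s0) Nt)); rewrite (negPf ab).
      apply: (le_trans (ler_wpM2l F0 (pw _ s m.+1 Hz s0))).
      rewrite /M -mulrA; apply: (ler_wpM2l F0); apply: (ler_wpM2l (S0 _)).
      have p1 := zp _ Hz.
      have p2 : 0 < nr z + s by rewrite ltr_pwDl.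
      rewrite lef_pV2 ?posrE ?(exprn_gt0 _ p1) ?(exprn_gt0 _ p2) //.
      by rewrite lerXn2r ?nnegrE ?(ltW p1) ?(ltW p2) // lerDl.
    apply: le_trans (exp_decay c0 s0); rewrite ler_expR ReN lerN2.
    by rewrite mulrCA Re_mulC mulrC ler_wpM2l // qe.
  + exists y; split=> // z t Hz Nt; apply: (le_trans (y3 _ _ Hz Nt)).
    rewrite /M /k.
    have -> : nr (e a) * (F * (2 + E) ^+ m.+1 / nr z ^+ m.+1 / (c / 2)) =
       (nr (e a) * (2 / c) * (2 + E) ^+ m.+1) * F / nr z ^+ m.+1.
      by have p1 := zp _ Hz; field; rewrite !gt_eqF // ?exprn_gt0.
    have Zi : 0 <= (nr z ^+ m.+1)^-1 by rewrite invr_ge0 exprn_ge0 // nr_ge0.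
    apply: (ler_wpM2r Zi); apply: (ler_wpM2r F0).
    have c2 : 0 <= 2 / c by rewrite divr_ge0 // ltW.
    apply: ler_pM; [exact: mulr_ge0 (nr_ge0 _) c2|exact: S0| |by rewrite ler_weXn2l].
    by apply: ler_pM; rewrite ?nr_ge0 // lerDl.
Qed.

(** The iteration contracts by 1/2 in a weighted norm: |z|^-m for the entry b, c1 |z|^-(m+1) for the
    others. The entry b loses a power in the integration but has room for it, since P b b = O(z^-2)
    and the other entries have smaller weights. *)
Lemma column_solution : exists x1 K' : R, exists s : 'I_n -> C -> V -> C,
  [/\ x0 <= x1, forall a, hol2 (H x1) N (s a),
     forall a z t, H x1 z -> N t -> is_derive z (1 : C) (s a ^~ t)
       (q a t * s a z t + (\sum_d P a d z t * s d z t + h a z t)) &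
     forall a z t, H x1 z -> N t -> nr (s a z t) <= K' / nr z ^+ m].
Proof.
have n1 : 1 <= n%:R :> R by rewrite ler1n (leq_ltn_trans _ (ltn_ord b)).
have n0 : 0 <= n%:R :> R by [].
have A0' : 0 <= A := A0.
have K0' : 0 <= K := ltW K0.
have AK0 : 0 <= A * K by exact: mulr_ge0.
(* For a != b the source term from the entry b has exactly the order of the weight, so only the
   constant can provide the factor: A K n X = (X / 2) c1. *)
pose c1 := 2 * (A * K) * n%:R.
have c10 : 0 <= c1 by rewrite mulr_ge0 // mulr_ge0.
have c1AK : A * K <= c1 by rewrite /c1; nra.
(* In the entry b a factor 1 / |z| is left over; |z| > c1 (1 + c1) makes A K n (1 + c1) / |z| at
   most 1/2. *)
pose x1 := Num.max (Num.max x0 1) (Num.max c1 (c1 * (1 + c1))).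
have x01 : x0 <= x1 by rewrite !le_max lexx.
have x11 : 1 <= x1 by rewrite !le_max lexx orbT.
have xc1 : c1 <= x1 by rewrite !le_max lexx !orbT.
have xc2 : c1 * (1 + c1) <= x1 by rewrite !le_max lexx !orbT.
have zx z : H x1 z -> x1 < nr z by exact: half_plane_nr.
have z1 z : H x1 z -> 1 < nr z by move=> /zx; exact: le_lt_trans.
have zp z : H x1 z -> 0 < nr z by move=> /z1; exact: lt_trans.
have Zi z j : H x1 z -> 0 <= (nr z ^+ j)^-1 by move=> Hz; rewrite invr_ge0 exprn_ge0 // nr_ge0.
have ZS z j : H x1 z -> (nr z ^+ j.+1)^-1 = (nr z)^-1 * (nr z ^+ j)^-1 by move=> _; rewrite exprS invfM.
have H01 : H x1 `<=` H x0 by exact: half_plane_sub.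
pose w (a : 'I_n) (z : C) : R := if a == b then (nr z ^+ m)^-1 else c1 / nr z ^+ m.+1.
pose Bd (X : R) (d : 'I_n -> C -> V -> C) := (forall a, hol2 (H x1) N (d a)) /\
  forall a z t, H x1 z -> N t -> nr (d a z t) <= X * w a z.
(* The assumptions stand inside the existential so that [choice] yields a total operator, which can
   be iterated together with its bound. *)
have step (p : ('I_n -> C -> V -> C) * R) : exists d' : 'I_n -> C -> V -> C, 0 <= p.2 -> Bd p.2 p.1 ->
    Bd (p.2 / 2) d' /\ forall a z t, H x1 z -> N t ->
      is_derive z (1 : C) (d' a ^~ t) (q a t * d' a z t + \sum_d P a d z t * p.1 d z t).
  case: p => d X /=.
  have [[X0 [hd dX]]|nX] := pselect (0 <= X /\ Bd X d); last first.
    by exists d => X0 Hd; exfalso; apply: nX.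
  have /choice [y Hy] : forall a, exists y : C -> V -> C, [/\ hol2 (H x1) N y,
      forall z t, H x1 z -> N t -> is_derive z (1 : C) (y ^~ t)
        (q a t * y z t + \sum_d0 P a d0 z t * d d0 z t) &
      forall z t, H x1 z -> N t -> nr (y z t) <= X / 2 * w a z].
    move=> a; pose Bt := if a == b then K * X * (1 + c1) else K * X.
    have KX0 : 0 <= K * X by exact: mulr_ge0.
    have Bt0 : 0 <= Bt by rewrite /Bt; case: (a == b) => //; rewrite mulr_ge0 // addr_ge0.
    have hf : hol2 (H x1) N (fun z t => \sum_d0 P a d0 z t * d d0 z t).
      by apply: hol2_sum => d0; apply: hol2_mul => //; exact: hol2_sub H01 (fun _ p => p) (hP a d0).
    have fF z t : H x1 z -> N t -> nr (\sum_d0 P a d0 z t * d d0 z t) <=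
        n%:R * Bt / nr z ^+ (if a == b then m.+2 else m.+1).
      move=> Hz Nt; have Hz0 := H01 _ Hz.
      apply: (le_trans (nr_sum _ _ _)).
      rewrite -mulrA; apply: ler_sum_ord => d0.
      rewrite nrM; have Dd := dX d0 z t Hz Nt.
      have i0 : 0 <= (nr z)^-1 by rewrite invr_ge0 nr_ge0.
      have ci : c1 * (nr z)^-1 <= 1.
        by rewrite ler_pdivrMr ?zp // mul1r (le_trans xc1) // ltW // zx.
      have u0 := Zi z m Hz; rewrite /w (ZS _ _ Hz) in Dd.
      rewrite /Bt; case: ifP => [/eqP ab|/eqP/eqP ab].
        rewrite !(ZS _ _ Hz); case: eqVneq Dd => [->|d0b] Dd.
          have := PbK Hz0 Nt; rewrite ab expr2 invfM => h1.
          apply: (le_trans (ler_pM (nr_ge0 _) (nr_ge0 _) h1 Dd)).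
          have -> : K * ((nr z)^-1 / nr z) * (X / nr z ^+ m) =
            K * X * ((nr z)^-1 * ((nr z)^-1 / nr z ^+ m)) by ring.
          rewrite ler_wpM2r ?mulr_ge0 // ler_peMr // lerDl //.
        have h1 := PK a d0 Hz0 Nt.
        apply: (le_trans (ler_pM (nr_ge0 _) (nr_ge0 _) h1 Dd)).
        have -> : K / nr z * (X * (c1 * ((nr z)^-1 / nr z ^+ m))) =
          K * X * c1 * ((nr z)^-1 * ((nr z)^-1 / nr z ^+ m)) by ring.
        rewrite ler_wpM2r ?mulr_ge0 // ler_wpM2l // lerDr //.
      have h1 := PK a d0 Hz0 Nt.
      apply: (le_trans (ler_pM (nr_ge0 _) (nr_ge0 _) h1 Dd)); rewrite (ZS _ _ Hz).
      case: eqVneq => _; first by rewrite le_eqVlt; apply/orP; left; apply/eqP; ring.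
      have -> : K / nr z * (X * (c1 * ((nr z)^-1 / nr z ^+ m))) =
          K * X * ((nr z)^-1 / nr z ^+ m) * (c1 * (nr z)^-1) by ring.
      by rewrite ler_piMr // !mulr_ge0.
    have [y [y1 y2 y3]] := column_solve x01 (mulr_ge0 n0 Bt0) hf fF.
    exists y; split => // z t Hz Nt; apply: (le_trans (y3 _ _ Hz Nt)).
    have u0 := Zi z m Hz; rewrite /w /Bt (ZS _ _ Hz).
    have i0 : 0 <= (nr z)^-1 by rewrite invr_ge0 nr_ge0.
    case: eqP => _.
      have -> : A * (n%:R * (K * X * (1 + c1))) * ((nr z)^-1 / nr z ^+ m) =
         (c1 * (1 + c1) / nr z) * (X / 2 / nr z ^+ m) by rewrite /c1; field; rewrite !gt_eqF ?exprn_gt0 ?zp.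
      rewrite ler_piMl //; first by rewrite mulr_ge0 // divr_ge0.
      by rewrite ler_pdivrMr ?zp // mul1r (le_trans xc2) // ltW // zx.
    by rewrite le_eqVlt; apply/orP; left; apply/eqP; rewrite /c1; field; rewrite !gt_eqF ?exprn_gt0 ?zp.
  exists y => _ _; split; last by move=> a z t Hz Nt; have [_ y2 _] := Hy a; exact: y2.
  by split=> a; have [y1 _ y3] := Hy a.
have [d0 [hd0 dd0]] : exists d0, Bd 1 d0 /\ forall a z t, H x1 z -> N t ->
    is_derive z (1 : C) (d0 a ^~ t) (q a t * d0 a z t + h a z t).
  have /choice [y Hy] : forall a, exists y : C -> V -> C, [/\ hol2 (H x1) N y,
      forall z t, H x1 z -> N t -> is_derive z (1 : C) (y ^~ t) (q a t * y z t + h a z t) &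
      forall z t, H x1 z -> N t -> nr (y z t) <= 1 * w a z].
    move=> a.
    have hf := hol2_sub H01 (fun _ p => p) (hh a).
    have fF z t : H x1 z -> N t -> nr (h a z t) <= K / nr z ^+ (if a == b then m.+2 else m.+1).
      move=> Hz Nt; apply: (le_trans (hK a (H01 _ Hz) Nt)); case: ifP => // _.
      rewrite ler_wpM2l // [leLHS](ZS _ _ Hz) ler_piMl ?Zi // invf_le1 ?zp // ltW // z1 //.
    have [y [y1 y2 y3]] := column_solve x01 K0' hf fF.
    exists y; split => // z t Hz Nt; apply: (le_trans (y3 _ _ Hz Nt)).
    have u0 := Zi z m Hz; rewrite /w mul1r (ZS _ _ Hz).
    have i0 : 0 <= (nr z)^-1 by rewrite invr_ge0 nr_ge0.
    case: eqP => _; last by rewrite ler_wpM2r // mulr_ge0.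
    rewrite mulrA ler_piMl // ler_pdivrMr ?zp // mul1r (le_trans c1AK) // (le_trans xc1) // ltW // zx //.
  exists y; split; last by move=> a z t Hz Nt; have [_ y2 _] := Hy a; exact: y2.
  by split=> a; have [y1 _ y3] := Hy a.
have /choice [stp Hstp] := step.
pose D := fix D i := if i is j.+1 then stp (D j, 2 ^- j) else d0.
have p2 j : 0 <= 2 ^- j :> R by rewrite invr_ge0 exprn_ge0.
have HD j : Bd (2 ^- j) (D j) /\ forall a z t, H x1 z -> N t ->
   is_derive z (1 : C) (D j.+1 a ^~ t) (q a t * D j.+1 a z t + \sum_d P a d z t * D j d z t).
  have BD : Bd (2 ^- j) (D j).
    elim: j => [|j IH]; first by rewrite expr0 invr1.
    by have [] := Hstp (D j, 2 ^- j) (p2 j) IH; rewrite /= exprSr invfM.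
  by split => //; have [] := Hstp (D j, 2 ^- j) (p2 j) BD.
pose S k a z t := \sum_(i < k) D i a z t.
pose W (z : C) : R := (1 + c1) / nr z ^+ m.
have wW a z : H x1 z -> w a z <= W z.
  move=> Hz; rewrite /w /W (ZS _ _ Hz); have u0 := Zi z m Hz.
  have i0 : 0 <= (nr z)^-1 by rewrite invr_ge0 nr_ge0.
  have i1 : (nr z)^-1 <= 1 by rewrite invf_le1 ?zp // ltW // z1.
  case: ifP => _; first by rewrite ler_peMl // lerDl.
  by rewrite mulrA ler_wpM2r // (le_trans (ler_piMr c10 i1)) // lerDr.
have SE k a z t : S k.+1 a z t = S k a z t + D k a z t by rewrite /S big_ord_recr.
have W0 z : H x1 z -> 0 <= W z by move=> Hz; rewrite /W mulr_ge0 ?addr_ge0 // Zi.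
have geo k j a z t : H x1 z -> N t -> nr (S (k + j)%N a z t - S k a z t) <= 2 * (2 ^- k - 2 ^- (k + j)) * W z.
  move=> Hz Nt; elim: j => [|j IH].
    by rewrite addn0 !subrr nr0 mulr0 mul0r.
  rewrite addnS SE addrAC (le_trans (nrD _ _)) //.
  have h1 := (HD (k + j)%N).1.2 a z t Hz Nt.
  have {}h1 := le_trans h1 (ler_wpM2l (p2 _) (wW a z Hz)).
  apply: (le_trans (lerD IH h1)); rewrite [2 ^+ (k + j).+1]exprSr invfM.
  by move: (2 ^- k : R) (2 ^- (k + j) : R) (W z) => u v y; lra.
have geo2 k k' a z t : (k <= k')%N -> H x1 z -> N t -> nr (S k' a z t - S k a z t) <= 2 * 2 ^- k * W z.
  move=> kk Hz Nt; rewrite -(subnKC kk); apply: (le_trans (geo _ _ _ _ _ Hz Nt)).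
  by rewrite ler_wpM2r ?W0 // ler_wpM2l // gerBl p2.
have small c' : 0 <= c' -> forall e' : R, 0 < e' -> exists k0, forall k, (k0 <= k)%N -> 2 * 2 ^- k * c' <= e'.
  move=> c'0 e' e'0; have k0 : 0 < 2 * c' + 1 by rewrite ltr_wpDl // mulr_ge0.
  have [k0' hk] := exists_2expn (divr_gt0 e'0 k0); exists k0' => k kk.
  have : 2 ^- k <= 2 ^- k0' :> R by rewrite lef_pV2 ?posrE ?exprn_gt0 // ler_eXn2l // ltr1n.
  move=> /le_lt_trans /(_ hk); rewrite ltr_pdivlMr // => /ltW; apply: le_trans.
  by have := p2 k; nra.
have /choice [s Hs] : forall p : 'I_n * C * V, exists l : C, H x1 p.1.2 -> N p.2 ->
    S k p.1.1 p.1.2 p.2 @[k --> \oo] --> l.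
  move=> [[a z] t] /=.
  have [[Hz Nt]|nH] := pselect (H x1 z /\ N t); last by exists 0 => Hz Nt; exfalso; apply: nH.
  have [|l hl] := @ccauchy_cvg R (fun k => S k a z t); last by exists l.
  move=> e' e'0; have e4 : 0 < e' / 4 by rewrite divr_gt0.
  have [k0 hk] := small _ (W0 z Hz) _ e4; exists k0 => k k' kk kk'.
  rewrite (le_lt_trans (nr_subD (S k0 a z t) _ _)) // [X in _ + X]nr_dist.
  have := geo2 _ _ a z t kk Hz Nt; have := geo2 _ _ a z t kk' Hz Nt.
  have := hk k0 (leqnn _); lra.
have sS a k z t : H x1 z -> N t -> nr (s (a, z, t) - S k a z t) <= 2 * 2 ^- k * W z.
  move=> Hz Nt.
  have h1 := @cvgn_nrB R _ (fun=> S k a z t) _ _ (Hs (a, z, t) Hz Nt) (@cvgn_cst _ _).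
  by apply: (cvgn_nr_le h1); exists k => k' kk; exact: geo2.
have hS k a : hol2 (H x1) N (S k a).
  apply: hol2_sum => i; exact: (HD i).1.1.
have DS k a z t : H x1 z -> N t -> is_derive z (1 : C) (S k.+1 a ^~ t)
    (q a t * S k.+1 a z t + (\sum_d P a d z t * S k d z t + h a z t)).
  move=> Hz Nt; elim: k => [|k IH].
    have E1 : S 1%N a ^~ t = d0 a ^~ t by apply/funext => y; rewrite /S big_ord1.
    have E2 y : S 1%N a y t = d0 a y t by rewrite /S big_ord1.
    rewrite E1 E2 big1 ?add0r; first exact: dd0.
    by move=> d _; rewrite /S big_ord0 mulr0.
  have E1 : S k.+2 a ^~ t = (fun y => S k.+1 a y t + D k.+1 a y t) by apply/funext => y; rewrite SE.
  rewrite E1; apply: der_eq (der_add IH ((HD k).2 a z t Hz Nt)) _.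
  have -> : \sum_d P a d z t * S k.+1 d z t =
      \sum_d P a d z t * S k d z t + \sum_d P a d z t * D k d z t.
    by rewrite -big_split; apply: eq_bigr => d _; rewrite SE mulrDr.
  by rewrite (SE k.+1); ring.
have Ds a z t : H x1 z -> N t -> is_derive z (1 : C) (fun z => s (a, z, t))
    (q a t * s (a, z, t) + (\sum_d P a d z t * s (d, z, t) + h a z t)).
  move=> Hz Nt; have [r r0 Hr] := (half_plane_domain kappa x1).1 z Hz.
  apply: (@weierstrass1 R (fun k => S k.+1 a ^~ t)
    (fun k y => q a t * S k.+1 a y t + (\sum_d P a d y t * S k d y t + h a y t)) _ z _ r r0).
  - by move=> k y /Hr Hy; exact: DS.
  - move=> e' e'0; have [k0 hk] := small _ (addr_ge0 ler01 c10) _ e'0; exists k0 => k u kk /Hr Hu.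
    rewrite nr_dist (le_trans (sS _ _ _ _ Hu Nt)) // (le_trans _ (hk k.+1 _)) //; last exact: leqW.
    rewrite ler_wpM2l ?mulr_ge0 // /W ler_piMr ?addr_ge0 // invf_le1 ?exprn_gt0 ?zp //.
    by rewrite exprn_ege1 // ltW // z1.
  - apply: cvgn_nrD.
      by apply: cvgn_nrZ; have := Hs (a, z, t) Hz Nt; rewrite /= -cvg_shiftS.
    apply: cvgn_nrD; last exact: cvgn_cst.
    by apply: cvgn_sumZ => d; exact: (Hs (d, z, t)).
exists x1, (2 * (1 + c1)), (fun a z t => s (a, z, t)); split; [exact: x01| |exact: Ds|].
- move=> a; split=> [t Nt z Hz|z Hz]; first by eexists; exact: Ds.
  apply: (@vholo_lim _ _ (fun k t => S k a z t)) => //; first by move=> k; exact: (hS k a).2.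
  move=> e' e'0; have [k0 hk] := small _ (W0 z Hz) _ e'0; exists k0 => k t kk Nt.
  by rewrite nr_dist (le_trans (sS _ _ _ _ Hz Nt)) // hk.
- move=> a z t Hz Nt; have := sS a 0%N z t Hz Nt.
  by rewrite /S big_ord0 subr0 expr0 invr1 mulr1 /W mulrA.
Qed.

End Column.

End Contraction.

(** * The recursion for the formal solution, column by column *)

Section FormalColumn.
Variable R : realType.
Local Notation C := R[i].
Local Notation Re := complex.Re.
Local Notation Im := complex.Im.

(** The reciprocal of 1 + sum 1 / f i serves, also for an empty index type. *)
Lemma fin_pos (I : finType) (f : I -> R) : (forall i, 0 < f i) -> exists2 c : R, 0 < c & forall i, c <= f i.
Proof.
move=> f0; pose g i := (f i)^-1; exists (1 + \sum_i g i)^-1 => [|i].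
  by rewrite invr_gt0 ltr_pwDl // sumr_ge0 // => i _; rewrite invr_ge0 ltW.
have gi : 0 < g i by rewrite invr_gt0.
rewrite -[leRHS]invrK lef_pV2 ?posrE //; last first.
  by rewrite ltr_pwDl // sumr_ge0 // => j _; rewrite invr_ge0 ltW.
rewrite -/(g i) (bigD1 i) //= addrCA lerDl addr_ge0 // sumr_ge0 // => j _.
by rewrite invr_ge0 ltW.
Qed.

(** Reindexing of a Cauchy product by l = k + j; the diagonal terms carry the coefficient of index
    0, which is zero in the application. *)
Lemma triangle_sum (G : nat -> nat -> C) L : (forall k, G k k = 0) ->
  \sum_(l < L) \sum_(k < l) G k l = \sum_(k < L) \sum_(j < L - k) G k (k + j)%N.
Proof.
move=> G0; elim: L => [|L IH]; first by rewrite !big_ord0.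
rewrite big_ord_recr IH [RHS]big_ord_recr /= subSnn big_ord1 addn0 G0 addr0 -big_split.
apply: eq_bigr => k _ /=; rewrite subSn ?(ltnW (ltn_ord k)) // big_ord_recr /=.
by rewrite subnKC // ltnW.
Qed.

(* The equation for the coefficient of z^-l in entry (a, b) of a formal solution
   phi z^(alpha_1 b b) e^(u_b z) of dy/dz = (diag u + sum_(j >= 1) alpha_j z^-j) y. *)
Definition column_rec n (u : 'I_n -> C) (al : nat -> 'I_n -> 'I_n -> C) (b : 'I_n)
    (phi : nat -> 'I_n -> C) (l : nat) (a : 'I_n) : Prop :=
  (u a - u b) * phi l a + \sum_(k < l) \sum_d al (l - k)%N a d * phi k d
    + (if l is l'.+1 then (l'%:R - al 1%N b b) * phi l' a else 0) = 0.

Lemma column_rec_diag n (u : 'I_n -> C) al b phi l :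
  column_rec u al b phi l.+1 b <->
  \sum_(k < l) \sum_d al (l.+1 - k)%N b d * phi k d + \sum_(d | d != b) al 1%N b d * phi l d
    + l%:R * phi l b = 0.
Proof.
rewrite /column_rec subrr mul0r add0r big_ord_recr /= subSnn (bigD1 b) //=.
set s1 := \sum_(k < l) _; set s2 := \sum_(d | _) _.
by have -> : s1 + (al 1%N b b * phi l b + s2) + (l%:R - al 1%N b b) * phi l b = s1 + s2 + l%:R * phi l b by ring.
Qed.

Lemma column_rec_ext n (u : 'I_n -> C) al b (phi psi : nat -> 'I_n -> C) l a :
  (forall k d, (k <= l)%N -> phi k d = psi k d) -> column_rec u al b phi l a -> column_rec u al b psi l a.
Proof.
move=> E; rewrite /column_rec E //.
have -> : \sum_(k < l) \sum_d al (l - k)%N a d * phi k d = \sum_(k < l) \sum_d al (l - k)%N a d * psi k d.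
  by apply: eq_bigr => k _; apply: eq_bigr => d _; rewrite E // ltnW.
by case: l E => // l E; rewrite (E l).
Qed.

(** Entries a != b of order k come from the equation of order k, the entry b from that of order k +
    1. Hence one further equation, of order M + 1, at the entry b only. *)
Lemma column_rec_uniq n (u : 'I_n -> C) al b (phi psi : nat -> 'I_n -> C) M :
  (forall a, a != b -> u a != u b) -> (forall a, phi 0%N a = psi 0%N a) ->
  (forall l a, (l <= M)%N -> column_rec u al b phi l a) -> column_rec u al b phi M.+1 b ->
  (forall l a, (l <= M)%N -> column_rec u al b psi l a) -> column_rec u al b psi M.+1 b ->
  forall k a, (k <= M)%N -> phi k a = psi k a.
Proof.
move=> ub E0 h1 h1' h2 h2' k; elim/ltn_ind: k => -[|k] IH a kM //.
have E l d : (l < k.+1)%N -> phi l d = psi l d by move=> lk; apply: IH => //; exact: leq_trans (ltnW lk) kM.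
have off d : d != b -> phi k.+1 d = psi k.+1 d.
  move=> db; have := h1 k.+1 d kM; have := h2 k.+1 d kM; rewrite /column_rec (E k) //.
  have -> : \sum_(j < k.+1) \sum_d0 al (k.+1 - j)%N d d0 * phi j d0 =
            \sum_(j < k.+1) \sum_d0 al (k.+1 - j)%N d d0 * psi j d0.
    by apply: eq_bigr => j _; apply: eq_bigr => d0 _; rewrite E.
  move=> H1 H2; have H := etrans H2 (esym H1); have /eqP := addIr _ (addIr _ H); rewrite -subr_eq0 -mulrBr mulf_eq0.
  by rewrite !subr_eq0 (negPf (ub d db)) => /eqP.
have [->|/off//] := eqVneq a b.
have d1 : column_rec u al b phi k.+2 b.
  by move: kM; rewrite leq_eqVlt => /orP[/eqP->|kM] //; exact: h1.
have d2 : column_rec u al b psi k.+2 b.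
  by move: kM; rewrite leq_eqVlt => /orP[/eqP->|kM] //; exact: h2.
move/column_rec_diag : d1; move/column_rec_diag : d2.
have -> : \sum_(j < k.+1) \sum_d al (k.+2 - j)%N b d * phi j d =
          \sum_(j < k.+1) \sum_d al (k.+2 - j)%N b d * psi j d.
  by apply: eq_bigr => j _; apply: eq_bigr => d0 _; rewrite E.
have -> : \sum_(d | d != b) al 1%N b d * phi k.+1 d = \sum_(d | d != b) al 1%N b d * psi k.+1 d.
  by apply: eq_bigr => d /off ->.
move=> H1 H2; have H := etrans H2 (esym H1); have /eqP := addrI _ H; rewrite -subr_eq0 -mulrBr mulf_eq0.
by rewrite pnatr_eq0 /= subr_eq0 => /eqP.
Qed.

Variable V : normedModType C.

Lemma diff_sumC_seq (I : eqType) (s : seq I) (P : pred I) (f : I -> V -> C) x :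
  (forall i, i \in s -> P i -> differentiable (f i) x) -> differentiable (fun t => \sum_(i <- s | P i) f i t) x.
Proof.
move=> h; elim: s h => [|i s IH] h.
  by apply: diff_near (@diff_cstC _ _ 0 x); near=> y; rewrite big_nil.
have h' : differentiable (fun t => \sum_(j <- s | P j) f j t) x.
  by apply: IH => j js; apply: h; rewrite inE js orbT.
case Pi : (P i).
  apply: diff_near (diff_addC (h i (mem_head _ _) Pi) h'); near=> y.
  by rewrite big_cons Pi.
by apply: diff_near h'; near=> y; rewrite big_cons Pi.
Unshelve. all: by end_near.
Qed.

(** The recursion divides only by u_a - u_b and by positive integers, so its solution is holomorphic
    on all of N, also beyond the polydisc, where nothing is known about [F]. *)
Lemma formal_column n (N : set V) (u : 'I_n -> V -> C) (al : nat -> 'I_n -> 'I_n -> V -> C) (b : 'I_n) (M : nat) :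
  (forall a, vholo N (u a)) -> (forall j a d, vholo N (al j a d)) ->
  (forall a t, a != b -> N t -> u a t != u b t) ->
  exists phi : nat -> 'I_n -> V -> C,
  [/\ forall k a, vholo N (phi k a), forall a t, phi 0%N a t = (a == b)%:R &
   forall t, N t -> let rec := column_rec (u ^~ t) (fun j a d => al j a d t) b (fun k a => phi k a t) in
     (forall l a, (l <= M)%N -> rec l a) /\ rec M.+1 b].
Proof.
move=> hu hal ub; elim: M => [|M [phi [h1 h2 h3]]].
  exists (fun _ a _ => (a == b)%:R); split => [k a t _|//|t Nt rec]; first exact: diff_cstC.
  split=> [l a|]; last first.
    apply/column_rec_diag; rewrite big_ord0 add0r mul0r addr0 big1 // => d db.
    by rewrite (negPf db) mulr0.
  rewrite leqn0 => /eqP ->; rewrite /rec /column_rec big_ord0 !addr0.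
  by case: eqVneq => [->|_]; rewrite ?subrr ?mul0r ?mulr0.
(* [f] solves the equations of order M + 1 off the entry b; [g] solves the equation of order M + 2
   at the entry b. *)
pose f a t := - ((u a t - u b t)^-1 * (\sum_(k < M.+1) \sum_d al (M.+1 - k)%N a d t * phi k d t
    + (M%:R - al 1%N b b t) * phi M a t)).
pose g t := - (M.+1%:R^-1 * (\sum_(k < M.+1) \sum_d al (M.+2 - k)%N b d t * phi k d t +
    \sum_(d | d != b) al 1%N b d t * f d t)).
pose psi k a t := if k == M.+1 then if a == b then g t else f a t else phi k a t.
have hs (l : nat) a t : N t -> differentiable (fun t => \sum_(k < M.+1) \sum_d al (l - k)%N a d t * phi k d t) t.
  by move=> Nt; apply: diff_sumC => k; apply: diff_sumC => d; apply: diff_mulC; [exact: hal|exact: h1].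
have hf a : a != b -> vholo N (f a).
  move=> ab t Nt; apply: diff_oppC; apply: diff_mulC.
    apply: diff_invC; last by rewrite subr_eq0; exact: ub.
    by apply: diff_subC; exact: hu.
  apply: diff_addC; first exact: hs.
  apply: diff_mulC; last exact: h1.
  by apply: diff_subC; [exact: diff_cstC|exact: hal].
have hg : vholo N g.
  move=> t Nt; apply: diff_oppC; apply: diff_mulC; first exact: diff_cstC.
  apply: diff_addC; first exact: hs.
  apply: diff_sumC_seq => d _ db; apply: diff_mulC; [exact: hal|exact: hf].
have lo k a t : (k <= M)%N -> psi k a t = phi k a t by move=> kM; rewrite /psi ltn_eqF.
exists psi; split=> [k a|a t|t Nt rec].
- rewrite /psi => t Nt; case: (k == M.+1); last exact: h1.
  by case: (eqVneq a b) => [_|ab]; [exact: hg|exact: hf].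
- by rewrite lo.
have [r1 r2] := h3 t Nt.
have S1 (l : nat) a : \sum_(k < M.+1) \sum_d al (l - k)%N a d t * psi k d t =
    \sum_(k < M.+1) \sum_d al (l - k)%N a d t * phi k d t.
  by apply: eq_bigr => k _; apply: eq_bigr => d _; rewrite lo // -ltnS.
have pf d : d != b -> psi M.+1 d t = f d t by move=> db; rewrite /psi eqxx (negPf db).
have pg : psi M.+1 b t = g t by rewrite /psi !eqxx.
split=> [l a|].
  rewrite leq_eqVlt => /orP[/eqP->|lM]; last first.
    apply: column_rec_ext (r1 l a lM) => k d kl; rewrite lo //; exact: leq_trans kl lM.
  have [->|ab] := eqVneq a b.
    by move: r2; rewrite /rec /column_rec subrr !mul0r S1 lo.
  rewrite /rec /column_rec S1 pf // lo // /f.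
  have qn : u a t - u b t != 0 by rewrite subr_eq0 ub.
  set s1 := \sum_(k < _) _; by field.
apply/column_rec_diag; rewrite S1 pg.
have -> : \sum_(d | d != b) al 1%N b d t * psi M.+1 d t = \sum_(d | d != b) al 1%N b d t * f d t.
  by apply: eq_bigr => d db; rewrite pf.
rewrite /g; set s1 := \sum_(k < _) _; set s2 := \sum_(d | _) _.
have mn : M.+1%:R != 0 :> C by rewrite pnatr_eq0.
by rewrite mulrN mulrA mulfV // mul1r subrr.
Qed.

End FormalColumn.

(** * Summation of the extended coefficients *)

Section LaurentTail.
Variable R : realType.
Local Notation C := R[i].
Local Notation Re := complex.Re.
Local Notation Im := complex.Im.
Variable V : normedModType C.

(** The factor 2 makes the series geometric with ratio at most 1/2. *)
Definition outer (rho : R) : set C := [set z | 2 * rho < nr z].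

Lemma outer_open rho : vopen (outer rho : set C).
Proof.
move=> z; rewrite /outer /= => zr; exists (nr z - 2 * rho); first by rewrite subr_gt0.
move=> y; rewrite /nball /= nr_dist => h; have := nrBl z y.
by have := h; lra.
Qed.

Lemma cholo_Xinv (H : set C) j : (forall z, H z -> z != 0) -> cholo H (fun z : C => z ^- j).
Proof.
move=> H0 z /H0 z0; eexists; apply: der_inv; last by rewrite expf_neq0.
exact: der_expn (der_id z).
Qed.

(** Outside the polydisc nothing is known about [A]; the sum S of the extended coefficients takes
    the place of the entries of G0^-1 A G0 - Lambda there. *)
Lemma laurent_tail (N : set V) (al : nat -> V -> C) (K rho : R) : vopen N -> 0 < rho ->
  (forall j, vholo N (al j)) -> (forall j t, N t -> nr (al j t) <= K * rho ^+ j) ->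
  exists S : C -> V -> C, hol2 (outer rho) N S /\ forall J z t, outer rho z -> N t ->
    nr (S z t - \sum_(j < J) al j t * z ^- j) <= 2 * K * (rho / nr z) ^+ J.
Proof.
move=> oN r0 hal aK.
pose T J z t := \sum_(j < J) al j t * z ^- j.
have zp z : outer rho z -> 0 < nr z by apply: lt_trans; rewrite mulr_gt0.
have yp z : outer rho z -> 0 <= rho / nr z by move=> /zp z0; rewrite divr_ge0 // ltW.
have y2 z : outer rho z -> rho / nr z <= 2^-1.
  by move=> oz; rewrite ler_pdivrMr ?zp // mulrC ler_pdivlMr // mulrC ltW.
have K0 t : N t -> 0 <= K by move=> Nt; have := aK 0%N t Nt; rewrite expr0 mulr1; exact: le_trans (nr_ge0 _).
have tm j z t : outer rho z -> N t -> nr (al j t * z ^- j) <= K * (rho / nr z) ^+ j.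
  move=> oz Nt; rewrite nrM nrV nrX expr_div_n mulrA ler_wpM2r ?aK //.
  by rewrite invr_ge0 exprn_ge0 // nr_ge0.
have geo J i z t : outer rho z -> N t ->
    nr (T (J + i)%N z t - T J z t) <= 2 * K * (rho / nr z) ^+ J * (1 - 2 ^- i).
  move=> oz Nt; elim: i => [|i IH]; first by rewrite addn0 !subrr nr0 expr0 invr1 subrr mulr0.
  rewrite addnS {1}/T big_ord_recr -/(T _ _ _) addrAC (le_trans (nrD _ _)) //.
  apply: (le_trans (lerD IH (tm _ _ _ oz Nt))); rewrite [_ ^+ (J + i)]exprD.
  have h1 : (rho / nr z) ^+ i <= 2 ^- i.
    by rewrite -exprVn lerXn2r ?nnegrE ?yp ?y2 // invr_ge0.
  have h2 : 0 <= K * (rho / nr z) ^+ J by rewrite mulr_ge0 ?exprn_ge0 ?yp // (K0 t).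
  have -> : 2 ^- i.+1 = 2 ^- i / 2 :> R by rewrite exprSr invfM.
  move: h1 h2; move: ((rho / nr z) ^+ i) ((rho / nr z) ^+ J) (2 ^- i : R) => u v w h1 h2; nra.
have geo2 J J' z t : (J <= J')%N -> outer rho z -> N t ->
    nr (T J' z t - T J z t) <= 2 * K * (rho / nr z) ^+ J.
  move=> JJ oz Nt; rewrite -(subnKC JJ) (le_trans (geo _ _ _ _ oz Nt)) //.
  have h2 : 0 <= 2 * K * (rho / nr z) ^+ J.
    by rewrite mulr_ge0 ?exprn_ge0 ?yp // mulr_ge0 // (K0 t).
  by rewrite ler_piMr // gerBl invr_ge0 exprn_ge0.
have small c : 0 <= c -> forall e : R, 0 < e -> exists J0, forall J z, (J0 <= J)%N -> outer rho z ->
    c * (rho / nr z) ^+ J <= e.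
  move=> c0 e e0; have c1 : 0 < c + 1 by rewrite ltr_wpDl.
  have [J0 hJ] := exists_2expn (divr_gt0 e0 c1); exists J0 => J z JJ oz.
  have h1 : (rho / nr z) ^+ J <= 2 ^- J.
    by rewrite -exprVn lerXn2r ?nnegrE ?yp ?y2 // invr_ge0.
  have h2 : 2 ^- J <= 2 ^- J0 :> R by rewrite lef_pV2 ?posrE ?exprn_gt0 // ler_eXn2l // ltr1n.
  have h3 := le_trans h1 h2; have h4 : 0 <= (rho / nr z) ^+ J by rewrite exprn_ge0 // yp.
  move: hJ; rewrite ltr_pdivlMr // => hJ; nra.
have /choice [S HS] : forall p : C * V, exists l : C, outer rho p.1 -> N p.2 ->
    T J p.1 p.2 @[J --> \oo] --> l.
  move=> [z t] /=.
  have [[oz Nt]|nH] := pselect (outer rho z /\ N t); last by exists 0 => oz Nt; exfalso; apply: nH.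
  have [|l hl] := @ccauchy_cvg R (fun k => T k z t); last by exists l.
  move=> e e0; have e4 : 0 < e / 4 by rewrite divr_gt0.
  have K2 : 0 <= 2 * K by rewrite mulr_ge0 // (K0 t).
  have [J0 hJ] := small _ K2 _ e4; exists J0 => J J' JJ JJ'.
  rewrite (le_lt_trans (nr_subD (T J0 z t) _ _)) // [X in _ + X]nr_dist.
  have := geo2 _ _ z t JJ oz Nt; have := geo2 _ _ z t JJ' oz Nt.
  have := hJ J0 z (leqnn _) oz; lra.
have ST J z t : outer rho z -> N t -> nr (S (z, t) - T J z t) <= 2 * K * (rho / nr z) ^+ J.
  move=> oz Nt.
  have h1 := @cvgn_nrB R _ (fun=> T J z t) _ _ (HS (z, t) oz Nt) (@cvgn_cst _ _).
  by apply: (cvgn_nr_le h1); exists J => k kk; exact: geo2.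
have hT J : hol2 (outer rho) N (T J).
  apply: hol2_sum => j; apply: hol2_mul; first exact: hol2_param.
  by apply: hol2_var; apply: cholo_Xinv => z /zp; rewrite nr_gt0.
exists (fun z t => S (z, t)); split; last exact: ST.
split=> [t Nt z oz|z oz].
- apply/is_derive1_diffP.
  have [r rr hr] := outer_open oz.
  have [|e e0|//] := @weierstrass R C (fun J u => T J u t) (fun u => S (u, t)) z r rr.
    by move=> J y /hr oy; apply/is_derive1_diffP; exact: (hT J).1.
  have K2 : 0 <= 2 * K by rewrite mulr_ge0 // (K0 t).
  have [J0 hJ] := small _ K2 _ e0; exists J0 => J u JJ /hr ou.
  by rewrite nr_dist (le_trans (ST _ _ _ ou Nt)) // hJ.
- apply: (@vholo_lim _ _ (fun J t => T J z t)) => //; first by move=> J; exact: (hT J).2.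
  move=> e e0; have [[t0 Nt0]|nN] := pselect (exists t0, N t0); last first.
    by exists 0%N => J u _ Nu; exfalso; apply: nN; exists u.
  have K2 : 0 <= 2 * K by rewrite mulr_ge0 // (K0 t0).
  have [J0 hJ] := small _ K2 _ e0; exists J0 => J u JJ Nu.
  by rewrite nr_dist (le_trans (ST _ _ _ oz Nu)) // hJ.
Qed.

End LaurentTail.

(** * One column of a solution with prescribed expansion on a half-plane *)

Section SectorialColumn.
Variable R : realType.
Local Notation C := R[i].
Local Notation Re := complex.Re.
Local Notation Im := complex.Im.

(** With X = 1 / z this is the defect of the partial sum of the phi_k in the equation of the column.
    The recursions up to order M cancel all terms of order at most M and leave one explicit term and
    tails of S. *)
Lemma residual_identity n (u : 'I_n -> C) (al : nat -> 'I_n -> 'I_n -> C) (b a : 'I_n)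
    (phi : nat -> 'I_n -> C) (M : nat) (X : C) (S : 'I_n -> C) :
  (forall d, al 0%N a d = 0) -> (forall l, (l <= M)%N -> column_rec u al b phi l a) ->
  (u a - u b) * (\sum_(k < M.+1) phi k a * X ^+ k)
    + \sum_d S d * (\sum_(k < M.+1) phi k d * X ^+ k)
    - al 1%N b b * X * (\sum_(k < M.+1) phi k a * X ^+ k)
    + \sum_(k < M.+1) k%:R * phi k a * X ^+ k.+1
  = (M%:R - al 1%N b b) * phi M a * X ^+ M.+1
    + \sum_(k < M.+1) \sum_d phi k d * X ^+ k * (S d - \sum_(j < M.+1 - k) al j a d * X ^+ j).
Proof.
move=> al0 rec; set be := al 1%N b b.
pose G k l := \sum_d al (l - k)%N a d * phi k d * X ^+ l.
have G0 k : G k k = 0 by rewrite /G big1 // => d _; rewrite subnn al0 !mul0r.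
have tri := triangle_sum M.+1 G0.
have E1 : \sum_(l < M.+1) ((u a - u b) * phi l a * X ^+ l + \sum_(k < l) G k l +
    (if val l is l'.+1 then (l'%:R - be) * phi l' a else 0) * X ^+ l) = 0.
  apply: big1 => l _; have := rec l (ltn_ord l); rewrite /column_rec => r.
  have -> : \sum_(k < l) G k l = (\sum_(k < l) \sum_d al (l - k)%N a d * phi k d) * X ^+ l.
    by rewrite mulr_suml; apply: eq_bigr => k _; rewrite mulr_suml.
  by rewrite -!mulrDl r mul0r.
rewrite !big_split /= tri in E1.
have E2 : \sum_(l < M.+1) (if val l is l'.+1 then (l'%:R - be) * phi l' a else 0) * X ^+ l =
    \sum_(l < M) (l%:R - be) * phi l a * X ^+ l.+1.
  by rewrite big_ord_recl /= mul0r add0r.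
rewrite E2 in E1.
have E3 : \sum_(k < M.+1) k%:R * phi k a * X ^+ k.+1 - be * X * (\sum_(k < M.+1) phi k a * X ^+ k) =
    \sum_(l < M) (l%:R - be) * phi l a * X ^+ l.+1 + (M%:R - be) * phi M a * X ^+ M.+1.
  transitivity (\sum_(k < M.+1) (k%:R - be) * phi k a * X ^+ k.+1); last by rewrite big_ord_recr.
  rewrite mulr_sumr -sumrB.
  by apply: eq_bigr => k _; rewrite exprS; ring.
have E4 : \sum_d S d * (\sum_(k < M.+1) phi k d * X ^+ k) =
    \sum_(k < M.+1) \sum_d phi k d * X ^+ k * S d.
  under eq_bigr do rewrite mulr_sumr.
  by rewrite exchange_big; apply: eq_bigr => k _; apply: eq_bigr => d _; rewrite mulrC.
have E5 : \sum_(k < M.+1) \sum_d phi k d * X ^+ k * (S d - \sum_(j < M.+1 - k) al j a d * X ^+ j) =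
    \sum_(k < M.+1) \sum_d phi k d * X ^+ k * S d - \sum_(k < M.+1) \sum_(j < M.+1 - k) G k (k + j)%N.
  rewrite -sumrB; apply: eq_bigr => k _.
  rewrite /G exchange_big -sumrB; apply: eq_bigr => d _ /=.
  rewrite mulrBr; congr (_ - _); rewrite mulr_sumr; apply: eq_bigr => j _.
  by rewrite addKn exprD; ring.
have E6 : (u a - u b) * (\sum_(k < M.+1) phi k a * X ^+ k) = \sum_(l < M.+1) (u a - u b) * phi l a * X ^+ l.
  by rewrite mulr_sumr; apply: eq_bigr => k _; rewrite mulrA.
rewrite E4 E5 E6 -addrA [- _ + _]addrC E3.
move: E1; set A := \sum_(i < M.+1) _ * _ * _; set B := \sum_(k < M.+1) \sum_(j < _ - _) _; set D := \sum_(l < M) _.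
move=> E1; set F := \sum_(k < M.+1) \sum_d _; set e := _ * _ * X ^+ _.
have -> : A + F + (D + e) = (A + B + D) + (e + (F - B)) by ring.
by rewrite E1 add0r.
Qed.

Lemma der_sum (I : Type) (s : seq I) (f : I -> C -> C) (df : I -> C) z :
  (forall i, is_derive z (1 : C) (f i) (df i)) ->
  is_derive z (1 : C) (fun z => \sum_(i <- s) f i z) (\sum_(i <- s) df i).
Proof.
move=> h; elim: s => [|i s IH].
  rewrite big_nil; apply: is_derive_near (der_cst 0 z); near=> y; by rewrite big_nil.
rewrite big_cons; apply: is_derive_near (der_add (h i) IH); near=> y; by rewrite big_cons.
Unshelve. all: by end_near.
Qed.

Lemma der_Xinv (k : nat) (z : C) : z != 0 ->
  is_derive z (1 : C) (fun z => z ^- k) (- (k%:R * z^-1 ^+ k.+1)).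
Proof.
move=> z0; apply: der_eq (der_inv (der_expn k (der_id z)) _) _; first by rewrite expf_neq0.
case: k => [|k]; first by rewrite !mul0r oppr0 mul0r.
rewrite /= mulr1 exprVn [z ^+ k.+2]exprS [z ^+ k.+1]exprS; field.
by rewrite z0 expf_neq0.
Qed.

Variable V : normedModType C.

Lemma near_nr_bound (f : V -> C) t : differentiable f t -> \forall y \near t, nr (f y) <= nr (f t) + 1.
Proof.
move=> /differentiable_continuous /cvg_nrP /(_ 1 ltr01) [d d0 h]; apply/nbhs_nrP; exists d => // y /h h1.
have := nrD (f y - f t) (f t); rewrite subrK => h2; apply: (le_trans h2).
by rewrite addrC lerD2l ltW.
Qed.

Lemma near_Re_gt (f : V -> C) t (c : R) : differentiable f t -> c < Re (f t) -> \forall y \near t, c < Re (f y).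
Proof.
move=> /differentiable_continuous /cvg_nrP h cf.
have e0 : 0 < Re (f t) - c by rewrite subr_gt0.
have [d d0 hd] := h _ e0; apply/nbhs_nrP; exists d => // y /hd h1.
have := le_lt_trans (nr_Re _) h1; rewrite ReB ltr_distl => /andP[+ _].
by rewrite opprB addrC subrK.
Qed.

Lemma fin_bound (I : finType) (f : I -> R) : exists B : R, 0 <= B /\ forall i, f i <= B.
Proof.
exists (\sum_i `|f i|); split; first exact: sumr_ge0.
move=> i; rewrite (bigD1 i) //= (le_trans (ler_norm _)) // lerDl; exact: sumr_ge0.
Qed.

Variables (n : nat) (t0 : V) (r0 : R) (u : 'I_n -> V -> C) (al : nat -> 'I_n -> 'I_n -> V -> C)
  (K rho : R) (S : 'I_n -> 'I_n -> C -> V -> C) (kappa : C).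
Let N := nball t0 r0.
Hypotheses (r0_gt0 : 0 < r0) (rho_gt0 : 0 < rho) (hu : forall a, vholo N (u a))
  (hal : forall j a d, vholo N (al j a d))
  (alK : forall j a d t, N t -> nr (al j a d t) <= K * rho ^+ j)
  (al0 : forall a d t, al 0%N a d t = 0)
  (hS : forall a d, hol2 (outer rho) N (S a d))
  (ST : forall a d J z t, outer rho z -> N t ->
    nr (S a d z t - \sum_(j < J) al j a d t * z ^- j) <= 2 * K * (rho / nr z) ^+ J)
  (k1 : nr kappa = 1)
  (dir : forall a b, a != b -> exists2 e, Re (kappa * e) = 1 & 0 < Re ((u a t0 - u b t0) * e)).

(** The column is a formal partial sum p plus a correction s, which solves the equation with the
    residual of p as source. The factor z^(al_1 b b) e^(u_b z) is divided out, which brings in u_a -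
    u_b and - al_1 b b / z. *)
Lemma sectorial_column (b : 'I_n) (m : nat) : exists (r x1 K' : R) (phi : nat -> 'I_n -> V -> C)
    (v : 'I_n -> C -> V -> C),
  [/\ 0 < r <= r0, 2 * rho <= x1,
    (forall a, hol2 (half_plane kappa x1) (nball t0 r) (v a)) /\
    (forall a t, phi 0%N a t = (a == b)%:R),
    forall t, nball t0 r t -> let rec := column_rec (u ^~ t) (fun j a d => al j a d t) b (fun k a => phi k a t) in
     (forall l a, (l <= m)%N -> rec l a) /\ rec m.+1 b &
    forall z t a, half_plane kappa x1 z -> nball t0 r t ->
      is_derive z (1 : C) (v a ^~ t)
        ((u a t - u b t) * v a z t + (\sum_d S a d z t * v d z t) - al 1%N b b t * z^-1 * v a z t) /\
      nr (v a z t - \sum_(k < m.+1) phi k a t * z ^- k) <= K' / nr z ^+ m.+1].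
Proof.
have Nt0 : N t0 by exact: nball_center.
have K0 : 0 <= K by have := alK 0%N b b Nt0; rewrite expr0 mulr1; exact: le_trans (nr_ge0 _).
have [e He] : exists e : 'I_n -> C, forall a, Re (kappa * e a) = 1 /\ (a != b -> 0 < Re ((u a t0 - u b t0) * e a)).
  have /choice [e He] : forall a, exists e, Re (kappa * e) = 1 /\ (a != b -> 0 < Re ((u a t0 - u b t0) * e)).
    move=> a; have [->|/dir[e e1 e2]] := eqVneq a b; last by exists e.
    by exists kappa^-1; split=> //; rewrite divff // -nr_gt0 k1.
  by exists e.
have [c c0 hc] : exists2 c : R, 0 < c & forall a, a != b -> c < Re ((u a t0 - u b t0) * e a).
  have [a|c c0 hc] := @fin_pos R _ (fun a => if a == b then 1 else Re ((u a t0 - u b t0) * e a)).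
    by case: eqVneq => // ab; exact: (He a).2.
  exists (c / 2) => [|a ab]; first by rewrite divr_gt0.
  by have := hc a; rewrite (negPf ab); lra.
have [E [E0 hE]] := fin_bound (fun a => nr (e a)).
have [Q [Q0 hQ]] := fin_bound (fun a => nr (u a t0 - u b t0) + 1).
(* Two more formal terms than asked for: the residual becomes O(z^-(m+3)), and [column_solution] at
   order m + 1 returns a correction O(z^-(m+1)). *)
pose M := m.+2.
have dq a t : N t -> differentiable (fun t => u a t - u b t) t.
  by move=> Nt; apply: diff_subC; exact: hu.
have near_N : \forall t \near t0, N t by apply/nbhs_nrP; exists r0.
(* The rays e a are chosen at t0; on a smaller ball they still give decay with the same c, and the u
   a stay distinct from u b. *)
have near1 : \forall t \near t0, N t /\ forall a, (a != b -> c < Re ((u a t - u b t) * e a)) /\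
     nr (u a t - u b t) <= Q.
  apply: filterI => //; apply: filter_forall => a; apply: filterI; last first.
    by apply: filterS (near_nr_bound (dq a t0 Nt0)) => t /le_trans; apply; exact: hQ.
  have [->|ab] := eqVneq a b; first by apply: filterE.
  apply: filterS (near_Re_gt (diff_mulC (dq a t0 Nt0) (diff_cstC _ _)) (hc a ab)) => t h _; exact: h.
have [r1 r10 hr1] := (nbhs_nrP _ _).1 near1.
pose N1 := nball t0 r1.
have N1N : N1 `<=` N by move=> t /hr1[].
have ub a t : a != b -> N1 t -> u a t != u b t.
  move=> ab /hr1[_ /(_ a) [/(_ ab)]] + _; apply: contraTneq => ->.
  by rewrite subrr mul0r -leNgt ltW.
have [phi [ph1 ph2 ph3]] := @formal_column R V n N1 u al b M
   (fun a => vholo_sub N1N (hu a)) (fun j a d => vholo_sub N1N (hal j a d)) ub.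
have [Phi [Phi0 hPhi]] := fin_bound (fun p : 'I_M.+1 * 'I_n => nr (phi p.1 p.2 t0) + 1).
have near2 : \forall t \near t0, [/\ t \in N1, nr (t - t0) < r0 & forall p : 'I_M.+1 * 'I_n, nr (phi p.1 p.2 t) <= Phi].
  have h1 : \forall t \near t0, t \in N1 by apply/nbhs_nrP; exists r1 => // y h; rewrite inE.
  have h2 : \forall t \near t0, forall p : 'I_M.+1 * 'I_n, nr (phi p.1 p.2 t) <= Phi.
    apply: filter_forall => p.
    by apply: filterS (near_nr_bound (ph1 p.1 p.2 t0 (nball_center _ r10))) => t /le_trans; apply; exact: hPhi.
  by apply: filterS3 h1 near_N h2 => t.
have [r2 r20 hr2] := (nbhs_nrP _ _).1 near2.
pose r := Num.min r2 r0; pose N2 := nball t0 r.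
have r_gt0 : 0 < r by rewrite lt_min r20.
have N2h t : N2 t -> [/\ N1 t, N t & forall k a, (k < M.+1)%N -> nr (phi k a t) <= Phi].
  rewrite /N2 /nball /= lt_min => /andP[/hr2[N1t Nt h] _]; split=> //; first by rewrite inE in N1t.
  by move=> k a kM; exact: (h (Ordinal kM, a)).
have N2N1 : N2 `<=` N1 by move=> t /N2h[].
have N2N : N2 `<=` N by move=> t /N2h[].
pose x0 := Num.max (2 * rho) 1.
have x0r : 2 * rho <= x0 by rewrite le_max lexx.
have x01 : 1 <= x0 by rewrite le_max lexx orbT.
pose H := half_plane kappa.
have Hn z : H x0 z -> x0 < nr z by exact: half_plane_nr.
have Ho z : H x0 z -> outer rho z by move=> /Hn; exact: le_lt_trans.
have zp z : H x0 z -> 0 < nr z by move=> /Hn; apply: lt_trans; exact: lt_le_trans x01.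
have zn z : H x0 z -> z != 0 by move=> /zp; rewrite nr_gt0.
have hX k : cholo (H x0) (fun z => z ^- k) by exact: cholo_Xinv zn.
have hX1 : cholo (H x0) (fun z => z^-1).
  by move=> z /hX-/(_ 1%N)[d hd]; exists d; apply: is_derive_near hd; near=> y; rewrite expr1.
have hol_al j a d : hol2 (H x0) N2 (fun _ t => al j a d t) by apply: hol2_param; exact: vholo_sub N2N (hal _ _ _).
have hol_phi k a : hol2 (H x0) N2 (fun _ t => phi k a t) by apply: hol2_param; exact: vholo_sub N2N1 (ph1 _ _).
have hol_q a : hol2 (H x0) N2 (fun _ t => u a t - u b t) by apply: hol2_param => t /N2N; exact: dq.
have hol_S a d : hol2 (H x0) N2 (S a d) := hol2_sub Ho N2N (hS a d).
have hol_1 : hol2 (H x0) N2 (fun z _ => z^-1) by exact: hol2_var.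
pose p a z t := \sum_(k < M.+1) phi k a t * z ^- k.
have hol_p a : hol2 (H x0) N2 (p a).
  by apply: hol2_sum => k; apply: hol2_mul (hol_phi _ _) _; exact: hol2_var.
(* Subtracting the formal exponent removes the leading term of S b b, so that P b b = O(z^-2), as
   the contraction requires. *)
pose P a d z t := S a d z t + (if a == d then - 1 else 0) * (al 1%N b b t * z^-1).
pose h a z t := (u a t - u b t) * p a z t + \sum_d S a d z t * p d z t
  + - 1 * (al 1%N b b t * z^-1 * p a z t) + \sum_(k < M.+1) k%:R * phi k a t * z^-1 ^+ k.+1.
have hol_P a d : hol2 (H x0) N2 (P a d).
  exact: hol2_add (hol_S a d) (hol2_mul (hol2_cst _ _ _) (hol2_mul (hol_al 1%N b b) hol_1)).
have hol_h a : hol2 (H x0) N2 (h a).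
  apply: hol2_add; last first.
    apply: hol2_sum => k; apply: hol2_mul; first by apply: hol2_mul => //; exact: hol2_cst.
    apply: hol2_var => z /(hX k.+1)[d hd]; exists d; apply: is_derive_near hd; near=> y; by rewrite exprVn.
  apply: hol2_add; last exact: hol2_mul (hol2_cst _ _ _) (hol2_mul (hol2_mul (hol_al 1%N b b) hol_1) (hol_p a)).
  apply: hol2_add; first exact: hol2_mul.
  by apply: hol2_sum => d; exact: hol2_mul.
have bK t : N2 t -> nr (al 1%N b b t) <= K * rho by move=> /N2N Nt; have := alK 1%N b b Nt; rewrite expr1.
have Kr0 : 0 <= K * rho by rewrite mulr_ge0 // ltW.
(* In 3 K rho, two parts come from the first-order tail of S and one from the exponent; 2 K rho^2 is
   the second-order tail for [PbK], and 1 ensures positivity. [Kh] bounds the two parts of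
   [residual_identity]. *)
pose KP := 1 + 3 * (K * rho) + 2 * (K * rho ^+ 2).
pose Kh := (M%:R + K * rho) * Phi + M.+1%:R * (n%:R * (Phi * (2 * K * (1 + rho) ^+ M.+1))).
have Kr2 : 0 <= K * rho ^+ 2 by rewrite mulr_ge0 // exprn_ge0 // ltW.
have rho1 : 1 <= 1 + rho by rewrite lerDl ltW.
have Kh1 : 0 <= Phi * (2 * K * (1 + rho) ^+ M.+1).
  by rewrite mulr_ge0 // mulr_ge0 ?exprn_ge0 ?mulr_ge0 // addr_ge0 // ltW.
have Kh0 : 0 <= Kh := addr_ge0 (mulr_ge0 (addr_ge0 (ler0n _ _) Kr0) Phi0) (mulr_ge0 (ler0n _ _) (mulr_ge0 (ler0n _ _) Kh1)).
pose KK := KP + Kh.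
have KP0 : 0 < KP by rewrite /KP; lra.
have KK0 : 0 < KK by rewrite ltr_pwDl.
have PK a d z t : H x0 z -> N2 t -> nr (P a d z t) <= KK / nr z.
  move=> Hz Nt; have i0 : 0 <= (nr z)^-1 by rewrite invr_ge0 nr_ge0.
  have s1 := ST a d 1 (Ho _ Hz) (N2N _ Nt); rewrite big_ord1 al0 mul0r subr0 expr1 in s1.
  rewrite (le_trans (nrD _ _)) // nrM nrM nrV.
  have e1 : nr (if a == d then - 1 else 0 : C) <= 1 by case: (a == d); rewrite ?nrN ?nr1 ?nr0.
  have s2 : nr (if a == d then - 1 else 0 : C) * (nr (al 1%N b b t) / nr z) <= 1 * (K * rho / nr z).
    by apply: ler_pM; rewrite ?nr_ge0 ?mulr_ge0 ?nr_ge0 // ler_wpM2r // bK.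
  apply: (le_trans (lerD s1 s2)); rewrite mul1r !mulrA -mulrDl ler_wpM2r // /KK /KP.
  by have := Kr0; have := Kr2; have := Kh0; lra.
have PbK z t : H x0 z -> N2 t -> nr (P b b z t) <= KK / nr z ^+ 2.
  move=> Hz Nt; have i0 : 0 <= (nr z ^+ 2)^-1 by rewrite invr_ge0 exprn_ge0 // nr_ge0.
  have s1 := ST b b 2 (Ho _ Hz) (N2N _ Nt).
  rewrite !big_ord_recl big_ord0 al0 mul0r add0r addr0 /= expr1 expr_div_n in s1.
  rewrite /P eqxx mulN1r; apply: (le_trans s1); rewrite !mulrA ler_wpM2r // /KK /KP.
  by have := Kr0; have := Kr2; have := Kh0; lra.
have hK a z t : H x0 z -> N2 t -> nr (h a z t) <= KK / nr z ^+ m.+3.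
  move=> Hz Nt; have [N1t Nt' hph] := N2h t Nt.
  have [rec _] := ph3 t N1t.
  have pE d : p d z t = \sum_(k < M.+1) phi k d t * z^-1 ^+ k by apply: eq_bigr => k _; rewrite exprVn.
  have -> : h a z t = (M%:R - al 1%N b b t) * phi M a t * z^-1 ^+ M.+1
    + \sum_(k < M.+1) \sum_d phi k d t * z^-1 ^+ k * (S a d z t - \sum_(j < M.+1 - k) al j a d t * z^-1 ^+ j).
    rewrite -(@residual_identity n (u ^~ t) (fun j a d => al j a d t) b a (fun k a => phi k a t) M z^-1 (fun d => S a d z t)) //; last first.
      by move=> l lM; exact: rec.
    rewrite /h mulN1r pE; congr (_ + _ - _ + _); by apply: eq_bigr => d _; rewrite pE.
  have ip : 0 < (nr z)^-1 by rewrite invr_gt0 zp.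
  have j0 : 0 <= (nr z)^-1 ^+ M.+1 by rewrite exprn_ge0 // ltW.
  have Mm : (nr (M%:R : C)) = M%:R.
    have -> : (M%:R : C) = (M%:R)%:C by rewrite rmorph_nat.
    by rewrite nr_real.
  rewrite (le_trans (nrD _ _)) //.
  have b1 : nr ((M%:R - al 1%N b b t) * phi M a t * z^-1 ^+ M.+1) <= (M%:R + K * rho) * Phi * (nr z)^-1 ^+ M.+1.
    rewrite 2!nrM nrX nrV; apply: ler_wpM2r => //; apply: ler_pM; rewrite ?nr_ge0 ?hph //.
    by rewrite (le_trans (nrB _ _)) // Mm lerD2l bK.
  have b2 : nr (\sum_(k < M.+1) \sum_d phi k d t * z^-1 ^+ k * (S a d z t - \sum_(j < M.+1 - k) al j a d t * z^-1 ^+ j)) <=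
     M.+1%:R * (n%:R * (Phi * (2 * K * (1 + rho) ^+ M.+1) * (nr z)^-1 ^+ M.+1)).
    rewrite (le_trans (nr_sum _ _ _)) //; apply: ler_sum_ord => k.
    rewrite (le_trans (nr_sum _ _ _)) //; apply: ler_sum_ord => d.
    rewrite 2!nrM nrX nrV -[leRHS]mulrA -[leLHS]mulrA; apply: ler_pM; rewrite ?nr_ge0 ?mulr_ge0 ?exprn_ge0 ?hph ?(ltW ip) ?nr_ge0 //.
    have -> : \sum_(j < M.+1 - k) al j a d t * z^-1 ^+ j = \sum_(j < M.+1 - k) al j a d t * z ^- j.
      by apply: eq_bigr => j _; rewrite exprVn.
    have s1 := ST a d (M.+1 - k) (Ho _ Hz) Nt'.
    have k0 : 0 <= (nr z)^-1 ^+ k by rewrite exprn_ge0 // ltW.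
    apply: (le_trans (ler_wpM2l k0 s1)).
    have kM : (k <= M.+1)%N by exact: ltnW.
    have -> : (nr z)^-1 ^+ M.+1 = (nr z)^-1 ^+ k * (nr z)^-1 ^+ (M.+1 - k) by rewrite -exprD subnKC.
    have g1 : rho ^+ (M.+1 - k) <= (1 + rho) ^+ M.+1.
      apply: (@le_trans _ _ ((1 + rho) ^+ (M.+1 - k))).
        by rewrite lerXn2r ?nnegrE ?(ltW rho_gt0) ?addr_ge0 ?(ltW rho_gt0) // lerDr.
      by rewrite ler_weXn2l // leq_subr.
    have i0 : 0 <= (nr z)^-1 ^+ (M.+1 - k) by rewrite exprn_ge0 // ltW.
    rewrite exprMn; move: g1 i0 k0.
    move: (rho ^+ _) ((1 + rho) ^+ _) ((nr z)^-1 ^+ (M.+1 - k)) ((nr z)^-1 ^+ k) => A B D F AB D0 F0.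
    have -> : F * (2 * K * (A * D)) = 2 * K * (D * F) * A by ring.
    have -> : 2 * K * B * (F * D) = 2 * K * (D * F) * B by ring.
    apply: ler_wpM2l AB; exact: (mulr_ge0 (mulr_ge0 (ler0n _ 2) K0) (mulr_ge0 D0 F0)).
  apply: (le_trans (lerD b1 b2)); rewrite -exprVn.
  have -> : (M%:R + K * rho) * Phi * (nr z)^-1 ^+ M.+1 +
    M.+1%:R * (n%:R * (Phi * (2 * K * (1 + rho) ^+ M.+1) * (nr z)^-1 ^+ M.+1)) = Kh * (nr z)^-1 ^+ M.+1.
    by rewrite /Kh; move: ((nr z)^-1 ^+ M.+1) ((1 + rho) ^+ M.+1) => A B; ring.
  by apply: ler_wpM2r j0 _ _ _; rewrite /KK lerDr ltW.
have ke a := (He a).1.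
have qe a t : a != b -> N2 t -> c <= Re ((u a t - u b t) * e a).
  by move=> ab /N2N1 /hr1[_ /(_ a) [/(_ ab)]] + _; exact: ltW.
have qQ a t : N2 t -> nr (u a t - u b t) <= Q by move=> /N2N1 /hr1[_ /(_ a) []].
have hq a : vholo N2 (fun t => u a t - u b t) by move=> t /N2N; exact: dq.
have [x1 [K' [s [s1 s2 s3 s4]]]] := @column_solution R V n b kappa x0 N2 (fun a t => u a t - u b t) e Q c KK E m.+1
  P h (@nball_open _ _ _ _) k1 (lt_le_trans ltr01 x01) c0 KK0 hq qQ (fun t _ => subrr _) ke hE qe hol_P PK PbK hol_h hK.
have H10 : H x1 `<=` H x0 by exact: half_plane_sub.
pose v a z t := p a z t + s a z t.
exists r, x1, (2 * Phi + `|K'|), phi, v; split.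
- by rewrite r_gt0 ge_min lexx orbT.
- exact: le_trans s1.
- split=> [a|a t]; last exact: ph2.
  apply: hol2_add; last exact: s2.
  exact: hol2_sub H10 (fun _ p => p) (hol_p a).
- move=> t /N2N1 N1t; have [rec rec'] := ph3 t N1t; split.
    by move=> l a lm; apply: rec; apply: leq_trans lm _; rewrite /M -addn2 leq_addr.
  by apply: rec; rewrite /M.
move=> z t a Hz1 Nt; have Hz := H10 _ Hz1; split.
- have dp : is_derive z (1 : C) (p a ^~ t) (\sum_(k < M.+1) phi k a t * - (k%:R * z^-1 ^+ k.+1)).
    by apply: der_sum => k; apply: der_scale; apply: der_Xinv; exact: zn.
  apply: der_eq (der_add dp (s3 a z t Hz1 Nt)) _.
  have -> : \sum_(k < M.+1) phi k a t * - (k%:R * z^-1 ^+ k.+1) = - \sum_(k < M.+1) k%:R * phi k a t * z^-1 ^+ k.+1.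
    by rewrite -sumrN; apply: eq_bigr => k _; ring.
  have -> : \sum_d S a d z t * v d z t = \sum_d S a d z t * p d z t + \sum_d S a d z t * s d z t.
    by rewrite -big_split; apply: eq_bigr => d _; rewrite /v mulrDr.
  have -> : \sum_d P a d z t * s d z t = \sum_d S a d z t * s d z t - al 1%N b b t * z^-1 * s a z t.
    rewrite /P; under eq_bigr do rewrite mulrDl.
    rewrite big_split /=; congr (_ + _); rewrite (bigD1 a) //= eqxx big1; first by rewrite addr0; ring.
    by move=> d /negPf da; rewrite eq_sym da !mul0r.
  rewrite /h /v; ring.
have iz := zp _ Hz.
have [_ _ hph] := N2h t Nt.
have -> : v a z t - \sum_(k < m.+1) phi k a t * z ^- k = phi m.+1 a t * z ^- m.+1 + phi m.+2 a t * z ^- m.+2 + s a z t.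
  by rewrite /v /p /M 2!big_ord_recr /=; ring.
have zz j : 0 <= (nr z ^+ j)^-1 by rewrite invr_ge0 exprn_ge0 // ltW.
have b1 : nr (phi m.+1 a t * z ^- m.+1) <= Phi / nr z ^+ m.+1.
  by rewrite nrM nrV nrX ler_wpM2r // hph.
have b2 : nr (phi m.+2 a t * z ^- m.+2) <= Phi / nr z ^+ m.+1.
  rewrite nrM nrV nrX; apply: ler_pM; rewrite ?nr_ge0 ?zz ?hph //.
  rewrite exprS invfM ler_piMl // invf_le1 // (le_trans x01) // ltW // Hn //.
have b3 := s4 a z t Hz1 Nt.
have b4 : K' / nr z ^+ m.+1 <= `|K'| / nr z ^+ m.+1 by rewrite ler_wpM2r // ler_norm.
rewrite (le_trans (nrD _ _)) // mulrDl lerD ?(le_trans b3) // (le_trans (nrD _ _)) //.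
by rewrite [2 * Phi](_ : _ = Phi + Phi) ?mulrDl ?lerD //; ring.
Unshelve. all: by end_near.
Qed.

End SectorialColumn.

(** * Uniqueness for linear systems and connection matrices *)

Section LinearSystems.
Variable R : realType.
Local Notation C := R[i].
Local Notation Re := complex.Re.
Local Notation Im := complex.Im.

Lemma nr_mx_lt m n (M : 'M[C]_(m, n)) (e : R) : 0 < e -> nr M < e <-> forall i j, nr (M i j) < e.
Proof.
move=> e0; have E : (nr M < e) <-> ball (0 : 'M[C]_(m, n)) e%:C M.
  by rewrite -ball_normE /ball_ /= sub0r normrN nr_lt.
split=> [/E[_ h] i j|h].
  by have := h i j; rewrite -ball_normE /ball_ /= mxE sub0r normrN nr_lt.
apply/E; split; first by rewrite ltcR.
by move=> i j; rewrite -ball_normE /ball_ /= mxE sub0r normrN nr_lt.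
Qed.

Lemma nr_mx_le m n (M : 'M[C]_(m, n)) (e : R) : 0 <= e -> (forall i j, nr (M i j) <= e) -> nr M <= e.
Proof.
move=> e0 h; apply/ler_addgt0Pr => d d0; apply/ltW/nr_mx_lt; first exact: ltr_wpDl.
by move=> i j; apply: (le_lt_trans (h i j)); rewrite ltrDl.
Qed.

Lemma nr_entry m n (M : 'M[C]_(m, n)) i j : nr (M i j) <= nr M.
Proof.
apply/ler_addgt0Pr => d d0; apply: ltW.
have h : nr M < nr M + d by rewrite ltrDl.
have p : 0 < nr M + d by rewrite ltr_wpDl // nr_ge0.
exact: (nr_mx_lt M p).1 h i j.
Qed.

Lemma nr_mulmx n (M N : 'M[C]_n) : nr (M *m N) <= n%:R * (nr M * nr N).
Proof.
apply: nr_mx_le => [|i j]; first by rewrite mulr_ge0 // mulr_ge0 // nr_ge0.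
rewrite mxE (le_trans (nr_sum _ _ _)) //; apply: ler_sum_ord => k.
by rewrite nrM ler_pM ?nr_ge0 // nr_entry.
Qed.

Lemma is_derive_entry m n (Y : C -> 'M[C]_(m, n)) (w : C) D i j : is_derive w (1 : C) Y D ->
  is_derive w (1 : C) (fun w => Y w i j) (D i j).
Proof.
move=> /is_derive1_nrP h; apply/is_derive1_nrP => e /h[r r0 hr]; exists r => // y /hr h1.
apply: le_trans h1; apply: le_trans (nr_entry _ i j).
by rewrite !mxE.
Qed.

Lemma seg_bounded (f : C -> C) (D : set C) (w1 w2 : C) : (forall s, 0 <= s <= 1 -> D (seg w1 w2 s)) ->
  (forall w, D w -> exists (B e : R), 0 < e /\ forall y, D y -> nr (y - w) < e -> nr (f y) <= B) ->
  exists B, forall s, 0 <= s <= 1 -> nr (f (seg w1 w2 s)) <= B.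
Proof.
move=> hD hf; pose Q (x y : R) := exists B, forall s, x <= s <= y -> nr (f (seg w1 w2 s)) <= B.
apply: (@itv_ind R Q 0 1) => // [x y z x0 xy yz z1 [B1 h1] [B2 h2]|x hx].
  exists (Num.max B1 B2) => s /andP[xs sz]; rewrite le_max.
  have [sy|/ltW ys] := leP s y; apply/orP; first by left; apply: h1; rewrite xs sy.
  by right; apply: h2; rewrite ys sz.
have [B [e [e0 hB]]] := hf _ (hD x hx).
have L0 : 0 < nr (w2 - w1) + 1 by rewrite ltr_wpDl // nr_ge0.
exists (e / (nr (w2 - w1) + 1)); first by rewrite divr_gt0.
move=> y z y0 yz z1 xy zx; exists B => s /andP[ys sz].
apply: hB; first by apply: hD; rewrite (le_trans y0 ys) (le_trans sz z1).
rewrite nr_segB.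
have sx : `|s - x| < e / (nr (w2 - w1) + 1).
  by rewrite ltr_distl (lt_le_trans xy ys) (le_lt_trans sz zx).
move: sx; rewrite ltr_pdivlMr // => sx; apply: le_lt_trans sx.
by rewrite ler_wpM2l // lerDl.
Qed.

Lemma seg_seg (a b : C) (x y s : R) : seg (seg a b x) (seg a b y) s = seg a b (x + s * (y - x)).
Proof. by rewrite /seg !rmorphD !rmorphM rmorphB /=; ring. Qed.

Section Uniqueness.
Variables (n : nat) (a : 'I_n -> 'I_n -> C -> C) (y : 'I_n -> C -> C) (D : set C).
Hypothesis ode : forall w i, D w -> is_derive w (1 : C) (y i) (\sum_d a i d w * y d w).

(** On so short a segment the mean value inequality halves any bound on y; iteration leaves only
    0. *)
Lemma lin_uniq_short (w1 w2 : C) (K : R) : 0 <= K -> (forall s, 0 <= s <= 1 -> D (seg w1 w2 s)) ->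
  (forall i d s, 0 <= s <= 1 -> nr (a i d (seg w1 w2 s)) <= K) ->
  n%:R * K * nr (w2 - w1) <= 2^-1 -> (forall i, y i w1 = 0) -> forall i, y i w2 = 0.
Proof.
move=> K0 hD aK small y0.
have [B [B0 hB]] : exists B, 0 <= B /\ forall i s, 0 <= s <= 1 -> nr (y i (seg w1 w2 s)) <= B.
  have /choice [B hB] : forall i, exists B, forall s, 0 <= s <= 1 -> nr (y i (seg w1 w2 s)) <= B.
    move=> i; apply: (@seg_bounded (y i) D) => // w /(ode i) /is_derive1_continuous /cvg_nrP /(_ 1 ltr01)[e e0 h].
    exists (nr (y i w) + 1), e; split=> // z _ /h h1.
    have := nrD (y i z - y i w) (y i w); rewrite subrK => h2; apply: (le_trans h2).
    by rewrite addrC lerD2l ltW.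
  have [B' [B'0 hB']] := fin_bound B; exists B'; split=> // i s hs.
  exact: le_trans (hB i s hs) (hB' i).
have step k : forall i s, 0 <= s <= 1 -> nr (y i (seg w1 w2 s)) <= B * 2 ^- k.
  elim: k => [|k IH] i s hs; first by rewrite expr0 invr1 mulr1 hB.
  have h1 r : 0 <= r <= 1 -> w1 + r%:C * (seg w1 w2 s - w1) = seg w1 w2 (s * r).
    by move=> hr; rewrite /seg rmorphM /=; ring.
  have sr r : 0 <= r <= 1 -> 0 <= s * r <= 1.
    by move: hs => /andP[s0 s1] /andP[r0 r1]; rewrite mulr_ge0 //= mulr_ile1.
  have := @mean_value_segment R (y i) (fun w => \sum_d a i d w * y d w) w1 (seg w1 w2 s) (n%:R * (K * (B * 2 ^- k))).
  rewrite y0 subr0 => h2.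
  apply: (le_trans (h2 _ _)) => [r hr|r hr|].
  - by rewrite h1 //; apply: ode; apply: hD; exact: sr.
  - rewrite h1 // (le_trans (nr_sum _ _ _)) //; apply: ler_sum_ord => d.
    by rewrite nrM; apply: ler_pM; rewrite ?nr_ge0 ?aK ?IH // sr.
  have -> : seg w1 w2 s - w1 = s%:C * (w2 - w1) by rewrite /seg; ring.
  move: (hs) => /andP[s0 s1]; rewrite nrM (nr_real s0).
  have p : 0 <= B * 2 ^- k by rewrite mulr_ge0 // invr_ge0 exprn_ge0.
  have -> : B * 2 ^- k.+1 = 2^-1 * (B * 2 ^- k) by rewrite exprS invfM mulrCA.
  have -> : n%:R * (K * (B * 2 ^- k)) * (s * nr (w2 - w1)) = s * (n%:R * K * nr (w2 - w1)) * (B * 2 ^- k) by ring.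
  apply: ler_wpM2r p _ _ _; apply: le_trans small.
  by rewrite ler_piMl // mulr_ge0 ?nr_ge0 // mulr_ge0.
move=> i; apply/eqP; rewrite -nr_eq0; apply/eqP/le_anti; rewrite nr_ge0 andbT.
apply/ler_addgt0Pr => e e0; rewrite add0r.
have B1 : 0 < B + 1 by rewrite ltr_wpDl.
have [k hk] := exists_2expn (divr_gt0 e0 B1).
have := step k i 1; rewrite ler01 lexx /= => /(_ isT).
have -> : seg w1 w2 1 = w2 by rewrite /seg; ring.
move=> /le_trans; apply; move: hk; rewrite ltr_pdivlMr // => hk.
have : 0 <= 2 ^- k :> R by rewrite invr_ge0 exprn_ge0.
by move: hk; move: (2 ^- k : R) => h; nra.
Qed.

Lemma lin_uniq (w1 w2 : C) : (forall s, 0 <= s <= 1 -> D (seg w1 w2 s)) ->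
  (forall i d w, D w -> exists (B e : R), 0 < e /\ forall z, D z -> nr (z - w) < e -> nr (a i d z) <= B) ->
  (forall i, y i w1 = 0) -> forall i, y i w2 = 0.
Proof.
move=> hD ha y0.
have [K [K0 hK]] : exists K, 0 <= K /\ forall i d s, 0 <= s <= 1 -> nr (a i d (seg w1 w2 s)) <= K.
  have /choice [B hB] : forall p : 'I_n * 'I_n, exists B, forall s, 0 <= s <= 1 -> nr (a p.1 p.2 (seg w1 w2 s)) <= B.
    by move=> p; apply: (@seg_bounded _ D) => //; exact: ha.
  have [K [K0 hK]] := fin_bound B; exists K; split=> // i d s hs.
  exact: le_trans (hB (i, d) s hs) (hK _).
pose L := n%:R * K * nr (w2 - w1).
have L0 : 0 <= L by rewrite mulr_ge0 ?nr_ge0 // mulr_ge0.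
pose Q (x z : R) := (forall i, y i (seg w1 w2 x) = 0) -> forall i, y i (seg w1 w2 z) = 0.
have E0 : seg w1 w2 0 = w1 by rewrite /seg; ring.
have E1 : seg w1 w2 1 = w2 by rewrite /seg; ring.
have : Q 0 1; last by rewrite /Q E0 E1; apply.
apply: itv_ind => // [x z z' _ _ _ _ q1 q2 /q1/q2//|x hx].
have L1 : 0 < 4 * (L + 1) by rewrite mulr_gt0 // ltr_wpDl.
exists (4 * (L + 1))^-1; first by rewrite invr_gt0.
move=> z z' z0 zz z1 xz zx hz.
have sub s : 0 <= s <= 1 -> 0 <= z + s * (z' - z) <= 1.
  move=> /andP[s0 s1]; have zz0 : 0 <= z' - z by rewrite subr_ge0.
  apply/andP; split; first by rewrite addr_ge0 // mulr_ge0.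
  by apply: le_trans z1; rewrite -lerBrDl ler_piMl.
apply: (@lin_uniq_short (seg w1 w2 z) (seg w1 w2 z') K) => // [s hs|i d s hs|].
- by rewrite seg_seg; apply: hD; exact: sub.
- by rewrite seg_seg; apply: hK; exact: sub.
rewrite nr_segB ger0_norm ?subr_ge0 //.
have -> : n%:R * K * ((z' - z) * nr (w2 - w1)) = (z' - z) * L by rewrite /L; ring.
have d1 : z' - z <= 2 * (4 * (L + 1))^-1 by move: xz zx; move: (4 * (L + 1))^-1 => h; lra.
apply: (le_trans (ler_wpM2r L0 d1)); rewrite mulrAC ler_pdivrMr //.
by move: L0; clear; move: L => L h; lra.
Qed.

End Uniqueness.

Definition ode n (a : C -> 'M[C]_n) (Y : C -> 'M[C]_n) (w : C) :=
  forall i j, is_derive w (1 : C) (fun w => Y w i j) ((a w *m Y w) i j).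

Definition loc_bounded n (D : set C) (a : C -> 'M[C]_n) :=
  forall w, D w -> exists (B e : R), 0 < e /\ forall z, D z -> nr (z - w) < e -> nr (a z) <= B.

(** The columns of Z - Y c solve the same system and vanish at w1. *)
Lemma connection n (a Y Z : C -> 'M[C]_n) (D : set C) (w1 w2 : C) (c : 'M[C]_n) :
  loc_bounded D a -> (forall w, D w -> ode a Y w) -> (forall w, D w -> ode a Z w) ->
  (forall s, 0 <= s <= 1 -> D (seg w1 w2 s)) -> Z w1 = Y w1 *m c -> Z w2 = Y w2 *m c.
Proof.
move=> ab hY hZ hD E; apply/matrixP => i j; apply/eqP; rewrite -subr_eq0; apply/eqP.
apply: (@lin_uniq n (fun i d w => a w i d) (fun i w => Z w i j - (Y w *m c) i j) D _ w1 w2 hD).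
- move=> w k Dw; apply: der_eq (der_sub (hZ w Dw k j) _) _.
  + apply: is_derive_near (der_sum _ (fun d => der_scale (c d j) (hY w Dw k d))); near=> v.
    by rewrite mxE; apply: eq_bigr => d _; rewrite mulrC.
  + have -> : \sum_d c d j * (a w *m Y w) k d = (a w *m (Y w *m c)) k j.
      by rewrite mulmxA [RHS]mxE; apply: eq_bigr => d _; rewrite mulrC.
    by rewrite !mxE -sumrB; apply: eq_bigr => d _; rewrite mulrBr.
- move=> k d w Dw; have [B [e [e0 h]]] := ab w Dw; exists B, e; split=> // z Dz wz.
  exact: le_trans (nr_entry _ _ _) (h z Dz wz).
- by move=> k; rewrite E subrr.
Unshelve. all: by end_near.
Qed.

End LinearSystems.

(** * Limits of normalized solutions along rays *)

Section RayLimits.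
Variable R : realType.
Local Notation C := R[i].
Local Notation Re := complex.Re.
Local Notation Im := complex.Im.

Lemma expR_dominates (c K : R) : 0 < c -> 0 <= K -> exists2 x0 : R, 0 <= x0 & forall x, x0 <= x ->
  K * (x + 1) <= c * expR x.
Proof.
move=> c0 K0; exists (4 * K / c + K / c) => [|x hx].
  by rewrite addr_ge0 // divr_ge0 ?(ltW c0) // mulr_ge0.
have k1 : 0 <= K / c by rewrite divr_ge0 // ltW.
have x0 : 0 <= x by apply: le_trans hx; rewrite addr_ge0 // -mulrA mulr_ge0.
have h1 : 4 * K <= c * x.
  by rewrite [leRHS]mulrC -ler_pdivrMr //; apply: le_trans hx; rewrite lerDl.
have h2 : K <= c * x.
  by rewrite [leRHS]mulrC -ler_pdivrMr //; apply: le_trans hx; rewrite lerDr -mulrA mulr_ge0.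
have h3 : (1 + x / 2) ^+ 2 <= expR x.
  have -> : expR x = expR (x / 2) ^+ 2 by rewrite expr2 -expRD; congr expR; field.
  by rewrite lerXn2r ?nnegrE ?expR_ge0 ?addr_ge0 ?divr_ge0 ?expR_ge1Dx.
apply: (@le_trans _ _ (c * (1 + x / 2) ^+ 2)); last by rewrite ler_wpM2l // ltW.
move: h1 h2 c0 x0; clear; move=> h1 h2 c0 x0.
have : 4 * K * x <= c * x * x by rewrite ler_wpM2r.
nra.
Qed.

(** In the coordinate w = log z a ray to infinity is a horizontal half-line, and theta also records
    the sheet. *)
Definition ray (theta x : R) : C := x +i* theta.

(** Of an asymptotic expansion only the leading term along single rays is retained; this suffices
    for uniqueness and for comparing consecutive solutions. *)
Definition tends1 n (N : C -> 'M[C]_n) (theta : R) :=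
  forall e : R, 0 < e -> exists x0, forall x, x0 <= x -> nr (N (ray theta x) - 1%:M) <= e.

Lemma cexp_ray theta x : cexp (ray theta x) = (expR x)%:C * cis theta.
Proof. by []. Qed.

(** Along the ray q z is exponential in x and d w only affine, so the sign of Re (q cis theta)
    decides. *)
Lemma ray_growth (q d : C) (theta : R) : Re (q * cis theta) != 0 -> exists x0, forall x, x0 <= x ->
  let E := Re (q * cexp (ray theta x) + d * ray theta x) in
  if 0 < Re (q * cis theta) then x <= E else E <= - x.
Proof.
move=> q0; pose c := `|Re (q * cis theta)|; pose K := 1 + nr d * (1 + `|theta|).
have c0 : 0 < c by rewrite normr_gt0.
have K0 : 0 <= K by rewrite addr_ge0 // mulr_ge0 ?nr_ge0 // addr_ge0.
have [x0 x00 hx0] := expR_dominates c0 K0; exists x0 => x /[dup] xx /hx0 h.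
have xp : 0 <= x := le_trans x00 xx.
have dr : `|Re (d * ray theta x)| <= nr d * (1 + `|theta|) * (x + 1).
  apply: (le_trans (nr_Re _)); rewrite nrM -mulrA ler_wpM2l ?nr_ge0 //.
  apply: (le_trans (nr_ReIm _)); rewrite /= (ger0_norm xp).
  by have := normr_ge0 theta; nra.
have [d1 d2] : Re (d * ray theta x) <= nr d * (1 + `|theta|) * (x + 1) /\
    - Re (d * ray theta x) <= nr d * (1 + `|theta|) * (x + 1).
  by move: dr; rewrite ler_norml => /andP[]; lra.
have -> /= : Re (q * cexp (ray theta x) + d * ray theta x) = expR x * Re (q * cis theta) + Re (d * ray theta x).
  by rewrite ReD cexp_ray mulrCA Re_mulC.
move: h; rewrite /K mulrDl mul1r; move: d1 d2.
move: (Re (d * ray theta x)) (nr d * (1 + `|theta|) * (x + 1)) => r s d1 d2; rewrite /c.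
case: ifPn => [p|]; first by rewrite gtr0_norm //; lra.
by rewrite -leNgt le_eqVlt (negPf q0) /= => p; rewrite ltr0_norm //; lra.
Qed.

Section Conjugation.
Variables (n : nat) (u be : 'I_n -> C).

(* X e^(-u z) z^(-be), where z = cexp w. *)
Definition nrm (X : C -> 'M[C]_n) (w : C) : 'M[C]_n :=
  \matrix_(a, b) (X w a b * cexp (- (u b * cexp w + be b * w))).

(** The conjugate of c by z^be e^(u z): the factor by which the normalizations of X and X c
    differ. *)
Definition conjm (c : 'M[C]_n) (w : C) : 'M[C]_n :=
  \matrix_(a, b) (c a b * cexp ((u a - u b) * cexp w + (be a - be b) * w)).

Lemma nrm_mul (X Z : C -> 'M[C]_n) c w : Z w = X w *m c -> nrm Z w = nrm X w *m conjm c w.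
Proof.
move=> E; apply/matrixP => a b; rewrite !mxE E mxE mulr_suml; apply: eq_bigr => d _.
rewrite !mxE.
have -> : cexp (- (u b * cexp w + be b * w)) = cexp (- (u d * cexp w + be d * w)) *
    cexp ((u d - u b) * cexp w + (be d - be b) * w) by rewrite -cexpD; congr cexp; ring.
by ring.
Qed.

Lemma conjm_tends1 (c : 'M[C]_n) theta : (forall a, c a a = 1) ->
  (forall a b, a != b -> c a b != 0 -> Re ((u a - u b) * cis theta) < 0) ->
  tends1 (conjm c) theta.
Proof.
move=> c1 h e e0.
have /choice [x0 hx0] : forall p : 'I_n * 'I_n, exists x0 : R, forall x, x0 <= x ->
    nr (conjm c (ray theta x) p.1 p.2 - (p.1 == p.2)%:R) <= e.
  move=> [a b] /=; have [<-|ab] := eqVneq a b.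
    by exists 0 => x _; rewrite mxE c1 !subrr !mul0r addr0 cexp0 mulr1 subrr nr0 ltW.
  have [cab|cab] := eqVneq (c a b) 0.
    by exists 0 => x _; rewrite mxE cab mul0r subr0 nr0 ltW.
  have hq := h a b ab cab; have hq0 : Re ((u a - u b) * cis theta) != 0 by rewrite lt_eqF.
  have [x1 hx1] := ray_growth (be a - be b) hq0.
  have K0 : 0 <= nr (c a b) / e by rewrite divr_ge0 ?nr_ge0 // ltW.
  have [x2 x20 hx2] := expR_dominates ltr01 K0.
  exists (Num.max x1 x2) => x; rewrite ge_max => /andP[/hx1 + xx2]; rewrite ltNge (ltW hq) /=.
  move=> hE; rewrite mxE subr0 nrM nr_cexp.
  have hE2 := hE; rewrite -ler_expR in hE2.
  apply: (le_trans (ler_wpM2l (nr_ge0 _) hE2)).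
  rewrite expRN ler_pdivrMr ?expR_gt0 //.
  have := hx2 x xx2; rewrite mul1r => h3.
  have h4 : nr (c a b) / e <= expR x.
    by apply: le_trans h3; rewrite ler_peMr // lerDr (le_trans x20).
  by move: h4; rewrite ler_pdivrMr // mulrC.
have [B [_ hB]] := fin_bound x0; exists B => x xB.
apply: nr_mx_le; first exact: ltW.
by move=> a b; rewrite !mxE; have := hx0 (a, b) x (le_trans (hB _) xB); rewrite mxE.
Qed.

(** The diagonal of [conjm c] is constant, and an entry multiplied by a growing exponential can tend
    to 0 only if it is 0. *)
Lemma tends1_conjm (c : 'M[C]_n) theta : tends1 (conjm c) theta ->
  (forall a, c a a = 1) /\ forall a b, a != b -> 0 < Re ((u a - u b) * cis theta) -> c a b = 0.
Proof.
move=> h; split=> [a|a b ab hq].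
  apply/eqP; rewrite -subr_eq0 -nr_eq0; apply/eqP/le_anti; rewrite nr_ge0 andbT.
  apply/ler_addgt0Pr => e e0; rewrite add0r; have [x0 hx0] := h e e0.
  apply: le_trans (hx0 x0 (lexx _)); apply: le_trans (nr_entry _ a a).
  by rewrite !mxE !subrr !mul0r addr0 cexp0 mulr1 eqxx.
apply/eqP; rewrite -nr_eq0; apply/eqP/le_anti; rewrite nr_ge0 andbT.
apply/ler_addgt0Pr => e e0; rewrite add0r; have [x0 hx0] := h e e0.
have hq0 : Re ((u a - u b) * cis theta) != 0 by rewrite gt_eqF.
have [x1 hx1] := ray_growth (be a - be b) hq0.
pose x := Num.max 0 (Num.max x0 x1).
have xx0 : x0 <= x by rewrite !le_max lexx orbT.
have xx1 : x1 <= x by rewrite !le_max lexx !orbT.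
have x00 : 0 <= x by rewrite le_max lexx.
have := hx1 x xx1; rewrite hq /= => hE.
apply: le_trans (hx0 x xx0); apply: le_trans (nr_entry _ a b).
rewrite !mxE (negPf ab) subr0 nrM nr_cexp ler_peMr ?nr_ge0 //.
by rewrite -expR0 ler_expR (le_trans x00).
Qed.

(** P - 1 = (N' - 1) - (N - 1) - (N - 1) (P - 1), and n |N - 1| <= 1/2 absorbs the last term. With
    |N - 1| and |N' - 1| at most d this gives |P - 1| <= 4 d, without inverting N. *)
Lemma tends1_conj (N N' : C -> 'M[C]_n) P theta : (exists x0, forall x, x0 <= x -> N' (ray theta x) = N (ray theta x) *m P (ray theta x)) ->
  tends1 N theta -> tends1 N' theta -> tends1 P theta.
Proof.
move=> [x2 E] h h' e e0.
pose d := Num.min (e / 4) (2 * (n%:R + 1))^-1.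
have n1 : 0 < 2 * (n%:R + 1) :> R by rewrite mulr_gt0 // ltr_wpDl.
have d0 : 0 < d by rewrite lt_min invr_gt0 n1 divr_gt0.
have [x0 hx0] := h d d0; have [x1 hx1] := h' d d0.
exists (Num.max x2 (Num.max x0 x1)) => x; rewrite !ge_max => /andP[xx2 /andP[/hx0 g0 /hx1 g1]].
have := E x xx2; set X := P _; set A := N _; set B := N' _ => EB.
have id : X - 1%:M = (B - 1%:M) - (A - 1%:M) - (A - 1%:M) *m (X - 1%:M).
  by rewrite mulmxBr mulmxBl mulmx1 mul1mx EB; move: (A *m X) => Y; rewrite !opprB !addrA; apply/matrixP => i j; rewrite !mxE; ring.
have hd1 : d <= e / 4 by rewrite ge_min lexx.
have hd2 : n%:R * d <= 2^-1.
  have : d <= (2 * (n%:R + 1))^-1 by rewrite ge_min lexx orbT.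
  move=> /(ler_wpM2l (ler0n R n)) /le_trans; apply.
  rewrite ler_pdivrMr // mulrA mulVf // mul1r lerDl //.
have := nr_mulmx (A - 1%:M) (X - 1%:M); have := nr_ge0 (X - 1%:M).
have t1 := nrB (B - 1%:M - (A - 1%:M)) ((A - 1%:M) *m (X - 1%:M)); rewrite -id in t1.
have t2 := nrB (B - 1%:M) (A - 1%:M).
have t3 := nr_ge0 (A - 1%:M); have n0 : 0 <= n%:R :> R by [].
move: t1 t2 t3 g0 g1 hd1 hd2 n0.
move: (nr (X - 1%:M)) (nr (A - 1%:M)) (nr (B - 1%:M)) (nr (B - 1%:M - (A - 1%:M))) (nr ((A - 1%:M) *m (X - 1%:M))) => p q r s t t1 t2 t3 g0 g1 hd1 hd2 n0 p0 h4.
have : n%:R * (q * p) <= 2^-1 * p.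
  by rewrite mulrA ler_wpM2r //; apply: le_trans hd2; rewrite ler_wpM2l.
lra.
Qed.

Lemma tends1_mul (N N' : C -> 'M[C]_n) P theta : (exists x0, forall x, x0 <= x -> N' (ray theta x) = N (ray theta x) *m P (ray theta x)) ->
  tends1 N theta -> tends1 P theta -> tends1 N' theta.
Proof.
move=> [x2 E] h h' e e0.
pose d := Num.min (e / 4) (2 * (n%:R + 1))^-1.
have n1 : 0 < 2 * (n%:R + 1) :> R by rewrite mulr_gt0 // ltr_wpDl.
have d0 : 0 < d by rewrite lt_min invr_gt0 n1 divr_gt0.
have [x0 hx0] := h d d0; have [x1 hx1] := h' d d0.
exists (Num.max x2 (Num.max x0 x1)) => x; rewrite !ge_max => /andP[xx2 /andP[/hx0 g0 /hx1 g1]].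
have := E x xx2; set X := P _; set A := N _; set B := N' _ => EB.
have id : B - 1%:M = (A - 1%:M) + (X - 1%:M) + (A - 1%:M) *m (X - 1%:M).
  by rewrite mulmxBr mulmxBl mulmx1 mul1mx EB; move: (A *m X) => Y; apply/matrixP => i j; rewrite !mxE; ring.
have hd1 : d <= e / 4 by rewrite ge_min lexx.
have hd2 : n%:R * d <= 2^-1.
  have : d <= (2 * (n%:R + 1))^-1 by rewrite ge_min lexx orbT.
  move=> /(ler_wpM2l (ler0n R n)) /le_trans; apply.
  rewrite ler_pdivrMr // mulrA mulVf // mul1r lerDl //.
have := nr_mulmx (A - 1%:M) (X - 1%:M); have := nr_ge0 (X - 1%:M).
have t1 := nrD (A - 1%:M + (X - 1%:M)) ((A - 1%:M) *m (X - 1%:M)); rewrite -id in t1.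
have t2 := nrD (A - 1%:M) (X - 1%:M).
have t3 := nr_ge0 (A - 1%:M); have n0 : 0 <= n%:R :> R by [].
move: t1 t2 t3 g0 g1 hd1 hd2 n0.
move: (nr (X - 1%:M)) (nr (A - 1%:M)) (nr (B - 1%:M)) (nr (A - 1%:M + (X - 1%:M))) (nr ((A - 1%:M) *m (X - 1%:M))) => p q r s t t1 t2 t3 g0 g1 hd1 hd2 n0 p0 h4.
have : n%:R * (q * p) <= 2^-1 * p.
  by rewrite mulrA ler_wpM2r //; apply: le_trans hd2; rewrite ler_wpM2l.
lra.
Qed.

(** Transposition exchanges the two factors and leads back to [tends1_conj]. *)
Lemma tends1_div (N N' : C -> 'M[C]_n) P theta : (exists x0, forall x, x0 <= x -> N' (ray theta x) = N (ray theta x) *m P (ray theta x)) ->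
  tends1 N' theta -> tends1 P theta -> tends1 N theta.
Proof.
move=> [x2 E] h h'.
pose tr (M : C -> 'M[C]_n) w := (M w)^T.
have trT M : tends1 M theta -> tends1 (tr M) theta.
  move=> hM e e0; have [x0 hx0] := hM e e0; exists x0 => x /hx0 hx; apply: nr_mx_le; first exact: ltW.
  by move=> a b; apply: le_trans hx; apply: le_trans (nr_entry _ b a); rewrite !mxE eq_sym.
move=> e e0.
have := trT _ h; have := trT _ h' => g' g.
have h2 : tends1 (tr N) theta.
  by apply: tends1_conj g' g; exists x2 => x /E; rewrite /tr => ->; rewrite trmx_mul.
have [x0 hx0] := h2 e e0; exists x0 => x /hx0 hx; apply: nr_mx_le; first exact: ltW.
by move=> a b; apply: le_trans hx; apply: le_trans (nr_entry _ b a); rewrite !mxE eq_sym.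
Qed.

End Conjugation.

End RayLimits.

(** * Stokes matrices at a fixed t and the enlarged sector *)

Section StokesPhenomenon.
Variable R : realType.
Local Notation C := R[i].
Local Notation Re := complex.Re.
Local Notation Im := complex.Im.

Lemma Re_cis_shift (q : C) (x : R) : Re (q * cis (x + pi)) = - Re (q * cis x).
Proof. by rewrite cisD !ReM /= cospi sinpi; case: q => a b /=; ring. Qed.

Lemma Re_cis_pi (q : C) (x : R) (k : int) : `|Re (q * cis (x + k%:~R * pi))| = `|Re (q * cis x)|.
Proof.
elim: k => [|k IH|k IH]; first by rewrite mul0r addr0.
  by rewrite -IH -addn1 PoszD rmorphD /= mulrDl mul1r addrA Re_cis_shift normrN.
rewrite -IH; have -> : x + (- k%:Z)%:~R * pi = x + (- (k.+1)%:Z)%:~R * pi + pi.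
  by rewrite -addn1 PoszD opprD rmorphD /= rmorphN1; ring.
by rewrite Re_cis_shift normrN.
Qed.

Lemma Re_cis_cont (q : C) : continuous (fun x : R => Re (q * cis x)).
Proof.
move=> x; have -> : (fun x : R => Re (q * cis x)) = (fun x => Re q * cos x - Im q * sin x).
  by apply/funext => y; rewrite ReM.
apply: cvgB; apply: cvgM; [exact: cvg_cst|exact: continuous_cos|exact: cvg_cst|exact: continuous_sin].
Qed.

Lemma Re_cis_sign (q : C) (x y : R) : x <= y ->
  (forall theta, x <= theta <= y -> Re (q * cis theta) != 0) ->
  (Re (q * cis x) < 0) = (Re (q * cis y) < 0).
Proof.
move=> xy h; have hx := h x; have hy := h y; rewrite !lexx xy /= in hx hy.
have iv : Num.min (Re (q * cis x)) (Re (q * cis y)) <= 0 <= Num.max (Re (q * cis x)) (Re (q * cis y)) -> False.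
  move=> hm; have [|c] := @IVT R (fun x => Re (q * cis x)) x y 0 xy _ hm.
    by apply: continuous_subspaceT; exact: Re_cis_cont.
  by rewrite in_itv /= => /h /eqP.
apply/idP/idP => p; rewrite ltNge; apply/negP => p'; apply: iv; rewrite ge_min le_max p' (ltW p) ?orbT //.
Qed.

Lemma ode_mulr n (a Y : C -> 'M[C]_n) w (c : 'M[C]_n) : ode a Y w -> ode a (fun w => Y w *m c) w.
Proof.
move=> h i j; apply: der_eq.
  apply: is_derive_near (der_sum _ (fun d => der_scale (c d j) (h i d))); near=> v.
  by rewrite mxE; apply: eq_bigr => d _; rewrite mulrC.
by rewrite mulmxA [RHS]mxE; apply: eq_bigr => d _; rewrite mulrC.
Unshelve. all: by end_near.
Qed.

Section Sectors.
Variables (n : nat) (u u0 be : 'I_n -> C) (tau N0 : R) (a : C -> 'M[C]_n) (G : 'M[C]_n)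
  (Y : int -> C -> 'M[C]_n) (S : int -> 'M[C]_n).
Let D : set C := [set w | N0 <= expR (Re w)].
Let Nk k := nrm u be (fun w => invmx G *m Y k w).
Let phi (k : int) : R := tau + k%:~R * pi.
Hypotheses (Gu : G \in unitmx) (aB : loc_bounded D a) (aper : forall w, a (w + (0 +i* (2 * pi))) = a w)
  (hY : forall k w, D w -> ode a (Y k) w) (Yu : forall k w, D w -> Y k w \in unitmx)
  (gen : forall i j, i != j -> Re ((u i - u j) * cis tau) != 0)
  (sec : forall k theta, phi k - pi <= theta <= phi k -> tends1 (Nk k) theta)
  (hS : forall k w, D w -> Y (k + 1) w = Y k w *m S k)
  (van : forall i j, i != j -> u0 i = u0 j -> S 0 i j = 0 /\ S 1 i j = 0).

Let phiS k : phi (k + 1) = phi k + pi.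
Proof. by rewrite /phi rmorphD /= mulrDl mul1r addrA. Qed.

Let D_ray theta : exists x0, forall x, x0 <= x -> D (ray theta x).
Proof.
exists N0 => x xx; rewrite /D /= (le_trans _ (expR_ge1Dx x)) //.
by rewrite (le_trans xx) // lerDr.
Qed.

Let D_seg w1 w2 : D w1 -> D w2 -> forall s, 0 <= s <= 1 -> D (seg w1 w2 s).
Proof.
rewrite /D /= => h1 h2 s /andP[s0 s1].
have E : Re (seg w1 w2 s) = Re w1 + s * (Re w2 - Re w1) by rewrite /seg ReD Re_mulC ReB.
have [h|/ltW h] := leP (Re w1) (Re w2).
  by apply: (le_trans h1); rewrite ler_expR E lerDl mulr_ge0 // subr_ge0.
by apply: (le_trans h2); rewrite ler_expR E; nra.
Qed.

(** A half-turn exchanges growth and decay, so each exponential grows at one end of the arc from phi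
    k - pi to phi k. *)
Let wit (k : int) i j : i != j -> exists2 theta, theta = phi k \/ theta = phi k - pi & 0 < Re ((u i - u j) * cis theta).
Proof.
move=> ij; have h : Re ((u i - u j) * cis (phi k)) != 0.
  by rewrite -normr_eq0 Re_cis_pi normr_eq0 gen.
have [p|p] := ltP 0 (Re ((u i - u j) * cis (phi k))); first by exists (phi k); [left|].
exists (phi k - pi); first by right.
have := Re_cis_shift (u i - u j) (phi k - pi); rewrite subrK => E.
by move: h p; rewrite E oppr_eq0 oppr_le0 le_eqVlt eq_sym => /negPf ->.
Qed.

Let sec_up k : tends1 (Nk k) (phi k).
Proof. by apply: sec; rewrite lexx gerBl pi_ge0. Qed.

Let sec_lo k : tends1 (Nk k) (phi k - pi).
Proof. by apply: sec; rewrite lexx gerBl pi_ge0. Qed.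

(** The inverse of the formal monodromy e^(2 pi i be). *)
Let e : 'M[C]_n := diag_mx (\row_b cexp (- (be b * (0 +i* (2 * pi))))).

(** A full turn, corrected by the formal monodromy, brings Y_(k+2) to a solution normalized like Y_k
    at both ends of an arc of opening pi. By [wit] every off-diagonal entry of the connection matrix
    meets a growing exponential and vanishes. *)
Lemma monodromy k w : D w -> Y (k + 2) (w + (0 +i* (2 * pi))) *m e = Y k w.
Proof.
move=> Dw; set p := 0 +i* (2 * pi).
have Dp v : D v -> D (v + p) by rewrite /D /= ReD addr0.
pose T w := Y (k + 2) (w + p) *m e.
have hT v : D v -> ode a T v.
  move=> /Dp Dv; apply: ode_mulr => i j.
  have h := hY (k + 2) Dv i j; rewrite aper in h.
  have dp : is_derive v (1 : C) (fun v => v + p) 1.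
    by apply: der_eq (der_add (der_id v) (der_cst p v)) _; rewrite addr0.
  by apply: der_eq (@der_comp R (fun v => Y (k + 2) v i j) (fun v => v + p) v _ _ dp h) _; rewrite mul1r.
pose c := invmx (Y k w) *m T w.
have Tc v : D v -> T v = Y k v *m c.
  move=> Dv; apply: (@connection R n a (Y k) T D w v c aB (hY k) hT (D_seg Dw Dv)).
  by rewrite /c mulKVmx // Yu.
have shift v : nrm u be (fun w => invmx G *m T w) v = Nk (k + 2) (v + p).
  apply/matrixP => i j.
  have E : (invmx G *m T v) i j = (invmx G *m Y (k + 2) (v + p)) i j * cexp (- (be j * p)).
    by rewrite /T mulmxA mul_mx_diag [LHS]mxE; congr (_ * _); rewrite mxE.
  rewrite [LHS]mxE E [RHS]mxE -mulrA -cexpD [cexp (v + p)]cexpD cexp2pi mulr1.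
  by congr (_ * cexp _); ring.
have rayp theta x : ray theta x + p = ray (theta + 2 * pi) x by rewrite /ray /p; simpc.
have tT theta : theta = phi k \/ theta = phi k - pi -> tends1 (nrm u be (fun w => invmx G *m T w)) theta.
  move=> h d d0.
  have h' : tends1 (Nk (k + 2)) (theta + 2 * pi).
    have E : phi (k + 2) = phi k + 2 * pi.
      by rewrite /phi rmorphD /= mulrDl addrA.
    case: h => ->; first by rewrite -E.
    by have -> : phi k - pi + 2 * pi = phi (k + 2) - pi by rewrite E; ring.
  have [x0 hx0] := h' d d0; exists x0 => x /hx0; rewrite shift rayp; exact.
have tk theta : theta = phi k \/ theta = phi k - pi -> tends1 (Nk k) theta by case=> ->.
have tc theta : theta = phi k \/ theta = phi k - pi -> tends1 (conjm u be c) theta.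
  move=> h; apply: tends1_conj (tk _ h) (tT _ h).
  have [x0 hx0] := D_ray theta; exists x0 => x /hx0 Dx; apply: nrm_mul.
  by rewrite -[RHS]mulmxA -(Tc _ Dx).
have c1 : c = 1%:M.
  have [cd _] := tends1_conjm (tc _ (or_introl erefl)).
  apply/matrixP => i j; rewrite [RHS]mxE; have [<-|ij] := eqVneq i j; first exact: cd.
  have [theta ht hq] := wit k ij.
  by have [_ ->] := tends1_conjm (tc _ ht).
by rewrite -/(T w) Tc // c1 mulmx1.
Qed.

Let D0 : D (N0%:C).
Proof. by rewrite /D /= (le_trans _ (expR_ge1Dx _)) // lerDr. Qed.

(** By [monodromy], S_(k+2) e = e S_k with e diagonal and invertible. *)
Lemma stokes_shift k i j : (S k i j == 0) = (S (k + 2) i j == 0).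
Proof.
pose p : C := 0 +i* (2 * pi); pose w : C := N0%:C.
have Dw : D w := D0.
have Dp : D (w + p) by move: D0; rewrite /D /= addr0.
have E1 := monodromy (k + 1) Dw.
have kk : k + 1 + 2 = k + 2 + 1 by rewrite addrAC.
rewrite (hS k Dw) -(monodromy k Dw) kk (hS (k + 2) Dp) -!mulmxA in E1.
have E2 : S (k + 2) *m e = e *m S k.
  by rewrite -[LHS](mulKmx (Yu (k + 2) Dp)) E1 mulKmx // Yu.
have /matrixP /(_ i j) E3 := E2; rewrite /e mul_mx_diag mul_diag_mx !mxE in E3.
have ne b : cexp (- (be b * p)) != 0 by exact: cexp_neq0.
apply/eqP/eqP => h; move: E3; rewrite h ?mulr0 ?mul0r => /eqP; rewrite ?(eq_sym 0) mulf_eq0 ?(negPf (ne _)) ?orbF => /eqP //.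
Qed.

(** Vanishing is given for k = 0 and k = 1; [stokes_shift] moves by 2, so the induction carries
    pairs of consecutive indices in both directions. *)
Lemma stokes_vanish k i j : i != j -> u0 i = u0 j -> S k i j = 0.
Proof.
move=> ij uij; have [v0 v1] := van ij uij.
suff h m : (S m%:Z i j = 0 /\ S (m%:Z + 1) i j = 0) /\ (S (- m%:Z) i j = 0 /\ S (- m%:Z + 1) i j = 0).
  by case: (intP k) => [|m|m]; [|exact: (h m.+1).1.1|exact: (h m.+1).2.1].
elim: m => [|m [[h1 h2] [h3 h4]]]; first by rewrite oppr0 add0r.
have Em : m.+1%:Z = m%:Z + 1 by rewrite -addn1.
split; split.
- by rewrite Em.
- by apply/eqP; rewrite Em -addrA -stokes_shift h1.
- by apply/eqP; rewrite stokes_shift Em opprD -addrA h4.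
- by rewrite Em opprD subrK.
Qed.

(* No ray Re ((u_i - u_j) z) = 0 with u0_i <> u0_j separates the two directions. *)
Let clear_of (x y : R) := forall i j theta, u0 i != u0 j -> x <= theta <= y -> Re ((u i - u j) * cis theta) != 0.

(** Along phi k both Y_k and Y_(k+1) are normalized, so a nonzero off-diagonal entry of S_k belongs
    to a decaying exponential. By [stokes_vanish] its pair has u0_i <> u0_j, and the sign persists
    until a ray of such a pair is met. *)
Lemma stokes_conj k theta : (phi k <= theta /\ clear_of (phi k) theta) \/ (theta <= phi k /\ clear_of theta (phi k)) ->
  tends1 (conjm u be (S k)) theta.
Proof.
move=> h.
have t0 : tends1 (conjm u be (S k)) (phi k).
  have h1 : tends1 (Nk (k + 1)) (phi k) by have := sec_lo (k + 1); rewrite phiS addrK.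
  apply: tends1_conj (sec_up k) h1.
  have [x0 hx0] := D_ray (phi k); exists x0 => x /hx0 Dx; apply: nrm_mul.
  by rewrite -[RHS]mulmxA -(hS _ Dx).
have [sd s0] := tends1_conjm t0.
apply: conjm_tends1 => // i j ij Sij.
have uij : u0 i != u0 j by apply: contraNneq Sij => /(stokes_vanish k ij) ->.
have n0 : Re ((u i - u j) * cis (phi k)) < 0.
  rewrite lt_neqAle -normr_eq0 Re_cis_pi normr_eq0 gen //= leNgt.
  by apply: contraNN Sij => /(s0 i j ij) ->.
case: h => -[le cl].
  by rewrite -(@Re_cis_sign _ (phi k) theta) // => x; exact: cl.
by rewrite (@Re_cis_sign _ theta (phi k)) // => x; exact: cl.
Qed.

Let relN k theta : exists x0, forall x, x0 <= x -> Nk (k + 1) (ray theta x) = Nk k (ray theta x) *m conjm u be (S k) (ray theta x).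
Proof.
have [x0 hx0] := D_ray theta; exists x0 => x /hx0 Dx; apply: nrm_mul.
by rewrite -[RHS]mulmxA -(hS _ Dx).
Qed.

(** Beyond the upper end one uses Y_(k+1) = Y_k S_k, where Y_(k+1) is normalized for a further
    half-turn; l counts the half-turns. *)
Lemma tends1_right (l : nat) k theta : phi k <= theta <= phi k + l%:R * pi -> clear_of (phi k) theta ->
  tends1 (Nk k) theta.
Proof.
elim: l k theta => [|l IH] k theta /andP[h1 h2] cl.
  by rewrite mul0r addr0 in h2; rewrite (@le_anti _ _ theta (phi k)) ?h2 //.
apply: tends1_div (relN k theta) _ _; last by apply: stokes_conj; left.
have [h3|/ltW h3] := leP theta (phi (k + 1)).
  by apply: sec; rewrite h3 phiS addrK h1.
apply: IH.
  rewrite h3 phiS /=; apply: (le_trans h2); rewrite -natr1 mulrDl mul1r; lra.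
by move=> i j x uij /andP[x1 x2]; apply: cl => //; rewrite x2 (le_trans _ x1) // phiS lerDl pi_ge0.
Qed.

(** Below the lower end the relation is Y_k = Y_(k-1) S_(k-1), so a product replaces the
    quotient. *)
Lemma tends1_left (l : nat) k theta : phi k - pi - l%:R * pi <= theta <= phi k - pi -> clear_of theta (phi k - pi) ->
  tends1 (Nk k) theta.
Proof.
elim: l k theta => [|l IH] k theta /andP[h1 h2] cl.
  by rewrite mul0r subr0 in h1; rewrite (@le_anti _ _ theta (phi k - pi)) ?h2 //.
have kE : k - 1 + 1 = k by rewrite subrK.
have pE : phi (k - 1) = phi k - pi by rewrite -[in RHS]kE phiS addrK.
rewrite -kE; apply: tends1_mul (relN (k - 1) theta) _ _; last first.
  by apply: stokes_conj; right; rewrite pE.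
have [h3|/ltW h3] := leP (phi (k - 1) - pi) theta.
  by apply: sec; rewrite h3 pE h2.
apply: IH.
  rewrite h3 andbT pE; apply: le_trans h1; rewrite -natr1 mulrDl mul1r; lra.
by move=> i j x uij /andP[x1 x2]; apply: cl => //; rewrite x1 (le_trans x2) // pE gerBl pi_ge0.
Qed.

Lemma tends1_sector k theta : clear_of theta (phi k - pi) -> clear_of (phi k) theta -> tends1 (Nk k) theta.
Proof.
move=> c1 c2; have [h1|/ltW h1] := leP theta (phi k); last first.
  have b0 : 0 <= (theta - phi k) / pi by rewrite divr_ge0 ?subr_ge0 // pi_ge0.
  apply: (@tends1_right (Num.bound ((theta - phi k) / pi))) => //; rewrite h1 -lerBlDl -ler_pdivrMr ?pi_gt0 //.
  exact/ltW/archi_boundP.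
have [h2|/ltW h2] := leP (phi k - pi) theta; first by apply: sec; rewrite h2.
have b0 : 0 <= (phi k - pi - theta) / pi by rewrite divr_ge0 ?subr_ge0 // pi_ge0.
apply: (@tends1_left (Num.bound ((phi k - pi - theta) / pi))) => //; rewrite h2 andbT lerBlDl -lerBlDr.
by rewrite -ler_pdivrMr ?pi_gt0 //; exact/ltW/archi_boundP.
Qed.

End Sectors.

End StokesPhenomenon.

(** * Walls, cells and the radius of the polydisc *)

Section Geometry.
Variable R : realType.
Local Notation C := R[i].
Local Notation Re := complex.Re.
Local Notation Im := complex.Im.

Let ii : C := 0 +i* 1.

Lemma cis_half : cis (pi / 2 : R) = ii. Proof. by rewrite /cis cos_pihalf sin_pihalf. Qed.

Lemma cis_eta (tau : R) (m : int) : Re (cis (eta_tilde tau + m%:~R * pi) * cis tau : C) = 0.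
Proof.
apply/eqP; rewrite -normr_eq0 -[cis (_ + _) * _]mulrC.
have -> : cis tau * cis (eta_tilde tau + m%:~R * pi) = cis (3%:R * pi / 2%:R) * cis (0 + m%:~R * pi) :> C.
  by rewrite -!cisD; congr cis; rewrite /eta_tilde; ring.
rewrite Re_cis_pi; have -> : 3%:R * pi / 2%:R = pi / 2 + pi :> R by field.
by rewrite -cisD addr0 /cis /= cosDpi cos_pihalf oppr0 normr0.
Qed.

(** Since cis (eta_tilde tau) cis tau = -i, a wall is the locus where tau is a Stokes direction of
    Lambda(t). *)
Lemma is_arg_eta (d : C) (tau : R) : d != 0 ->
  (exists m : int, is_arg d (eta_tilde tau + m%:~R * pi)) <-> Re (d * cis tau) = 0.
Proof.
move=> d0; split=> [[m [r [r0 ->]]]|h].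
  by rewrite -mulrA Re_mulC cis_eta mulr0.
pose y := Im (d * cis tau).
have E : d * cis tau = y%:C * ii by rewrite /y; move: h; case: (d * cis tau) => p q /= ->; rewrite /ii; simpc.
have cc : cis tau * cis (- tau) = 1 :> C by rewrite -cisD subrr /cis cos0 sin0.
have dE : d = y%:C * (ii * cis (- tau)) by rewrite mulrA -E -mulrA cc mulr1.
have y0 : y != 0 by apply: contraNneq d0 => yy; rewrite dE yy mul0r.
have [yp|yn] := ltP 0 y.
  exists (-1), y; split=> //; rewrite [LHS]dE; congr (_ * _).
  rewrite -cis_half -cisD; congr cis; by rewrite /eta_tilde rmorphN1; field.
exists 0, (- y); split; first by rewrite oppr_gt0 lt_neqAle y0.
rewrite [LHS]dE rmorphN mulNr -mulrN; congr (_ * _); rewrite mul0r addr0 /eta_tilde.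
have -> : 3%:R * pi / 2%:R - tau = (pi / 2 - tau) + pi by field.
rewrite cisD -cis_half -cisD; have -> : cis pi = -1 :> C by rewrite /cis cospi sinpi; simpc.
by rewrite mulrN1 opprK.
Qed.

(** Multiplication by cis tau makes the line vertical; at rho = Im (d cis tau) the imaginary part
    cancels and |Re (d cis tau)| is left. *)
Lemma half_dist_le (d : C) (tau : R) : half_dist_line d (eta_tilde tau) <= 2^-1 * `|Re (d * cis tau)|.
Proof.
rewrite /half_dist_line ler_wpM2l ?invr_ge0 //.
pose rho := Im (d * cis tau).
have E : Re `|d + rho%:C * cis (eta_tilde tau)| = `|Re (d * cis tau)|.
  rewrite -/(nr (d + rho%:C * cis (eta_tilde tau))) -[LHS]mulr1 -(nr_cis tau) -nrM mulrDl -mulrA.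
  have -> : cis (eta_tilde tau) * cis tau = - ii.
    rewrite -cisD /eta_tilde subrK; have -> : 3%:R * pi / 2%:R = pi / 2 + pi :> R by field.
    by rewrite cisD cis_half /cis cospi sinpi /ii; simpc.
  have -> : d * cis tau + rho%:C * - ii = (Re (d * cis tau))%:C.
    rewrite /rho /ii; move: (d * cis tau) => [p q] /=; apply/eqP; rewrite eq_complex /=; apply/andP; split; apply/eqP; ring.
  by rewrite nrC.
rewrite -E; apply: ge_inf; last by exists rho.
by exists 0 => _ [r _ <-]; exact: (@nr_ge0 R C (d + r%:C * cis (eta_tilde tau))).
Qed.

Variable n : nat.
Local Notation V := 'rV[C]_n.
Variables (u0 : 'I_n -> C) (eps0 tau : R).
Hypothesis eps0_gt0 : 0 < eps0.
Let U : set V := polydisc eps0.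
Let D : set V := U `\` coalescence u0 eps0.
Let W : set V := U `\` (coalescence u0 eps0 `|` walls u0 eps0 tau).
Definition gap (a b : 'I_n) (t : V) : C := eigval u0 t a - eigval u0 t b.

Lemma polydiscE t : U t = (nr t <= eps0). Proof. by rewrite /U /polydisc /= nr_le. Qed.

Lemma W_generic t : W t <-> U t /\ forall a b, a != b -> Re (gap a b t * cis tau) != 0.
Proof.
split=> [[Ut nW]|[Ut h]].
  split=> // a b ab; apply/negP => /eqP h; apply: nW.
  have [E|E] := eqVneq (eigval u0 t a) (eigval u0 t b); first by left; split=> //; exists a, b.
  by right; split=> //; exists a, b; split=> //; apply/is_arg_eta => //; rewrite subr_eq0.
split=> // -[[_ [a [b [ab E]]]]|[_ [a [b [E H]]]]].
  by have := h a b ab; rewrite /gap E subrr mul0r eqxx.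
have ab : a != b by apply: contraNneq E => ->.
have := h a b ab; rewrite (is_arg_eta tau _).1 ?eqxx //; by rewrite subr_eq0.
Qed.

Lemma W_sub_D : W `<=` D.
Proof. by move=> t [Ut nW]; split=> // h; apply: nW; left. Qed.

Lemma D_distinct t : D t -> forall a b, a != b -> gap a b t != 0.
Proof.
move=> [Ut nC] a b ab; rewrite subr_eq0; apply/negP => /eqP E; apply: nC.
by split=> //; exists a, b.
Qed.

Lemma cell_sub c t : cell u0 eps0 tau c -> c t -> W t.
Proof. by move=> [t0 _ ->] /connected_component_sub. Qed.

Lemma W_cell t : W t -> exists2 c, cell u0 eps0 tau c & c t.
Proof. by move=> Wt; exists (connected_component W t); [exists t|exact: connected_component_refl]. Qed.

(** Here the radius enters: on the polydisc a difference of eigenvalues moves by at most 2 eps0,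
    less than |Re ((u0 a - u0 b) cis tau)|. Hence tau is in no R(t). *)
Lemma cluster_gap a b t : U t -> eps0 < half_dist_line (u0 a - u0 b) (eta_tilde tau) -> Re (gap a b t * cis tau) != 0.
Proof.
rewrite polydiscE => Ut /lt_le_trans /(_ (half_dist_le _ _)) h.
have E : gap a b t = (u0 a - u0 b) + (t 0 a - t 0 b) by rewrite /gap /eigval; ring.
apply/negP => /eqP; rewrite E mulrDl ReD => /eqP; rewrite addr_eq0 => /eqP E2.
move: h; rewrite E2 normrN ltr_pdivlMl //; apply/negP; rewrite -leNgt.
apply: (le_trans (nr_Re _)); rewrite nrM nr_cis mulr1 (le_trans (nrB _ _)) //.
by have := nr_entry t 0 a; have := nr_entry t 0 b; lra.
Qed.

Lemma gap_cont a b (t : V) (e : R) : 0 < e -> forall t', nr (t' - t) < e / 2 -> nr (gap a b t' - gap a b t) < e.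
Proof.
move=> e0 t' h; have -> : gap a b t' - gap a b t = (t' - t) 0 a - (t' - t) 0 b.
  by rewrite /gap /eigval !mxE; ring.
apply: (le_lt_trans (nrB _ _)); have := nr_entry (t' - t) 0 a; have := nr_entry (t' - t) 0 b; lra.
Qed.

Lemma near_gap (t : V) : (forall a b, a != b -> Re (gap a b t * cis tau) != 0) ->
  exists2 r : R, 0 < r & forall t', nr (t' - t) < r -> forall a b, a != b -> Re (gap a b t' * cis tau) != 0.
Proof.
move=> h; have [p|c c0 hc] := @fin_pos R _ (fun p : 'I_n * 'I_n => if p.1 == p.2 then 1 else `|Re (gap p.1 p.2 t * cis tau)|).
  by case: ifPn => // ab; rewrite normr_gt0 h.
exists (c / 2) => [|t' tt a b ab]; first by rewrite divr_gt0.
have := hc (a, b); rewrite /= (negPf ab) => hc'.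
have h1 := gap_cont a b c0 tt.
have h2 : `|Re (gap a b t' * cis tau) - Re (gap a b t * cis tau)| < c.
  rewrite -ReB -mulrBl (le_lt_trans (nr_Re _)) // nrM nr_cis mulr1 //.
apply: contraTneq h2 => ->; rewrite sub0r normrN -leNgt //.
Qed.

Lemma polydisc_convex (t t' : V) (s : R) : U t -> U t' -> 0 <= s <= 1 -> U (t + s%:C *: (t' - t)).
Proof.
rewrite !polydiscE => h h' /andP[s0 s1].
have -> : t + s%:C *: (t' - t) = (1 - s)%:C *: t + s%:C *: t'.
  by rewrite rmorphB rmorph1 scalerBl scale1r scalerBr -addrA; congr (_ + _); exact: addrC.
rewrite (le_trans (nrD _ _)) // !nrZ !nr_real ?subr_ge0 //.
by have := nr_ge0 t; have := nr_ge0 t'; nra.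
Qed.

(** Cells are open relative to the closed polydisc: a short segment in it stays off the walls and,
    being connected, in one component. *)
Lemma cell_open c (t : V) : cell u0 eps0 tau c -> c t ->
  exists2 r : R, 0 < r & forall t', nr (t' - t) < r -> U t' -> c t'.
Proof.
move=> hc ct; have Wt := cell_sub hc ct; have [Ut ht] := (W_generic t).1 Wt.
have [r r0 hr] := near_gap ht; exists r => // t' tt Ut'.
case: hc ct => t1 Wt1 -> ct.
pose gamma (s : R) : V := t + s%:C *: (t' - t).
have cg : continuous gamma.
  move=> s; apply/(@cvgrPdist_lt _ V _ _ _ gamma (gamma s)) => e e0.
  have e1 : exists2 d : R, 0 < d & d%:C = e.
    exists (Re e); last by move: e0; case: e => p q; rewrite ltcE /= => /andP[/eqP -> _].
    by move: e0; case: e => p q; rewrite ltcE /= => /andP[].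
  have [d d0 <-] := e1.
  have k0 : 0 < nr (t' - t) + 1 by rewrite ltr_wpDl // nr_ge0.
  near=> y.
  have -> : gamma s - gamma y = (s - y)%:C *: (t' - t).
    by rewrite /gamma opprD addrACA subrr add0r rmorphB scalerBl.
  rewrite nr_lt nrZ nrC.
  have : `|s - y| < d / (nr (t' - t) + 1) by near: y; apply: cvgr_dist_lt; rewrite ?divr_gt0 //; exact: cvg_id.
  rewrite ltr_pdivlMr // => h; apply: le_lt_trans h; rewrite ler_wpM2l // lerDl //.
pose B := [set gamma s | s in `[0, 1]].
have cB : connected B.
  by apply: connected_continuous_connected; [exact: segment_connected|exact: continuous_subspaceT].
have g0 : gamma 0 = t by rewrite /gamma scale0r addr0.
have g1 : gamma 1 = t' by rewrite /gamma scale1r addrC subrK.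
have BW : B `<=` W.
  move=> _ [s + <-]; rewrite /= in_itv /= => hs; apply/W_generic; split; first exact: polydisc_convex.
  apply: hr; rewrite /gamma addrC addKr nrZ; move: hs => /andP[s0 s1]; rewrite nr_real //.
  by apply: le_lt_trans tt; rewrite ler_piMl ?nr_ge0.
have cc := same_connected_component ct.
rewrite cc; apply: (connected_component_max _ BW cB).
  by exists 0 => //=; rewrite in_itv /= lexx ler01.
by exists 1 => //=; rewrite in_itv /= lexx ler01.
Unshelve. all: by end_near.
Qed.

Lemma avoid_reals (I : finType) (z : I -> R) (eta : R) : 0 < eta -> exists xi : R, 0 < xi < eta /\ forall i, xi != z i.
Proof.
move=> e0; have [i|c c0 hc] := @fin_pos R I (fun i => if 0 < z i then z i else 1); first by case: ifP.
exists (Num.min c eta / 2); split.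
  by rewrite divr_gt0 ?lt_min ?c0 //= ltr_pdivrMr // (le_lt_trans (_ : _ <= eta)) ?ge_min ?lexx ?orbT // ltr_pMr // ltr1n.
have m0 : 0 < Num.min c eta by rewrite lt_min c0.
move=> i; have := hc i; case: ifP => [zi ci|zi _].
  rewrite lt_eqF // (lt_le_trans _ ci) // ltr_pdivrMr // (le_lt_trans (_ : _ <= c)) ?ge_min ?lexx // ltr_pMr // ltr1n //.
by apply: contraFneq zi => <-; rewrite divr_gt0.
Qed.

Lemma Re_affine (p q c : C) (s : R) : Re ((p + s%:C * q) * c) = Re (p * c) + s * Re (q * c).
Proof. by rewrite mulrDl ReD -mulrA Re_mulC. Qed.

Lemma affine_zero (p q s : R) : p + s * (q - p) = 0 -> p - q != 0 -> s == p / (p - q).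
Proof. by move=> E d0; apply/eqP/(canRL (mulfK d0)); lra. Qed.

(** One moves from t a little towards a generic interior point v. The conditions are affine along
    the way, so finitely many parameters are to be avoided. Moving inwards yields a full ball even
    when t is on the boundary. *)
Lemma W_dense (t : V) (r : R) : U t -> 0 < r ->
  exists t1 (d : R), [/\ 0 < d, nball t1 d `<=` nball t r & nball t1 d `<=` W].
Proof.
move=> Ut r0; pose x (a : 'I_n) := Re (u0 a * cis tau).
have n0 : 0 < n%:R + 1 :> R by rewrite ltr_wpDl.
have eN : 0 < eps0 / (n%:R + 1) by rewrite divr_gt0.
(* v shifts the a-th eigenvalue by xi a in the direction cis (- tau). The excluded xi are those for
   which some gap of v loses its real part, and xi < eps0 / (n + 1) keeps v in the polydisc. *)
have [xi [/andP[xi0 xi1] hxi]] := avoid_reals (fun p : 'I_n * 'I_n => (x p.2 - x p.1) / ((val p.1)%:R - (val p.2)%:R)) eN.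
pose v : V := \row_a ((xi * (val a)%:R)%:C * cis (- tau)).
have vE : nr v < eps0.
  apply/nr_mx_lt => // i a; rewrite mxE nrM nr_cis mulr1 nr_real; last by rewrite mulr_ge0 // ltW.
  apply: (@le_lt_trans _ _ (xi * (n%:R + 1))); last by rewrite -ltr_pdivlMr.
  rewrite ler_wpM2l ?(ltW xi0) //; apply: (@le_trans _ _ n%:R); last by rewrite lerDl.
  by rewrite ler_nat; exact: ltnW (ltn_ord a).
have cc : cis (- tau) * cis tau = 1 :> C by rewrite -cisD addNr /cis cos0 sin0.
have gv a b : a != b -> Re (gap a b v * cis tau) != 0.
  move=> ab; have -> : Re (gap a b v * cis tau) = (x a - x b) + xi * ((val a)%:R - (val b)%:R).
    have -> : gap a b v * cis tau = (u0 a - u0 b) * cis tau + (xi * ((val a)%:R - (val b)%:R))%:C * (cis (- tau) * cis tau).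
      by rewrite /gap /eigval !mxE !rmorphM rmorphB /=; ring.
    by rewrite cc mulr1 ReD mulrBl ReB.
  have q0 : (val a)%:R - (val b)%:R != 0 :> R by rewrite subr_eq0 eqr_nat.
  apply: contraNneq (hxi (a, b)) => /= E; apply/eqP; apply: (canRL (mulfK q0)).
  by move: E => /eqP; rewrite addr_eq0 => /eqP h; lra.
pose f a b (s : R) := Re (gap a b (t + s%:C *: (v - t)) * cis tau).
have fE a b s : f a b s = f a b 0 + s * (f a b 1 - f a b 0).
  have gE s' : gap a b (t + s'%:C *: (v - t)) = gap a b t + s'%:C * (gap a b v - gap a b t).
    by rewrite /gap /eigval !mxE; ring.
  have fE' s' : f a b s' = Re (gap a b t * cis tau) + s' * Re ((gap a b v - gap a b t) * cis tau).
    by rewrite /f gE; exact: Re_affine.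
  by rewrite (fE' s) (fE' 0) (fE' 1) mul0r addr0 mul1r [in RHS](addrC (_ + _)) addKr.
have f1 a b : f a b 1 = Re (gap a b v * cis tau) by rewrite /f scale1r addrC subrK.
have k0 : 0 < nr (v - t) + 1 by rewrite ltr_wpDl // nr_ge0.
have e2 : 0 < Num.min 1 (r / 2 / (nr (v - t) + 1)) by rewrite lt_min ltr01 !divr_gt0.
have [s [/andP[s0 s1] hs]] := avoid_reals (fun p : 'I_n * 'I_n => f p.1 p.2 0 / (f p.1 p.2 0 - f p.1 p.2 1)) e2.
have s11 : s < 1 by move: s1; rewrite lt_min => /andP[].
pose t1 := t + s%:C *: (v - t).
have g1 a b : a != b -> Re (gap a b t1 * cis tau) != 0.
  move=> ab; rewrite -/(f a b s) fE; apply: contraNneq (hs (a, b)) => /= E.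
  have d0 : f a b 0 - f a b 1 != 0.
    apply: contraNneq (gv a b ab) => /eqP; rewrite subr_eq0 -f1 => /eqP d0.
    by move: E; rewrite d0 subrr mulr0 addr0 => ->.
  exact: affine_zero.
have t1U : nr t1 < eps0.
  have -> : t1 = (1 - s)%:C *: t + s%:C *: v.
    by rewrite /t1 rmorphB rmorph1 scalerBl scale1r scalerBr -addrA; congr (_ + _); exact: addrC.
  rewrite (le_lt_trans (nrD _ _)) // !nrZ !nr_real ?subr_ge0 ?(ltW s0) ?(ltW s11) //.
  by move: Ut; rewrite polydiscE; have := nr_ge0 t; nra.
have t1r : nr (t1 - t) < r / 2.
  rewrite /t1 addrC addKr nrZ nr_real ?(ltW s0) //.
  move: s1; rewrite lt_min => /andP[_]; rewrite ltr_pdivlMr // => h; apply: le_lt_trans h.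
  by rewrite ler_wpM2l ?(ltW s0) // lerDl.
have [d d0 hd] := near_gap g1.
exists t1, (Num.min d (Num.min (r / 2) (eps0 - nr t1))); split.
- by rewrite !lt_min d0 divr_gt0 //= subr_gt0.
- move=> y; rewrite /nball /= !lt_min => /and3P[_ y2 _].
  rewrite (le_lt_trans (nr_subD t1 _ _)) //; lra.
- move=> y; rewrite /nball /= !lt_min => /and3P[y1 _ y3]; apply/W_generic; split; last exact: hd.
  by rewrite polydiscE; have := nrBl y t1; lra.
Qed.

End Geometry.

(** * Choice of an admissible half-plane around a direction *)

Section Windows.
Variable R : realType.
Local Notation C := R[i].
Local Notation Re := complex.Re.
Local Notation Im := complex.Im.

(** Where Re (q cis x) is not 0, continuity suffices; where it is, the function equals - Im (q cis
    x) sin s near x. *)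
Lemma Re_cis_punctured (q : C) (x : R) : q != 0 ->
  exists2 d : R, 0 < d & forall s, 0 < `|s| < d -> Re (q * cis (x + s)) != 0.
Proof.
move=> q0; have [f0|f0] := eqVneq (Re (q * cis x)) 0; last first.
  have [d d0 hd] : exists2 d : R, 0 < d & forall y, `|x - y| < d -> Re (q * cis y) != 0.
    have : \forall y \near x, `|Re (q * cis x) - Re (q * cis y)| < `|Re (q * cis x)|.
      by have /cvgrPdist_lt h := @Re_cis_cont R q x; apply: h; rewrite normr_gt0.
    case=> d /= d0 hd; exists d => // y xy; have := hd y xy; rewrite /=.
    by apply: contraTneq => ->; rewrite subr0 ltxx.
  exists d => // s /andP[_ sd]; apply: hd; by rewrite opprD addNKr normrN.
exists 1 => // s /andP[s0 s1]; rewrite cisD mulrA ReM f0 mul0r sub0r oppr_eq0 mulf_neq0 //.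
  apply: contra_neq q0 => i0; have : q * cis x = 0 by case: (q * cis x) f0 i0 => a b /= -> ->.
  by move=> /eqP; rewrite mulf_eq0 -[cis x == 0]nr_eq0 nr_cis oner_eq0 orbF => /eqP.
rewrite /=; have pi1 : 1 < pi :> R by have := pi_ge2 R; lra.
have [sp|sn|sz] := ltgtP 0 s; last by move: s0; rewrite -sz normr0 ltxx.
  by rewrite gt_eqF // sin_gt0_pi // sp (lt_trans _ pi1) // -(gtr0_norm sp).
rewrite -oppr_eq0 -sinN gt_eqF // sin_gt0_pi // oppr_gt0 sn (lt_trans _ pi1) //.
by rewrite -(ltr0_norm sn).
Qed.

Lemma Re_cis_pi_neq0 (q : C) (x : R) (k : int) : (Re (q * cis (x + k%:~R * pi)) != 0) = (Re (q * cis x) != 0).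
Proof. by rewrite -normr_eq0 Re_cis_pi normr_eq0. Qed.

(* A half-plane around the direction theta, bounded by a generic direction that no
   ray in the class [cl] separates from tau. *)
Lemma window n (q : 'I_n -> 'I_n -> C) (cl : rel 'I_n) (tau theta : R) (k : int) :
  (forall i j, i != j -> q i j != 0) -> (forall i j, cl i j -> i != j) ->
  (forall i j, cl i j -> Re (q i j * cis tau) != 0) ->
  (forall i j x, cl i j -> theta <= x <= tau + k%:~R * pi - pi -> Re (q i j * cis x) != 0) ->
  (forall i j x, cl i j -> tau + k%:~R * pi <= x <= theta -> Re (q i j * cis x) != 0) ->
  exists tau' : R, [/\ forall i j, i != j -> Re (q i j * cis tau') != 0,
    forall i j x, cl i j -> Num.min tau tau' <= x <= Num.max tau tau' -> Re (q i j * cis x) != 0 &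
    tau' + k%:~R * pi - pi < theta < tau' + k%:~R * pi].
Proof.
move=> q0 clN c0 c1 c2; have pi0 : 0 < pi :> R := pi_gt0 R.
pose th := theta - k%:~R * pi.
have small y : exists2 d : R, 0 < d & forall s, 0 < `|s| < d -> forall i j, i != j -> Re (q i j * cis (y + s)) != 0.
  have /choice [d hd] : forall p : 'I_n * 'I_n, exists d : R, 0 < d /\ (p.1 != p.2 ->
      forall s, 0 < `|s| < d -> Re (q p.1 p.2 * cis (y + s)) != 0).
    move=> [i j] /=; have [->|ij] := eqVneq i j; first by exists 1.
    by have [d d0 hd] := Re_cis_punctured y (q0 i j ij); exists d.
  have [p|c cp hc] := @fin_pos R _ d; first by have [] := hd p.
  exists c => // s /andP[s0 sc] i j ij; apply: (hd (i, j)).2 => //=.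
  by rewrite s0 (lt_le_trans sc).
(* The direction lies at or above the upper end of the sector: tau' goes just above it. Up to [th]
   the interval from tau to tau' is clear by hypothesis, beyond it by the choice of d. *)
have [h1|h1] := leP tau th.
  have [d d0 hd] := small th; pose s := Num.min d pi / 2.
  have m0 : 0 < Num.min d pi by rewrite lt_min d0.
  have s0 : 0 < s by rewrite divr_gt0.
  have sd : s < d by rewrite /s ltr_pdivrMr // (le_lt_trans (_ : _ <= d)) ?ge_min ?lexx // ltr_pMr // ltr1n.
  have sp : s < pi by rewrite /s ltr_pdivrMr // (le_lt_trans (_ : _ <= pi)) ?ge_min ?lexx ?orbT // ltr_pMr // ltr1n.
  exists (th + s); split; last by rewrite /th; apply/andP; split; lra.
    by move=> i j; apply: hd; rewrite gtr0_norm // s0.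
  move=> i j x cij; rewrite min_l ?max_r; [|lra|lra] => /andP[x1 x2].
  have [xt|xt] := leP x th; last first.
    rewrite -[x](subrKC th); apply: hd; last exact: clN.
    by rewrite gtr0_norm ?subr_gt0 // xt /=; lra.
  rewrite -(Re_cis_pi_neq0 _ x k); apply: c2 => //; move: xt; rewrite /th; lra.
(* The direction lies at or below the lower end: now tau' - pi goes just below it. *)
have [h2|h2] := leP th (tau - pi).
  have [d d0 hd] := small (th + pi); pose s := Num.min d pi / 2.
  have m0 : 0 < Num.min d pi by rewrite lt_min d0.
  have s0 : 0 < s by rewrite divr_gt0.
  have sd : s < d by rewrite /s ltr_pdivrMr // (le_lt_trans (_ : _ <= d)) ?ge_min ?lexx // ltr_pMr // ltr1n.
  have sp : s < pi by rewrite /s ltr_pdivrMr // (le_lt_trans (_ : _ <= pi)) ?ge_min ?lexx ?orbT // ltr_pMr // ltr1n.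
  exists (th + pi - s); split; last by rewrite /th; apply/andP; split; lra.
    by move=> i j; apply: hd; rewrite normrN gtr0_norm // s0.
  move=> i j x cij; rewrite min_r ?max_l; [|lra|lra] => /andP[x1 x2].
  have [xt|xt] := leP (th + pi) x; last first.
    rewrite -[x](subrKC (th + pi)); apply: hd; last exact: clN.
    by rewrite ltr0_norm ?subr_lt0 // oppr_gt0 subr_lt0 xt /=; lra.
  have := Re_cis_shift (q i j) (x - pi); rewrite subrK => ->; rewrite oppr_eq0.
  rewrite -(Re_cis_pi_neq0 _ (x - pi) k); apply: c1 => //; move: xt; rewrite /th; lra.
(* The direction is already inside, and a slight turn of tau makes it generic. *)
have [d d0 hd] := small tau; pose s := Num.min d (th + pi - tau) / 2.
have e0 : 0 < th + pi - tau by lra.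
have m0 : 0 < Num.min d (th + pi - tau) by rewrite lt_min d0.
have s0 : 0 < s by rewrite divr_gt0.
have sd : s < d by rewrite /s ltr_pdivrMr // (le_lt_trans (_ : _ <= d)) ?ge_min ?lexx // ltr_pMr // ltr1n.
have sp : s < th + pi - tau by rewrite /s ltr_pdivrMr // (le_lt_trans (_ : _ <= th + pi - tau)) ?ge_min ?lexx ?orbT // ltr_pMr // ltr1n.
exists (tau + s); split; last by rewrite /th in h1 sp *; apply/andP; split; lra.
  by move=> i j; apply: hd; rewrite gtr0_norm // s0.
move=> i j x cij; rewrite min_l ?max_r; [|lra|lra] => /andP[x1 x2].
have [xt|xt] := eqVneq x tau; first by rewrite xt c0.
rewrite -[x](subrKC tau); apply: hd; last exact: clN.
have xs : 0 < x - tau by rewrite subr_gt0 lt_neqAle eq_sym xt.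
by rewrite gtr0_norm // xs /=; lra.
Qed.

(** The modulus of each projection has a positive minimum on the compact interval, which leaves room
    for moving t. *)
Lemma near_clear n (u0 : 'I_n -> C) (t : 'rV[C]_n) (x y : R) (cl : rel 'I_n) : x <= y ->
  (forall a b z, cl a b -> x <= z <= y -> Re (gap u0 a b t * cis z) != 0) ->
  exists2 r : R, 0 < r & forall t', nr (t' - t) < r ->
    forall a b z, cl a b -> x <= z <= y -> Re (gap u0 a b t' * cis z) != 0.
Proof.
move=> xy h; have /choice [c hc] : forall p : 'I_n * 'I_n, exists c : R, 0 < c /\ (cl p.1 p.2 ->
    forall z, x <= z <= y -> c <= `|Re (gap u0 p.1 p.2 t * cis z)|).
  move=> [a b] /=; case E : (cl a b); last by exists 1.
  have cf : {within `[x, y], continuous (fun z => `|Re (gap u0 a b t * cis z)|)}.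
    apply: continuous_subspaceT => z; apply: (@continuous_comp _ _ _ (fun z => Re (gap u0 a b t * cis z)) Num.norm).
      exact: Re_cis_cont.
    exact: norm_continuous.
  have [c] := EVT_min xy cf; rewrite in_itv /= => cxy hm.
  exists `|Re (gap u0 a b t * cis c)|; rewrite normr_gt0 h //; split=> // _ z hz; exact: hm.
have [p|d d0 hd] := @fin_pos R _ c; first by have [] := hc p.
exists (d / 2) => [|t' tt a b z ab hz]; first by rewrite divr_gt0.
have h1 := gap_cont u0 a b d0 tt.
have h2 : `|Re (gap u0 a b t' * cis z) - Re (gap u0 a b t * cis z)| < d.
  by rewrite -ReB -mulrBl (le_lt_trans (nr_Re _)) // nrM nr_cis mulr1.
apply: contraTneq h2 => ->; rewrite sub0r normrN -leNgt.
exact: le_trans (hd (a, b)) ((hc (a, b)).2 ab z hz).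
Qed.

End Windows.

(** * Extension of the coefficients A_j beyond the polydisc *)

Section Coefficients.
Variable R : realType.
Local Notation C := R[i].
Local Notation Re := complex.Re.
Local Notation Im := complex.Im.

Lemma diff_entry (V : normedModType C) m n (f : V -> 'M[C]_(m, n)) t i j :
  differentiable f t -> differentiable (fun t => f t i j : C) t.
Proof. by move=> h; exact: (differentiable_comp h (differentiable_coord _ i j)). Qed.

Lemma diff_mx (V : normedModType C) m n (f : V -> 'M[C]_(m, n)) t :
  (forall i j, differentiable (fun t => f t i j : C) t) -> differentiable f t.
Proof.
move=> h; have -> : f = \sum_i \sum_j (fun t => f t i j *: (delta_mx i j : 'M[C]_(m, n))).
  apply/funext => y; rewrite [LHS]matrix_sum_delta fct_sumE; apply: eq_bigr => i _.
  by rewrite fct_sumE.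
apply: differentiable_sum => i; apply: differentiable_sum => j.
exact: differentiableZl.
Qed.

Lemma cexpMn (n : nat) (z : C) : cexp (n%:R * z) = cexp z ^+ n.
Proof.
elim: n => [|n IH]; first by rewrite mul0r cexp0.
by rewrite -natr1 mulrDl mul1r cexpD IH exprSr.
Qed.

Variables (n : nat) (A : C -> 'rV[C]_n -> 'M[C]_n) (N0 : R).
Local Notation V := 'rV[C]_n.
Variable U : set V.
Hypothesis N0_gt0 : 0 < N0.
Hypothesis holA : holo_on [set zt : C * V | N0%:C <= `|zt.1| /\ U zt.2] (fun zt => A zt.1 zt.2).

Lemma joint_hol2 (z0 : C) (t0 : V) (a b : 'I_n) : N0 <= nr z0 -> U t0 ->
  exists (r B : R) (h : C -> V -> C), [/\ 0 < r, hol2 [set z | nr (z - z0) < r] (nball t0 r) h,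
    forall z t, nr (z - z0) < r -> nball t0 r t -> nr (h z t) <= B &
    forall z t, nr (z - z0) < r -> nball t0 r t -> N0 <= nr z -> U t -> A z t a b = h z t].
Proof.
move=> Nz Ut; have [|g [dg gA]] := holA (x := (z0, t0)).
  by split=> //=; rewrite nrE lecR.
pose h z t := g (z, t) a b.
have d0 : differentiable (fun y : C * V => g y a b) (z0, t0) by apply: diff_entry; exact: nbhs_singleton dg.
have hb := near_nr_bound d0.
have hn : \forall y \near (z0, t0), [/\ differentiable g y, nr (g y a b) <= nr (g (z0, t0) a b) + 1 &
    ([set zt : C * V | N0%:C <= `|zt.1| /\ U zt.2] y -> A y.1 y.2 = g y)].
  by apply: filterS3 dg hb gA => y.
case: hn => -[P Q] /= [/nbhs_nrP[r1 r10 h1] /nbhs_nrP[r2 r20 h2]] PQ.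
have m0 : 0 < Num.min r1 r2 by rewrite lt_min r10.
have K z t : nr (z - z0) < Num.min r1 r2 -> nball t0 (Num.min r1 r2) t ->
    [/\ differentiable g (z, t), nr (h z t) <= nr (g (z0, t0) a b) + 1 &
    (N0%:C <= `|z| /\ U t -> A z t = g (z, t))].
  rewrite /nball /= !lt_min => /andP[/h1 Pz _] /andP[_ /h2 Qt].
  exact: (PQ (z, t) (conj Pz Qt)).
exists (Num.min r1 r2), (nr (g (z0, t0) a b) + 1), h; split=> //.
- split=> [t Nt z /= zz|z /= zz t Nt].
    have [dz _ _] := K z t zz Nt.
    apply/is_derive1_diffP; apply: (@differentiable_comp _ _ _ _ (fun z : C => (z, t)) (fun y => g y a b)).
      exact: differentiable_pair.
    exact: diff_entry.
  have [dz _ _] := K z t zz Nt.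
  apply: (@differentiable_comp _ _ _ _ (fun t : V => (z, t)) (fun y => g y a b)).
    exact: differentiable_pair.
  exact: diff_entry.
- by move=> z t zz Nt; have [_ h3 _] := K z t zz Nt.
- move=> z t zz Nt Nz' Ut'; have [_ _ ->] := K z t zz Nt => //.
  by split=> //; rewrite nrE lecR.
Qed.

(** Integrals run over |z| = 2 N0, in the coordinate w over the segment from [pt 0] to
    [pt (2 * pi)]; the series converges there with ratio 1/2. *)
Let rho := 2 * N0.
Let x := ln rho.
Let rho_gt0 : 0 < rho. Proof. by rewrite mulr_gt0. Qed.
Let ex : expR x = rho. Proof. by rewrite lnK // posrE. Qed.
Let pt (y : R) : C := x +i* y.
Let L : set C := half_plane 1 (ln N0).

Let L_pt y : L (pt y).
Proof. by rewrite /L /half_plane /= !mul1r mul0r subr0 ltr_ln ?posrE // /rho ltr_pMl // ltr1n. Qed.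

Let L_nr w : L w -> N0 < nr (cexp w).
Proof. by rewrite /L /half_plane /= mul1r nr_cexp => h; rewrite -[N0]lnK ?posrE // ltr_expR. Qed.

Lemma coef_cholo t a b : U t -> cholo L (fun w => A (cexp w) t a b).
Proof.
move=> Ut w Lw; have Nw := L_nr Lw.
have [r [B [h [r0 [h1 _] _ hA]]]] := joint_hol2 a b (ltW Nw) Ut.
have [|d hd] := h1 t (nball_center _ r0) (cexp w); first by rewrite /= subrr nr0.
have := @der_comp R (h ^~ t) (@cexp R) w _ _ (is_derive_cexp w) hd => he.
eexists; apply: is_derive_near he.
have /cvg_nrP /(_ _ r0)[e e0 he'] := is_derive1_continuous (is_derive_cexp w).
have [e2 e20 h2] := (half_plane_domain 1 (ln N0)).1 w Lw.
apply/nbhs_nrP; exists (Num.min e e2); first by rewrite lt_min e0.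
move=> y; rewrite lt_min => /andP[/he' y1 /h2 y2]; apply/esym/hA => //; first exact: nball_center.
exact: ltW (L_nr y2).
Qed.

(** A primitive of A z^(j-1) dz on the covering. It need not be periodic: its increment over one
    turn is 2 pi i times the coefficient of z^-j. *)
Definition is_coef_prim (Phi : C -> C) t a b (j : nat) :=
  forall w, L w -> is_derive w (1 : C) Phi (A (cexp w) t a b * cexp (j%:R * w)).

Lemma coef_prim t a b j : U t -> exists Phi, is_coef_prim Phi t a b j.
Proof.
move=> Ut; have ch : cholo L (fun w => A (cexp w) t a b * cexp (j%:R * w)).
  move=> w Lw; have [d hd] := coef_cholo a b Ut Lw.
  eexists; exact: der_mul hd (der_cexp (der_scale j%:R (der_id w))).
by eexists; exact: primitive (half_plane_domain 1 (ln N0)) ch (L_pt 0).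
Qed.

(** The circle is cut into arcs so short that one local extension of A serves on each. For t in U
    the pieces telescope to the increment of one primitive; for other t near t0 they define the
    extension. *)
Lemma coef_integral (t0 : V) (a b : 'I_n) : U t0 -> exists (r K : R) (g : nat -> V -> C),
  [/\ 0 < r, forall j, vholo (nball t0 r) (g j), forall j t, nball t0 r t -> nr (g j t) <= K * rho ^+ j &
  forall j t Phi, nball t0 r t -> U t -> is_coef_prim Phi t a b j -> g j t = Phi (pt (2 * pi)) - Phi (pt 0)].
Proof.
move=> Ut.
pose Q (y1 y2 : R) := exists (r K : R) (g : nat -> V -> C),
  [/\ 0 < r, forall j, vholo (nball t0 r) (g j), forall j t, nball t0 r t -> nr (g j t) <= K * rho ^+ j &
  forall j t Phi, nball t0 r t -> U t -> is_coef_prim Phi t a b j -> g j t = Phi (pt y2) - Phi (pt y1)].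
apply: (@itv_ind R Q 0 (2 * pi)); first by rewrite mulr_ge0 // pi_ge0.
- move=> y1 y2 y3 _ _ _ _ [r1 [K1 [g1 [r10 h1 b1 e1]]]] [r2 [K2 [g2 [r20 h2 b2 e2]]]].
  have s1 : nball t0 (Num.min r1 r2) `<=` nball t0 r1 by move=> y; rewrite /nball /= lt_min => /andP[].
  have s2 : nball t0 (Num.min r1 r2) `<=` nball t0 r2 by move=> y; rewrite /nball /= lt_min => /andP[].
  exists (Num.min r1 r2), (K1 + K2), (fun j t => g1 j t + g2 j t); split.
  + by rewrite lt_min r10.
  + by move=> j t Nt; apply: diff_addC; [exact: vholo_sub s1 (h1 j) _ Nt|exact: vholo_sub s2 (h2 j) _ Nt].
  + by move=> j t Nt; rewrite mulrDl (le_trans (nrD _ _)) // lerD ?b1 ?b2 //; [exact: s1|exact: s2].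
  + move=> j t Phi Nt Ut' hP; rewrite (e1 j t Phi (s1 _ Nt) Ut' hP) (e2 j t Phi (s2 _ Nt) Ut' hP).
    by rewrite addrC addrA subrK.
- move=> y0 _; have Nw := L_nr (L_pt y0).
  have [r [B [h [r0 [h1 h2] hB hA]]]] := joint_hol2 a b (ltW Nw) Ut.
  have /cvg_nrP /(_ _ r0)[e e0 he] := is_derive1_continuous (is_derive_cexp (pt y0)).
  have ptB y y' : pt y - pt y' = 0 +i* (y - y') by rewrite /pt; apply/eqP; rewrite eq_complex /=; apply/andP; split; apply/eqP; ring.
  have nri y : nr (0 +i* y : C) = `|y|.
    apply/le_anti; rewrite (le_trans (nr_ReIm _)) /= ?normr0 ?add0r //.
    exact: (nr_Im (0 +i* y)).
  have sE y1 y2 s : seg (pt y1) (pt y2) s = pt (y1 + s * (y2 - y1)).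
    rewrite /seg ptB /pt; apply/eqP; rewrite eq_complex /=; apply/andP; split; apply/eqP; ring.
  have e20 : 0 < e / 2 by rewrite divr_gt0.
  exists (e / 2) => // y1 y2 y10 y12 y2p yy1 yy2.
  have B0 : 0 <= B.
    by apply: le_trans (nr_ge0 _) (hB (cexp (pt y0)) t0 _ (nball_center _ r0)); rewrite subrr nr0.
  have close s w : 0 <= s <= 1 -> nr (w - seg (pt y1) (pt y2) s) < e / 2 -> nr (w - pt y0) < e.
    move=> /andP[s0 s1] h3; rewrite (le_lt_trans (nr_subD (seg (pt y1) (pt y2) s) _ _)) //.
    have : nr (seg (pt y1) (pt y2) s - pt y0) < e / 2.
      rewrite sE ptB nri ltr_distl; have p1 : 0 <= s * (y2 - y1) by rewrite mulr_ge0 // subr_ge0.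
      have p2 : s * (y2 - y1) <= y2 - y1 by rewrite ler_piMl // subr_ge0.
      by apply/andP; split; lra.
    lra.
  have on s : 0 <= s <= 1 -> nr (cexp (seg (pt y1) (pt y2) s) - cexp (pt y0)) < r.
    by move=> hs; apply: he; apply: (close s) => //; rewrite subrr nr0.
  pose f (j : nat) w t := h (cexp w) t * cexp (j%:R * w).
  have cs j t : nball t0 r t -> cont_seg (f j ^~ t) (pt y1) (pt y2).
    move=> Nt; apply: cont_seg_cont => s hs.
    have [d hd] := h1 t Nt _ (on s hs).
    exact: is_derive1_continuous (der_mul (@der_comp R (h ^~ t) (@cexp R) _ _ _ (is_derive_cexp _) hd)
      (der_cexp (der_scale j%:R (der_id _)))).
  have nj j y : nr (cexp (j%:R * pt y)) = rho ^+ j by rewrite cexpMn nrX nr_cexp /= ex.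
  exists r, (B * e), (fun j t => segint (f j ^~ t) (pt y1) (pt y2)); split; first exact: r0.
  + move=> j; apply: (@segint_vholo _ _ (nball t0 r) (f j) (pt y1) (pt y2) (e / 2) (B * expR (x + e) ^+ j)) => //.
    * exact: nball_open.
    * move=> s hs t Nt; apply: diff_mulC; last exact: diff_cstC.
      exact: h2 (on s hs) t Nt.
    * move=> t s z Nt hs zs; have zc := he _ (close s z hs zs).
      have [d hd] := h1 t Nt _ zc; split.
        eexists; exact: (der_mul (@der_comp R (h ^~ t) (@cexp R) _ _ _ (is_derive_cexp _) hd)
          (der_cexp (der_scale j%:R (der_id _)))).
      rewrite nrM; apply: ler_pM; rewrite ?nr_ge0 ?hB //.
      rewrite cexpMn nrX nr_cexp lerXn2r ?nnegrE ?expR_ge0 // ler_expR.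
      have := le_lt_trans (nr_Re _) (close s z hs zs); rewrite ReB /= => /(le_lt_trans (ler_norm _)); lra.
  + move=> j t Nt; apply: (le_trans (segint_le (K := B * rho ^+ j) (cs j t Nt) _)).
      move=> s hs; rewrite nrM; apply: ler_pM; rewrite ?nr_ge0 //; first by apply: hB => //; exact: on.
      by rewrite sE nj.
    rewrite ptB nri ger0_norm ?subr_ge0 //.
    rewrite -mulrA [_ ^+ j * _]mulrC mulrA; apply: ler_wpM2r; first by rewrite exprn_ge0 // ltW.
    by apply: ler_wpM2l => //; lra.
  + move=> j t Phi Nt Ut' hP; apply: segint_ftc; first exact: cs.
    move=> s hs; have := hP _ (L_pt (y1 + s * (y2 - y1))); rewrite -sE.
    have Nn : N0 <= nr (cexp (seg (pt y1) (pt y2) s)) by rewrite sE; exact: ltW (L_nr (L_pt _)).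
    by rewrite (hA _ t (on s hs) Nt Nn Ut').
Qed.

Variable A_ : nat -> V -> 'M[C]_n.
Hypothesis serA : forall z t, N0%:C <= `|z| -> U t -> series (fun j => z ^- j *: A_ j t) @ \oo --> A z t.

Lemma series_entry (z : C) t a b : N0 <= nr z -> U t ->
  (\sum_(j < k) A_ j t a b * z ^- j) @[k --> \oo] --> A z t a b.
Proof.
move=> Nz Ut; have /cvgn_nrP h : series (fun j => z ^- j *: A_ j t) @ \oo --> A z t by apply: serA; rewrite // nrE lecR.
apply/cvgn_nrP => e /h[k0 hk]; exists k0 => k /hk; apply: le_lt_trans.
apply: le_trans (nr_entry _ a b); rewrite /series /= !mxE summxE big_mkord.
have -> // : \sum_(i < k) (z ^- i *: A_ i t) a b = \sum_(j < k) A_ j t a b * z ^- j.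
by apply: eq_bigr => j _; rewrite mxE mulrC.
Qed.

Lemma coef_bound t a b : U t -> exists M, 0 <= M /\ forall j, nr (A_ j t a b) <= M * N0 ^+ j.
Proof.
move=> Ut; have nN : nr (N0%:C : C) = N0 by rewrite nr_real // ltW.
have /cvgn_nrP /(_ 1 ltr01)[k0 hk] := @series_entry N0%:C t a b (eq_ind _ (fun y => N0 <= y) (lexx _) _ (esym nN)) Ut.
have [B [B0 hB]] := fin_bound (fun j : 'I_k0 => nr (A_ j t a b) / N0 ^+ j).
(* From index k0 on a term is the difference of two partial sums, each within 1 of the limit. *)
exists (B + 2); split=> [|j]; first exact: addr_ge0.
have Nj : 0 < N0 ^+ j by rewrite exprn_gt0.
rewrite -ler_pdivrMr //; have [jk|jk] := ltnP j k0.
  by rewrite (le_trans (hB (Ordinal jk))) // lerDl.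
have h1 := hk j jk; have h2 := hk j.+1 (leqW jk).
have E : nr (A_ j t a b) / N0 ^+ j = nr ((\sum_(i < j.+1) A_ i t a b * (N0%:C : C) ^- i - A N0%:C t a b) -
   (\sum_(i < j) A_ i t a b * (N0%:C : C) ^- i - A N0%:C t a b)).
  rewrite big_ord_recr /= opprD addrACA subrr addr0 addrAC subrr add0r.
  by rewrite nrM nrV nrX nN.
rewrite E (le_trans (nrB _ _)) //; lra.
Qed.

Lemma coef_residue t a b j Phi : U t -> is_coef_prim Phi t a b j ->
  Phi (pt (2 * pi)) - Phi (pt 0) = A_ j t a b * (0 +i* (2 * pi)).
Proof.
move=> Ut hP; set p : C := 0 +i* (2 * pi).
have [M [M0 hM]] := coef_bound a b Ut.
pose c l := A_ l t a b.
(* A primitive of e^((j - l) w), periodic unless l = j: only the j-th coefficient contributes to the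
   increment. *)
pose ph (l : nat) (w : C) : C := if l == j then w else cexp ((j%:R - l%:R) * w) / (j%:R - l%:R).
have dph l w : is_derive w (1 : C) (ph l) (cexp (j%:R * w) * cexp w ^- l).
  have -> : cexp (j%:R * w) * cexp w ^- l = cexp ((j%:R - l%:R) * w).
    by rewrite mulrBl cexpD cexpN !cexpMn.
  rewrite /ph; have [->|lj] := eqVneq l j; first by rewrite subrr mul0r cexp0; exact: der_id.
  have q0 : j%:R - l%:R != 0 :> C by rewrite subr_eq0 eqr_nat eq_sym.
  have := der_scale (j%:R - l%:R)^-1 (der_cexp (der_scale (j%:R - l%:R) (der_id w))).
  rewrite mulr1 mulrA mulVf // mul1r => h; apply: is_derive_near h; near=> y.
  by rewrite mulrC.
have ptE : pt (2 * pi) = pt 0 + p by rewrite /pt /p; simpc.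
have Dph l : ph l (pt (2 * pi)) - ph l (pt 0) = if l == j then p else 0.
  rewrite /ph; case: eqVneq => [_|lj]; first by rewrite ptE addrC addKr.
  have -> : cexp ((j%:R - l%:R) * pt (2 * pi)) = cexp ((j%:R - l%:R) * pt 0); last by rewrite subrr.
  have cp : cexp ((j%:R - l%:R) * p) = 1 by rewrite mulrBl cexpD cexpN !cexpMn /p cexp2pi !expr1n divr1.
  by rewrite ptE mulrDr cexpD cp mulr1.
have key J : (j < J)%N -> nr (Phi (pt (2 * pi)) - Phi (pt 0) - c j * p) <=
    (rho ^+ j * (2 * M * 2 ^- J)) * nr p.
  move=> jJ; pose Psi w := Phi w - \sum_(l < J) c l * ph l w.
  have -> : Phi (pt (2 * pi)) - Phi (pt 0) - c j * p = Psi (pt (2 * pi)) - Psi (pt 0).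
    rewrite /Psi.
    have -> : c j * p = \sum_(l < J) (c l * ph l (pt (2 * pi)) - c l * ph l (pt 0)).
      rewrite (bigD1 (Ordinal jJ)) //= big1 => [|l lj]; first by rewrite -mulrBr Dph eqxx addr0.
      by rewrite -mulrBr Dph ifN ?mulr0.
    rewrite sumrB; ring.
  have pE : p = pt (2 * pi) - pt 0 by rewrite ptE addrC addKr.
  rewrite [in X in _ <= X]pE.
  apply: (@mean_value_segment R Psi (fun w => A (cexp w) t a b * cexp (j%:R * w) -
     \sum_(l < J) c l * (cexp (j%:R * w) * cexp w ^- l))).
    move=> s _; have sE : pt 0 + s%:C * (pt (2 * pi) - pt 0) = pt (s * (2 * pi)).
      by rewrite /pt; apply/eqP; rewrite eq_complex /=; apply/andP; split; apply/eqP; ring.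
    rewrite sE; apply: der_sub; first exact: hP.
    by apply: der_sum => l; exact: der_scale.
  move=> s _; have sE : pt 0 + s%:C * (pt (2 * pi) - pt 0) = pt (s * (2 * pi)).
    by rewrite /pt; apply/eqP; rewrite eq_complex /=; apply/andP; split; apply/eqP; ring.
  rewrite sE; set w := pt _.
  have -> : A (cexp w) t a b * cexp (j%:R * w) - \sum_(l < J) c l * (cexp (j%:R * w) * cexp w ^- l) =
     cexp (j%:R * w) * (A (cexp w) t a b - \sum_(l < J) c l * cexp w ^- l).
    rewrite mulrBr mulr_sumr mulrC; congr (_ - _); apply: eq_bigr => l _; ring.
  have nw : nr (cexp w) = rho by rewrite nr_cexp /w /= ex.
  rewrite nrM cexpMn nrX nw; apply: ler_wpM2l; first by rewrite exprn_ge0 // ltW.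
  have Nw : N0 <= nr (cexp w) by rewrite nw /rho ler_peMl ?(ltW N0_gt0) // ler1n.
  have h1 := @cvgn_nrB R _ (fun=> \sum_(l < J) c l * cexp w ^- l) _ _ (@series_entry (cexp w) t a b Nw Ut) (@cvgn_cst _ (\sum_(l < J) c l * cexp w ^- l)).
  apply: (cvgn_nr_le h1); exists J => k Jk.
  suff geo i : nr (\sum_(l < J + i) c l * cexp w ^- l - \sum_(l < J) c l * cexp w ^- l) <= 2 * M * (2 ^- J - 2 ^- (J + i)).
    rewrite -(subnKC Jk); apply: (le_trans (geo _)); rewrite ler_wpM2l ?mulr_ge0 //.
    by rewrite gerBl invr_ge0 exprn_ge0.
  elim: i => [|i IH]; first by rewrite addn0 !subrr nr0 mulr0.
  rewrite addnS big_ord_recr addrAC (le_trans (nrD _ _)) //=.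
  have tm : nr (c (J + i)%N * cexp w ^- (J + i)) <= M * 2 ^- (J + i).
    rewrite nrM nrV nrX nw ler_pdivrMr ?exprn_gt0 // /rho exprMn -mulrA mulKf ?expf_neq0 //.
    exact: hM.
  apply: (le_trans (lerD IH tm)).
  have -> : 2 ^- (J + i).+1 = 2 ^- (J + i) / 2 :> R by rewrite exprSr invfM.
  by move: (2 ^- J : R) (2 ^- (J + i) : R) => u v; lra.
apply/eqP; rewrite -subr_eq0 -nr_eq0; apply/eqP/le_anti; rewrite nr_ge0 andbT.
apply/ler_addgt0Pr => e e0; rewrite add0r.
pose k := rho ^+ j * (2 * M) * nr p + 1.
have kk0 : 0 <= rho ^+ j * (2 * M) * nr p.
  by rewrite mulr_ge0 ?nr_ge0 // mulr_ge0 ?mulr_ge0 ?exprn_ge0 // ltW.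
have k0 : 0 < k by rewrite ltr_wpDl.
have [J hJ] := exists_2expn (divr_gt0 e0 k0).
have h := key (maxn J j.+1) (leq_maxr _ _); apply: (le_trans h).
have : 2 ^- maxn J j.+1 <= 2 ^- J :> R by rewrite lef_pV2 ?posrE ?exprn_gt0 // ler_eXn2l ?leq_maxl // ltr1n.
have : 0 <= 2 ^- maxn J j.+1 :> R by rewrite invr_ge0 exprn_ge0.
move: hJ; rewrite ltr_pdivlMr // /k; move: kk0; clear.
have -> : rho ^+ j * (2 * M / 2 ^+ maxn J j.+1) * nr p = rho ^+ j * (2 * M) * nr p * 2 ^- maxn J j.+1 by ring.
move: (rho ^+ j * (2 * M) * nr p) (2 ^- J : R) (2 ^- maxn J j.+1 : R) => y u v y0 h1 v0 vu.
by apply: le_trans (ltW h1); rewrite [leRHS]mulrC; apply: ler_pM => //; rewrite lerDl.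
Unshelve. all: by end_near.
Qed.

(** The A_j are given pointwise, as coefficients of a series on the closed polydisc. The integral
    formula makes them restrictions of holomorphic functions with Cauchy bounds. *)
Lemma coef_ext (t0 : V) : U t0 -> exists (r K : R) (g : nat -> 'I_n -> 'I_n -> V -> C),
  [/\ 0 < r, forall j a b, vholo (nball t0 r) (g j a b),
    forall j a b t, nball t0 r t -> nr (g j a b t) <= K * rho ^+ j &
    forall j a b t, nball t0 r t -> U t -> A_ j t a b = g j a b t].
Proof.
move=> Ut; set p : C := 0 +i* (2 * pi).
have p0 : p != 0.
  by rewrite /p eq_complex /= eqxx /= mulf_neq0 // gt_eqF // pi_gt0.
have /choice [r /choice [K /choice [g Hg]]] : forall q : 'I_n * 'I_n, exists (r K : R) (g : nat -> V -> C),
  [/\ 0 < r, forall j, vholo (nball t0 r) (g j), forall j t, nball t0 r t -> nr (g j t) <= K * rho ^+ j &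
  forall j t Phi, nball t0 r t -> U t -> is_coef_prim Phi t q.1 q.2 j -> g j t = Phi (pt (2 * pi)) - Phi (pt 0)].
  by move=> q; exact: coef_integral.
have [q|r' r0 hr] := @fin_pos R _ r; first by have [] := Hg q.
have [K' [K0 hK]] := fin_bound K.
have sub q : nball t0 r' `<=` nball t0 (r q) by move=> t h; exact: lt_le_trans h (hr q).
exists r', (K' / nr p), (fun j a b t => g (a, b) j t / p); split=> //.
- move=> j a b t Nt; apply: diff_mulC; last exact: diff_cstC.
  by have [_ h _ _] := Hg (a, b); apply: h; exact: sub Nt.
- move=> j a b t Nt; have [_ _ h _] := Hg (a, b).
  rewrite nrM nrV mulrAC ler_wpM2r ?invr_ge0 ?nr_ge0 //.
  apply: le_trans (h j t (sub _ _ Nt)) _; rewrite ler_wpM2r ?exprn_ge0 ?(ltW rho_gt0) //.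
- move=> j a b t Nt Ut'; have [Phi hP] := coef_prim a b j Ut'.
  have [_ _ _ h] := Hg (a, b).
  by rewrite (h j t Phi (sub _ _ Nt) Ut' hP) (coef_residue Ut' hP) mulfK.
Qed.

End Coefficients.

(** * Local transfer matrices depending holomorphically on t *)

Section Picard.
Variable R : realType.
Local Notation C := R[i].
Local Notation Re := complex.Re.
Local Notation Im := complex.Im.
Variable V : normedModType C.

(** Each term of the series is driven by the preceding one, so the partial sums solve the equation
    up to a shift of index, which disappears in the limit. *)
Lemma iterate_sum n (H : set C) (N : set V) (q : 'I_n -> V -> C) (P : 'I_n -> 'I_n -> C -> V -> C)
    (h : 'I_n -> C -> V -> C) (D : nat -> 'I_n -> C -> V -> C) (W : C -> R) (B : R) :
  vopen (H : set C) -> vopen N -> (forall k a, hol2 H N (D k a)) ->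
  (forall k a z t, H z -> N t -> nr (D k a z t) <= 2 ^- k * W z) ->
  (forall z, H z -> 0 <= W z <= B) ->
  (forall a z t, H z -> N t -> is_derive z (1 : C) (D 0%N a ^~ t) (q a t * D 0%N a z t + h a z t)) ->
  (forall k a z t, H z -> N t -> is_derive z (1 : C) (D k.+1 a ^~ t)
    (q a t * D k.+1 a z t + \sum_d P a d z t * D k d z t)) ->
  exists s : 'I_n -> C -> V -> C, [/\ forall a, hol2 H N (s a),
    forall a z t, H z -> N t -> is_derive z (1 : C) (s a ^~ t)
      (q a t * s a z t + (\sum_d P a d z t * s d z t + h a z t)),
    forall a z t, H z -> N t -> nr (s a z t) <= 2 * W z &
    forall a z t, H z -> N t -> (\sum_(i < k) D i a z t) @[k --> \oo] --> s a z t].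
Proof.
move=> oH oN hD DW WB D0 DS'.
have W0 z : H z -> 0 <= W z by move=> /WB /andP[].
have p2 j : 0 <= 2 ^- j :> R by rewrite invr_ge0 exprn_ge0.
pose S k a z t := \sum_(i < k) D i a z t.
have SE k a z t : S k.+1 a z t = S k a z t + D k a z t by rewrite /S big_ord_recr.
have geo k j a z t : H z -> N t -> nr (S (k + j)%N a z t - S k a z t) <= 2 * (2 ^- k - 2 ^- (k + j)) * W z.
  move=> Hz Nt; elim: j => [|j IH].
    by rewrite addn0 !subrr nr0 mulr0 mul0r.
  rewrite addnS SE addrAC (le_trans (nrD _ _)) //.
  apply: (le_trans (lerD IH (DW (k + j)%N a z t Hz Nt))); rewrite [2 ^+ (k + j).+1]exprSr invfM.
  by move: (2 ^- k : R) (2 ^- (k + j) : R) (W z) => u v y; lra.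
have geo2 k k' a z t : (k <= k')%N -> H z -> N t -> nr (S k' a z t - S k a z t) <= 2 * 2 ^- k * W z.
  move=> kk Hz Nt; rewrite -(subnKC kk); apply: (le_trans (geo _ _ _ _ _ Hz Nt)).
  by rewrite ler_wpM2r ?W0 // ler_wpM2l // gerBl p2.
have small c' : 0 <= c' -> forall e' : R, 0 < e' -> exists k0, forall k, (k0 <= k)%N -> 2 * 2 ^- k * c' <= e'.
  move=> c'0 e' e'0; have k0 : 0 < 2 * c' + 1 by rewrite ltr_wpDl // mulr_ge0.
  have [k0' hk] := exists_2expn (divr_gt0 e'0 k0); exists k0' => k kk.
  have : 2 ^- k <= 2 ^- k0' :> R by rewrite lef_pV2 ?posrE ?exprn_gt0 // ler_eXn2l // ltr1n.
  move=> /le_lt_trans /(_ hk); rewrite ltr_pdivlMr // => /ltW; apply: le_trans.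
  by have := p2 k; nra.
have /choice [s Hs] : forall p : 'I_n * C * V, exists l : C, H p.1.2 -> N p.2 ->
    S k p.1.1 p.1.2 p.2 @[k --> \oo] --> l.
  move=> [[a z] t] /=.
  have [[Hz Nt]|nH] := pselect (H z /\ N t); last by exists 0 => Hz Nt; exfalso; apply: nH.
  have [|l hl] := @ccauchy_cvg R (fun k => S k a z t); last by exists l.
  move=> e' e'0; have e4 : 0 < e' / 4 by rewrite divr_gt0.
  have [k0 hk] := small _ (W0 z Hz) _ e4; exists k0 => k k' kk kk'.
  rewrite (le_lt_trans (nr_subD (S k0 a z t) _ _)) // [X in _ + X]nr_dist.
  have := geo2 _ _ a z t kk Hz Nt; have := geo2 _ _ a z t kk' Hz Nt.
  have := hk k0 (leqnn _); lra.
have sS a k z t : H z -> N t -> nr (s (a, z, t) - S k a z t) <= 2 * 2 ^- k * W z.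
  move=> Hz Nt.
  have h1 := @cvgn_nrB R _ (fun=> S k a z t) _ _ (Hs (a, z, t) Hz Nt) (@cvgn_cst _ _).
  by apply: (cvgn_nr_le h1); exists k => k' kk; exact: geo2.
have hS k a : hol2 H N (S k a) by apply: hol2_sum => i; exact: hD.
have DS k a z t : H z -> N t -> is_derive z (1 : C) (S k.+1 a ^~ t)
    (q a t * S k.+1 a z t + (\sum_d P a d z t * S k d z t + h a z t)).
  move=> Hz Nt; elim: k => [|k IH].
    have E1 : S 1%N a ^~ t = D 0%N a ^~ t by apply/funext => y; rewrite /S big_ord1.
    have E2 y : S 1%N a y t = D 0%N a y t by rewrite /S big_ord1.
    rewrite E1 E2 big1 ?add0r; first exact: D0.
    by move=> d _; rewrite /S big_ord0 mulr0.
  have E1 : S k.+2 a ^~ t = (fun y => S k.+1 a y t + D k.+1 a y t) by apply/funext => y; rewrite SE.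
  rewrite E1; apply: der_eq (der_add IH (DS' k a z t Hz Nt)) _.
  have -> : \sum_d P a d z t * S k.+1 d z t =
      \sum_d P a d z t * S k d z t + \sum_d P a d z t * D k d z t.
    by rewrite -big_split; apply: eq_bigr => d _; rewrite SE mulrDr.
  by rewrite (SE k.+1); ring.
have Ds a z t : H z -> N t -> is_derive z (1 : C) (fun z => s (a, z, t))
    (q a t * s (a, z, t) + (\sum_d P a d z t * s (d, z, t) + h a z t)).
  move=> Hz Nt; have [r r0 Hr] := oH z Hz.
  have B0 : 0 <= B by have /andP[w0 wB] := WB z Hz; exact: le_trans wB.
  apply: (@weierstrass1 R (fun k => S k.+1 a ^~ t)
    (fun k y => q a t * S k.+1 a y t + (\sum_d P a d y t * S k d y t + h a y t)) _ z _ r r0).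
  - by move=> k y /Hr Hy; exact: DS.
  - move=> e' e'0; have [k0 hk] := small _ B0 _ e'0; exists k0 => k u kk /Hr Hu.
    rewrite nr_dist (le_trans (sS _ _ _ _ Hu Nt)) // (le_trans _ (hk k.+1 _)) //; last exact: leqW.
    by rewrite ler_wpM2l ?mulr_ge0 //; have /andP[] := WB u Hu.
  - apply: cvgn_nrD.
      by apply: cvgn_nrZ; have := Hs (a, z, t) Hz Nt; rewrite /= -cvg_shiftS.
    apply: cvgn_nrD; last exact: cvgn_cst.
    by apply: cvgn_sumZ => d; exact: (Hs (d, z, t)).
exists (fun a z t => s (a, z, t)); split; [|exact: Ds| |by move=> a z t Hz Nt; exact: Hs].
- move=> a; split=> [t Nt z Hz|z Hz]; first by eexists; exact: Ds.
  apply: (@vholo_lim _ _ (fun k t => S k a z t)) => //; first by move=> k; exact: (hS k a).2.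
  move=> e' e'0; have [k0 hk] := small _ (W0 z Hz) _ e'0; exists k0 => k t kk Nt.
  by rewrite nr_dist (le_trans (sS _ _ _ _ Hz Nt)) // hk.
- move=> a z t Hz Nt; have := sS a 0%N z t Hz Nt.
  by rewrite /S big_ord0 subr0 expr0 invr1 mulr1.
Qed.

(** Two points of the disc are at most 2 e apart, so each integration from w1 halves the bound. The
    iteration starts from the unit vectors and all further terms vanish at w1. *)
Lemma picard n (w0 : C) (e K : R) (N : set V) (a : 'I_n -> 'I_n -> C -> V -> C) (w1 : C) :
  0 < e -> 0 <= K -> vopen N -> (forall i d, hol2 [set w | nr (w - w0) < e] N (a i d)) ->
  (forall i d w t, nr (w - w0) < e -> N t -> nr (a i d w t) <= K) ->
  n%:R * K * (2 * e) <= 2^-1 -> nr (w1 - w0) < e ->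
  exists s : 'I_n -> 'I_n -> C -> V -> C, [/\ forall i j, hol2 [set w | nr (w - w0) < e] N (s i j),
    forall i j w t, nr (w - w0) < e -> N t ->
      is_derive w (1 : C) (s i j ^~ t) (\sum_d a i d w t * s d j w t) &
    forall i j t, N t -> s i j w1 t = (i == j)%:R].
Proof.
move=> e0 K0 oN ha aK small hw1; pose H : set C := [set w | nr (w - w0) < e].
have dH : cvx_domain H := ball_domain w0 e.
have cH := cvx_domain_convex dH.
have oH : vopen (H : set C) by move=> z /(dH.1)[r r0 hr]; exists r.
suff /choice [s Hs] : forall j : 'I_n, exists s : 'I_n -> C -> V -> C, [/\ forall i, hol2 H N (s i),
    forall i w t, H w -> N t -> is_derive w (1 : C) (s i ^~ t) (\sum_d a i d w t * s d w t) &
    forall i t, N t -> s i w1 t = (i == j)%:R].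
  by exists (fun i j => s j i); split=> [i j|i j w t Hw Nt|i j t Nt]; have [h1 h2 h3] := Hs j; [exact: h1|exact: h2|exact: h3].
move=> j.
pose Bd (X : R) (d : 'I_n -> C -> V -> C) := (forall i, hol2 H N (d i)) /\
  forall i w t, H w -> N t -> nr (d i w t) <= X.
have step (p : ('I_n -> C -> V -> C) * R) : exists d' : 'I_n -> C -> V -> C, 0 <= p.2 -> Bd p.2 p.1 ->
    [/\ Bd (p.2 / 2) d', forall i w t, H w -> N t -> is_derive w (1 : C) (d' i ^~ t) (\sum_d a i d w t * p.1 d w t) &
    forall i t, N t -> d' i w1 t = 0].
  case: p => d X /=.
  have [[X0 [hd dX]]|nX] := pselect (0 <= X /\ Bd X d); last first.
    by exists d => X0 Hd; exfalso; apply: nX.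
  have sK i w t : H w -> N t -> nr (\sum_d0 a i d0 w t * d d0 w t) <= n%:R * (K * X).
    move=> Hw Nt; rewrite (le_trans (nr_sum _ _ _)) //; apply: ler_sum_ord => l.
    by rewrite nrM ler_pM ?nr_ge0 ?aK ?dX.
  have /choice [y Hy] : forall i, exists y : C -> V -> C, [/\ hol2 H N y,
      forall w t, H w -> N t -> is_derive w (1 : C) (y ^~ t) (\sum_d0 a i d0 w t * d d0 w t) &
      forall t, N t -> y w1 t = 0].
    move=> i; have hg : hol2 H N (fun w t => \sum_d0 a i d0 w t * d d0 w t).
      by apply: hol2_sum => l; apply: hol2_mul; [exact: ha|exact: hd].
    have [|y [y1 y2]] := hol2_primitive dH oN hw1 hg.
      by move=> M0; exists (n%:R * (K * X)) => w t Hw _ Nt; exact: sK.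
    exists (fun w t => y w t - y w1 t); split.
    - split=> [t Nt w Hw|w Hw t Nt]; first by eexists; exact: der_sub (y2 w t Hw Nt) (der_cst _ _).
      by apply: diff_subC; [exact: y1|exact: y1].
    - by move=> w t Hw Nt; apply: der_eq (der_sub (y2 w t Hw Nt) (der_cst _ _)) _; rewrite subr0.
    - by move=> t _; rewrite subrr.
  exists y => _ _; split; [split| |].
  - by move=> i; have [] := Hy i.
  - move=> i w t Hw Nt; have [_ dy y0] := Hy i.
    have Hseg s : 0 <= s <= 1 -> H (w1 + s%:C * (w - w1)) by move=> hs; exact: cH.
    have := @mean_value_segment R (y i ^~ t) (fun w => \sum_d0 a i d0 w t * d d0 w t) w1 w (n%:R * (K * X)).
    rewrite y0 // subr0 => /(_ (fun s hs => dy _ t (Hseg s hs) Nt) (fun s hs => sK i _ t (Hseg s hs) Nt)) /le_trans; apply.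
    have ww : nr (w - w1) <= 2 * e.
      by rewrite (le_trans (nr_subD w0 _ _)) // [X in _ + X]nr_dist; move: Hw; rewrite /H /=; lra.
    apply: (@le_trans _ _ (n%:R * (K * X) * (2 * e))); first by rewrite ler_wpM2l // mulr_ge0 // mulr_ge0.
    have -> : n%:R * (K * X) * (2 * e) = X * (n%:R * K * (2 * e)) by ring.
    exact: ler_wpM2l.
  - by move=> i w t Hw Nt; have [_ dy _] := Hy i; exact: dy.
  - by move=> i t Nt; have [_ _ y0] := Hy i; exact: y0.
have /choice [stp Hstp] := step.
pose d0 := fun (i : 'I_n) (_ : C) (_ : V) => (i == j)%:R : C.
pose D := fix D i := if i is l.+1 then stp (D l, 2 ^- l) else d0.
have p2 l : 0 <= 2 ^- l :> R by rewrite invr_ge0 exprn_ge0.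
have HD l : Bd (2 ^- l) (D l).
  elim: l => [|l IH]; last by have [] := Hstp (D l, 2 ^- l) (p2 l) IH; rewrite /= exprSr invfM.
  rewrite expr0 invr1; split=> [i|i w t _ _]; first exact: hol2_cst.
  by rewrite /= /d0; case: (i == j); rewrite ?nr1 ?nr0.
have HS l := Hstp (D l, 2 ^- l) (p2 l) (HD l).
have [|||||s [s1 s2 _ s4]] := @iterate_sum n H N (fun _ _ => 0) a (fun _ _ _ => 0) D (fun _ => 1) 1 oH oN.
- by move=> l i; have [h _] := HD l; exact: h.
- by move=> l i w t Hw Nt; rewrite mulr1; have [_ h] := HD l; exact: h.
- by rewrite ler01 lexx.
- by move=> i w t _ _; rewrite mul0r addr0; exact: der_cst.
- by move=> l i w t Hw Nt; rewrite mul0r add0r; have [_ h _] := HS l; exact: h.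
exists s; split=> [i|i w t Hw Nt|i t Nt]; first exact: s1.
  by apply: der_eq (s2 i w t Hw Nt) _; rewrite mul0r add0r addr0.
have c1 := s4 i w1 t hw1 Nt.
have c2 : (\sum_(l < k) D l i w1 t) @[k --> \oo] --> ((i == j)%:R : C).
  apply/cvgn_nrP => x x0; exists 1%N => -[//|k] _.
  rewrite big_ord_recl big1 => [|l _]; last by have [_ _ h] := HS l; exact: h.
  by rewrite addr0 /= /d0 subrr nr0.
exact: cvgn_nr_unique c1 c2.
Qed.

End Picard.

(** * The given system at points of cells and near points of the polydisc *)

Section Main.
Variable R : realType.
Local Notation C := R[i].
Local Notation Re := complex.Re.
Local Notation Im := complex.Im.
Variable n : nat.
Local Notation V := 'rV[C]_n.
Variables (A : C -> V -> 'M[C]_n) (A_ : nat -> V -> 'M[C]_n) (G0 : V -> 'M[C]_n)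
  (u0 : 'I_n -> C) (N0 eps0 tau : R) (F : nat -> V -> 'M[C]_n)
  (Y : set V -> int -> C -> V -> 'M[C]_n) (St : set V -> int -> V -> 'M[C]_n).
Let U : set V := polydisc eps0.
Let D : set V := U `\` coalescence u0 eps0.
Let isCell := cell u0 eps0 tau.
Hypotheses (N0_gt0 : 0 < N0) (eps0_gt0 : 0 < eps0)
  (holA : holo_on [set zt : C * V | N0%:C <= `|zt.1| /\ U zt.2] (fun zt => A zt.1 zt.2))
  (serA : forall z t, N0%:C <= `|z| -> U t -> series (fun j => z ^- j *: A_ j t) @ \oo --> A z t)
  (holG : holo_on U G0)
  (G0u : forall t, U t -> G0 t \in unitmx)
  (diagA : forall t, U t -> invmx (G0 t) *m A_ 0%N t *m G0 t = Lambda u0 t)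
  (heps : forall a b : 'I_n, u0 a != u0 b -> eps0 < half_dist_line (u0 a - u0 b) (eta_tilde tau))
  (formal : forall t, D t -> formal_solution A_ G0 u0 F t)
  (hY : forall c k, isCell c ->
     (forall w, N0 <= expR (Re w) -> holo_on c (Y c k w)) /\
     (forall t, c t ->
        fundamental_solution (A ^~ t) N0 (Y c k ^~ t) /\
        asymptotic (sector (stokes_directions u0 t) tau k)
          (normalized A_ G0 u0 t (Y c k ^~ t)) (F ^~ t)))
  (hSt : forall c k w t, isCell c -> N0 <= expR (Re w) -> c t ->
     Y c (k + 1) w t = Y c k w t *m St c k t)
  (van : forall c t (a b : 'I_n), isCell c -> c t -> a != b -> u0 a = u0 b ->
     [/\ St c 0 t a b = 0, St c 0 t b a = 0, St c 1 t a b = 0 & St c 1 t b a = 0]).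

Let be t (b : 'I_n) : C := (invmx (G0 t) *m A_ 1%N t *m G0 t) b b.
(** The system in the coordinate w = log z reads dY/dw = z A(z) Y, with coefficients periodic in
    w. *)
Let coef t (w : C) : 'M[C]_n := cexp w *: A (cexp w) t.
Let dom : set C := [set w | N0 <= expR (Re w)].
Let D_U t : D t -> U t. Proof. by case. Qed.

Lemma coef_loc_bounded t : U t -> loc_bounded dom (coef t).
Proof.
move=> Ut w Dw; have Nw : N0 <= nr (cexp w) by rewrite nr_cexp.
have /choice [r /choice [B Hh]] : forall p : 'I_n * 'I_n, exists r B : R, 0 < r /\
    forall z, nr (z - cexp w) < r -> N0 <= nr z -> nr (A z t p.1 p.2) <= B.
  move=> [a b]; have [r [B [h [r0 _ hB hA]]]] := joint_hol2 holA a b Nw Ut.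
  exists r, B; split=> // z zr Nz; rewrite (hA z t zr (nball_center _ r0) Nz Ut).
  by apply: hB => //; exact: nball_center.
have [p|r' r0 hr] := @fin_pos R _ r; first by have [] := Hh p.
have [B' [B0 hB]] := fin_bound B.
have m0 : 0 < Num.min r' 1 by rewrite lt_min r0 ltr01.
have /cvg_nrP /(_ _ m0)[e e0 he] := is_derive1_continuous (is_derive_cexp w).
exists ((nr (cexp w) + 1) * B'), e; split=> // v Dv /he; rewrite lt_min => /andP[v1 v2].
rewrite /coef nrZ; apply: ler_pM; rewrite ?nr_ge0 //.
  have := nrD (cexp v - cexp w) (cexp w); rewrite subrK => h; apply: (le_trans h).
  by rewrite addrC lerD2l ltW.
apply: nr_mx_le => // a b; have [_ h] := Hh (a, b); apply: le_trans (hB (a, b)).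
apply: h; last by rewrite nr_cexp.
exact: lt_le_trans v1 (hr _).
Qed.

Lemma tends1_series (N : C -> 'M[C]_n) (f : nat -> 'M[C]_n) (m : nat) (theta r K : R) : f 0%N = 1%:M ->
  (forall x, r <= expR x -> nr (N (ray theta x) - \sum_(j < m.+1) (cexp (ray theta x)) ^- j *: f j) <= K * expR x ^- m.+1) ->
  tends1 N theta.
Proof.
move=> f0 h e e0; pose B := `|K| + \sum_(j < m) nr (f j.+1).
have B0 : 0 <= B by rewrite addr_ge0 // sumr_ge0 // => j _; exact: nr_ge0.
exists (Num.max 0 (Num.max r (B / e))) => x; rewrite !ge_max => /and3P[x0 xr xB].
have ex1 : 1 + x <= expR x := expR_ge1Dx x.
have e1 : 1 <= expR x by lra.
have ep : 0 < expR x := expR_gt0 x.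
have nz : nr (cexp (ray theta x)) = expR x by rewrite nr_cexp.
have small j : (expR x ^+ j.+1)^-1 <= (expR x)^-1.
  by rewrite lef_pV2 ?posrE ?exprn_gt0 // exprS ler_peMr ?(ltW ep) // exprn_ege1.
have h1 : nr (N (ray theta x) - \sum_(j < m.+1) (cexp (ray theta x)) ^- j *: f j) <= `|K| / expR x.
  apply: (le_trans (h x _)); first lra.
  apply: (@le_trans _ _ (`|K| * (expR x ^+ m.+1)^-1)).
    by rewrite ler_wpM2r ?ler_norm // invr_ge0 exprn_ge0 // ltW.
  exact: ler_wpM2l (normr_ge0 _) _ _ (small m).
have h2 : nr (\sum_(j < m.+1) (cexp (ray theta x)) ^- j *: f j - 1%:M) <= (\sum_(j < m) nr (f j.+1)) / expR x.
  rewrite big_ord_recl expr0 invr1 scale1r f0 addrC addKr (le_trans (nr_sum _ _ _)) // mulr_suml.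
  apply: ler_sum => j _; rewrite nrZ nrV nrX nz mulrC; exact: ler_wpM2l (nr_ge0 _) _ _ (small j).
apply: (le_trans (nr_subD (\sum_(j < m.+1) (cexp (ray theta x)) ^- j *: f j) _ _)).
apply: (le_trans (lerD h1 h2)); rewrite -mulrDl ler_pdivrMr // mulrC -ler_pdivrMr //.
by rewrite -/B (le_trans xB) //; lra.
Qed.

Lemma normalizedE t (X : C -> 'M[C]_n) w :
  normalized A_ G0 u0 t X w = nrm (eigval u0 t) (be t) (fun w => invmx (G0 t) *m X w) w.
Proof.
apply/matrixP => a b; rewrite /normalized /exp_diag !mul_mx_diag mxE [in LHS]mxE [RHS]mxE.
rewrite -mulrA; congr (_ * _); rewrite [in X in X * _]mxE [in X in _ * X]mxE -cexpD; congr cexp.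
rewrite /Lambda /B1 !mxE !eqxx !mulr1n mulrN mulrN -opprD; congr (- (_ + _)).
by rewrite /be [in RHS]mxE.
Qed.

Lemma cell_D c t : isCell c -> c t -> D t.
Proof. by move=> hc /(cell_sub hc) /W_sub_D. Qed.

Lemma cell_gap c t : isCell c -> c t -> forall a b, a != b -> Re (gap u0 a b t * cis tau) != 0.
Proof. by move=> hc /(cell_sub hc) /W_generic[]. Qed.

Lemma fund_ode c k t : isCell c -> c t -> forall w, dom w -> ode (coef t) (Y c k ^~ t) w /\ Y c k w t \in unitmx.
Proof.
move=> hc ct w Dw; have [_ /(_ t ct)[h _]] := hY k hc; have [h1 h2] := h w Dw; split=> //.
by move=> i j; apply: der_eq (is_derive_entry i j h1) _; rewrite /coef -scalemxAl.
Qed.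

Lemma cexp_period w : cexp (w + (0 +i* (2 * pi))) = cexp w :> C.
Proof. by rewrite cexpD cexp2pi mulr1. Qed.

Lemma cell_tends1 c k t theta : isCell c -> c t ->
  (forall a b x, u0 a != u0 b -> theta <= x <= tau + k%:~R * pi - pi -> Re (gap u0 a b t * cis x) != 0) ->
  (forall a b x, u0 a != u0 b -> tau + k%:~R * pi <= x <= theta -> Re (gap u0 a b t * cis x) != 0) ->
  tends1 (nrm (eigval u0 t) (be t) (fun w => invmx (G0 t) *m Y c k w t)) theta.
Proof.
move=> hc ct c1 c2; have Dt := cell_D hc ct; have Ut := D_U Dt; have gen := cell_gap hc ct.
apply: (@tends1_sector R n (eigval u0 t) u0 (be t) tau N0 (coef t) (G0 t) (fun k w => Y c k w t) (fun k => St c k t)).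
- exact: coef_loc_bounded.
- by move=> w; rewrite /coef cexp_period.
- by move=> j w Dw; have [] := fund_ode j hc ct Dw.
- by move=> j w Dw; have [] := fund_ode j hc ct Dw.
- exact: gen.
(* Off the walls tau is no Stokes direction of Lambda(t), so the closed arc, ends included, lies in
   the open sector of the asymptotics. *)
- move=> j x hx; have [_ /(_ t ct)[_ as_]] := hY j hc.
  have sub : [set w : C | x <= Im w <= x] `<=` sector (stokes_directions u0 t) tau j.
    move=> w /= /andP[x1 x2] th [a [b [ab E]]].
    have aNb : a != b by apply: contraNneq ab => ->.
    have gt1 : Re (gap u0 a b t * cis (tau + j%:~R * pi)) != 0 by rewrite Re_cis_pi_neq0 gen.
    move: hx => /andP[hx1 hx2]; split=> /andP[t1 t2].
      have E2 : th = tau + j%:~R * pi - pi by apply/le_anti/andP; split; lra.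
      move: gt1; have := Re_cis_shift (gap u0 a b t) th; rewrite {1}E2 subrK => ->.
      by rewrite /gap E oppr0 eqxx.
    have E2 : th = tau + j%:~R * pi by apply/le_anti/andP; split; lra.
    by move: gt1; rewrite -E2 /gap E eqxx.
  have [r [K h]] := as_ x x sub 0%N.
  apply: (@tends1_series _ (F ^~ t) 0 x r K); first by case: (formal Dt).
  move=> y ry; have := h (ray x y); rewrite /= lexx /= => /(_ isT ry).
  by rewrite nr_le normalizedE.
- by move=> j w Dw; exact: hSt.
- by move=> i j ij uij; have [? _ ? _] := van hc ct ij uij.
- by move=> a b x; exact: c1.
- by move=> a b x; exact: c2.
Qed.

(** Multiplication by G0^-1 moves the formal identity to the eigenframe, where the terms with Lambda
    combine to u_a - u_b. The coefficient of index 0 is therefore replaced by 0. *)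
Lemma formal_rec t b : D t -> forall l a,
  column_rec (eigval u0 t) (fun j a d => if j is 0 then 0 else (invmx (G0 t) *m A_ j t *m G0 t) a d) b
    (fun k a => F k t a b) l a.
Proof.
move=> Dt l a; have [F0 /(_ l)] := formal Dt; have Gu := G0u (D_U Dt).
move=> /(congr1 (mulmx (invmx (G0 t)))).
rewrite mulmxDr mulmx_sumr -!mulmxA (mulKmx Gu).
have E j : invmx (G0 t) *m (A_ j t *m (G0 t *m F (l - j)%N t)) = (invmx (G0 t) *m A_ j t *m G0 t) *m F (l - j)%N t.
  by rewrite !mulmxA.
under [in RHS]eq_bigr do rewrite E.
rewrite big_ord_recl subn0 diagA; last exact: D_U.
move=> /matrixP /(_ a b); rewrite mxE [RHS]mxE.
have -> : (F l t *m Lambda u0 t) a b = F l t a b * eigval u0 t b by rewrite /Lambda mul_mx_diag !mxE.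
have -> : (Lambda u0 t *m F l t) a b = eigval u0 t a * F l t a b by rewrite /Lambda mul_diag_mx !mxE.
have -> : (invmx (G0 t) *m (if l is k'.+1 then (G0 t *m F k' t) *m B1 A_ G0 t - k'%:R *: (G0 t *m F k' t) else 0)) a b =
   (if l is k'.+1 then F k' t a b * be t b - k'%:R * F k' t a b else 0).
  case: l {E} => [|k']; first by rewrite mulmx0 mxE.
  rewrite mulmxBr -scalemxAr -mulmxA !(mulKmx Gu) mxE [X in _ + X]mxE [X in _ - X]mxE /B1 mul_mx_diag.
  by rewrite mxE; congr (_ * _ - _); rewrite [LHS]mxE.
have -> : (\sum_(i < l) invmx (G0 t) *m A_ (lift ord0 i) t *m G0 t *m F (l - lift ord0 i)%N t) a b =
   \sum_(k < l) \sum_d (if (l - k)%N is 0 then 0 else (invmx (G0 t) *m A_ (l - k)%N t *m G0 t) a d) * F k t d b.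
  rewrite summxE (reindex_inj rev_ord_inj) /=; apply: eq_bigr => i _; rewrite mxE; apply: eq_bigr => d _.
  rewrite /bump /= add1n subnSK // subKn; last exact: ltnW.
  by case: (l - i)%N (subn_gt0 i l) => // ; rewrite ltn_ord.
rewrite /column_rec; set s := \sum_(k < l) _; move=> H.
have {}H : s = F l t a b * eigval u0 t b + (if l is k'.+1 then F k' t a b * be t b - k'%:R * F k' t a b else 0) - eigval u0 t a * F l t a b.
  by rewrite H [X in _ = X - _]addrC addrK.
rewrite H /be; case: l {s H E} => [|k']; ring.
Qed.

Lemma diff_det m (f : V -> 'M[C]_m) t : (forall i j, differentiable (fun t => f t i j : C) t) ->
  differentiable (fun t => \det (f t) : C) t.
Proof.
move=> h; apply: diff_sumC => s; apply: diff_mulC; first exact: diff_cstC.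
by apply: diff_prodC => i; exact: h.
Qed.

(** G0^-1 is extended through cofactors and the determinant, which stays nonzero near t0. al_0 is 0
    because Lambda is carried by the eigenvalues, already defined for every t. *)
Lemma frame_ext t0 : U t0 -> exists (r K : R) (G : 'I_n -> 'I_n -> V -> C) (al : nat -> 'I_n -> 'I_n -> V -> C),
  [/\ 0 < r, forall a b, vholo (nball t0 r) (G a b), forall j a b, vholo (nball t0 r) (al j a b),
    forall j a b t, nball t0 r t -> nr (al j a b t) <= K * (2 * N0) ^+ j &
    (forall a b t, al 0%N a b t = 0) /\ forall t, nball t0 r t -> U t ->
      (forall a b, G a b t = G0 t a b) /\
      forall j a b, al j.+1 a b t = (invmx (G0 t) *m A_ j.+1 t *m G0 t) a b].
Proof.
move=> Ut; have [g [dg gG]] := holG Ut.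
have [r1 [K [gA [r10 h1 h2 h3]]]] := coef_ext N0_gt0 holA serA Ut.
have gG0 : G0 t0 = g t0 by exact: (nbhs_singleton gG) Ut.
have d0 : \det (g t0) != 0 by rewrite -unitfE -gG0 -unitmxE; exact: G0u.
have dge t i j : differentiable g t -> differentiable (fun t => g t i j : C) t by exact: diff_entry.
have dd : differentiable (fun t => \det (g t) : C) t0.
  by apply: diff_det => i j; apply: dge; exact: nbhs_singleton dg.
pose Gi a b t := (\det (g t))^-1 * (\adj (g t)) a b.
have dGi a b t : differentiable g t -> \det (g t) != 0 -> differentiable (Gi a b) t.
  move=> dt nt; apply: diff_mulC.
    by apply: (@diff_invC _ _ (fun t => \det (g t)) t _ nt); apply: diff_det => i j; exact: dge.
  have -> : (fun t => (\adj (g t)) a b : C) = (fun t => (-1) ^+ (b + a) * \det (row' b (col' a (g t)))).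
    by apply/funext => y; rewrite mxE /cofactor.
  apply: diff_mulC; first exact: diff_cstC.
  apply: diff_det => i j; have -> : (fun t => row' b (col' a (g t)) i j : C) = (fun t => g t (lift b i) (lift a j)).
    by apply/funext => y; rewrite !mxE.
  exact: dge.
have iE t : \det (g t) != 0 -> invmx (g t) = \matrix_(i, k) Gi i k t.
  by move=> nt; rewrite /invmx unitmxE unitfE nt; apply/matrixP => i k; rewrite [LHS]mxE [RHS]mxE.
clearbody Gi.
have ndet : \forall t \near t0, \det (g t) != 0.
  have := differentiable_continuous dd; move/cvg_nrP => /(_ (nr (\det (g t0)))).
  rewrite nr_gt0 => /(_ d0)[d dp hd]; apply/nbhs_nrP; exists d; [exact: dp|move=> t /hd].
  by apply: contraTneq => ->; rewrite sub0r nrN ltxx.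
have [B [B0 hB]] := fin_bound (fun p : 'I_n * 'I_n => nr (g t0 p.1 p.2) + 1 + (nr (Gi p.1 p.2 t0) + 1)).
have bnd : \forall t \near t0, forall p : 'I_n * 'I_n, nr (g t p.1 p.2) <= B /\ nr (Gi p.1 p.2 t) <= B.
  apply: (@filter_forall V ('I_n * 'I_n)%type (fun p t => nr (g t p.1 p.2) <= B /\ nr (Gi p.1 p.2 t) <= B) (nbhs t0) (nbhs_filter t0)) => p; have dgt := nbhs_singleton dg.
  apply: filterS2 (near_nr_bound (dge t0 p.1 p.2 dgt)) (near_nr_bound (dGi p.1 p.2 t0 dgt d0)) => t b1 b2.
  split; [apply: (le_trans b1)|apply: (le_trans b2)]; apply: le_trans (hB p).
    by rewrite lerDl; exact: addr_ge0 (nr_ge0 _) ler01.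
  by rewrite lerDr; exact: addr_ge0 (nr_ge0 _) ler01.
have all : \forall t \near t0, [/\ differentiable g t, U t -> G0 t = g t, \det (g t) != 0 &
    forall p : 'I_n * 'I_n, nr (g t p.1 p.2) <= B /\ nr (Gi p.1 p.2 t) <= B].
  near=> t; split; near: t; [exact: dg|exact: gG|exact: ndet|exact: bnd].
have [r2 r20 hr2] := (nbhs_nrP _ _).1 all.
pose r := Num.min r1 r2.
have s1 t : nball t0 r t -> nball t0 r1 t by rewrite /nball /= lt_min => /andP[].
have s2 t : nball t0 r t -> nr (t - t0) < r2 by rewrite /nball /= lt_min => /andP[].
pose al j a d t := if j is 0 then 0 else \sum_b \sum_e Gi a b t * gA j b e t * g t e d.
exists r, (n%:R * (n%:R * (B * K * B))), (fun a b t => g t a b), al; split.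
- by rewrite lt_min r10.
- by move=> a b t Nt; have [dt _ _ _] := hr2 t (s2 _ Nt); exact: dge.
- move=> [|j] a b t Nt; first exact: diff_cstC.
  have [dt _ nt _] := hr2 t (s2 _ Nt).
  apply: diff_sumC => e; apply: diff_sumC => f; apply: diff_mulC; last exact: dge.
  by apply: diff_mulC; [exact: dGi|exact: h1 (s1 _ Nt)].
- have K0 : 0 <= K \/ n = 0%N.
    case: (posnP n) => [|np]; [by right|left].
    have := h2 0%N (Ordinal np) (Ordinal np) t0 (nball_center _ r10); rewrite expr0 mulr1.
    exact: le_trans (nr_ge0 _).
  move=> j a b t Nt; have [_ _ _ hb] := hr2 t (s2 _ Nt).
  have {}K0 : 0 <= K by case: K0 => // nn; exfalso; case: a => a; rewrite nn.
  have P0 : 0 <= (2 * N0) ^+ j by rewrite exprn_ge0 // mulr_ge0 // ltW.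
  case: j P0 => [|j] P0; first by rewrite /al nr0 !mulr_ge0.
  rewrite /al (le_trans (nr_sum _ _ _)) // -mulrA; apply: ler_sum_ord => e.
  rewrite (le_trans (nr_sum _ _ _)) // -mulrA; apply: ler_sum_ord => f.
  have -> : B * K * B * (2 * N0) ^+ j.+1 = B * (K * (2 * N0) ^+ j.+1) * B by ring.
  rewrite 2!nrM; apply: ler_pM; rewrite ?nr_ge0 //; first exact: mulr_ge0 (nr_ge0 _) (nr_ge0 _).
    apply: ler_pM; rewrite ?nr_ge0 //; first by have [] := hb (a, e).
    exact: h2 (s1 _ Nt).
  by have [] := hb (f, b).
- split=> // t Nt Ut'; have [_ gt nt _] := hr2 t (s2 _ Nt).
  rewrite (gt Ut'); split=> // j a b.
  rewrite /al (iE t nt) mxE exchange_big; apply: eq_bigr => f _ /=; rewrite mxE mulr_suml.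
  apply: eq_bigr => e _; rewrite mxE (h3 j.+1 e f t (s1 _ Nt) Ut') //.
Unshelve. all: by end_near.
Qed.

(** With Q cis theta = X + i Yq and e = cis theta (1 - i la Yq), Re (Q e) = X + la Yq^2, and la is
    chosen to make this X + |X| + 1. The hypothesis says Yq <> 0: no Stokes ray of the pair bounds
    the half-plane. *)
Lemma half_plane_direction (Q : C) (theta : R) : Re (Q * cis (theta + pi / 2)) != 0 ->
  exists2 e : C, Re (cis (- theta) * e) = 1 & 0 < Re (Q * e).
Proof.
move=> h; pose q := Q * cis theta; pose X := Re q; pose Yq := Im q.
have cc : cis (- theta) * cis theta = 1 :> C by rewrite -cisD addNr /cis cos0 sin0.
have Y0 : Yq != 0.
  apply: contraNneq h => y0; rewrite cisD mulrA -/q ReM /cis /= cos_pihalf sin_pihalf.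
  by rewrite mulr0 mulr1 sub0r -/Yq y0 oppr0.
pose la := (`|X| + 1) / Yq ^+ 2.
have Y2 : Yq ^+ 2 != 0 by rewrite expf_neq0.
exists (cis theta * (1 +i* - (la * Yq))); first by rewrite mulrA cc mul1r.
rewrite mulrA -/q ReM /= mulr1 mulrN opprK -/X -/Yq.
have -> : Yq * (la * Yq) = `|X| + 1 by rewrite /la; field.
by have := ler_norm (- X); rewrite normrN; lra.
Qed.

Lemma sum_sub_first J (f g : nat -> C) (x : C) : g 0%N = 0 -> (forall j, g j.+1 = f j.+1) ->
  \sum_(j < J.+1) f j * x ^- j - \sum_(j < J.+1) g j * x ^- j = f 0%N.
Proof.
move=> g0 gf; rewrite !big_ord_recl expr0 invr1 !mulr1 g0 add0r.
have -> : \sum_(i < J) g (lift ord0 i) * x ^- lift ord0 i = \sum_(i < J) f (lift ord0 i) * x ^- lift ord0 i.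
  by apply: eq_bigr => i _; rewrite lift0 gf.
by rewrite addrK.
Qed.

(** * The holomorphic local solution near a point of D *)

Section Chart.
Variables (t0 : V) (tau' : R) (k : int) (m : nat).
Hypotheses (Dt0 : D t0) (adm : forall a b, a != b -> Re (gap u0 a b t0 * cis tau') != 0)
  (clr : forall a b x, u0 a != u0 b -> Num.min tau tau' <= x <= Num.max tau tau' -> Re (gap u0 a b t0 * cis x) != 0).
Let th0 : R := tau' + k%:~R * pi - pi / 2.
Let kappa : C := cis (- th0).
(** The half-plane lifted to the sheet of the covering around the direction th0. *)
Let Om (R1 : R) : set C := [set w | `|Im w - th0| < pi / 2 /\ half_plane kappa R1 (cexp w)].

(** Column b of X is the sectorial column times z^be_b e^(u_b z). Normalization removes this factor
    again, and by [column_rec_uniq] the coefficients of the expansion are those of [F]. *)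
Lemma chart_local : exists (r R1 K : R) (G : 'I_n -> 'I_n -> V -> C) (X : 'I_n -> 'I_n -> C -> V -> C),
  [/\ 0 < r /\ N0 <= R1,
    (forall a b, vholo (nball t0 r) (G a b)) /\ (forall a b t, nball t0 r t -> U t -> G a b t = G0 t a b),
    forall a b w, half_plane kappa R1 (cexp w) -> vholo (nball t0 r) (X a b w),
    forall t w, nball t0 r t -> U t -> half_plane kappa R1 (cexp w) ->
      ode (coef t) (fun w => G0 t *m \matrix_(a, b) X a b w t) w &
    forall t w, nball t0 r t -> D t -> half_plane kappa R1 (cexp w) -> forall a b,
      nr (X a b w t * cexp (- (eigval u0 t b * cexp w + be t b * w)) - \sum_(j < m.+1) F j t a b * cexp w ^- j)
      <= K / nr (cexp w) ^+ m.+1].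
Proof.
have Ut0 := D_U Dt0.
have [r0 [K [G [al [r00 hG hal alK [al0 hE]]]]]] := frame_ext Ut0.
have rho0 : 0 < 2 * N0 by rewrite mulr_gt0.
pose u a t := eigval u0 t a.
have hu a : vholo (nball t0 r0) (u a).
  move=> t _; apply: diff_addC; first exact: diff_cstC.
  exact: differentiable_coord.
have /choice [S1 HS1] : forall p : 'I_n * 'I_n, exists S : C -> V -> C, hol2 (outer (2 * N0)) (nball t0 r0) S /\
    forall J z t, outer (2 * N0) z -> nball t0 r0 t ->
    nr (S z t - \sum_(j < J) al j p.1 p.2 t * z ^- j) <= 2 * K * (2 * N0 / nr z) ^+ J.
  move=> [a d].
  exact: (@laurent_tail R V (nball t0 r0) (fun j => al j a d) K (2 * N0) (@nball_open _ _ _ _) rho0 (fun j => hal j a d) (fun j => alK j a d)).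
pose S a d := S1 (a, d).
have k1 : nr kappa = 1 by rewrite /kappa nr_cis.
have dir a b : a != b -> exists2 e, Re (kappa * e) = 1 & 0 < Re ((u a t0 - u b t0) * e).
  move=> ab; apply: half_plane_direction; rewrite /th0 subrK Re_cis_pi_neq0; exact: adm.
have col b := @sectorial_column R V n t0 r0 u al K (2 * N0) S kappa r00 rho0 hu hal alK al0
  (fun a d => (HS1 (a, d)).1) (fun a d => (HS1 (a, d)).2) k1 dir b m.
have /choice [rb /choice [xb /choice [Kb /choice [phi /choice [v Hv]]]]] := col.
have [b|r rp hr] := @fin_pos R _ rb; first by have [/andP[]] := Hv b.
have [xM [_ hxM]] := fin_bound xb; have [KM [_ hKM]] := fin_bound Kb.
pose R1 := Num.max xM (Num.max (2 * (2 * N0)) 1).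
have R1x b : xb b <= R1 by rewrite le_max hxM.
have R12 : 2 * (2 * N0) <= R1 by rewrite !le_max lexx orbT.
have R1N : N0 <= R1 by apply: le_trans R12; move: N0_gt0; lra.
have H1 b w : half_plane kappa R1 w -> half_plane kappa (xb b) w by exact: half_plane_sub (R1x b) _.
pose r' := Num.min r r0.
have sr b t : nball t0 r' t -> nball t0 (rb b) t.
  by rewrite /nball /= lt_min => /andP[h _]; exact: lt_le_trans h (hr b).
have sr0 t : nball t0 r' t -> nball t0 r0 t by rewrite /nball /= lt_min => /andP[].
pose X a b w t := v b a (cexp w) t * cexp (al 1%N b b t * w + u b t * cexp w).
have beE t b : nball t0 r' t -> U t -> al 1%N b b t = be t b.
  by move=> Nt Ut; have [_ ->] := hE t (sr0 _ Nt) Ut.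
exists r', R1, KM, G, X; split.
- by rewrite lt_min rp r00.
- split=> [a b t Nt|a b t Nt Ut]; first by apply: hG; exact: sr0.
  by have [-> _] := hE t (sr0 _ Nt) Ut.
- move=> a b w Hw t Nt; apply: diff_mulC.
    by have [_ _ [h _] _ _] := Hv b; exact: (h a).2 (H1 b _ Hw) t (sr b _ Nt).
  apply: diff_cexpC; apply: diff_addC; apply: diff_mulC; try exact: diff_cstC.
    exact: hal (sr0 _ Nt).
  exact: hu (sr0 _ Nt).
- move=> t w Nt Ut Hw; have Gu := G0u Ut.
  have oz : outer (2 * N0) (cexp w).
    by rewrite /outer /=; exact: le_lt_trans R12 (half_plane_nr k1 Hw).
  have Nw : N0 <= nr (cexp w) by exact: (ltW (le_lt_trans R1N (half_plane_nr k1 Hw))).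
  (* For t in U both sides are limits of series that differ in the term of index 0 only, and that
     term is Lambda. *)
  have SE a d : S a d (cexp w) t = (invmx (G0 t) *m A (cexp w) t *m G0 t) a d - Lambda u0 t a d.
    have c1 : (\sum_(j < J) al j a d t * (cexp w) ^- j) @[J --> \oo] --> S a d (cexp w) t.
      apply/cvgn_nrP => e e0.
      have k0 : 0 < 2 * `|K| + 1 by rewrite ltr_wpDl // mulr_ge0.
      have [J0 hJ0] := exists_2expn (divr_gt0 e0 k0); exists J0 => J JJ.
      rewrite nr_dist; apply: (le_lt_trans ((HS1 (a, d)).2 J (cexp w) t oz (sr0 _ Nt))).
      have y1 : 0 <= 2 * N0 / nr (cexp w) <= 2^-1.
        rewrite divr_ge0 ?nr_ge0 ?(ltW rho0) //= ler_pdivrMr; last by exact: lt_le_trans Nw.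
        by move: oz; rewrite /outer /=; lra.
      have y2 : (2 * N0 / nr (cexp w)) ^+ J <= 2 ^- J0.
        move: y1 => /andP[y0 y1]; apply: (@le_trans _ _ (2^-1 ^+ J)); first by rewrite lerXn2r ?nnegrE ?invr_ge0.
        by rewrite exprVn lef_pV2 ?posrE ?exprn_gt0 // ler_eXn2l // ltr1n.
      have y3 : 0 <= (2 * N0 / nr (cexp w)) ^+ J by rewrite exprn_ge0 //; case/andP: y1.
      move: hJ0; rewrite ltr_pdivlMr // => hJ0; apply: le_lt_trans hJ0; rewrite mulrC.
      have K0 : 0 <= K by have := alK 0%N a a t0 (nball_center _ r00); rewrite expr0 mulr1; exact: le_trans (nr_ge0 _).
      apply: ler_pM => //; first by rewrite mulr_ge0.
      by rewrite (le_trans (_ : _ <= 2 * `|K|)) ?lerDl // ler_wpM2l // ler_norm.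
    have c2 : (\sum_(j < J) (invmx (G0 t) *m A_ j t *m G0 t) a d * (cexp w) ^- j) @[J --> \oo] -->
        (invmx (G0 t) *m A (cexp w) t *m G0 t) a d.
      pose c (p : 'I_n * 'I_n) := invmx (G0 t) a p.1 * G0 t p.2 d.
      have E (M : 'M[C]_n) : (invmx (G0 t) *m M *m G0 t) a d = \sum_p c p * M p.1 p.2.
        rewrite mxE; rewrite -(pair_bigA _ (fun i j => c (i, j) * M i j)) exchange_big /=.
        by apply: eq_bigr => f _; rewrite mxE mulr_suml; apply: eq_bigr => e _; rewrite /c /=; ring.
      have cs := @cvgn_sumZ R _ (index_enum ('I_n * 'I_n)%type) c (fun p J => \sum_(j < J) A_ j t p.1 p.2 * (cexp w) ^- j)
        (fun p => A (cexp w) t p.1 p.2) (fun p => @series_entry R n A N0 U A_ serA (cexp w) t p.1 p.2 Nw Ut).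
      rewrite E; apply: cvgn_ext cs => J.
      under [RHS]eq_bigr do rewrite E mulr_suml.
      rewrite exchange_big; apply: eq_bigr => p _; rewrite mulr_sumr.
      by apply: eq_bigr => j _; rewrite mulrA.
    have c3 := cvgn_nrB c2 c1.
    have c4 : (\sum_(j < J) (invmx (G0 t) *m A_ j t *m G0 t) a d * (cexp w) ^- j - \sum_(j < J) al j a d t * (cexp w) ^- j)
        @[J --> \oo] --> Lambda u0 t a d.
      apply/cvgn_nrP => e e0; exists 1%N => -[//|J] _.
      have := @sum_sub_first J (fun j => (invmx (G0 t) *m A_ j t *m G0 t) a d) (fun j => al j a d t) (cexp w)
        (al0 a d t) (fun j => (hE t (sr0 _ Nt) Ut).2 j a d).
      by rewrite /= (diagA Ut) => ->; rewrite subrr nr0.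
    by have := cvgn_nr_unique c3 c4 => <-; rewrite opprB addrC subrK.
  pose Ah := invmx (G0 t) *m A (cexp w) t *m G0 t.
  have oX a b : is_derive w (1 : C) (fun w => X a b w t) (cexp w * \sum_d Ah a d * X d b w t).
    have [_ _ _ _ hv] := Hv b; have [dv _] := hv (cexp w) t a (H1 b _ Hw) (sr b _ Nt).
    have := der_mul (@der_comp R (v b a ^~ t) (@cexp R) w _ _ (is_derive_cexp w) dv)
      (der_cexp (der_add (der_scale (al 1%N b b t) (der_id w)) (der_scale (u b t) (is_derive_cexp w)))).
    move=> h; apply: der_eq h _.
    have -> : \sum_d Ah a d * X d b w t = (\sum_d (S a d (cexp w) t + Lambda u0 t a d) * v b d (cexp w) t) *
        cexp (al 1%N b b t * w + u b t * cexp w).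
      rewrite mulr_suml; apply: eq_bigr => d _; rewrite SE subrK mulrA //.
    have -> : \sum_d (S a d (cexp w) t + Lambda u0 t a d) * v b d (cexp w) t =
        \sum_d S a d (cexp w) t * v b d (cexp w) t + u a t * v b a (cexp w) t.
      under eq_bigr do rewrite mulrDl; rewrite big_split; congr (_ + _).
      rewrite (bigD1 a) //= big1 ?addr0 => [|d da]; first by rewrite !mxE eqxx.
      by rewrite !mxE eq_sym (negPf da) mulr0n mul0r.
    rewrite mulr1; set s := \sum_d _; set E := cexp (_ + _).
    have ew : cexp w * (cexp w)^-1 = 1 by rewrite mulfV // cexp_neq0.
    have -> : cexp w * ((u a t - u b t) * v b a (cexp w) t + s - al 1%N b b t * (cexp w)^-1 * v b a (cexp w) t) * E =
      (cexp w * ((u a t - u b t) * v b a (cexp w) t + s) - al 1%N b b t * (cexp w * (cexp w)^-1) * v b a (cexp w) t) * E by ring.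
    by rewrite ew; ring.
  have GA : G0 t *m Ah = A (cexp w) t *m G0 t by rewrite /Ah !mulmxA mulmxV // mul1mx.
  move=> i j; have -> : (coef t w *m (G0 t *m (\matrix_(a, b) X a b w t))) i j =
      \sum_d G0 t i d * (cexp w * \sum_e Ah d e * X e j w t).
    rewrite /coef -scalemxAl mulmxA -GA -mulmxA mxE [X in _ * X]mxE mulr_sumr; apply: eq_bigr => d _.
    by rewrite mxE mulrCA; congr (_ * (_ * _)); apply: eq_bigr => e _; rewrite mxE.
  apply: is_derive_near (der_sum _ (fun d => der_scale (G0 t i d) (oX d j))); near=> y.
  by rewrite mxE; apply: eq_bigr => d _; rewrite mxE.
- move=> t w Nt Dt Hw a b; have Ut := D_U Dt.
  have -> : X a b w t * cexp (- (eigval u0 t b * cexp w + be t b * w)) = v b a (cexp w) t.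
    rewrite /X -mulrA -cexpD (beE t b Nt Ut).
    have -> : be t b * w + u b t * cexp w + - (eigval u0 t b * cexp w + be t b * w) = 0 by rewrite /u; ring.
    by rewrite cexp0 mulr1.
  have [_ _ [_ p0] hrec hv] := Hv b.
  have [_ bd] := hv (cexp w) t a (H1 b _ Hw) (sr b _ Nt).
  have [rec rec'] := hrec t (sr b _ Nt).
  have dist d : d != b -> u d t != u b t.
    by move=> db; have := D_distinct Dt db; rewrite /gap subr_eq0.
  have alE : (fun j a d => if j is 0 then 0 else (invmx (G0 t) *m A_ j t *m G0 t) a d) = (fun j a d => al j a d t).
    apply/funext => -[|j]; apply/funext => d; apply/funext => e; first by rewrite al0.
    by have [_ ->] := hE t (sr0 _ Nt) Ut.
  have frec := formal_rec b Dt; rewrite alE in frec.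
  have F0 : F 0%N t = 1%:M by case: (formal Dt).
  have F0e a' : phi b 0%N a' t = F 0%N t a' b by rewrite p0 F0 mxE.
  have pF := @column_rec_uniq R n (u ^~ t) (fun j a d => al j a d t) b (fun k a => phi b k a t) (fun k a => F k t a b) m
    dist F0e rec rec' (fun l a _ => frec l a) (frec _ _).
  have -> : \sum_(j < m.+1) F j t a b * (cexp w) ^- j = \sum_(j < m.+1) phi b j a t * (cexp w) ^- j.
    by apply: eq_bigr => j _; rewrite pF // -ltnS.
  apply: (le_trans bd); rewrite ler_wpM2r ?hKM // invr_ge0 exprn_ge0 // nr_ge0.
Unshelve. all: by end_near.
Qed.

Lemma Om_Re (R1 : R) w : half_plane kappa R1 (cexp w) <-> R1 < expR (Re w) * cos (Im w - th0).
Proof.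
have -> : Im w - th0 = - th0 + Im w by rewrite addrC.
have E : Re (kappa * cexp w) = expR (Re w) * cos (- th0 + Im w).
  by rewrite /kappa /cexp mulrCA -cisD Re_mulC.
by rewrite -E; split; exact.
Qed.

Lemma cos_window (x : R) : `|x| < pi / 2 -> 0 < cos x.
Proof. by rewrite ltr_norml => h; apply: cos_gt0_pihalf. Qed.

Lemma cos_norm (x : R) : cos `|x| = cos x.
Proof. by case: (ler0P x) => _; rewrite ?cosN. Qed.

Lemma cos_le_norm (x y : R) : `|x| <= `|y| -> `|y| < pi / 2 -> cos y <= cos x.
Proof.
move=> xy y2; rewrite -(cos_norm x) -(cos_norm y) leNgt ltr_cos -?leNgt // in_itv /= normr_ge0 /=.
  by have := pi_gt0 R; lra.
by have := pi_gt0 R; lra.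
Qed.

Lemma convex_comb_le (p q M s : R) : p <= M -> q <= M -> 0 <= s -> s <= 1 -> (1 - s) * p + s * q <= M.
Proof. by move=> pM qM s0 s1; nra. Qed.

(** Out horizontally to a large common real part, across, and back in; only monotonicity of exp and
    of cos in the absolute angle is used. *)
Lemma Om_path (R1 : R) w1 w2 : 0 <= R1 -> Om R1 w1 -> Om R1 w2 -> exists w3 w4,
  [/\ forall s, 0 <= s <= 1 -> Om R1 (seg w1 w3 s), forall s, 0 <= s <= 1 -> Om R1 (seg w3 w4 s) &
   forall s, 0 <= s <= 1 -> Om R1 (seg w4 w2 s)].
Proof.
move=> R10 [a1 /Om_Re h1] [a2 /Om_Re h2].
have c1 := cos_window a1; have c2 := cos_window a2.
pose X := Num.max (Re w1) (Re w2).
pose c := Num.min (cos (Im w1 - th0)) (cos (Im w2 - th0)).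
have c0 : 0 < c by rewrite lt_min c1.
pose X' := Num.max X (R1 / c + 1).
have X1 : Re w1 <= X' by rewrite !le_max lexx.
have X2 : Re w2 <= X' by rewrite !le_max lexx orbT.
have hX x : X' <= x -> R1 < expR x * c.
  move=> xx; rewrite -ltr_pdivrMr //; have := expR_ge1Dx x.
  have h3 : R1 / c + 1 <= X' by rewrite le_max lexx orbT.
  by move: h3 xx; move: (R1 / c) => y; lra.
have hor w : `|Im w - th0| < pi / 2 -> R1 < expR (Re w) * cos (Im w - th0) -> forall x, Re w <= x ->
    forall s, 0 <= s <= 1 -> Om R1 (seg w (x +i* Im w) s).
  move=> a h x wx s /andP[s0 s1].
  have E : seg w (x +i* Im w) s = (Re w + s * (x - Re w)) +i* Im w.
    by case: w {a h wx} => p q; rewrite /seg; apply/eqP; rewrite eq_complex /=; apply/andP; split; apply/eqP; ring.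
  rewrite E; split=> //; apply/Om_Re => /=; apply: (lt_le_trans h).
  rewrite ler_wpM2r ?(ltW (cos_window a)) // ler_expR lerDl mulr_ge0 // subr_ge0 //.
have rev a b s : seg b a s = seg a b (1 - s) by exact: seg_rev.
exists (X' +i* Im w1), (X' +i* Im w2); split.
- exact: hor.
- move=> s /andP[s0 s1].
  have E : seg (X' +i* Im w1) (X' +i* Im w2) s = X' +i* (Im w1 + s * (Im w2 - Im w1)).
    by rewrite /seg; apply/eqP; rewrite eq_complex /=; apply/andP; split; apply/eqP; ring.
  pose y1 := Im w1 - th0; pose y2 := Im w2 - th0.
  have Ey : Im w1 + s * (Im w2 - Im w1) - th0 = (1 - s) * y1 + s * y2 by rewrite /y1 /y2; ring.
  have ny : `|(1 - s) * y1 + s * y2| <= Num.max `|y1| `|y2|.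
    rewrite (le_trans (ler_normD _ _)) // !normrM (ger0_norm s0) ger0_norm ?subr_ge0 //.
    have m1 : `|y1| <= Num.max `|y1| `|y2| by rewrite le_max lexx.
    have m2 : `|y2| <= Num.max `|y1| `|y2| by rewrite le_max lexx orbT.
    exact: convex_comb_le.
  have [mlt cm] : Num.max `|y1| `|y2| < pi / 2 /\ c <= cos ((1 - s) * y1 + s * y2).
    split; first by rewrite gt_max a1.
    move: ny; rewrite le_max => /orP[] ny; [apply: (@le_trans _ _ (cos y1))|apply: (@le_trans _ _ (cos y2))];
      by [rewrite /c ge_min lexx ?orbT | exact: cos_le_norm].
  rewrite E; split; first by rewrite /= Ey (le_lt_trans ny).
  apply/Om_Re; rewrite /= Ey; apply: (lt_le_trans (hX X' (lexx _))).
  by rewrite ler_wpM2l // expR_ge0.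
- move=> s /andP[s0 s1]; rewrite rev; apply: hor => //; rewrite subr_ge0 s1 /=.
  by rewrite gerBl.
Qed.

Lemma Om_ray (R1 theta : R) : `|theta - th0| < pi / 2 -> exists x0, forall x, x0 <= x -> Om R1 (ray theta x).
Proof.
move=> h; have c0 := cos_window h; exists (`|R1| / cos (theta - th0)) => x xx; split=> //.
apply/Om_Re; rewrite /= -ltr_pdivrMr //.
have := expR_ge1Dx x; have : R1 / cos (theta - th0) <= `|R1| / cos (theta - th0).
  by rewrite ler_wpM2r ?ler_norm // invr_ge0 ltW.
lra.
Qed.

Let ebe (t : V) := nrm (eigval u0 t) (be t).

(** On a cell both Y_k and the local solution are normalized along every direction of the window,
    the former by [cell_tends1] because no ray of R(t) lies between tau and tau'. Their connection
    matrix is then 1. *)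
Lemma chart : exists (r R1 K : R) (g : 'I_n -> 'I_n -> C -> V -> C),
  [/\ 0 < r /\ N0 <= R1,
    forall a b w, Om R1 w -> vholo (nball t0 r) (g a b w),
    forall c t w, isCell c -> c t -> nball t0 r t -> Om R1 w -> forall a b, Y c k w t a b = g a b w t &
    forall w, Om R1 w -> forall Z : C -> 'M[C]_n, (forall a b, Z w a b = g a b w t0) -> forall a b,
      nr (normalized A_ G0 u0 t0 Z w a b - \sum_(j < m.+1) F j t0 a b * cexp w ^- j) <= K / nr (cexp w) ^+ m.+1].
Proof.
have Ut0 := D_U Dt0.
have [r0 [R1 [K [G [X [[r00 R1N] [hG GE] hX hode hasy]]]]]] := chart_local.
have [r1 r10 hr1] := near_gap adm.
have mm : Num.min tau tau' <= Num.max tau tau' by rewrite ge_min !le_max lexx.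
have [r2 r20 hr2] := @near_clear R n u0 t0 (Num.min tau tau') (Num.max tau tau') (fun a b => u0 a != u0 b) mm clr.
pose r := Num.min r0 (Num.min r1 r2).
have s0 t : nball t0 r t -> nball t0 r0 t by rewrite /nball /= lt_min => /andP[].
have s1 t : nball t0 r t -> nr (t - t0) < r1 by rewrite /nball /= !lt_min => /and3P[].
have s2 t : nball t0 r t -> nr (t - t0) < r2 by rewrite /nball /= !lt_min => /and3P[].
have Om_dom w : Om R1 w -> dom w.
  case=> _ h; rewrite /dom /= -nr_cexp; apply: ltW; apply: le_lt_trans R1N _.
  by apply: half_plane_nr h; rewrite /kappa nr_cis.
have R10 : 0 <= R1 by rewrite (le_trans (ltW N0_gt0)).
pose Z t w := G0 t *m \matrix_(a, b) X a b w t.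
exists r, R1, K, (fun a b w t => \sum_d G a d t * X d b w t); split.
- by rewrite !lt_min r00 r10 r20.
- move=> a b w [_ Hw] t Nt; apply: diff_sumC => d; apply: diff_mulC; first by apply: hG; exact: s0.
  exact: hX Hw t (s0 _ Nt).
- move=> c t w hc ct Nt Ow a b; have Dt := cell_D hc ct; have Ut := D_U Dt; have Gu := G0u Ut.
  have -> : \sum_d G a d t * X d b w t = Z t w a b.
    by rewrite /Z mxE; apply: eq_bigr => d _; rewrite mxE GE //; exact: s0.
  suff -> : Z t w = Y c k w t by [].
  have Yo w' : Om R1 w' -> ode (coef t) (Y c k ^~ t) w' by move=> /Om_dom Dw; have [] := fund_ode k hc ct Dw.
  have Yu w' : Om R1 w' -> Y c k w' t \in unitmx by move=> /Om_dom Dw; have [] := fund_ode k hc ct Dw.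
  have Zo w' : Om R1 w' -> ode (coef t) (Z t) w' by case=> _ h; exact: hode (s0 _ Nt) Ut h.
  have aB : loc_bounded (Om R1) (coef t).
    move=> w' /Om_dom /(coef_loc_bounded Ut)[B [e [e0 h]]]; exists B, e; split=> // v /Om_dom; exact: h.
  pose c0 := invmx (Y c k w t) *m Z t w.
  have ZY w' : Om R1 w' -> Z t w' = Y c k w' t *m c0.
    move=> Ow'; have [w3 [w4 [p1 p2 p3]]] := Om_path R10 Ow Ow'.
    have e1 : Z t w = Y c k w t *m c0 by rewrite /c0 mulKVmx // Yu.
    have e3 := connection aB Yo Zo p1 e1.
    have e4 := connection aB Yo Zo p2 e3.
    exact: connection aB Yo Zo p3 e4.
  have tX theta : `|theta - th0| < pi / 2 -> tends1 (ebe t (fun w => \matrix_(a, b) X a b w t)) theta.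
    move=> ht; have [x0 hx0] := Om_ray R1 ht.
    apply: (@tends1_series _ (F ^~ t) m theta (expR x0) `|K|); first by case: (formal Dt).
    move=> x; rewrite ler_expR => /hx0 Ox; apply: nr_mx_le => [|i j].
      by rewrite mulr_ge0 // invr_ge0 exprn_ge0 // expR_ge0.
    have := hasy t (ray theta x) (s0 _ Nt) Dt Ox.2 i j; rewrite nr_cexp => h.
    apply: le_trans (_ : _ <= K / expR x ^+ m.+1) _; last first.
      by rewrite ler_wpM2r ?ler_norm // invr_ge0 exprn_ge0 // expR_ge0.
    apply: le_trans h; rewrite le_eqVlt; apply/orP; left; apply/eqP; congr nr.
    rewrite /ebe !mxE summxE; congr (_ - _).
    by apply: eq_bigr => l _; rewrite mxE mulrC.
  have tY theta : `|theta - th0| < pi / 2 -> tends1 (ebe t (fun w => invmx (G0 t) *m Y c k w t)) theta.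
    rewrite ltr_norml /th0 => /andP[t1 t2]; have pi0 := pi_gt0 R.
    have cl x : Num.min tau tau' <= x <= Num.max tau tau' -> forall a' b', u0 a' != u0 b' -> Re (gap u0 a' b' t * cis x) != 0.
      by move=> hx a' b' uab; exact: hr2 (s2 _ Nt) a' b' x uab hx.
    (* Directions between the ends of the sectors of tau and of tau' come, after a shift by
       multiples of pi, to lie between tau and tau'. *)
    apply: cell_tends1 => // a' b' x uab /andP[x1 x2].
      rewrite -oppr_eq0 -Re_cis_shift.
      have -> : x + pi = (x + pi - k%:~R * pi) + k%:~R * pi by rewrite subrK.
      rewrite Re_cis_pi_neq0; apply: cl => //; rewrite ge_min le_max; apply/andP; split; apply/orP; [right|left]; lra.
    rewrite -[x](subrK (k%:~R * pi)) Re_cis_pi_neq0; apply: cl => //.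
    by rewrite ge_min le_max; apply/andP; split; apply/orP; [left|right]; lra.
  have tc theta : `|theta - th0| < pi / 2 -> tends1 (conjm (eigval u0 t) (be t) c0) theta.
    move=> ht; apply: tends1_conj (tY _ ht) (tX _ ht).
    have [x0 hx0] := Om_ray R1 ht; exists x0 => x /hx0 Ox; apply: nrm_mul.
    have := ZY _ Ox; rewrite /Z => /(congr1 (mulmx (invmx (G0 t)))).
    rewrite (mulKmx Gu) => ->; exact: mulmxA.
  have pi0 := pi_gt0 R.
  have th00 : `|th0 - th0| < pi / 2 by rewrite subrr normr0 divr_gt0.
  have [cd _] := tends1_conjm (tc _ th00).
  have c1 : c0 = 1%:M.
    apply/matrixP => i j; rewrite [RHS]mxE; have [<-|ij] := eqVneq i j; first exact: cd.
    have ga : Re (gap u0 i j t * cis (tau' + k%:~R * pi)) != 0 by rewrite Re_cis_pi_neq0; exact: hr1 (s1 _ Nt) i j ij.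
    (* Admissibility of tau' makes the exponential grow at one of the two ends of the window, and by
       continuity also slightly inside. *)
    have [theta ht hq] : exists2 theta, `|theta - th0| < pi / 2 & 0 < Re (gap u0 i j t * cis theta).
      have cont (y : R) : 0 < Re (gap u0 i j t * cis y) -> exists2 d : R, 0 < d & forall x, `|y - x| < d -> 0 < Re (gap u0 i j t * cis x).
        move=> p; have /cvgrPdist_lt /(_ _ p) [d /= d0 hd] := @Re_cis_cont R (gap u0 i j t) y.
        exists d => // x /hd; rewrite /= ltr_distl => /andP[_]; lra.
      have [p|p] := ltP 0 (Re (gap u0 i j t * cis (tau' + k%:~R * pi))).
        have [d d0 hd] := cont _ p; pose e := Num.min d pi / 2.
        have e0 : 0 < e by rewrite divr_gt0 // lt_min d0.
        have ed : e < d by rewrite /e ltr_pdivrMr // (le_lt_trans (_ : _ <= d)) ?ge_min ?lexx // ltr_pMr // ltr1n.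
        have ep : e < pi by rewrite /e ltr_pdivrMr // (le_lt_trans (_ : _ <= pi)) ?ge_min ?lexx ?orbT // ltr_pMr // ltr1n.
        exists (tau' + k%:~R * pi - e); last by apply: hd; rewrite [X in `|X|](_ : _ = e) ?gtr0_norm //; ring.
        by rewrite /th0 ltr_norml; apply/andP; split; lra.
      have p' : 0 < Re (gap u0 i j t * cis (tau' + k%:~R * pi - pi)).
        have := Re_cis_shift (gap u0 i j t) (tau' + k%:~R * pi - pi); rewrite subrK => E.
        by move: ga p; rewrite E oppr_eq0 oppr_le0 le_eqVlt eq_sym => /negPf ->.
      have [d d0 hd] := cont _ p'; pose e := Num.min d pi / 2.
      have e0 : 0 < e by rewrite divr_gt0 // lt_min d0.
      have ed : e < d by rewrite /e ltr_pdivrMr // (le_lt_trans (_ : _ <= d)) ?ge_min ?lexx // ltr_pMr // ltr1n.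
      have ep : e < pi by rewrite /e ltr_pdivrMr // (le_lt_trans (_ : _ <= pi)) ?ge_min ?lexx ?orbT // ltr_pMr // ltr1n.
      exists (tau' + k%:~R * pi - pi + e); last by apply: hd; rewrite [X in `|X|](_ : _ = - e) ?normrN ?gtr0_norm //; ring.
      by rewrite /th0 ltr_norml; apply/andP; split; lra.
    by have [_ ->] := tends1_conjm (tc _ ht).
  by rewrite (ZY _ Ow) c1 mulmx1.
- move=> w Ow Z0 hZ a b; rewrite normalizedE.
  have ZE : Z0 w = Z t0 w.
    apply/matrixP => i j; rewrite hZ /Z mxE; apply: eq_bigr => d _; rewrite mxE GE //; exact: nball_center.
  have := hasy t0 w (nball_center _ r00) Dt0 Ow.2 a b.
  by rewrite mxE ZE /Z mulKmx ?G0u // mxE.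
Qed.

End Chart.

(** One function for all cells at once: this expresses both continuation across the walls at t0 and
    independence of the cell. *)
Definition glued k w (t0 : V) := exists (r : R) (g : 'I_n -> 'I_n -> V -> C),
  [/\ 0 < r, forall a b, vholo (nball t0 r) (g a b) &
    forall c t, isCell c -> c t -> nball t0 r t -> forall a b, Y c k w t a b = g a b t].

Lemma half_plane_dom theta (R1 : R) w : N0 <= R1 -> half_plane (cis theta) R1 (cexp w) -> dom w.
Proof.
move=> R1N h; have h2 := half_plane_nr (nr_cis _) h; rewrite nr_cexp in h2.
exact: (ltW (le_lt_trans R1N h2)).
Qed.

Lemma gap_admissible k theta (t0 : V) : D t0 ->
  (forall a b x, u0 a != u0 b -> theta <= x <= tau + k%:~R * pi - pi -> Re (gap u0 a b t0 * cis x) != 0) ->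
  (forall a b x, u0 a != u0 b -> tau + k%:~R * pi <= x <= theta -> Re (gap u0 a b t0 * cis x) != 0) ->
  exists tau', [/\ forall a b, a != b -> Re (gap u0 a b t0 * cis tau') != 0,
    forall a b x, u0 a != u0 b -> Num.min tau tau' <= x <= Num.max tau tau' -> Re (gap u0 a b t0 * cis x) != 0 &
    tau' + k%:~R * pi - pi < theta < tau' + k%:~R * pi].
Proof.
move=> Dt0 c1 c2; have Ut0 := D_U Dt0.
apply: (@window R n (fun a b => gap u0 a b t0) (fun a b => u0 a != u0 b) tau theta k).
- exact: (D_distinct Dt0).
- by move=> a b; apply: contraNneq => ->.
- by move=> a b uab; exact: (cluster_gap Ut0 (heps uab)).
- exact: c1.
- exact: c2.
Qed.

Lemma glued_far k t0 : D t0 -> exists2 w, dom w & glued k w t0.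
Proof.
move=> Dt0; have pi0 := pi_gt0 R; pose theta := tau + k%:~R * pi - pi / 2.
have [||tau' [a1 a2 a3]] := @gap_admissible k theta t0 Dt0.
- by move=> a b x _ /andP[x1 x2]; exfalso; move: x1 x2; rewrite /theta; lra.
- by move=> a b x _ /andP[x1 x2]; exfalso; move: x1 x2; rewrite /theta; lra.
have [r [R1 [K [g [[r0 R1N] g1 g2 _]]]]] := @chart t0 tau' k 0 Dt0 a1 a2.
have [|x0 hx0] := @Om_ray tau' k R1 (tau' + k%:~R * pi - pi / 2); first by rewrite subrr normr0 divr_gt0.
have Ow := hx0 x0 (lexx _).
exists (ray (tau' + k%:~R * pi - pi / 2) x0).
  exact: half_plane_dom R1N Ow.2.
exists r, (fun a b t => g a b (ray (tau' + k%:~R * pi - pi / 2) x0) t); split=> [//|a b|c t hc ct Nt a b].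
  exact: g1 Ow.
exact: g2 hc ct Nt Ow a b.
Qed.

(** The Picard transfer matrix from w1 to w2 is holomorphic in t and the same for all cells. Its
    radius e does not depend on w1 or w2, so the steps can be chained. *)
Lemma glued_step k t0 w0 : D t0 -> dom w0 -> exists2 e : R, 0 < e &
  forall w1 w2, dom w1 -> dom w2 -> nr (w1 - w0) < e -> nr (w2 - w0) < e -> glued k w1 t0 -> glued k w2 t0.
Proof.
move=> Dt0 Dw0; have Ut0 := D_U Dt0.
have Nw : N0 <= nr (cexp w0) by rewrite nr_cexp.
have /choice [r /choice [B /choice [h Hh]]] : forall p : 'I_n * 'I_n, exists (r B : R) (h : C -> V -> C),
    [/\ 0 < r, hol2 [set z | nr (z - cexp w0) < r] (nball t0 r) h,
    forall z t, nr (z - cexp w0) < r -> nball t0 r t -> nr (h z t) <= B &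
    forall z t, nr (z - cexp w0) < r -> nball t0 r t -> N0 <= nr z -> U t -> A z t p.1 p.2 = h z t].
  by move=> p; exact: joint_hol2.
have [p|r' r0 hr] := @fin_pos R _ r; first by have [] := Hh p.
have [B' [B0 hB]] := fin_bound B.
have m0 : 0 < Num.min r' 1 by rewrite lt_min r0 ltr01.
have /cvg_nrP /(_ _ m0)[e1 e10 he1] := is_derive1_continuous (is_derive_cexp w0).
pose K := (nr (cexp w0) + 1) * B'.
have K0 : 0 <= K by rewrite mulr_ge0 // addr_ge0 // nr_ge0.
have q0 : 0 < 4 * (n%:R * K + 1) by rewrite mulr_gt0 // ltr_wpDl // mulr_ge0.
pose e := Num.min e1 (4 * (n%:R * K + 1))^-1.
have e0 : 0 < e by rewrite lt_min e10 invr_gt0.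
pose H : set C := [set w | nr (w - w0) < e].
have Hc w : H w -> nr (cexp w - cexp w0) < r' /\ nr (cexp w) <= nr (cexp w0) + 1.
  rewrite /H /= lt_min => /andP[/he1 + _]; rewrite lt_min => /andP[h1 h2]; split=> //.
  have := nrD (cexp w - cexp w0) (cexp w0); rewrite subrK => h3; apply: (le_trans h3).
  by rewrite addrC lerD2l ltW.
have sp p t : nball t0 r' t -> nball t0 (r p) t by move=> ht; exact: lt_le_trans ht (hr p).
have cp p w : H w -> nr (cexp w - cexp w0) < r p by move=> /Hc[h1 _]; exact: lt_le_trans h1 (hr p).
pose a i d w t := cexp w * h (i, d) (cexp w) t.
have ha i d : hol2 H (nball t0 r') (a i d).
  have [_ [h1 h2] _ _] := Hh (i, d); split=> [t Nt w Hw|w Hw t Nt].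
    have [f hf] := h1 t (sp _ _ Nt) _ (cp _ _ Hw).
    eexists; exact: der_mul (is_derive_cexp w) (@der_comp R (h (i, d) ^~ t) (@cexp R) w _ _ (is_derive_cexp w) hf).
  by apply: diff_mulC; [exact: diff_cstC|exact: h2 (cp _ _ Hw) t (sp _ _ Nt)].
have aK i d w t : nr (w - w0) < e -> nball t0 r' t -> nr (a i d w t) <= K.
  move=> Hw Nt; have [_ _ hb _] := Hh (i, d); have [_ h2] := Hc w Hw.
  rewrite nrM; apply: ler_pM; rewrite ?nr_ge0 //; apply: le_trans (hb _ _ (cp _ _ Hw) (sp _ _ Nt)) (hB _).
have small : n%:R * K * (2 * e) <= 2^-1.
  have nK : 0 <= n%:R * K by rewrite mulr_ge0.
  have e4 : e * (4 * (n%:R * K + 1)) <= 1 by rewrite -ler_pdivlMr // div1r /e ge_min lexx orbT.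
  by move: nK e4; move: (n%:R * K) => y; have := e0; nra.
exists e => // w1 w2 D1 D2 H1 H2 [r1 [g [r10 hg gY]]].
have [s [s1 s2 s3]] := picard e0 K0 (@nball_open _ _ t0 r') ha aK small H1.
have m1 : 0 < Num.min r' r1 by rewrite lt_min r0.
have sr t : nball t0 (Num.min r' r1) t -> nball t0 r' t by rewrite /nball /= lt_min => /andP[].
have sr1 t : nball t0 (Num.min r' r1) t -> nball t0 r1 t by rewrite /nball /= lt_min => /andP[].
exists (Num.min r' r1), (fun i j t => \sum_d s i d w2 t * g d j t); split=> //.
  move=> i j t Nt; apply: diff_sumC => d; apply: diff_mulC; last exact: hg (sr1 _ Nt).
  exact: (s1 i d).2 w2 H2 t (sr _ Nt).
move=> c t hc ct Nt i j; have Dt := cell_D hc ct; have Ut := D_U Dt.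
pose Y1 := Y c k w1 t.
pose Ps w := \matrix_(i, j) s i j w t.
pose HD : set C := [set w | H w /\ dom w].
have coefE w : HD w -> coef t w = \matrix_(i, d) a i d w t.
  move=> [Hw Dw]; apply/matrixP => p q; rewrite /coef [LHS]mxE [RHS]mxE /a; congr (_ * _).
  by have [_ _ _ ->] := Hh (p, q); rewrite ?nr_cexp //; [exact: cp|exact: sp _ _ (sr _ Nt)].
have Po w : HD w -> ode (coef t) (fun w => Ps w *m Y1) w.
  move=> Hw; apply: ode_mulr => p q.
  have E : (coef t w *m Ps w) p q = \sum_d a p d w t * s d q w t.
    by rewrite (coefE w Hw) mxE; apply: eq_bigr => d _; rewrite !mxE.
  rewrite E; apply: is_derive_near (s2 p q w t Hw.1 (sr _ Nt)); near=> y; by rewrite mxE.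
have Yo w : HD w -> ode (coef t) (Y c k ^~ t) w by case=> _ Dw; have [] := fund_ode k hc ct Dw.
have aB : loc_bounded HD (coef t).
  move=> w [_ /(coef_loc_bounded Ut)[B1 [e2 [e20 hb]]]]; exists B1, e2; split=> // v [_]; exact: hb.
have sg x : 0 <= x <= 1 -> HD (seg w1 w2 x).
  move=> hx; split; first exact: (cvx_domain_convex (ball_domain w0 e)) H1 H2 hx.
  move: hx D1 D2; rewrite /dom /= => /andP[x0 x1] D1 D2.
  have E : Re (seg w1 w2 x) = Re w1 + x * (Re w2 - Re w1) by rewrite /seg ReD Re_mulC ReB.
  have [h1|/ltW h1] := leP (Re w1) (Re w2).
    by apply: (le_trans D1); rewrite ler_expR E lerDl mulr_ge0 // subr_ge0.
  by apply: (le_trans D2); rewrite ler_expR E; move: (Re w1) (Re w2) h1 => p q h1; nra.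
have P1 : Ps w1 = 1%:M by apply/matrixP => p q; rewrite !mxE s3 //; exact: sr.
have E1 : Y c k w1 t = Ps w1 *m Y1 *m 1%:M by rewrite mulmx1 P1 mul1mx.
have := @connection R n (coef t) (fun w => Ps w *m Y1) (Y c k ^~ t) HD w1 w2 1%:M aB Po Yo sg E1.
rewrite mulmx1 => ->; rewrite mxE; apply: eq_bigr => d _; rewrite mxE; congr (_ * _).
exact: gY hc ct (sr1 _ Nt) d j.
Unshelve. all: by end_near.
Qed.

Lemma glued_all k w t0 : D t0 -> dom w -> glued k w t0.
Proof.
move=> Dt0 Dw; have [w1 Dw1 g1] := glued_far k Dt0.
have sg x : 0 <= x <= 1 -> dom (seg w1 w x).
  move: Dw1 Dw; rewrite /dom /= => D1 D2 /andP[x0 x1].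
  have E : Re (seg w1 w x) = Re w1 + x * (Re w - Re w1) by rewrite /seg ReD Re_mulC ReB.
  have [h1|/ltW h1] := leP (Re w1) (Re w).
    by apply: (le_trans D1); rewrite ler_expR E lerDl mulr_ge0 // subr_ge0.
  by apply: (le_trans D2); rewrite ler_expR E; move: (Re w1) (Re w) h1 => p q h1; nra.
pose Q (x y : R) := glued k (seg w1 w x) t0 -> glued k (seg w1 w y) t0.
have : Q 0 1.
  apply: itv_ind => // [x y z _ _ _ _ q1 q2 /q1/q2//|x hx].
  have [e e0 he] := glued_step k Dt0 (sg x hx).
  have L0 : 0 < nr (w - w1) + 1 by rewrite ltr_wpDl // nr_ge0.
  exists (e / (nr (w - w1) + 1)); first by rewrite divr_gt0.
  move=> y z y0 yz z1 xy zx.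
  have cl v : x - e / (nr (w - w1) + 1) < v -> v < x + e / (nr (w - w1) + 1) -> nr (seg w1 w v - seg w1 w x) < e.
    move=> v1 v2; rewrite nr_segB; have : `|v - x| < e / (nr (w - w1) + 1) by rewrite ltr_distl v1.
    rewrite ltr_pdivlMr // => hv; apply: le_lt_trans hv.
    by rewrite ler_wpM2l // lerDl.
  apply: he.
  - by apply: sg; rewrite y0 (le_trans yz).
  - by apply: sg; rewrite z1 (le_trans y0).
  - apply: cl => //; lra.
  - apply: cl => //; lra.
rewrite /Q; have -> : seg w1 w 0 = w1 by rewrite /seg; ring.
have -> : seg w1 w 1 = w by rewrite /seg; ring.
exact.
Qed.

(* The cells accumulate at t0. *)
Lemma glue_uniq (t0 : V) (r : R) (f g : V -> C) : U t0 -> 0 < r -> differentiable f t0 -> differentiable g t0 ->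
  (forall c t, isCell c -> c t -> nball t0 r t -> f t = g t) -> f t0 = g t0.
Proof.
move=> Ut0 r0 df dg E; apply/eqP; rewrite -subr_eq0 -nr_eq0; apply/eqP/le_anti; rewrite nr_ge0 andbT.
apply/ler_addgt0Pr => e e0; rewrite add0r.
have /cvg_nrP /(_ _ e0)[d d0 hd] := differentiable_continuous (diff_subC df dg).
have m0 : 0 < Num.min r d by rewrite lt_min r0.
have [t1 [d1 [d10 s1 s2]]] := @W_dense R n u0 eps0 tau eps0_gt0 t0 (Num.min r d) Ut0 m0.
have [c hc ct] := W_cell (s2 _ (nball_center _ d10)).
have := s1 _ (nball_center _ d10); rewrite /nball /= lt_min => /andP[t1r /hd].
by rewrite (E c t1 hc ct t1r) subrr sub0r nrN => /ltW.
Qed.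

Lemma exists_continuation : exists Yh : int -> C -> V -> 'M[C]_n, forall k w t0, D t0 -> dom w ->
  exists (r : R) (g : 'I_n -> 'I_n -> V -> C),
  [/\ 0 < r, forall a b, vholo (nball t0 r) (g a b),
    forall c t, isCell c -> c t -> nball t0 r t -> forall a b, Y c k w t a b = g a b t &
    forall a b, Yh k w t0 a b = g a b t0].
Proof.
have /choice [f hf] : forall p : int * C * V, exists G : 'M[C]_n, D p.2 -> dom p.1.2 ->
    exists (r : R) (g : 'I_n -> 'I_n -> V -> C),
    [/\ 0 < r, forall a b, vholo (nball p.2 r) (g a b),
      forall c t, isCell c -> c t -> nball p.2 r t -> forall a b, Y c p.1.1 p.1.2 t a b = g a b t &
      forall a b, G a b = g a b p.2].
  move=> [[k w] t0] /=.
  have [[Dt0 Dw]|nH] := pselect (D t0 /\ dom w); last by exists 0 => Dt0 Dw; exfalso; apply: nH.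
  have [r [g [r0 h1 h2]]] := glued_all k Dt0 Dw.
  by exists (\matrix_(a, b) g a b t0) => _ _; exists r, g; split=> // a b; rewrite mxE.
by exists (fun k w t => f (k, w, t)) => k w t0; exact: (hf (k, w, t0)).
Qed.

(** * Holomorphy and asymptotics of the glued function *)

Section Continuation.
Variable Yh : int -> C -> V -> 'M[C]_n.
Hypothesis hYh : forall k w t0, D t0 -> dom w ->
  exists (r : R) (g : 'I_n -> 'I_n -> V -> C),
  [/\ 0 < r, forall a b, vholo (nball t0 r) (g a b),
    forall c t, isCell c -> c t -> nball t0 r t -> forall a b, Y c k w t a b = g a b t &
    forall a b, Yh k w t0 a b = g a b t0].

Lemma Yh_cell c k w t : isCell c -> c t -> dom w -> Yh k w t = Y c k w t.
Proof.
move=> hc ct Dw; have [r [g [r0 _ h2 h3]]] := hYh k (cell_D hc ct) Dw.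
apply/matrixP => a b; rewrite h3; apply/esym.
exact: h2 hc ct (nball_center _ r0) a b.
Qed.

(** By [glue_uniq] the value at t0 can be computed from any local function that agrees with the Y on
    nearby cells, in particular from one attached to another centre. *)
Lemma Yh_eq k w t0 (r : R) (g : V -> C) a b : D t0 -> dom w -> 0 < r -> differentiable g t0 ->
  (forall c t, isCell c -> c t -> nball t0 r t -> Y c k w t a b = g t) -> Yh k w t0 a b = g t0.
Proof.
move=> Dt0 Dw r0 dg hg; have [r1 [f [r10 h1 h2 h3]]] := hYh k Dt0 Dw.
have m0 : 0 < Num.min r r1 by rewrite lt_min r0.
rewrite h3; apply: (glue_uniq (D_U Dt0) m0 (h1 a b t0 (nball_center _ r10)) dg) => c t hc ct.
rewrite /nball /= lt_min => /andP[n1 n2].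
by rewrite -(hg c t hc ct n1) -(h2 c t hc ct n2).
Qed.

Lemma Yh_near k w t0 : D t0 -> dom w -> exists (r : R) (g : 'I_n -> 'I_n -> V -> C),
  [/\ 0 < r, forall a b, vholo (nball t0 r) (g a b) & forall t, nball t0 r t -> D t -> forall a b, Yh k w t a b = g a b t].
Proof.
move=> Dt0 Dw; have [r [g [r0 h1 h2 h3]]] := hYh k Dt0 Dw.
exists r, g; split=> // t Nt Dt a b.
have [d d0 hd] := nball_open Nt.
apply: (Yh_eq Dt Dw d0); first exact: h1.
by move=> c t' hc ct /hd N'; exact: h2.
Qed.

Lemma Yh_holo k w : dom w -> holo_on D (Yh k w).
Proof.
move=> Dw t0 Dt0; have [r [g [r0 h1 h2]]] := Yh_near k Dt0 Dw.
have nr0 : \forall y \near t0, nball t0 r y by apply/nbhs_nrP; exists r.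
exists (fun t => \matrix_(a, b) g a b t); split.
  apply: filterS nr0 => y Ny; apply: diff_mx => a b.
  have -> : (fun t => (\matrix_(a, b) g a b t) a b : C) = g a b by apply/funext => t; rewrite mxE.
  exact: h1.
by apply: filterS nr0 => y Ny Dy; apply/matrixP => a b; rewrite mxE (h2 y Ny Dy).
Qed.

Lemma Yh_asymptotic k t : D t ->
  asymptotic (sector (stokes_directions0 u0 t) tau k) (normalized A_ G0 u0 t (Yh k ^~ t)) (F ^~ t).
Proof.
move=> Dt al be' sub m; have pi0 := pi_gt0 R.
(* For be' < al the subsector is empty. *)
have [ab|ba] := leP al be'; last first.
  by exists 0, 0 => w /andP[h1 h2]; move: (lt_le_trans ba (le_trans h1 h2)); rewrite ltxx.
pose Q (x y : R) := exists r K : R, forall w : C, x <= Im w <= y -> r <= expR (Re w) ->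
    nr (normalized A_ G0 u0 t (Yh k ^~ t) w - \sum_(j < m.+1) (cexp w) ^- j *: F j t) <= K * expR (Re w) ^- m.+1.
(* Each direction lies in a window where the glued function is the local solution of [chart], with
   its error bound; continuous induction joins the windows to the closed subsector. *)
have : Q al be'.
  apply: itv_ind => // [x y z _ xy yz _ [r1 [K1 h1]] [r2 [K2 h2]]|theta hth].
    exists (Num.max r1 r2), (Num.max K1 K2) => w /andP[wx wz]; rewrite ge_max => /andP[w1 w2].
    have ip : 0 <= (expR (Re w) ^+ m.+1)^-1 by rewrite invr_ge0 exprn_ge0 // expR_ge0.
    have [wy|/ltW yw] := leP (Im w) y.
      by apply: (le_trans (h1 w _ w1)); [rewrite wx|apply: ler_wpM2r; rewrite // le_max lexx].
    by apply: (le_trans (h2 w _ w2)); [rewrite yw|apply: ler_wpM2r; rewrite // le_max lexx orbT].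
  have sth : sector (stokes_directions0 u0 t) tau k (0 +i* theta) by apply: sub.
  have c1 a b x : u0 a != u0 b -> theta <= x <= tau + k%:~R * pi - pi -> Re (gap u0 a b t * cis x) != 0.
    move=> uab hx; apply/negP => /eqP E.
    have [] := sth x; first by exists a, b.
    by rewrite addrAC => h _; exact: h hx.
  have c2 a b x : u0 a != u0 b -> tau + k%:~R * pi <= x <= theta -> Re (gap u0 a b t * cis x) != 0.
    move=> uab hx; apply/negP => /eqP E.
    have [] := sth x; first by exists a, b.
    by move=> _ h; exact: h hx.
  have [tau' [a1 a2 /andP[a3 a4]]] := gap_admissible Dt c1 c2.
  have [r [R1 [K [g [[r0 R1N] g1 g2 g3]]]]] := @chart t tau' k m Dt a1 a2.
  pose th0 := tau' + k%:~R * pi - pi / 2.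
  have ht : `|theta - th0| < pi / 2 by rewrite ltr_norml /th0; apply/andP; split; lra.
  (* Half of the remaining angle: |Im w - th0| <= q < pi / 2 bounds the cosine below, so all large
     |z| lie in the half-plane. *)
  pose e := (pi / 2 - `|theta - th0|) / 2.
  have e0 : 0 < e by rewrite divr_gt0 // subr_gt0.
  pose q := `|theta - th0| + e.
  have q0 : 0 <= q by rewrite addr_ge0 // ltW.
  have q2 : q < pi / 2 by rewrite /q /e; move: ht; move: (`|theta - th0|) => y; lra.
  have cq : 0 < cos q by apply: cos_window; rewrite ger0_norm.
  exists e => // x y alx xy ybe xth yth.
  exists (`|R1| / cos q + 1), `|K| => w /andP[w1 w2] rw.
  have wq : `|Im w - th0| <= `|q|.
    rewrite (ger0_norm q0) /q; have -> : Im w - th0 = (theta - th0) + (Im w - theta) by ring.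
    rewrite (le_trans (ler_normD _ _)) // lerD2l ler_norml; apply/andP; split; lra.
  have qq : `|q| < pi / 2 by rewrite ger0_norm.
  have Ow : `|Im w - th0| < pi / 2 /\ half_plane (cis (- th0)) R1 (cexp w).
    split; first exact: le_lt_trans wq qq.
    apply/Om_Re; apply: (@lt_le_trans _ _ (expR (Re w) * cos q)).
      rewrite -ltr_pdivrMr //; apply: lt_le_trans rw; apply: (@le_lt_trans _ _ (`|R1| / cos q)).
        by rewrite ler_wpM2r ?ler_norm // invr_ge0 ltW.
      by rewrite ltrDl.
    by rewrite ler_wpM2l ?expR_ge0 //; exact: cos_le_norm wq qq.
  have Dw : dom w := half_plane_dom R1N Ow.2.
  have Zg a b : Yh k w t a b = g a b w t.
    apply: (Yh_eq Dt Dw r0); first exact: g1 Ow _ (nball_center _ r0).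
    by move=> c t' hc ct Nt; exact: g2 hc ct Nt Ow a b.
  have K0 a b : nr (normalized A_ G0 u0 t (Yh k ^~ t) w a b - \sum_(j < m.+1) F j t a b * cexp w ^- j) <= `|K| * expR (Re w) ^- m.+1.
    have := g3 w Ow (Yh k ^~ t) Zg a b; rewrite nr_cexp => /le_trans; apply.
    by rewrite ler_wpM2r ?ler_norm // invr_ge0 exprn_ge0 // expR_ge0.
  apply: nr_mx_le => [|a b].
    by rewrite mulr_ge0 // invr_ge0 exprn_ge0 // expR_ge0.
  have -> : (normalized A_ G0 u0 t (Yh k ^~ t) w - \sum_(j < m.+1) (cexp w) ^- j *: F j t) a b =
     normalized A_ G0 u0 t (Yh k ^~ t) w a b - \sum_(j < m.+1) F j t a b * cexp w ^- j.
    rewrite mxE [X in _ + X]mxE summxE; congr (_ - _); apply: eq_bigr => j _; by rewrite mxE mulrC.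
  exact: K0.
move=> [r [K h]]; exists r, K => w h1 h2.
by rewrite nr_le; exact: h.
Qed.

End Continuation.

(** By the identity theorem a function with nonzero germ vanishes identically on no smaller ball;
    the functions are treated one after another on shrinking balls. *)
Lemma common_nonzero (I : eqType) (s : seq I) (h : I -> V -> C) (t0 : V) (r : R) (x : V) (d : R) :
  (forall i, i \in s -> vholo (nball t0 r) (h i) /\ ~ (\forall y \near t0, h i y = 0)) ->
  0 < r -> 0 < d -> nball x d `<=` nball t0 r ->
  exists x' (d' : R), [/\ 0 < d', nball x' d' `<=` nball x d & forall i y, i \in s -> nball x' d' y -> h i y != 0].
Proof.
elim: s x d => [|i s IH] x d hs r0 d0 sub; first by exists x, d; split=> // i y; rewrite in_nil.
have [hi ni] := hs i (mem_head _ _).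
have [y yx hy] : exists2 y, nball x d y & h i y != 0.
  apply: contrapT => nex; apply: ni; apply/nbhs_nrP; exists r => // y Ny.
  apply: (@vholo_identity R V (nball t0 r) (h i) x y d); [exact: nball_convex|exact: nball_open|exact: hi| |exact: Ny|exact: d0|].
    exact: sub (nball_center _ d0).
  move=> u Nu; apply: contrapT => /eqP nz; apply: nex; by exists u.
have := differentiable_continuous (hi y (sub _ yx)); move/cvg_nrP => /(_ (nr (h i y))).
rewrite nr_gt0 => /(_ hy)[d1 d10 hd1].
have [d2 d20 hd2] := nball_open yx.
have m0 : 0 < Num.min d1 d2 by rewrite lt_min d10.
have s2 : nball y (Num.min d1 d2) `<=` nball x d by move=> u; rewrite /nball /= lt_min => /andP[_ /hd2].
have [|x' [d' [d'0 sd' hd']]] := IH y (Num.min d1 d2) _ r0 m0 (subset_trans s2 sub).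
  by move=> j js; apply: hs; rewrite inE js orbT.
exists x', d'; split=> [//||j u]; first exact: subset_trans sd' s2.
rewrite inE => /orP[/eqP -> /sd'|js Nu]; last exact: hd' js Nu.
rewrite /nball /= lt_min => /andP[/hd1 + _].
by apply: contraTneq => ->; rewrite sub0r nrN ltxx.
Qed.

Lemma continuous_near (E T : topologicalType) (p : E -> T) (e : E) (P : set T) :
  continuous p -> (\forall y \near p e, P y) -> \forall x \near e, P (p x).
Proof. by move=> pc; exact: pc. Qed.

(** * Identification with the meromorphic continuations on the covering *)

Section Covering.
Variables (Yh : int -> C -> V -> 'M[C]_n) (E : topologicalType) (p : E -> V) (lift : set V -> V -> E)
  (M : set V -> int -> C -> E -> 'M[C]_n).
Hypothesis hYh : forall k w t0, D t0 -> dom w ->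
  exists (r : R) (g : 'I_n -> 'I_n -> V -> C),
  [/\ 0 < r, forall a b, vholo (nball t0 r) (g a b),
    forall c t, isCell c -> c t -> nball t0 r t -> forall a b, Y c k w t a b = g a b t &
    forall a b, Yh k w t0 a b = g a b t0].
Hypotheses (cov : universal_covering R p D)
  (hlift : forall c, isCell c -> {within c, continuous (lift c)} /\ forall t, c t -> p (lift c t) = t)
  (hM : forall c k w, isCell c -> N0 <= expR (Re w) ->
     (forall a b : 'I_n, meromorphic_along p (fun e => M c k w e a b)) /\
     (forall t, c t -> M c k w (lift c t) = Y c k w t)).

Let pD e : D (p e). Proof. by have [_ <- _ _] := cov; exists e. Qed.
Let pcont : continuous p. Proof. by have [] := cov. Qed.

Let near_p (e : E) (d : R) : 0 < d -> \forall x \near e, nball (p e) d (p x).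
Proof.
move=> d0; have nb : \forall y \near p e, nball (p e) d y by apply/nbhs_nrP; exists d.
exact: (@continuous_near E _ p e (nball (p e) d) pcont nb).
Qed.

(** A sheet through e with its section. The section is continuous relative to D only, hence the last
    clause, restricted to points of D. *)
Lemma cover_section (e : E) : exists (O : set E) (s : V -> E) (d : R),
  [/\ open O, O e, 0 < d,
    forall x, O x -> s (p x) = x &
    (forall t, D t -> nball (p e) d t -> O (s t) /\ p (s t) = t) /\
    forall N : set E, nbhs e N -> exists2 d' : R, 0 < d' & forall t, D t -> nball (p e) d' t -> N (s t)].
Proof.
have [_ _ ev _] := cov; have [W [oW Wp [I [ O [s [pW _ oO hO]]]]]] := ev (p e) (pD e).
have [i _ Oe] : (\bigcup_i O i) e by rewrite -pW.
have [cs hs si] := hO i.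
have /nbhs_nrP[d d0 hd] : nbhs (p e) W by exact: open_nbhs_nbhs.
exists (O i), (s i), d; split=> //; split=> [t Dt /hd Wt|N nN].
  by apply: hs.
have /subspace_continuousP /(_ (p e) (conj Wp (pD e))) cs1 := cs; have nN' : nbhs (s i (p e)) N by rewrite si.
have := cs1 N nN'; rewrite /= /within /= => /nbhs_nrP[d1 d10 hd1].
exists (Num.min d d1); first by rewrite lt_min d0.
move=> t Dt; rewrite /nball /= lt_min => /andP[/hd Wt /hd1]; exact.
Qed.

Variables (c : set V) (k : int) (w : C).
Hypotheses (hc : isCell c) (Dw : dom w).

(* M = Yh o p near e, away from the zeros of a denominator. *)
Let good (a b : 'I_n) (e : E) := exists (h : V -> C) (r : R), [/\ 0 < r, vholo (nball (p e) r) h,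
  ~ (\forall y \near p e, h y = 0) & \forall x \near e, h (p x) != 0 -> M c k w x a b = Yh k w (p x) a b].

(** If [good] holds at one point near e0, then g = Phi h on a small ball, hence on the whole ball
    about p e0 by the identity theorem, and so [good] holds at all points near e0. Openness and
    closedness come together. *)
Lemma good_local a b (e0 : E) : exists N : set E, nbhs e0 N /\ forall e e', N e -> N e' -> good a b e -> good a b e'.
Proof.
have [hm _] := hM k hc Dw; have [g [h [gh hn fgh]]] := hm a b e0.
have [r1 [Phi [r10 hPhi PhiE]]] := Yh_near hYh k (pD e0) Dw.
have /nbhs_nrP[r2 r20 hgh] := gh.
pose r := Num.min r1 r2; have r0 : 0 < r by rewrite lt_min r10.
have sr1 t : nball (p e0) r t -> nball (p e0) r1 t by rewrite /nball /= lt_min => /andP[].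
have sr2 t : nball (p e0) r t -> nr (t - p e0) < r2 by rewrite /nball /= lt_min => /andP[].
have hh : vholo (nball (p e0) r) h by move=> t /sr2 /hgh[].
have hgf : vholo (nball (p e0) r) (fun t => g t - Phi a b t * h t).
  move=> t Nt; apply: diff_subC; first by have [] := hgh t (sr2 _ Nt).
  by apply: diff_mulC; [exact: hPhi (sr1 _ Nt)|exact: hh].
have goodh e : nball (p e0) r (p e) -> (\forall x \near e, h (p x) != 0 -> M c k w x a b = g (p x) / h (p x)) ->
   (forall t, nball (p e0) r t -> g t = Phi a b t * h t) -> good a b e.
  move=> Ne fe gE; have [d d0 hd] := nball_open Ne.
  have hh' : vholo (nball (p e) d) h := fun t Nt => hh t (hd t Nt).
  exists h, d; split; [exact: d0|exact: hh'| |].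
    move=> /nbhs_nrP[d1 d10 hd1]; apply: hn; apply/nbhs_nrP; exists r => // y Ny.
    by apply: (@vholo_identity R V (nball (p e0) r) h (p e) y d1); [exact: nball_convex|exact: nball_open|exact: hh|exact: Ne|exact: Ny|exact: d10|exact: hd1].
  have np : \forall x \near e, nball (p e) d (p x) by exact: near_p.
  apply: filterS2 fe np => x fx /hd Nx hx; rewrite fx // gE // mulfK //.
  by rewrite (PhiE _ (sr1 _ Nx) (pD x)).
have nN : \forall e \near e0, nball (p e0) r (p e) by exact: near_p.
have nF : \forall e \near e0, \forall x \near e, h (p x) != 0 -> M c k w x a b = g (p x) / h (p x).
  exact: (near_join fgh).
have loc : \forall e \near e0, good a b e -> forall t, nball (p e0) r t -> g t = Phi a b t * h t.
  apply: filterS2 nN nF => e Ne Fe [h' [r' [r'0 hh' hn' fe]]] t Nt.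
  have [ O [s [d0 [oO Oe d00 sp [sO sN]]]]] := cover_section e.
  have nb : nbhs e [set x | (h' (p x) != 0 -> M c k w x a b = Yh k w (p x) a b) /\
      (h (p x) != 0 -> M c k w x a b = g (p x) / h (p x))] by apply: filterI.
  have [d1 d10 hd1] := sN _ nb.
  have [d2 d20 hd2] := nball_open Ne.
  pose d := Num.min (Num.min d0 d1) (Num.min d2 r').
  have dp : 0 < d by rewrite !lt_min d00 d10 d20 r'0.
  (* The functions are compared through the section, which lives over D; a full ball inside D is
     found first, then shrunk away from the zeros of both denominators. *)
  have [x1 [e1 [e10 s1 s2]]] := @W_dense R n u0 eps0 tau eps0_gt0 (p e) d (D_U (pD e)) dp.
  have s1' : nball x1 e1 `<=` nball (p e) r'.
    by move=> y /s1; rewrite /nball /= !lt_min => /andP[_ /andP[]].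
  have [|x2 [e2 [e20 s3 nz1]]] := @common_nonzero unit [:: tt] (fun=> h') (p e) r' x1 e1 _ r'0 e10 s1'.
    by move=> i _; split.
  have s4 : nball x2 e2 `<=` nball (p e0) r.
    by move=> y /s3 /s1 y1; apply: hd2; move: y1; rewrite /nball /= !lt_min => /andP[_ /andP[]].
  have [|x3 [e3 [e30 s5 nz2]]] := @common_nonzero unit [:: tt] (fun=> h) (p e0) r x2 e2 _ r0 e20 s4.
    by move=> i _; split.
  apply/eqP; rewrite -subr_eq0; apply/eqP.
  apply: (@vholo_identity R V (nball (p e0) r) (fun t => g t - Phi a b t * h t) x3 t e3).
  - exact: nball_convex.
  - exact: nball_open.
  - exact: hgf.
  - exact: s4 (s5 _ (nball_center _ e30)).
  - exact: Nt.
  - exact: e30.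
  move=> y Ny; have Ny2 := s5 _ Ny; have Ny1 := s3 _ Ny2.
  have Dy : D y := W_sub_D (s2 _ Ny1).
  have := s1 _ Ny1; rewrite /nball /= !lt_min => /andP[/andP[y0 y1] _].
  have [_ psy] := sO y Dy y0; have [f1 f2] := hd1 y Dy y1.
  rewrite psy in f1 f2.
  have hy := nz2 tt y (mem_head _ _) Ny.
  have := f2 hy; rewrite (f1 (nz1 tt y (mem_head _ _) Ny2)) (PhiE _ (sr1 _ (s4 _ Ny2)) Dy) => ->.
  by rewrite divfK // subrr.
have nNF : \forall e \near e0, nball (p e0) r (p e) /\
  \forall x \near e, h (p x) != 0 -> M c k w x a b = g (p x) / h (p x) by apply: filterI.
exists [set e | (good a b e -> forall t, nball (p e0) r t -> g t = Phi a b t * h t) /\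
  (nball (p e0) r (p e) /\ \forall x \near e, h (p x) != 0 -> M c k w x a b = g (p x) / h (p x))].
split; first exact: filterI loc nNF.
by move=> e e' [le _] [_ [Ne' Fe']] ge; exact: goodh Ne' Fe' (le ge).
Qed.

(** At the lift of a point of c the sheet coincides over the cell with [lift c], where M, Y and Yh
    agree; the denominator 1 will do. *)
Lemma good_start a b : exists e, good a b e.
Proof.
have [t1 Wt1 cE] := hc; have ct : c t1 by rewrite cE; exact: connected_component_refl.
have [lc lp] := hlift hc; have [_ Ml] := hM k hc Dw.
pose e := lift c t1; have pe : p e = t1 by exact: lp.
have [ O [s [d [oO Oe d0 sp _]]]] := cover_section e.
have [r r0 hr] := cell_open hc ct.
have /subspace_continuousP /(_ t1 ct) lc1 := lc; have := lc1 O (open_nbhs_nbhs (conj oO Oe)).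
rewrite /= /within /= => /nbhs_nrP[d1 d10 hd1].
exists e, (fun=> 1), 1; split=> //.
  by move=> /nbhs_singleton /eqP; rewrite oner_eq0.
have m0 : 0 < Num.min r d1 by rewrite lt_min r0.
have np : \forall x \near e, nball (p e) (Num.min r d1) (p x) by exact: near_p.
have nO : \forall x \near e, O x by exact: open_nbhs_nbhs.
apply: filterS2 np nO => x; rewrite pe /nball /= lt_min => /andP[xr xd] Ox _.
have cx : c (p x) by apply: hr => //; exact: D_U (pD x).
have lx : lift c (p x) = x.
  by have := sp (lift c (p x)) (hd1 _ xd cx); rewrite (lp _ cx) (sp x Ox) => <-.
by rewrite (Yh_cell hYh k hc cx Dw) -(Ml _ cx) lx.
Qed.

Lemma good_all a b e : good a b e.
Proof.
have [e1 g1] := good_start a b; have [_ _ _ [pc _]] := cov.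
have [gam [gc ga0 ga1]] := pc e1 e.
pose Q (x y : R) := good a b (gam x) -> good a b (gam y).
have : Q 0 1; last by rewrite /Q ga0 ga1; apply.
apply: itv_ind => // [x y z _ _ _ _ q1 q2 /q1/q2//|x hx].
have xI : `[(0 : R), 1]%classic x by rewrite /= in_itv.
have /subspace_continuousP /(_ x xI) cx := gc.
have [N [nN hN]] := good_local a b (gam x).
have h1 := cx _ nN; move: h1; rewrite /= /within /= => -[d /= d0 hd].
exists d => // y z y0 yz z1 xy zx.
have Iy : `[(0 : R), 1]%classic y by rewrite /= in_itv /= y0 (le_trans yz).
have Iz : `[(0 : R), 1]%classic z by rewrite /= in_itv /= z1 (le_trans y0).
have xy' : `|x - y| < d by rewrite ltr_distl; apply/andP; split; lra.
have xz' : `|x - z| < d by rewrite ltr_distl; apply/andP; split; lra.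
exact: hN (hd _ xy' Iy) (hd _ xz' Iz).
Qed.

(** The open dense set consists of the points near which equality holds. For density one moves to a
    point over a ball on which the denominators of all entries are nonzero. *)
Lemma continuation_mero_eq : mero_eq (M c k w) (Yh k w \o p).
Proof.
exists [set x | \forall y \near x, M c k w y = Yh k w (p y)]; split.
- by rewrite openE => x /near_join.
- move=> B [e0 Be0] oB.
  have [h hh] := choice (fun q : 'I_n * 'I_n => good_all q.1 q.2 e0).
  have [r hr] := choice hh.
  have [q|r' r'0 hr'] := @fin_pos R _ r; first by have [] := hr q.
  have [ O [s [d0 [oO Oe d00 sp [sO sN]]]]] := cover_section e0.
  have nb : nbhs e0 (B `&` [set x | forall q, h q (p x) != 0 -> M c k w x q.1 q.2 = Yh k w (p x) q.1 q.2]).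
    apply: filterI; first exact: open_nbhs_nbhs.
    by apply: (@filter_forall E _ _ (nbhs e0) (nbhs_filter e0)) => q; have [] := hr q.
  have [N nN Nsub] : exists2 N : set E, nbhs e0 N & forall x, N x -> nbhs x (B `&` [set x | forall q, h q (p x) != 0 -> M c k w x q.1 q.2 = Yh k w (p x) q.1 q.2]).
    by exists [set x | nbhs x (B `&` [set x | forall q, h q (p x) != 0 -> M c k w x q.1 q.2 = Yh k w (p x) q.1 q.2])] => //; exact: near_join.
  have [d1 d10 hd1] := sN _ nN.
  pose d := Num.min (Num.min d0 d1) r'.
  have dp : 0 < d by rewrite !lt_min d00 d10 r'0.
  have [x1 [e1 [e10 s1 s2]]] := @W_dense R n u0 eps0 tau eps0_gt0 (p e0) d (D_U (pD e0)) dp.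
  have s1' : nball x1 e1 `<=` nball (p e0) r'.
    by move=> y /s1; rewrite /nball /= !lt_min => /andP[].
  have [|x2 [e2 [e20 s3 nz]]] := @common_nonzero ('I_n * 'I_n)%type (enum {: 'I_n * 'I_n}) h (p e0) r' x1 e1 _ r'0 e10 s1'.
    move=> q _; have [r0 hq nq _] := hr q; split=> // t Nt; apply: hq.
    exact: lt_le_trans Nt (hr' _).
  have N2 := nball_center x2 e20; have D2 : D x2 := W_sub_D (s2 _ (s3 _ N2)).
  have := s1 _ (s3 _ N2); rewrite /nball /= !lt_min => /andP[/andP[y0 y1] _].
  have [_ psy] := sO _ D2 y0; have nx := Nsub _ (hd1 _ D2 y1).
  exists (s x2); split; first by case: (nbhs_singleton nx).
  have np : \forall x \near s x2, nball x2 e2 (p x) by have := near_p (s x2) e20; rewrite psy.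
  apply: filterS2 nx np => x [_ hx] px.
  by apply/matrixP => a b; apply: (hx (a, b)); apply: nz => //; rewrite mem_enum.
- by move=> x /nbhs_singleton.
Qed.

End Covering.

End Main.

Theorem theorem15p1 (R : realType) (n : nat)
  (* the system *)
  (A : R[i] -> 'rV[R[i]]_n -> 'M[R[i]]_n)
  (A_ : nat -> 'rV[R[i]]_n -> 'M[R[i]]_n)
  (G0 : 'rV[R[i]]_n -> 'M[R[i]]_n)
  (u0 : 'I_n -> R[i]) (N0 eps0 tau : R)
  (* the formal solution, the solutions Y c k (k for nu + k mu), and the Stokes
     matrices *)
  (F : nat -> 'rV[R[i]]_n -> 'M[R[i]]_n)
  (Y : set 'rV[R[i]]_n -> int -> R[i] -> 'rV[R[i]]_n -> 'M[R[i]]_n)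
  (St : set 'rV[R[i]]_n -> int -> 'rV[R[i]]_n -> 'M[R[i]]_n)
  (* the universal covering, lifts of the cells to it, and the continuations *)
  (E : topologicalType) (p : E -> 'rV[R[i]]_n)
  (lift : set 'rV[R[i]]_n -> 'rV[R[i]]_n -> E)
  (M : set 'rV[R[i]]_n -> int -> R[i] -> E -> 'M[R[i]]_n) :
  let U : set 'rV[R[i]]_n := polydisc eps0 in
  let D := U `\` coalescence u0 eps0 in
  let isCell := cell u0 eps0 tau in
  0 < N0 -> 0 < eps0 ->
  (* equal eigenvalues of Lambda(0) are consecutive *)
  (forall a b c : 'I_n, (a <= b <= c)%N -> u0 a = u0 c -> u0 b = u0 a) ->
  holo_on [set zt : R[i] * 'rV[R[i]]_n | N0%:C <= `|zt.1| /\ U zt.2]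
    (fun zt => A zt.1 zt.2) ->
  (forall z t, N0%:C <= `|z| -> U t ->
     series (fun j => z ^- j *: A_ j t) @ \oo --> A z t) ->
  holo_on U G0 ->
  (forall t, U t -> G0 t \in unitmx) ->
  G0 0 = 1%:M ->
  (forall t, U t -> invmx (G0 t) *m A_ 0%N t *m G0 t = Lambda u0 t) ->
  (forall a b : 'I_n, u0 a != u0 b ->
     eps0 < half_dist_line (u0 a - u0 b) (eta_tilde tau)) ->
  (* tau is admissible for Lambda(0) *)
  ~ stokes_directions u0 0 tau ->
  (forall t, D t -> formal_solution A_ G0 u0 F t) ->
  (forall c k, isCell c ->
     (forall w, N0 <= expR (complex.Re w) -> holo_on c (Y c k w)) /\
     (forall t, c t ->
        fundamental_solution (A ^~ t) N0 (Y c k ^~ t) /\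
        asymptotic (sector (stokes_directions u0 t) tau k)
          (normalized A_ G0 u0 t (Y c k ^~ t)) (F ^~ t))) ->
  (forall c k w t, isCell c -> N0 <= expR (complex.Re w) -> c t ->
     Y c (k + 1) w t = Y c k w t *m St c k t) ->
  (* meromorphic continuation on the universal covering of D *)
  universal_covering R p D ->
  (forall c, isCell c ->
     {within c, continuous (lift c)} /\ forall t, c t -> p (lift c t) = t) ->
  (forall c k w, isCell c -> N0 <= expR (complex.Re w) ->
     (forall a b : 'I_n, meromorphic_along p (fun e => M c k w e a b)) /\
     (forall t, c t -> M c k w (lift c t) = Y c k w t)) ->
  (* vanishing condition *)
  (forall c t (a b : 'I_n), isCell c -> c t -> a != b -> u0 a = u0 b ->
     [/\ St c 0 t a b = 0, St c 0 t b a = 0, St c 1 t a b = 0 & St c 1 t b a = 0]) ->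
  exists Yhat : set 'rV[R[i]]_n -> int -> R[i] -> 'rV[R[i]]_n -> 'M[R[i]]_n,
    [/\ (* (i) *)
        forall c k w, isCell c -> N0 <= expR (complex.Re w) ->
          [/\ holo_on D (Yhat c k w),
              forall t, c t -> Yhat c k w t = Y c k w t
            & mero_eq (M c k w) (Yhat c k w \o p)],
        (* (ii) *)
        forall c c' k w t, isCell c -> isCell c' -> N0 <= expR (complex.Re w) -> D t ->
          Yhat c k w t = Yhat c' k w t
      & (* (iii) *)
        forall c k t, isCell c -> D t ->
          asymptotic (sector (stokes_directions0 u0 t) tau k)
            (normalized A_ G0 u0 t (Yhat c k ^~ t)) (F ^~ t)].
Proof.
move=> U D isCell N0p epsp _ holA serA holG G0u _ diagA heps _ formal hY hSt cov hlift hM van.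
have [Yh hYh] := exists_continuation N0p holA serA holG G0u diagA heps formal hY hSt van.
(* The continuation is built without reference to a cell, so (ii) holds by definition. *)
exists (fun _ => Yh); split=> [c k w hc Dw|//|c k t _ Dt].
- split; first exact: (Yh_holo epsp hYh).
  + by move=> t ct; exact: (Yh_cell hYh).
  + exact: (continuation_mero_eq epsp hYh cov hlift hM k hc Dw).
- exact: (Yh_asymptotic N0p epsp holA serA holG G0u diagA heps formal hY hSt van hYh).
Qed.
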